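(* Let $p$ be a strongly irreducible $\mathbb{Z}^d$-invariant transition kernel on $\mathbb{Z}^d\times\{1,\dots,N\}$. Let $\gamma_0\geq0$. For $\gamma\in[0,\gamma_0]$, $u\in H$, $x\in\mathbb{Z}^d$ and $n\ge1$, define $$A_n(x,u)=(2\pi n)^{\frac d2}P_u^{(n)}(0,x)-|Q_u|^{-\frac12}\,\mathrm{e}^{-\frac{1}{2n}\Sigma_u(x-n\nabla\lambda(u))}\,C(u)\cdot\nu(u),$$ $$\tilde A_n(x,u,\gamma)=\left(\frac{\|x-n\nabla\lambda(u)\|}{\sqrt n}\right)^{\gamma}A_n(x,u).$$ Then for every $x\in\mathbb{Z}^d$, every $u\in H$ and every $\gamma\in[0,\gamma_0]$, $\tilde A_n(x,u,\gamma)$ converges to $0$ as $n\to\infty$. Furthermore, the convergence is uniform in $x\in\mathbb{Z}^d$, in $u$ lying in a compact subset of $H$, and in $\gamma\in[0,\gamma_0]$.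
   Context: Let $d,N\ge1$. A $\mathbb{Z}^d$-invariant transition kernel on $\mathbb{Z}^d\times\{1,\dots,N\}$ is a family $p((x,k),(y,j))=p_{k,j}(x,y)\ge0$ with $p_{k,j}(x,y)=p_{k,j}(0,y-x)$ and finite mass $\sum_{y,j}p_{k,j}(x,y)<\infty$ (total mass is not assumed to be $1$). $p^{(n)}$ is its $n$th convolution power, with entries $p^{(n)}_{k,j}(x,y)$. It is strongly irreducible if for all $k,j$ and $x,y$ there is $n_0$ such that $p^{(n)}_{k,j}(x,y)>0$ for all $n\ge n_0$. For $u\in\mathbb{R}^d$, $P_u^{(n)}(0,x)$ is the $N\times N$ matrix with entries $p^{(n)}_{k,j}(0,x)\mathrm{e}^{u\cdot x}$. $F(u)$ is the $N\times N$ matrix with entries $F_{k,j}(u)=\sum_{x\in\mathbb{Z}^d}p_{k,j}(0,x)\mathrm{e}^{u\cdot x}\in[0,\infty]$, and $\mathcal F$ is the interior of the set of $u\in\mathbb{R}^d$ for which all entries of $F(u)$ are finite. When $F(u)$ is finite, it has a dominant (Perron–Frobenius) eigenvalue $\lambda(u)>0$, simple and strictly larger than the modulus of any other eigenvalue; $\lambda$ is analytic on $\mathcal F$ and $\nabla\lambda$ is its gradient. $H=\{u\in\mathcal F:\lambda(u)=1\}$. $C(u)$ (column) and $\nu(u)$ (row) are right and left eigenvectors of $F(u)$ for $\lambda(u)$ with positive coordinates, normalized by $\sum_j\nu(0)_j=1$, $\nu(0)\cdot C(u)=1$ and $\nu(u)\cdot C(u)=1$; $C(u)\cdot\nu(u)$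 is an $N\times N$ matrix (the spectral projector). For $\xi\in\mathbb{R}^d$, $\chi_u(\xi)$ is the matrix with entries $\mathrm{e}^{-i\nabla\lambda(u)\cdot\xi}\sum_{x}p_{k,j}(0,x)\mathrm{e}^{u\cdot x}\mathrm{e}^{ix\cdot\xi}$. For $\xi$ near $0$ it has a simple eigenvalue $\lambda_u(\xi)$ of strictly maximal modulus, with $\lambda_u(0)=\lambda(u)$. For $u\in H$, $Q_u$ is the positive definite quadratic form on $\mathbb{R}^d$ with $\lambda_u(\xi)=1-\frac12Q_u(\xi)+o(\|\xi\|^2)$, i.e. $Q_u=-\nabla^2_\xi\lambda_u(0)$. $|Q_u|$ is the determinant of its symmetric matrix, and $\Sigma_u$ is the quadratic form whose symmetric matrix is the inverse of that of $Q_u$. Convention: $0^0=1$, so $\tilde A_n(x,u,0)=A_n(x,u)$. *)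

(* Defs.v *)
From mathcomp Require Import all_boot all_order all_algebra.
From mathcomp Require Import complex.
From mathcomp Require Import all_classical all_reals all_analysis.

Set Implicit Arguments.
Unset Strict Implicit.
Unset Printing Implicit Defensive.

Import Order.TTheory GRing.Theory Num.Theory.
Import numFieldNormedType.Exports.

Local Open Scope classical_set_scope.
Local Open Scope ring_scope.

Section linear_algebra.
Variable R : realType.

Definition dotp d (u v : 'rV[R]_d) : R := \sum_i u 0 i * v 0 i.

(* The library norm on ['rV[R]_d] is the sup norm. *)
Definition euclid_norm d (v : 'rV[R]_d) : R := Num.sqrt (dotp v v).

Definition rvec d (x : 'rV[int]_d) : 'rV[R]_d := \row_i (x 0 i)%:~R.

Definition quad_form d (Q : 'M[R]_d) (v : 'rV[R]_d) : R := (v *m Q *m v^T) 0 0.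

Definition sym_posdef d (Q : 'M[R]_d) : Prop :=
  Q^T = Q /\ forall v : 'rV[R]_d, v != 0 -> 0 < quad_form Q v.

Definition gradient d (f : 'rV[R]_d -> R) (u : 'rV[R]_d) : 'rV[R]_d :=
  \row_i 'D_(delta_mx 0 i) f u.

Definition cexpi (t : R) : R[i] := Complex (cos t) (sin t).

(* Sum of an absolutely summable family; [esum] alone only sums nonnegative
   families. *)
Definition rsum (T : choiceType) (f : T -> R) : R :=
  fine (\esum_(t in [set: T]) (Num.max (f t) 0)%:E)
  - fine (\esum_(t in [set: T]) (Num.max (- f t) 0)%:E).

Definition csum (T : choiceType) (f : T -> R[i]) : R[i] :=
  Complex (rsum (fun t => complex.Re (f t))) (rsum (fun t => complex.Im (f t))).

(* [mup] is the algebraic multiplicity, so [l] is a simple eigenvalue. At most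
   one [l] satisfies this predicate. *)
Definition is_dominant_eigenvalue N (M : 'M[R[i]]_N) (l : R[i]) : Prop :=
  mup l (char_poly M) = 1%N /\
  forall m : R[i], eigenvalue M m -> m != l -> `|m| < `|l|.

End linear_algebra.

Section kernels.
Variables (R : realType) (d N : nat).

Local Notation lattice := 'rV[int]_d.
Local Notation state := (lattice * 'I_N)%type.

Definition lattice_kernel := state -> state -> R.

Definition invariant_kernel (p : lattice_kernel) : Prop :=
  [/\ forall a b, 0 <= p a b,
      forall (x y : lattice) (k j : 'I_N),
        p (x, k) (y, j) = p (0, k) (y - x, j)
    & forall a, (\esum_(b in [set: state]) (p a b)%:E < +oo)%E].

(* For an invariant kernel all the sums below are finite. *)
Fixpoint conv_pow (p : lattice_kernel) (n : nat) : lattice_kernel :=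
  if n is m.+1 then
    fun a b => fine (\esum_(c in [set: state]) (p a c * conv_pow p m c b)%:E)
  else fun a b => (a == b)%:R.

Definition strongly_irreducible (p : lattice_kernel) : Prop :=
  forall (k j : 'I_N) (x y : lattice),
    exists n0 : nat, forall n : nat, (n0 <= n)%N ->
      0 < conv_pow p n (x, k) (y, j).

Variable p : lattice_kernel.

Definition P_mx (n : nat) (u : 'rV[R]_d) (x : lattice) : 'M[R]_N :=
  \matrix_(k, j) (conv_pow p n (0, k) (x, j) * expR (dotp u (rvec R x))).

Definition F_entry (u : 'rV[R]_d) (k j : 'I_N) : \bar R :=
  \esum_(x in [set: lattice]) (p (0, k) (x, j) * expR (dotp u (rvec R x)))%:E.

Definition F_finite : set 'rV[R]_d :=
  [set u | forall k j, (F_entry u k j < +oo)%E].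

Definition F_domain : set 'rV[R]_d := interior F_finite.

Definition F_mx (u : 'rV[R]_d) : 'M[R]_N := \matrix_(k, j) fine (F_entry u k j).

(* Perron-Frobenius eigenvalue; 0 by default when there is none. *)
Definition lam (u : 'rV[R]_d) : R :=
  xget 0 [set l : R | 0 < l /\
    is_dominant_eigenvalue (map_mx (real_complex R) (F_mx u)) (real_complex R l)].

Definition H_set : set 'rV[R]_d := [set u | F_domain u /\ lam u = 1].

Definition PF_eigenvectors (C : 'rV[R]_d -> 'cV[R]_N) (nu : 'rV[R]_d -> 'rV[R]_N)
    : Prop :=
  (forall u, F_finite u ->
    [/\ F_mx u *m C u = lam u *: C u,
        nu u *m F_mx u = lam u *: nu u,
        forall k, 0 < C u k 0,
        forall j, 0 < nu u 0 j
      & (nu 0 *m C u) 0 0 = 1 /\ (nu u *m C u) 0 0 = 1]) /\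
  \sum_j nu 0 0 j = 1.

Definition chi_mx (u xi : 'rV[R]_d) : 'M[R[i]]_N :=
  \matrix_(k, j)
    (cexpi (- dotp (gradient lam u) xi) *
     csum (fun x : lattice =>
       real_complex R (p (0, k) (x, j) * expR (dotp u (rvec R x)))
       * cexpi (dotp (rvec R x) xi))).

Definition lam_xi (u xi : 'rV[R]_d) : R[i] :=
  xget 0 (is_dominant_eigenvalue (chi_mx u xi)).

Definition quadratic_expansion (u : 'rV[R]_d) (Q : 'M[R]_d) : Prop :=
  forall e : R, 0 < e -> \forall xi \near (0 : 'rV[R]_d),
    ComplexField.Normc.normc
      (lam_xi u xi - real_complex R (1 - 2^-1 * quad_form Q xi))
    <= e * euclid_norm xi ^+ 2.

Definition Q_mx (u : 'rV[R]_d) : 'M[R]_d :=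
  xget 0 [set Q | sym_posdef Q /\ quadratic_expansion u Q].

Definition Sigma_mx (u : 'rV[R]_d) : 'M[R]_d := invmx (Q_mx u).

Definition centered (n : nat) (x : lattice) (u : 'rV[R]_d) : 'rV[R]_d :=
  rvec R x - n%:R *: gradient lam u.

Definition A_mx (C : 'rV[R]_d -> 'cV[R]_N) (nu : 'rV[R]_d -> 'rV[R]_N)
    (n : nat) (x : lattice) (u : 'rV[R]_d) : 'M[R]_N :=
  ((2 * pi * n%:R) `^ (d%:R / 2)) *: P_mx n u x
  - ((\det (Q_mx u)) `^ (- 2^-1)
     * expR (- (2 * n%:R)^-1 * quad_form (Sigma_mx u) (centered n x u)))
    *: (C u *m nu u).

(* [powR] satisfies 0 `^ 0 = 1. *)
Definition At_mx (C : 'rV[R]_d -> 'cV[R]_N) (nu : 'rV[R]_d -> 'rV[R]_N)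
    (n : nat) (x : lattice) (u : 'rV[R]_d) (g : R) : 'M[R]_N :=
  ((euclid_norm (centered n x u) / Num.sqrt n%:R) `^ g) *: A_mx C nu n x u.

End kernels.

(* Main.v *)
(* Fourier analysis, uniform over the tilts [u].  Multiplying the kernel by
   [exp (u . x)] and conjugating by the eigenvector [C u] gives a Markov additive
   chain on [Z^d x {1, ..., N}] with stationary law [nu_k C_k] and drift [mu].
   Strong irreducibility gives a Doeblin condition for the modulating chain, so
   the Poisson equation has a solution; it provides a corrector [c xi] with
   [Psi xi * c xi = (1 - Q xi / 2) * c xi + O(|xi|^3)] for the centered
   characteristic matrix [Psi], whence [Psi (xi / sqrt n) ^ n] converges to the
   spectral projection times [exp (- Q xi / 2)], locally uniformly.  Strong
   irreducibility also gives [|Psi eta ^ n| <= B exp (- c n |eta|^2)] on the torus,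
   and Fourier inversion yields the local limit theorem without the factor
   [|x - n mu|^gamma].  Traces of powers of [Psi xi] identify its dominant
   eigenvalue near [0], so that [Q] is the covariance form; perturbing the Perron
   eigenvalue identifies [mu] with the gradient of [lambda].  Finally, tilting
   further by [+- e_i / sqrt n] shows that the error [E_n] of the local limit
   theorem is [O (exp (- |z| / d))] in the rescaled variable [z], and
   [|E_n|^2 <= sup |E_n| * O (exp (- |z| / d))] absorbs the factor [|z|^gamma].

   Integrals are avoided: the characteristic function is inverted by Riemann sums
   over the mesh [2 pi / (2 M + 1)] with [M] tending to infinity for fixed [n],
   and these are compared with Riemann sums for the Gaussian. *)

Require Import Defs.
From mathcomp Require Import all_boot all_order all_algebra.
From mathcomp Require Import complex.
From mathcomp Require Import all_classical all_reals all_analysis.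
From mathcomp Require Import ring lra zify.

Set Implicit Arguments.
Unset Strict Implicit.
Unset Printing Implicit Defensive.

Import Order.TTheory GRing.Theory Num.Theory.
Import numFieldNormedType.Exports.

Local Open Scope classical_set_scope.
Local Open Scope ring_scope.

(** * Absolutely summable families *)

Section summation.
Variable R : realType.

(** The conjugation by [C u] is what makes everything quantitative: the characteristic matrices
    become contractions for the operator norm on sup-normed columns. Errors then add up over [n]
    steps instead of multiplying. Frequencies live on the scale [1 / sqrt n], so an approximate
    eigenvector with error of third order costs [n] times [n ^ (-3/2)], which tends to 0. Uniformity
    in [u] is arranged by the order of quantifiers: every threshold and constant is computed from
    the few numbers of [tilt_bounds], before the tilt is introduced, and compactness enters only to
    produce these numbers. [lam] and [Q_mx] are values of a choice operator with a default, so
    nothing is known about them by definition; positivity of [lam], its gradient and the covariance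
    form have to be identified from estimates. In the tail bound a shift [v] of length [1 / sqrt n]
    changes the [n]-th power of the eigenvalue to [exp (n mu . v + O(1))]. The first term recenters
    [x] at [n mu] and the second is a constant, which is why this length is the right one. *)

Definition rsummable (T : choiceType) (f : T -> R) : Prop :=
  (\esum_(t in [set: T]) `|f t|%:E < +oo)%E.

Section one_index.
Variable T : choiceType.
Implicit Types f g : T -> R.

Lemma rsummable_seq f (B : R) :
  (forall s : seq T, uniq s -> \sum_(t <- s) `|f t| <= B) ->
  (\esum_(t in [set: T]) `|f t|%:E <= B%:E)%E.
Proof.
move=> fB; apply: ge_ereal_sup => _ [A [finA _] <-].
by rewrite fsbig_finite//= sumEFin lee_fin fB// fset_uniq.
Qed.

Lemma esum_ge_seq f (s : seq T) : (forall t, 0 <= f t) -> uniq s ->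
  ((\sum_(t <- s) f t)%:E <= \esum_(t in [set: T]) (f t)%:E)%E.
Proof.
move=> f0 us; apply: esum_ge; exists [set` s].
  by split=> //; exact: finite_seq.
by rewrite -fsbig_seq// sumEFin.
Qed.

Lemma esum_fin f : (forall t, 0 <= f t) -> rsummable f ->
  \esum_(t in [set: T]) (f t)%:E \is a fin_num.
Proof.
move=> f0; rewrite /rsummable => h.
rewrite ge0_fin_numE ?esum_ge0// => [|t _]; last by rewrite lee_fin.
by apply: le_lt_trans h; apply: le_esum => t _; rewrite lee_fin ler_norm.
Qed.

Lemma rsummable_le f g : (forall t, `|f t| <= g t) -> rsummable g -> rsummable f.
Proof.
move=> fg; apply: le_lt_trans; apply: le_esum => t _.
by rewrite lee_fin (le_trans (fg t))// ler_norm.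
Qed.

Lemma rsummable_norm f : rsummable f -> rsummable (fun t => `|f t|).
Proof. by move=> sf; apply: le_lt_trans sf; apply: le_esum => t _; rewrite normr_id. Qed.

Lemma rsummableD f g : rsummable f -> rsummable g -> rsummable (fun t => f t + g t).
Proof.
move=> hf hg; apply: le_lt_trans (lte_add_pinfty hf hg).
rewrite -esumD; [|by move=> t _; rewrite lee_fin..].
by apply: le_esum => t _; rewrite -EFinD lee_fin ler_normD.
Qed.

Lemma esumZ f (a : R) : 0 <= a -> (forall t, 0 <= f t) ->
  (\esum_(t in [set: T]) (a * f t)%:E = a%:E * \esum_(t in [set: T]) (f t)%:E)%E.
Proof.
move=> a0 f0.
have le b g : 0 < b -> (forall t, 0 <= g t) ->
  (\esum_(t in [set: T]) (b * g t)%:E <= b%:E * \esum_(t in [set: T]) (g t)%:E)%E.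
  move=> b0 g0; apply: ge_ereal_sup => _ [A [finA _] <-].
  rewrite fsbig_finite//= sumEFin -mulr_sumr EFinM lee_pmul2l//.
  by rewrite esum_ge_seq// fset_uniq.
move: a0; rewrite le_eqVlt => /orP[/eqP <-|a0].
  by rewrite mul0e esum1// => t _; rewrite mul0r.
apply/eqP; rewrite eq_le le//=.
rewrite -lee_pdivlMl// -[X in (X <= _)%E](@eq_esum _ _ _ (fun t => (a^-1 * (a * f t))%:E)).
  by rewrite muleC -muleC; apply: le; rewrite ?invr_gt0// => t; rewrite mulr_ge0// ltW.
by move=> t _; rewrite mulKf// gt_eqF.
Qed.

Lemma rsummableZ f (a : R) : rsummable f -> rsummable (fun t => a * f t).
Proof.
move=> hf; rewrite /rsummable; under eq_esum do rewrite normrM.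
rewrite esumZ//; move: (esum_fin (fun t => normr_ge0 (f t)) (rsummable_norm hf)).
by move/fineK => <-; rewrite -EFinM ltry.
Qed.

Lemma rsummableN f : rsummable f -> rsummable (fun t => - f t).
Proof. by apply: le_lt_trans; apply: le_esum => t _; rewrite normrN. Qed.

Lemma rsummableB f g : rsummable f -> rsummable g -> rsummable (fun t => f t - g t).
Proof. by move=> hf hg; apply: rsummableD => //; exact: rsummableN. Qed.

Lemma rsummable0 : rsummable (fun _ : T => 0).
Proof. by rewrite /rsummable esum1// => t _; rewrite normr0. Qed.

Lemma rsummable_sum (I : Type) (r : seq I) (P : pred I) (F : I -> T -> R) :
  (forall i, P i -> rsummable (F i)) -> rsummable (fun t => \sum_(i <- r | P i) F i t).
Proof.
move=> hF; elim: r => [|i r IH].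
  by apply: rsummable_le rsummable0 => t; rewrite big_nil normr0.
case: (boolP (P i)) => Pi; last first.
  by apply: le_lt_trans IH; apply: le_esum => t _; rewrite big_cons (negPf Pi).
apply: le_lt_trans (rsummableD (hF i Pi) IH); apply: le_esum => t _.
by rewrite big_cons Pi.
Qed.

Lemma eq_rsum f g : f =1 g -> rsum f = rsum g.
Proof. by move=> /funext ->. Qed.

Lemma rsum_ge0E f : (forall t, 0 <= f t) ->
  rsum f = fine (\esum_(t in [set: T]) (f t)%:E).
Proof.
move=> f0; rewrite /rsum [X in _ - fine X]esum1 ?subr0.
  by congr fine; apply: eq_esum => t _; rewrite max_l.
by move=> t _; rewrite max_r// oppr_le0.
Qed.

Lemma EFin_rsum f : (forall t, 0 <= f t) -> rsummable f ->
  (rsum f)%:E = \esum_(t in [set: T]) (f t)%:E.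
Proof. by move=> f0 sf; rewrite rsum_ge0E// fineK// esum_fin. Qed.

Lemma rsum_ge0 f : (forall t, 0 <= f t) -> 0 <= rsum f.
Proof. by move=> f0; rewrite rsum_ge0E// fine_ge0// esum_ge0// => t _; rewrite lee_fin. Qed.

Lemma rsum_ubound f (B : R) : (forall t, 0 <= f t) -> 
  (\esum_(t in [set: T]) (f t)%:E <= B%:E)%E -> rsummable f /\ rsum f <= B.
Proof.
move=> f0 fB.
have sf : rsummable f.
  rewrite /rsummable; under eq_esum do rewrite ger0_norm//.
  exact: le_lt_trans fB (ltry _).
by split=> //; rewrite -lee_fin EFin_rsum.
Qed.

Lemma ge0_rsumD f g : (forall t, 0 <= f t) -> (forall t, 0 <= g t) ->
  rsummable f -> rsummable g -> rsum (fun t => f t + g t) = rsum f + rsum g.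
Proof.
move=> f0 g0 sf sg; apply/eqP; rewrite -eqe [X in _ == X]EFinD; apply/eqP; rewrite !EFin_rsum//.
- by rewrite -esumD//; move=> t _; rewrite lee_fin.
- by move=> t; rewrite addr_ge0.
- exact: rsummableD.
Qed.

(** Any decomposition into nonnegative summable parts computes [rsum], not only the canonical one of
    its definition; additivity and homogeneity follow from this freedom. *)
Lemma rsum_diff f g : (forall t, 0 <= f t) -> (forall t, 0 <= g t) ->
  rsummable f -> rsummable g -> rsum (fun t => f t - g t) = rsum f - rsum g.
Proof.
move=> f0 g0 sf sg.
have sfg := rsummableB sf sg.
have sp : rsummable (fun t => Num.max (f t - g t) 0).
  apply: rsummable_le (rsummable_norm sfg) => t.
  by rewrite ger0_norm ?le_max ?lexx ?orbT// ge_max ler_norm normr_ge0.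
have sn : rsummable (fun t => Num.max (- (f t - g t)) 0).
  apply: rsummable_le (rsummable_norm sfg) => t.
  by rewrite ger0_norm ?le_max ?lexx ?orbT// ge_max ler_normr lexx orbT normr_ge0.
rewrite [LHS]/(rsum _) -!rsum_ge0E => [|t|t]; rewrite ?le_max ?lexx ?orbT//.
apply/eqP; rewrite subr_eq addrAC -subr_eq opprK; apply/eqP.
rewrite -!ge0_rsumD// => [|t|t]; rewrite ?le_max ?lexx ?orbT//.
apply: eq_rsum => t.
have [h|h] := leP 0 (f t - g t).
  by rewrite (max_r (_ : - _ <= 0)) ?oppr_le0// addr0 subrK.
by rewrite (max_l (_ : 0 <= - _)) ?oppr_ge0 1?ltW// add0r opprB addrC subrK.
Qed.

Lemma rsum_posneg f : exists f1 f2 : T -> R,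
  [/\ forall t, 0 <= f1 t, forall t, 0 <= f2 t, forall t, f t = f1 t - f2 t,
   (forall t, f1 t <= `|f t|) & (forall t, f2 t <= `|f t|)].
Proof.
exists (fun t => Num.max (f t) 0), (fun t => Num.max (- f t) 0).
split=> t; rewrite ?le_max ?lexx ?orbT//.
- have [h|h] := leP 0 (f t); first by rewrite max_r ?oppr_le0// subr0.
  by rewrite max_l ?oppr_ge0 1?ltW// sub0r opprK.
- by rewrite ge_max ler_norm normr_ge0.
- by rewrite ge_max -normrN ler_norm normr_ge0.
Qed.

Lemma rsumD f g : rsummable f -> rsummable g ->
  rsum (fun t => f t + g t) = rsum f + rsum g.
Proof.
move=> sf sg.
have [f1 [f2 [f10 f20 fE f1f f2f]]] := rsum_posneg f.
have [g1 [g2 [g10 g20 gE g1g g2g]]] := rsum_posneg g.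
have sf1 : rsummable f1 by apply: rsummable_le (rsummable_norm sf) => t; rewrite ger0_norm.
have sf2 : rsummable f2 by apply: rsummable_le (rsummable_norm sf) => t; rewrite ger0_norm.
have sg1 : rsummable g1 by apply: rsummable_le (rsummable_norm sg) => t; rewrite ger0_norm.
have sg2 : rsummable g2 by apply: rsummable_le (rsummable_norm sg) => t; rewrite ger0_norm.
rewrite (eq_rsum fE) (eq_rsum gE) !rsum_diff//.
rewrite (@eq_rsum _ (fun t => (f1 t + g1 t) - (f2 t + g2 t))).
  rewrite rsum_diff ?ge0_rsumD//; try by move=> t; rewrite addr_ge0.
  - by ring.
  - exact: rsummableD.
  - exact: rsummableD.
by move=> t; rewrite fE gE; ring.
Qed.

Lemma rsumN f : rsum (fun t => - f t) = - rsum f.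
Proof.
rewrite /rsum opprB; congr (_ - fine _).
by apply: eq_esum => t _; rewrite opprK.
Qed.

Lemma rsumB f g : rsummable f -> rsummable g ->
  rsum (fun t => f t - g t) = rsum f - rsum g.
Proof. by move=> sf sg; rewrite rsumD ?rsumN//; exact: rsummableN. Qed.

Lemma rsum0 : rsum (fun _ : T => 0 : R) = 0.
Proof. by rewrite rsum_ge0E// esum1. Qed.

Lemma ge0_rsumZ f (a : R) : 0 <= a -> (forall t, 0 <= f t) ->
  rsummable f -> rsum (fun t => a * f t) = a * rsum f.
Proof.
move=> a0 f0 sf; apply/eqP; rewrite -eqe EFinM; apply/eqP; rewrite !EFin_rsum ?esumZ//.
  by move=> t; rewrite mulr_ge0.
exact: rsummableZ.
Qed.

Lemma rsumZ f (a : R) : rsummable f -> rsum (fun t => a * f t) = a * rsum f.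
Proof.
move=> sf.
have [f1 [f2 [f10 f20 fE f1f f2f]]] := rsum_posneg f.
have sf1 : rsummable f1 by apply: rsummable_le (rsummable_norm sf) => t; rewrite ger0_norm.
have sf2 : rsummable f2 by apply: rsummable_le (rsummable_norm sf) => t; rewrite ger0_norm.
wlog a0 : a / 0 <= a => [wl|].
  have [a0|a0] := leP 0 a; first exact: wl.
  rewrite -[in RHS](opprK a) mulNr -wl ?oppr_ge0 1?ltW// -rsumN.
  by apply: eq_rsum => t; rewrite mulNr opprK.
rewrite (eq_rsum fE) (@eq_rsum _ (fun t => a * f1 t - a * f2 t)) => [|t]; last first.
  by rewrite fE mulrBr.
rewrite !rsum_diff// ?ge0_rsumZ//; try exact: rsummableZ.
- by ring.
- by move=> t; rewrite mulr_ge0.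
- by move=> t; rewrite mulr_ge0.
Qed.

Lemma ler_rsum f g : rsummable f -> rsummable g -> (forall t, f t <= g t) ->
  rsum f <= rsum g.
Proof.
move=> sf sg fg; rewrite -subr_ge0 -rsumB//.
by apply: rsum_ge0 => t; rewrite subr_ge0.
Qed.

Lemma ler_norm_rsum f : rsummable f -> `|rsum f| <= rsum (fun t => `|f t|).
Proof.
move=> sf; rewrite ler_norml -rsumN !ler_rsum//.
- exact: rsummable_norm.
- by move=> t; rewrite ler_norm.
- by apply: rsummableN; exact: rsummable_norm.
- by move=> t; rewrite lerNl -normrN ler_norm.
Qed.

Lemma rsum_sum (I : Type) (r : seq I) (P : pred I) (F : I -> T -> R) :
  (forall i, P i -> rsummable (F i)) ->
  rsum (fun t => \sum_(i <- r | P i) F i t) = \sum_(i <- r | P i) rsum (F i).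
Proof.
move=> hF; elim: r => [|i r IH].
  by rewrite big_nil -[RHS]rsum0; apply: eq_rsum => t; rewrite big_nil.
rewrite big_cons; case: (boolP (P i)) => Pi; last first.
  by rewrite -IH; apply: eq_rsum => t; rewrite big_cons (negPf Pi).
rewrite -IH -rsumD; [|exact: hF|exact: rsummable_sum].
by apply: eq_rsum => t; rewrite big_cons Pi.
Qed.

Lemma ler_sum_rsum f (s : seq T) : (forall t, 0 <= f t) -> rsummable f -> uniq s ->
  \sum_(t <- s) f t <= rsum f.
Proof. by move=> f0 sf us; rewrite -lee_fin EFin_rsum// esum_ge_seq. Qed.

Lemma ler_rsum1 f t : (forall t, 0 <= f t) -> rsummable f -> f t <= rsum f.
Proof. by move=> f0 sf; rewrite -[f t](big_seq1 +%R) ler_sum_rsum. Qed.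

(** One finite set serves every [g] dominated by [f]. This covers truncation to boxes as well as the
    aliasing error of the discrete Fourier transform, where [g] changes with the mesh. *)
Lemma rsum_tail f (e : R) : rsummable f -> 0 < e -> exists s : seq T,
  forall g, (forall t, `|g t| <= `|f t|) -> (forall t, t \in s -> g t = 0) -> 
    rsum (fun t => `|g t|) <= e.
Proof.
move=> sf e0; have sf' := rsummable_norm sf.
have := esum_fin (fun t => normr_ge0 (f t)) sf'.
move=> /fineK finE.
have : ((rsum (fun t => `|f t|) - e)%:E < \esum_(t in [set: T]) `|f t|%:E)%E.
  by rewrite -EFin_rsum// lte_fin ltrBlDr ltrDl.
move=> /ereal_sup_gt[_ [A [finA _]] <-]; rewrite fsbig_finite//= sumEFin lte_fin.
set s := finmap.enum_fset (fset_set A) => hs; exists s => g gf gs.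
have sg : rsummable g.
  by apply: rsummable_le sf' => t.
have [sF FE] : rsummable (fun t => if t \in s then `|f t| else 0) /\ \sum_(t <- s) `|f t| <= rsum (fun t => if t \in s then `|f t| else 0).
  have sF : rsummable (fun t => if t \in s then `|f t| else 0).
    by apply: rsummable_le sf' => t; case: ifP; rewrite ?normr_id ?normr0.
  split=> //; rewrite big_seq; under eq_bigr => t ts do rewrite -[`|f t|]/(if true then `|f t| else 0) -{1}ts.
  rewrite -big_seq; apply: ler_sum_rsum => //; last exact: finmap.fset_uniq.
  by move=> t; case: ifP.
rewrite -(lerD2l (rsum (fun t => if t \in s then `|f t| else 0))).
apply: (@le_trans _ _ (rsum (fun t => `|f t|))).
  rewrite -rsumD//; last exact: rsummable_norm.
  apply: ler_rsum => //; first by apply: rsummableD => //; exact: rsummable_norm.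
  by move=> t; case: ifPn => ts; [rewrite gs// normr0 addr0|rewrite add0r].
by rewrite -lerBlDr (le_trans (ltW hs)).
Qed.

Lemma rsum_finsupp f (s : seq T) : uniq s -> (forall t, t \notin s -> f t = 0) ->
  rsummable f /\ rsum f = \sum_(t <- s) f t.
Proof.
move=> us f0.
have key (g : T -> R) : (forall t, 0 <= g t) -> (forall t, t \notin s -> g t = 0) ->
    \esum_(t in [set: T]) (g t)%:E = (\sum_(t <- s) g t)%:E.
  move=> g0 gs; rewrite (esumID [set` s]) => [|t _]; last by rewrite lee_fin.
  rewrite setTI [X in (_ + X)%E]esum1 ?adde0.
    rewrite (@esum_fset _ _ [set` s])//; last by move=> *; rewrite lee_fin.
    by rewrite -fsbig_seq// sumEFin.
  by move=> t [_ /negP ts]; rewrite gs.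
have sf : rsummable f.
  rewrite /rsummable key ?ltry// => t ts; by rewrite f0// normr0.
split=> //.
have [f1 [f2 [f10 f20 fE f1f f2f]]] := rsum_posneg f.
have h1 t : t \notin s -> f1 t = 0.
  by move=> ts; apply: le_anti; rewrite f10 (le_trans (f1f t))// f0// normr0.
have h2 t : t \notin s -> f2 t = 0.
  by move=> ts; apply: le_anti; rewrite f20 (le_trans (f2f t))// f0// normr0.
have sf1 : rsummable f1 by apply: rsummable_le (rsummable_norm sf) => t; rewrite ger0_norm.
have sf2 : rsummable f2 by apply: rsummable_le (rsummable_norm sf) => t; rewrite ger0_norm.
rewrite (eq_rsum fE) rsum_diff// !rsum_ge0E// !key//= -sumrB.
by apply: eq_bigr => t _.
Qed.

End one_index.

Section two_indices.
Variables T U : choiceType.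

Lemma rsummable_reindex (e : T -> U) (f : U -> R) : bijective e ->
  rsummable (f \o e) <-> rsummable f.
Proof.
by move=> [g eg ge]; rewrite /rsummable (reindex_esum [set: T] [set: U] e (fun t => `|f t|%:E))//;
  split=> // [x y _ _ /(can_inj eg)//|x _]; exists (g x).
Qed.

Lemma rsum_reindex (e : T -> U) (f : U -> R) : bijective e ->
  rsum f = rsum (f \o e).
Proof.
move=> [g eg ge]; have be : set_bij [set: T] [set: U] e.
  by split=> // [x y _ _ /(can_inj eg)//|x _]; exists (g x).
by rewrite /rsum !(reindex_esum [set: T] [set: U] e).
Qed.

Lemma esum_pair (f : T * U -> R) : (forall z, 0 <= f z) ->
  \esum_(z in [set: T * U]) (f z)%:E =
  \esum_(x in [set: T]) \esum_(y in [set: U]) (f (x, y))%:E.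
Proof.
move=> f0; rewrite (@esum_esum _ _ _ _ (fun=> setT) (fun x y => (f (x, y))%:E)) => [|*]; last by rewrite lee_fin.
rewrite (_ : _ `*`` _ = setT); first by apply: eq_esum => -[].
by apply/seteqP; split.
Qed.

Lemma rsummable_pair (f : T * U -> R) :
  (forall x, rsummable (fun y => f (x, y))) ->
  rsummable (fun x => rsum (fun y => `|f (x, y)|)) -> rsummable f.
Proof.
move=> sf sF; rewrite /rsummable (esum_pair (fun z => normr_ge0 (f z))).
apply: le_lt_trans sF; apply: le_esum => x _.
rewrite -EFin_rsum//; last exact: rsummable_norm.
by rewrite lee_fin ler_norm.
Qed.

Lemma rsummable_section (f : T * U -> R) x : rsummable f -> rsummable (fun y => f (x, y)).
Proof.
rewrite /rsummable (esum_pair (fun z => normr_ge0 (f z))); apply: le_lt_trans.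
rewrite -[leLHS](@esum_set1 _ _ x (fun x => \esum_(y in [set: U]) `|f (x, y)|%:E)); last first.
  by apply: esum_ge0 => *; rewrite lee_fin.
rewrite esum_mkcond; apply: le_esum => z _; case: ifP => // _.
by apply: esum_ge0 => *; rewrite lee_fin.
Qed.

Lemma ge0_rsum_pair (f : T * U -> R) : (forall z, 0 <= f z) -> rsummable f ->
  rsummable (fun x => rsum (fun y => f (x, y))) /\
  rsum f = rsum (fun x => rsum (fun y => f (x, y))).
Proof.
move=> f0 sf.
have h : \esum_(z in [set: T * U]) (f z)%:E = \esum_(x in [set: T]) (rsum (fun y => f (x, y)))%:E.
  rewrite esum_pair//; apply: eq_esum => x _.
  by rewrite EFin_rsum//; exact: rsummable_section.
have r0 x : 0 <= rsum (fun y => f (x, y)) by apply: rsum_ge0.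
split.
  rewrite /rsummable; under eq_esum do rewrite ger0_norm//.
  rewrite -h; apply: le_lt_trans sf; apply: le_esum => z _.
  by rewrite lee_fin ler_norm.
by rewrite !rsum_ge0E// h.
Qed.

Lemma rsum_pair (f : T * U -> R) : rsummable f ->
  rsummable (fun x => rsum (fun y => f (x, y))) /\
  rsum f = rsum (fun x => rsum (fun y => f (x, y))).
Proof.
move=> sf.
have [f1 [f2 [f10 f20 fE f1f f2f]]] := rsum_posneg f.
have sf1 : rsummable f1 by apply: rsummable_le (rsummable_norm sf) => t; rewrite ger0_norm.
have sf2 : rsummable f2 by apply: rsummable_le (rsummable_norm sf) => t; rewrite ger0_norm.
have [s1 e1] := ge0_rsum_pair f10 sf1.
have [s2 e2] := ge0_rsum_pair f20 sf2.
have E x : rsum (fun y => f (x, y)) = rsum (fun y => f1 (x, y)) - rsum (fun y => f2 (x, y)).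
  rewrite -rsumB; [|exact: rsummable_section..].
  by apply: eq_rsum => y; rewrite fE.
split.
  by rewrite (funext E); exact: rsummableB.
by rewrite (eq_rsum fE) rsumB// e1 e2 -rsumB//; apply: eq_rsum => x; rewrite E.
Qed.

End two_indices.

Lemma rsum_exchange (T U : choiceType) (f : T -> U -> R) :
  rsummable (fun z : T * U => f z.1 z.2) ->
  rsum (fun x => rsum (f x)) = rsum (fun y => rsum (fun x => f x y)).
Proof.
move=> sf; have [_ <-] := rsum_pair sf.
have bs : bijective (fun z : U * T => (z.2, z.1)).
  by exists (fun z : T * U => (z.2, z.1)) => -[].
rewrite (rsum_reindex _ bs).
by have [_ ->] := rsum_pair ((rsummable_reindex _ bs).2 sf).
Qed.

End summation.

(** * Complex-valued absolutely summable families *)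

Section complex_summation.
Variable R : realType.
Local Notation nc := (@ComplexField.Normc.normc R).
Local Notation "x %:C" := (real_complex R x) (at level 1, format "x %:C").

Lemma cplx_eq (x y : R[i]) : complex.Re x = complex.Re y -> complex.Im x = complex.Im y -> x = y.
Proof. by case: x => a b; case: y => c d /= -> ->. Qed.

Lemma cReD (x y : R[i]) : complex.Re (x + y) = complex.Re x + complex.Re y.
Proof. by case: x; case: y. Qed.

Lemma cImD (x y : R[i]) : complex.Im (x + y) = complex.Im x + complex.Im y.
Proof. by case: x; case: y. Qed.

Lemma cReM (x y : R[i]) : complex.Re (x * y) =
  complex.Re x * complex.Re y - complex.Im x * complex.Im y.
Proof. by case: x; case: y. Qed.

Lemma cImM (x y : R[i]) : complex.Im (x * y) =
  complex.Re x * complex.Im y + complex.Im x * complex.Re y.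
Proof. by case: x; case: y. Qed.

Lemma nc0 : nc 0 = 0. Proof. exact: ComplexField.Normc.normc0. Qed.
Lemma nc1 : nc 1 = 1. Proof. exact: ComplexField.Normc.normc1. Qed.
Lemma ncM x y : nc (x * y) = nc x * nc y. Proof. exact: ComplexField.Normc.normcM. Qed.
Lemma ncD x y : nc (x + y) <= nc x + nc y. Proof. exact: le_normcD. Qed.
Lemma ncN x : nc (- x) = nc x. Proof. exact: normcN. Qed.
Lemma ncB x y : nc (x - y) <= nc x + nc y. Proof. by rewrite -(ncN y) ncD. Qed.
Lemma nc_ge0 x : 0 <= nc x. Proof. by case: x => a b; exact: sqrtr_ge0. Qed.
Lemma nc_eq0 x : nc x = 0 -> x = 0. Proof. exact: ComplexField.Normc.eq0_normc. Qed.

Lemma ncX x n : nc (x ^+ n) = nc x ^+ n.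
Proof. by elim: n => [|n IH]; rewrite ?expr0 ?nc1// !exprS ncM IH. Qed.

Lemma nc_real (a : R) : nc a%:C = `|a|.
Proof. by rewrite /= expr0n/= addr0 sqrtr_sqr. Qed.

Lemma nc_Re x : `|complex.Re x| <= nc x.
Proof.
case: x => a b /=; rewrite -sqrtr_sqr ler_wsqrtr// lerDl sqr_ge0//.
Qed.

Lemma nc_Im x : `|complex.Im x| <= nc x.
Proof. by case: x => a b /=; rewrite -sqrtr_sqr ler_wsqrtr// lerDr sqr_ge0. Qed.

Lemma nc_ReIm x : nc x <= `|complex.Re x| + `|complex.Im x|.
Proof.
case: x => a b /=; rewrite -[leRHS]ger0_norm ?addr_ge0// -sqrtr_sqr ler_wsqrtr//.
by rewrite sqrrD !real_normK ?num_real// addrAC lerDl mulrn_wge0// mulr_ge0.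
Qed.

Lemma nc_sum (I : Type) (r : seq I) (P : pred I) (F : I -> R[i]) :
  nc (\sum_(i <- r | P i) F i) <= \sum_(i <- r | P i) nc (F i).
Proof.
elim/big_ind2 : _ => [|x1 x2 y1 y2 h1 h2|//]; first by rewrite nc0.
by rewrite (le_trans (ncD _ _))// lerD.
Qed.

Lemma normCE (x : R[i]) : `|x| = (nc x)%:C. Proof. by []. Qed.

Lemma cexpiD (a b : R) : cexpi (a + b) = cexpi a * cexpi b.
Proof.
apply: cplx_eq; first by rewrite cReM /= cosD.
by rewrite cImM /= sinD addrC [X in _ + X]mulrC [X in X + _]mulrC.
Qed.

Lemma cexpi0 : cexpi 0 = 1 :> R[i].
Proof. by rewrite /cexpi cos0 sin0. Qed.

Lemma nc_cexpi (a : R) : nc (cexpi a) = 1.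
Proof. by rewrite /= cos2Dsin2 sqrtr1. Qed.

Lemma cexpi_neq0 (a : R) : cexpi a != 0 :> R[i].
Proof. by apply/eqP => h; have := nc_cexpi a; rewrite h nc0 => /eqP; rewrite eq_sym oner_eq0. Qed.

Lemma cexpiN (a : R) : cexpi (- a) = (cexpi a)^-1.
Proof. by apply: (mulIf (cexpi_neq0 a)); rewrite -cexpiD addNr cexpi0 mulVf// cexpi_neq0. Qed.

Lemma cexpi_sum (I : Type) (r : seq I) (F : I -> R) :
  cexpi (\sum_(i <- r) F i) = \prod_(i <- r) cexpi (F i).
Proof.
elim: r => [|i r IH]; first by rewrite !big_nil cexpi0.
by rewrite !big_cons cexpiD IH.
Qed.

Lemma cexpi_mulrn (a : R) n : cexpi (a *+ n) = cexpi a ^+ n.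
Proof. by elim: n => [|n IH]; rewrite ?mulr0n ?cexpi0// mulrS exprS cexpiD IH. Qed.

Definition csummable (T : choiceType) (f : T -> R[i]) : Prop :=
  rsummable (fun t => nc (f t)).

Section one_index.
Variable T : choiceType.
Implicit Types f g : T -> R[i].

Lemma csummable_Re f : csummable f -> rsummable (fun t => complex.Re (f t)).
Proof. by apply: rsummable_le => t; exact: nc_Re. Qed.

Lemma csummable_Im f : csummable f -> rsummable (fun t => complex.Im (f t)).
Proof. by apply: rsummable_le => t; exact: nc_Im. Qed.

Lemma csummable_ReIm f : rsummable (fun t => complex.Re (f t)) ->
  rsummable (fun t => complex.Im (f t)) -> csummable f.
Proof.
move=> s1 s2; apply: rsummable_le (rsummableD (rsummable_norm s1) (rsummable_norm s2)) => t.
by rewrite ger0_norm ?nc_ge0// nc_ReIm.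
Qed.

Lemma csummable_le f (g : T -> R) : (forall t, nc (f t) <= g t) -> rsummable g -> csummable f.
Proof. by move=> fg; apply: rsummable_le => t; rewrite ger0_norm ?nc_ge0. Qed.

Lemma csummable_real (f : T -> R) : rsummable f -> csummable (fun t => (f t)%:C).
Proof. by move=> sf; apply: csummable_le (rsummable_norm sf) => t; rewrite nc_real. Qed.

Lemma csummableD f g : csummable f -> csummable g -> csummable (fun t => f t + g t).
Proof. by move=> sf sg; apply: csummable_le (rsummableD sf sg) => t; exact: ncD. Qed.

Lemma csummableZ f (a : R[i]) : csummable f -> csummable (fun t => a * f t).
Proof. by move=> sf; apply: csummable_le (rsummableZ (nc a) sf) => t; rewrite ncM. Qed.

Lemma csummableN f : csummable f -> csummable (fun t => - f t).
Proof. by apply: csummable_le => t; rewrite ncN. Qed.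

Lemma csummableB f g : csummable f -> csummable g -> csummable (fun t => f t - g t).
Proof. by move=> sf sg; apply: csummableD => //; exact: csummableN. Qed.

Lemma csummable_sum (I : Type) (r : seq I) (P : pred I) (F : I -> T -> R[i]) :
  (forall i, P i -> csummable (F i)) -> csummable (fun t => \sum_(i <- r | P i) F i t).
Proof.
move=> hF; apply: csummable_le (rsummable_sum r hF) => t; exact: nc_sum.
Qed.

Lemma eq_csum f g : f =1 g -> csum f = csum g.
Proof. by move=> /funext ->. Qed.

Lemma csumD f g : csummable f -> csummable g ->
  csum (fun t => f t + g t) = csum f + csum g.
Proof.
move=> sf sg; apply: cplx_eq; rewrite (cReD, cImD) /= -rsumD.
- by apply: eq_rsum => t; rewrite cReD.
- exact: csummable_Re.
- exact: csummable_Re.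
- by apply: eq_rsum => t; rewrite cImD.
- exact: csummable_Im.
- exact: csummable_Im.
Qed.

Lemma csumZ f (a : R[i]) : csummable f -> csum (fun t => a * f t) = a * csum f.
Proof.
move=> sf; have s1 := csummable_Re sf; have s2 := csummable_Im sf.
apply: cplx_eq; rewrite (cReM, cImM) /= -!rsumZ//.
- rewrite -rsumB; [|exact: rsummableZ..].
  by apply: eq_rsum => t; rewrite cReM.
- rewrite -rsumD; [|exact: rsummableZ..].
  by apply: eq_rsum => t; rewrite cImM.
Qed.

Lemma csumN f : csummable f -> csum (fun t => - f t) = - csum f.
Proof.
move=> sf; rewrite -mulN1r -csumZ//; apply: eq_csum => t; by rewrite mulN1r.
Qed.

Lemma csumB f g : csummable f -> csummable g ->
  csum (fun t => f t - g t) = csum f - csum g.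
Proof. by move=> sf sg; rewrite csumD ?csumN//; exact: csummableN. Qed.

Lemma csum_real (f : T -> R) : csum (fun t => (f t)%:C) = (rsum f)%:C.
Proof. by apply: cplx_eq => //=; rewrite rsum0. Qed.

Lemma csum0 : csum (fun _ : T => 0 : R[i]) = 0.
Proof. by rewrite -[RHS]/(0%:C) -(rsum0 R T) -csum_real. Qed.

Lemma csum_sum (I : Type) (r : seq I) (P : pred I) (F : I -> T -> R[i]) :
  (forall i, P i -> csummable (F i)) ->
  csum (fun t => \sum_(i <- r | P i) F i t) = \sum_(i <- r | P i) csum (F i).
Proof.
move=> hF; elim: r => [|i r IH].
  by rewrite big_nil -[RHS]csum0; apply: eq_csum => t; rewrite big_nil.
rewrite big_cons; case: (boolP (P i)) => Pi; last first.
  by rewrite -IH; apply: eq_csum => t; rewrite big_cons (negPf Pi).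
rewrite -IH -csumD; [|exact: hF|exact: csummable_sum].
by apply: eq_csum => t; rewrite big_cons Pi.
Qed.

(* Multiplying by a unimodular constant makes the sum real nonnegative. *)
Lemma nc_csum f : csummable f -> nc (csum f) <= rsum (fun t => nc (f t)).
Proof.
move=> sf; have [/eqP->|h] := boolP (csum f == 0).
  by rewrite nc0; apply: rsum_ge0 => t; exact: nc_ge0.
have n0 : nc (csum f) != 0 by apply: contra h => /eqP/nc_eq0 ->.
pose z : R[i] := (nc (csum f))%:C / csum f.
have nz : nc z = 1.
  apply: (mulIf n0); rewrite -ncM /z mulfVK// nc_real ger0_norm ?nc_ge0//.
  by rewrite mul1r.
have E : nc (csum f) = complex.Re (csum (fun t => z * f t)).
  by rewrite csumZ// /z mulfVK.
rewrite E /=; apply: ler_rsum => //.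
  by apply: csummable_Re; exact: csummableZ.
by move=> t; rewrite (le_trans (ler_norm _))// (le_trans (nc_Re _))// ncM nz mul1r.
Qed.

Lemma nc_csum_le f (g : T -> R) : (forall t, nc (f t) <= g t) -> rsummable g ->
  nc (csum f) <= rsum g.
Proof.
move=> fg sg; have sf := csummable_le fg sg.
by rewrite (le_trans (nc_csum sf))// ler_rsum.
Qed.

Lemma csum_finsupp f (s : seq T) : uniq s -> (forall t, t \notin s -> f t = 0) ->
  csummable f /\ csum f = \sum_(t <- s) f t.
Proof.
move=> us f0.
have r0 t : t \notin s -> complex.Re (f t) = 0 by move=> /f0 ->.
have i0 t : t \notin s -> complex.Im (f t) = 0 by move=> /f0 ->.
have [s1 e1] := rsum_finsupp us r0.
have [s2 e2] := rsum_finsupp us i0.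
split; first exact: csummable_ReIm.
apply: cplx_eq; rewrite /= ?e1 ?e2.
  by elim/big_rec2 : _ => // t x y _ ->; rewrite cReD.
by elim/big_rec2 : _ => // t x y _ ->; rewrite cImD.
Qed.

End one_index.

Section two_indices.
Variables T U : choiceType.

Lemma csummable_reindex (e : T -> U) (f : U -> R[i]) : bijective e ->
  csummable (f \o e) <-> csummable f.
Proof. by move=> be; exact: (rsummable_reindex (fun t => nc (f t)) be). Qed.

Lemma csum_reindex (e : T -> U) (f : U -> R[i]) : bijective e ->
  csum f = csum (f \o e).
Proof. by move=> be; rewrite /csum !(rsum_reindex _ be). Qed.

Lemma csummable_section (f : T * U -> R[i]) x : csummable f -> csummable (fun y => f (x, y)).
Proof. by move=> sf; exact: (rsummable_section x sf). Qed.

Lemma csum_pair (f : T * U -> R[i]) : csummable f ->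
  csummable (fun x => csum (fun y => f (x, y))) /\
  csum f = csum (fun x => csum (fun y => f (x, y))).
Proof.
move=> sf.
have [s1 e1] := rsum_pair (csummable_Re sf).
have [s2 e2] := rsum_pair (csummable_Im sf).
split; first exact: csummable_ReIm.
by apply: cplx_eq.
Qed.

End two_indices.

Lemma csum_exchange (T U : choiceType) (f : T -> U -> R[i]) :
  csummable (fun z : T * U => f z.1 z.2) ->
  csum (fun x => csum (f x)) = csum (fun y => csum (fun x => f x y)).
Proof.
move=> sf; apply: cplx_eq; apply: (@rsum_exchange R T U).
  exact: (csummable_Re sf).
exact: (csummable_Im sf).
Qed.

Lemma csummable_prod (T U : choiceType) (f : T -> R[i]) (g : U -> R[i]) :
  csummable f -> csummable g -> csummable (fun z : T * U => f z.1 * g z.2).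
Proof.
move=> sf sg; apply: rsummable_pair => [x|].
  apply: rsummable_le (rsummableZ (nc (f x)) sg) => y /=.
  by rewrite ger0_norm ?nc_ge0// ncM.
apply: rsummable_le (rsummableZ (rsum (fun y => nc (g y))) sf) => x /=.
rewrite ger0_norm; last by apply: rsum_ge0 => y.
rewrite mulrC -rsumZ// le_eqVlt; apply/orP; left; apply/eqP; apply: eq_rsum => y.
by rewrite ger0_norm ?nc_ge0// ncM.
Qed.

End complex_summation.

Arguments ComplexField.Normc.normc : simpl never.
Arguments cexpi : simpl never.
Arguments real_complex_def : simpl never.

Section integer_boxes.
Variable R : realType.

(** Listed in increasing order, so that sums of increments over it telescope. *)
Definition box (m : nat) : seq int := [seq (Posz i - Posz m)%R | i <- iota 0 m.*2.+1].

Lemma box_uniq m : uniq (box m).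
Proof. by rewrite map_inj_uniq ?iota_uniq// => i j /addIr[]. Qed.

Lemma mem_box m (k : int) : (k \in box m) = (`|k|%N <= m)%N.
Proof.
apply/mapP/idP => [[i ih]|km].
  by move: ih; rewrite mem_iota add0n ltnS => /andP[_ im] ->; lia.
exists `|(k + Posz m)%R|%N; last by lia.
by rewrite mem_iota; lia.
Qed.

Lemma sub_box (s : seq int) : exists m, {subset s <= box m}.
Proof.
elim: s => [|k s [m sm]]; first by exists 0%N.
exists (maxn m `|k|%N) => z; rewrite in_cons mem_box => /orP[/eqP ->|/sm].
  exact: leq_maxr.
by rewrite mem_box => zm; rewrite (leq_trans zm)// leq_maxl.
Qed.

Lemma sum_box (V : nmodType) m (F : int -> V) :
  \sum_(k <- box m) F k = \sum_(0 <= i < m.*2.+1) F (Posz i - Posz m).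
Proof. by rewrite big_map /index_iota subn0. Qed.

Lemma rsummable_box (f : int -> R) (B : R) :
  (forall m, \sum_(k <- box m) `|f k| <= B) ->
  rsummable f /\ rsum (fun k => `|f k|) <= B.
Proof.
move=> fB; have h : (\esum_(t in [set: int]) `|f t|%:E <= B%:E)%E.
  apply: rsummable_seq => s us; have [m sm] := sub_box s.
  apply: le_trans (fB m).
  rewrite [leRHS](bigID (mem s))/= -[leLHS]addr0 lerD//; last by apply: sumr_ge0.
  rewrite -[leRHS]big_filter le_eqVlt; apply/orP; left; apply/eqP.
  apply: perm_big.
  apply: uniq_perm => //; first by rewrite filter_uniq// box_uniq.
  by move=> k; rewrite mem_filter /=; case: (boolP (k \in s)) => // /sm ->.
have [s1 s2] := rsum_ubound (fun t => normr_ge0 (f t)) h; split=> //.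
exact: le_lt_trans h (ltry _).
Qed.

Lemma rsum_box_lim (f : int -> R) (e : R) : rsummable f -> 0 < e ->
  exists m0, forall m, (m0 <= m)%N -> `|rsum f - \sum_(k <- box m) f k| <= e.
Proof.
move=> sf e0; have [s hs] := rsum_tail sf e0; have [m0 sm0] := sub_box s.
exists m0 => m m0m.
pose g k := if k \in box m then f k else 0.
have gE : forall k, k \notin box m -> g k = 0 by rewrite /g => k /negPf ->.
have [sg eg] := rsum_finsupp (box_uniq m) gE.
have -> : \sum_(k <- box m) f k = rsum g.
  by rewrite eg big_seq [RHS]big_seq; apply: eq_bigr => k kb; rewrite /g kb.
rewrite -rsumB// (le_trans (ler_norm_rsum _))//; first exact: rsummableB.
apply: hs => k; rewrite /g; case: ifPn => kb; rewrite ?subrr ?subr0 ?normr0//.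
by move=> /sm0; rewrite mem_box => km; move: kb; rewrite mem_box (leq_trans km).
Qed.

End integer_boxes.

(** * Riemann sums of the Gaussian *)

Section riemann_sums.
Variable R : realType.
Variables (h s : R).
Local Notation x_ k := (h * (k : int)%:~R + s).

Lemma box_telescope m (G : R -> R) :
  \sum_(k <- box m) (G (x_ k + h) - G (x_ k)) =
  G (h * m.+1%:R + s) - G (- (h * m%:R) + s).
Proof.
rewrite sum_box.
under eq_bigr => i _.
  have -> : x_ (Posz i - Posz m) + h = x_ (Posz i.+1 - Posz m).
    by rewrite !intrB -!pmulrn -(natr1 i); ring.
  over.
rewrite (telescope_sumr (fun i => G (x_ (Posz i - Posz m))))//.
congr (G _ - G _); last by rewrite sub0r intrN mulrN -pmulrn.
congr (_ * _ + _); rewrite intrB -!pmulrn -natrB; last by lia.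
by congr (_%:R); lia.
Qed.

Hypotheses (h0 : 0 < h) (h1 : h <= 1).

(* Increments of the bounded logistic function telescope, so lattice sums of
   [h e^-|x|] are bounded uniformly in the mesh and the shift. *)
Lemma logistic_increment (x : R) :
  h * expR (- `|x|) <= 2 * (1 + expR 1) *
    (expR (x + h) / (1 + expR (x + h)) - expR x / (1 + expR x)).
Proof.
set y := expR x; have y0 : 0 < y := expR_gt0 x.
set E := expR 1; have E0 : 0 < E := expR_gt0 1.
rewrite expRD -/y; set z := expR h.
have zE : z <= E by rewrite ler_expR.
have z1 : 1 + h <= z by exact: expR_ge1Dx.
have z0 : 0 < z := expR_gt0 h.
have p1 : 0 < 1 + y * z by rewrite addr_gt0// mulr_gt0.
have p2 : 0 < 1 + y by rewrite addr_gt0.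
have -> : y * z / (1 + y * z) - y / (1 + y) = y * (z - 1) / ((1 + y * z) * (1 + y)).
  by field; rewrite !gt_eqF.
rewrite mulrA ler_pdivlMr; last by rewrite mulr_gt0.
have hz : h <= z - 1 by lra.
(* For [x >= 0] the summands 1 in both factors are at most [y]; for [x < 0] the powers of [y] are at
   most 1. *)
have key : expR (- `|x|) * ((1 + y * z) * (1 + y)) <= 2 * (1 + E) * y.
  have yz : y * z <= y * E by rewrite ler_wpM2l// ltW.
  have [x0|x0] := leP 0 x.
    have y1 : 1 <= y by rewrite /y -expR0 ler_expR.
    rewrite ger0_norm// expRN -/y mulrC ler_pdivrMr//.
    apply: (@le_trans _ _ ((y + y * E) * (y + y))); last by rewrite le_eqVlt; apply/orP; left; apply/eqP; ring.
    by apply: ler_pM; lra.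
  have y1 : y <= 1 by rewrite /y -expR0 ler_expR ltW.
  have yE : y * E <= E by rewrite ler_piMl// ltW.
  rewrite ltr0_norm// opprK -/y mulrC ler_wpM2r ?(ltW y0)// mulrC.
  by apply: ler_pM; lra.
apply: le_trans (_ : h * (2 * (1 + E) * y) <= _).
  by rewrite -[leLHS]mulrA; exact: (ler_wpM2l (ltW h0) key).
rewrite [leLHS](_ : _ = 2 * (1 + E) * (y * h)); last by ring.
by rewrite ler_wpM2l ?ler_wpM2l ?(ltW y0)//; lra.
Qed.

Definition exp_mass : R := 2 * (1 + expR 1).

Lemma exp_lattice_sum : rsummable (fun k : int => h * expR (- `|x_ k|)) /\
  rsum (fun k : int => h * expR (- `|x_ k|)) <= exp_mass.
Proof.
have ge0 k : 0 <= h * expR (- `|x_ k|) by rewrite mulr_ge0 ?expR_ge0// ltW.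
have B m : \sum_(k <- box m) `|h * expR (- `|x_ k|)| <= exp_mass.
  apply: le_trans (_ : \sum_(k <- box m) exp_mass * (expR (x_ k + h) / (1 + expR (x_ k + h)) - expR (x_ k) / (1 + expR (x_ k))) <= _).
    by apply: ler_sum => k _; rewrite ger0_norm// logistic_increment.
  rewrite -mulr_sumr (box_telescope _ (fun x => expR x / (1 + expR x))).
  have b (x : R) : 0 <= expR x / (1 + expR x) <= 1.
    have p := expR_gt0 x.
    by apply/andP; split; [apply: divr_ge0; lra|rewrite ler_pdivrMr; lra].
  rewrite ler_piMr//; first by rewrite mulr_ge0// addr_ge0 ?expR_ge0.
  have := b (h * m.+1%:R + s); have := b (- (h * m%:R) + s); lra.
have [sf le] := rsummable_box B; split=> //.
by rewrite (eq_rsum (fun k => esym (ger0_norm (ge0 k)))).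
Qed.

End riemann_sums.

(** * Calculus of one real variable *)

Section derivative_rules.
Variables (R : realType) (x : R).
Implicit Types (f g : R -> R) (a b : R).

Lemma is_derive_eq1 f a b : is_derive x 1 f a -> a = b -> is_derive x 1 f b.
Proof. by move=> h <-. Qed.

Lemma is_derive_add1 f g a b : is_derive x 1 f a -> is_derive x 1 g b ->
  is_derive x 1 (fun y => f y + g y) (a + b).
Proof. by move=> hf hg; exact: is_deriveD. Qed.

Lemma is_derive_mul1 f g a b : is_derive x 1 f a -> is_derive x 1 g b ->
  is_derive x 1 (fun y => f y * g y) (f x * b + g x * a).
Proof. by move=> hf hg; exact: is_deriveM. Qed.

Lemma is_derive_cst1 a : is_derive x 1 (fun=> a) 0.
Proof. exact: is_derive_cst. Qed.

Lemma is_derive_id1 : is_derive x 1 (fun y : R => y) 1.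
Proof. exact: is_derive_id. Qed.

Lemma is_derive_exp1 f a : is_derive x 1 f a ->
  is_derive x 1 (fun y => expR (f y)) (expR (f x) * a).
Proof. by move=> hf; exact: (is_derive1_comp (is_derive_expR (f x)) hf). Qed.

Lemma is_derive_sin1 f a : is_derive x 1 f a ->
  is_derive x 1 (fun y => sin (f y)) (cos (f x) * a).
Proof. by move=> hf; exact: (is_derive1_comp (is_derive_sin (f x)) hf). Qed.

Lemma is_derive_cos1 f a : is_derive x 1 f a ->
  is_derive x 1 (fun y => cos (f y)) (- sin (f x) * a).
Proof. by move=> hf; exact: (is_derive1_comp (is_derive_cos (f x)) hf). Qed.

Lemma is_derive_sum1 (I : Type) (r : seq I) (f : I -> R -> R) (a : I -> R) :
  (forall i, is_derive x 1 (f i) (a i)) ->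
  is_derive x 1 (fun y => \sum_(i <- r) f i y) (\sum_(i <- r) a i).
Proof.
move=> hf; elim: r => [|i r IH].
  under [X in is_derive _ _ X _]funext => y do rewrite big_nil.
  by rewrite big_nil; exact: is_derive_cst1.
under [X in is_derive _ _ X _]funext => y do rewrite big_cons.
by rewrite big_cons; exact: is_derive_add1.
Qed.

End derivative_rules.

Section mean_value.
Variable R : realType.

Lemma is_derive_continuous (f df : R -> R) :
  (forall x : R, is_derive x 1 f (df x)) -> continuous f.
Proof.
by move=> h x; apply: differentiable_continuous; apply/derivable1_diffP; case: (h x).
Qed.

Lemma mean_value (f df : R -> R) (a b : R) : a <= b ->
  (forall x : R, is_derive x 1 f (df x)) ->
  exists2 c : R, a <= c <= b & f b - f a = df c * (b - a).
Proof.
move=> ab h; have [c cab E] := MVT_segment ab (fun x _ => h x)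
  (continuous_subspaceT (is_derive_continuous h)).
by exists c.
Qed.

Lemma mean_value_bound (f df : R -> R) (a b M : R) : a <= b ->
  (forall x : R, is_derive x 1 f (df x)) -> (forall x : R, a <= x <= b -> `|df x| <= M) ->
  `|f b - f a| <= M * (b - a).
Proof.
move=> ab h hM; have [c /hM cM ->] := mean_value ab h.
by rewrite normrM (ger0_norm (_ : 0 <= b - a)) ?subr_ge0// ler_wpM2r// subr_ge0.
Qed.

Lemma sqr_le_exp (x : R) : x ^+ 2 <= 2 * expR `|x|.
Proof.
rewrite -real_normK ?num_real//; have := expR_ge1Dxn 1 (normr_ge0 x).
by rewrite (_ : 2`! = 2%N)//; lra.
Qed.

Lemma le_exp (x : R) : `|x| <= expR `|x|.
Proof. by have := expR_ge1Dx `|x|; lra. Qed.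

(** From [(|x| - 1)^2 >= 0]. The rate 2 leaves [exp (- |x|)] after a factor bounded by [exp |x|] has
    been absorbed. *)
Lemma gauss_le_exp (x : R) : gauss_fun x <= expR 1 * expR (- (2 * `|x|)).
Proof.
rewrite /gauss_fun -expRD ler_expR -real_normK ?num_real//.
by have := sqr_ge0 (`|x| - 1); nra.
Qed.

Lemma is_derive_gauss (x : R) : is_derive x 1 (@gauss_fun R) (- (2 * x) * gauss_fun x).
Proof.
have h1 := is_derive_id1 x.
have h2 := is_derive_mul1 (is_derive_cst1 x (-1)) (is_derive_mul1 h1 h1).
have h3 := is_derive_exp1 h2.
have -> : @gauss_fun R = (fun y => expR (-1 * (y * y))).
  by apply/funext => y; rewrite /gauss_fun mulN1r expr2.
by apply: is_derive_eq1 h3 _; ring.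
Qed.

End mean_value.

Section riemann_remainder.
Variable R : realType.
Variables (h s : R).
Hypotheses (h0 : 0 < h) (h1 : h <= 1).
Variables (G g g' : R -> R) (K : R).
Hypothesis dG : forall x : R, is_derive x 1 G (g x).
Hypothesis dg : forall x : R, is_derive x 1 g (g' x).
Hypothesis g'K : forall x : R, `|g' x| <= K * expR (- `|x|).
Local Notation x_ k := (h * (k : int)%:~R + s).

Lemma taylor_increment (x : R) :
  `|G (x + h) - G x - h * g x| <= h * (h * (K * expR 1)) * expR (- `|x|).
Proof.
have K0 : 0 <= K.
  by rewrite -(pmulr_lge0 _ (expR_gt0 (- `|x|))) (le_trans _ (g'K x)).
have xh : x <= x + h by rewrite lerDl ltW.
have [c /andP[xc cxh] E] := mean_value xh dG.
have -> : G (x + h) - G x - h * g x = (g c - g x) * h by rewrite E; ring.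
rewrite normrM (gtr0_norm h0) mulrC -!mulrA ler_wpM2l ?(ltW h0)//.
apply: le_trans (_ : (K * expR 1 * expR (- `|x|)) * (c - x) <= _).
  apply: (mean_value_bound xc dg) => y /andP[xy yc].
  rewrite (le_trans (g'K y))// -mulrA ler_wpM2l// -expRD ler_expR.
  have dxy : `|x - y| = y - x by rewrite distrC ger0_norm ?subr_ge0.
  have h1' := h1.
  by rewrite lerBrDr addrC (le_trans (lerB_dist _ _))// dxy; lra.
by rewrite mulrC !mulrA ler_wpM2r ?expR_ge0// ler_wpM2r ?expR_ge0// ler_wpM2r//; lra.
Qed.

(** The Taylor errors on the cells add up to [h] times a lattice sum of [h exp (- |x|)], which is
    bounded independently of [m], of the mesh and of the shift. *)
Lemma riemann_box m :
  `|\sum_(k <- box m) h * g (x_ k) - (G (h * m.+1%:R + s) - G (- (h * m%:R) + s))|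
  <= h * (K * expR 1 * exp_mass R).
Proof.
have [sf le] := exp_lattice_sum s h0 h1.
rewrite -(box_telescope h s m G) -sumrB -normrN -sumrN.
apply: le_trans (ler_norm_sum _ _ _) _.
apply: le_trans (_ : \sum_(k <- box m) (h * (K * expR 1)) * (h * expR (- `|x_ k|)) <= _).
  apply: ler_sum => k _; rewrite opprB; apply: le_trans (taylor_increment _) _.
  by rewrite le_eqVlt; apply/orP; left; apply/eqP; ring.
have K0 : 0 <= K.
  by rewrite -(pmulr_lge0 _ (expR_gt0 (- `|0 : R|))) (le_trans _ (g'K 0)).
rewrite -mulr_sumr -!mulrA ler_wpM2l ?(ltW h0)// ler_wpM2l// ler_wpM2l ?expR_ge0//.
apply: le_trans le; apply: ler_sum_rsum => //; last exact: box_uniq.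
by move=> k; rewrite mulr_ge0 ?expR_ge0// ltW.
Qed.

End riemann_remainder.

Section gauss_primitive.
Variable R : realType.
Local Notation mu := (@lebesgue_measure R).

(** The odd part of the distribution function is taken. This fixes the additive constant, so that
    the boundary terms at both ends of a box tend to [sqrt pi / 2]. *)
Lemma gauss_primitive : exists Psi : R -> R,
  [/\ forall x : R, is_derive x 1 Psi (gauss_fun x),
      Psi x @[x --> +oo] --> Num.sqrt pi / 2 &
      forall x, Psi (- x) = - Psi x].
Proof.
pose G (x : R) := (\int[mu]_(t in [set` `]-oo, x]]) gauss_fun t)%R.
have dG (x : R) : is_derive x 1 G (gauss_fun x).
  have ig : mu.-integrable [set` `]-oo, x + 1]] (EFin \o @gauss_fun R).
    by apply: integrableS integrableT_gauss.
  have [] := @continuous_FTC1 R (@gauss_fun R) -oo%O x (x + 1) _ ig.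
  - by rewrite ltrDl.
  - by rewrite ltNyr.
  - exact: continuous_gauss_fun.
  by rewrite derive1E => d1 d2; exact: DeriveDef.
pose Psi x := 2^-1 * (G x + -1 * G (-1 * x)).
have Podd x : Psi (- x) = - Psi x.
  by rewrite /Psi !mulN1r !opprK; ring.
have dPsi (x : R) : is_derive x 1 Psi (gauss_fun x).
  have dGN : is_derive x 1 (fun y => G (-1 * y)) (gauss_fun (-1 * x) * -1).
    have h2 := is_derive_mul1 (is_derive_cst1 x (-1)) (is_derive_id1 x).
    apply: is_derive_eq1 (is_derive1_comp (dG (-1 * x)) h2) _.
    by ring.
  have h3 := is_derive_add1 (dG x) (is_derive_mul1 (is_derive_cst1 x (-1)) dGN).
  apply: is_derive_eq1 (is_derive_mul1 (is_derive_cst1 x 2^-1) h3) _.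
  have -> : gauss_fun (-1 * x) = gauss_fun x.
    by rewrite /gauss_fun mulN1r sqrrN.
  by field.
have P0 : Psi 0 = 0 by have := Podd 0; rewrite oppr0; lra.
have PE (x : R) : 0 < x -> Psi x = gauss_integral_proof.integral0_gauss x.
  move=> x0; rewrite /gauss_integral_proof.integral0_gauss.
  rewrite /Rintegral (@continuous_FTC2 R _ Psi) ?P0 ?sube0//.
  - by apply: continuous_subspaceT => y; exact: continuous_gauss_fun.
  - have cP := is_derive_continuous dPsi.
    split=> [z _||]; first by case: (dPsi z).
      exact: cvg_at_right_filter (cP 0).
    exact: cvg_at_left_filter (cP x).
  - by move=> z _; rewrite derive1E; have /@derive_val := dPsi z; apply.
exists Psi; split=> //.
have h : Num.sqrt (gauss_integral_proof.integral0_gauss x ^+ 2) @[x --> +oo] --> Num.sqrt (pi / 4 : R).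
  apply: continuous_cvg; [exact: sqrt_continuous|].
  exact: gauss_integral_proof.cvg_integral0_gauss_sqr.
have <- : Num.sqrt (pi / 4) = Num.sqrt pi / 2 :> R.
  rewrite sqrtrM ?pi_ge0// sqrtrV// -[4](_ : 2 ^+ 2 = 4 :> R) ?sqrtr_sqr ?ger0_norm//.
  by rewrite expr2; ring.
apply: cvg_trans h; apply: near_eq_cvg; near=> x.
have x0 : 0 < x by near: x; exact: nbhs_pinfty_gt.
rewrite PE// sqrtr_sqr ger0_norm//.
exact: gauss_integral_proof.integral0_gauss_ge0.
Unshelve. all: by end_near. Qed.

End gauss_primitive.

(** * Fourier transform of the Gaussian on fine lattices *)

Section gauss_fourier.
Variable R : realType.
Local Notation nc := (@ComplexField.Normc.normc R).
Local Notation "x %:C" := (real_complex R x) (at level 1, format "x %:C").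

Lemma rsum_box_cvg (f : int -> R) : rsummable f ->
  (\sum_(k <- box m) f k) @[m --> \oo] --> rsum f.
Proof.
move=> sf; apply/cvgrPdist_le => e e0.
have [m0 hm] := rsum_box_lim sf e0.
by near=> m; apply: hm; near: m; exact: nbhs_infty_ge.
Unshelve. all: by end_near. Qed.

Lemma affine_cvgy (h s : R) : 0 < h -> (h * m.+1%:R + s) @[m --> \oo] --> +oo.
Proof.
move=> h0; apply/cvgryPge => A; near=> m.
have : (A - s) / h <= m.+1%:R.
  rewrite ltW// (@lt_le_trans _ _ m%:R) ?ler_nat//.
  by near: m; exact: nbhs_infty_gtr.
by rewrite ler_pdivrMr//; lra.
Unshelve. all: by end_near. Qed.

Lemma affine_cvgy0 (h s : R) : 0 < h -> (h * m%:R - s) @[m --> \oo] --> +oo.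
Proof.
move=> h0; apply/cvgryPge => A; near=> m.
have : (A + s) / h <= m%:R.
  by near: m; exact: nbhs_infty_ger.
by rewrite ler_pdivrMr//; lra.
Unshelve. all: by end_near. Qed.

Lemma gauss_le_exp1 (x : R) : gauss_fun x <= expR 1 * expR (- `|x|).
Proof.
rewrite (le_trans (gauss_le_exp x))// ler_wpM2l ?expR_ge0// ler_expR lerN2.
by rewrite ler_peMl// ler1n.
Qed.

Lemma gaussN (x : R) : gauss_fun (- x) = gauss_fun x.
Proof. by rewrite /gauss_fun sqrrN. Qed.

Section fixed_mesh.
Variables (h s : R).
Hypotheses (h0 : 0 < h) (h1 : h <= 1).
Local Notation x_ k := (h * (k : int)%:~R + s).

Lemma gauss_lattice_summable : rsummable (fun k : int => h * gauss_fun (x_ k)).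
Proof.
have [sf _] := exp_lattice_sum s h0 h1.
apply: rsummable_le (rsummableZ (expR 1) sf) => k.
rewrite ger0_norm ?mulr_ge0 ?gauss_fun_ge0 ?(ltW h0)//.
by rewrite mulrCA ler_wpM2l ?(ltW h0)// gauss_le_exp1.
Qed.

Lemma gauss_trig_summable (c : R -> R) : (forall x : R, `|c x| <= 1) ->
  rsummable (fun k : int => h * gauss_fun (x_ k) * c (x_ k)).
Proof.
move=> c1; apply: rsummable_le gauss_lattice_summable => k.
rewrite normrM ger0_norm ?mulr_ge0 ?gauss_fun_ge0 ?(ltW h0)//.
by rewrite ler_piMr// mulr_ge0 ?gauss_fun_ge0 ?(ltW h0)//.
Qed.

Lemma gauss_lattice_mass :
  `|rsum (fun k : int => h * gauss_fun (x_ k)) - Num.sqrt pi| <=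
  h * (2 * expR 1 * expR 1 * exp_mass R).
Proof.
have [Psi [dPsi Plim Podd]] := gauss_primitive R.
have dg (x : R) : `|- (2 * x) * gauss_fun x| <= 2 * expR 1 * expR (- `|x|).
  rewrite normrM normrN normrM (ger0_norm (gauss_fun_ge0 x)) (ger0_norm (_ : 0 <= 2))//.
  rewrite -!mulrA ler_wpM2l//.
  apply: (@le_trans _ _ (expR `|x| * (expR 1 * expR (- (2 * `|x|))))).
    by apply: ler_pM => //; [exact: gauss_fun_ge0|exact: le_exp|exact: gauss_le_exp].
  by rewrite -!expRD ler_expR; lra.
have B m := riemann_box s h0 h1 dPsi (@is_derive_gauss R) dg m.
set f := fun k : int => h * gauss_fun (x_ k) in B *.
have c1 : (\sum_(k <- box m) f k) @[m --> \oo] --> rsum f.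
  exact: rsum_box_cvg gauss_lattice_summable.
have c2 : Psi (h * m.+1%:R + s) @[m --> \oo] --> Num.sqrt pi / 2.
  by apply: cvg_comp Plim; exact: affine_cvgy.
have c3 : Psi (h * m%:R - s) @[m --> \oo] --> Num.sqrt pi / 2.
  by apply: cvg_comp Plim; exact: affine_cvgy0.
have c4 : `|\sum_(k <- box m) f k - (Psi (h * m.+1%:R + s) + Psi (h * m%:R - s))| @[m --> \oo]
   --> `|rsum f - (Num.sqrt pi / 2 + Num.sqrt pi / 2)|.
  by apply: cvg_norm; apply: cvgB => //; apply: cvgD.
have -> : Num.sqrt pi = Num.sqrt pi / 2 + Num.sqrt pi / 2 :> R by field.
apply: ler_cvg_to c4 (cvg_cst _) _; near=> m.
apply: le_trans (B m); rewrite le_eqVlt; apply/orP; left; apply/eqP.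
congr (`|_ - (_ + _)|); rewrite -Podd; congr Psi; ring.
Unshelve. all: by end_near. Qed.

(* [t |-> F t] solves [F' = - t/2 F] up to a Riemann remainder, because
   [F' + t/2 F] is half the lattice sum of [d/dx (gauss x * sin (t x + phi))]. *)
Lemma gauss_lattice_ode (phi T : R) (F : R -> R) : 0 <= T ->
  (forall t : R, F t = rsum (fun k : int => h * gauss_fun (x_ k) * cos (t * x_ k + phi))) ->
  `|expR (T ^+ 2 / 4) * F T - F 0| <=
  h * (expR (T ^+ 2 / 4) * T * ((14 + 3 * T ^+ 2) * expR 1 * expR 1 * exp_mass R)).
Proof.
move=> T0 FE.
(* Truncation to a box makes the sum finite, hence differentiable in [t] term by term; the limit in
   [m] is taken at the end. *)
pose Fm m (t : R) := \sum_(k <- box m) h * gauss_fun (x_ k) * cos (t * x_ k + phi).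
pose G (t x : R) := gauss_fun x * sin (t * x + phi).
pose g (t x : R) := gauss_fun x * (t * cos (t * x + phi) - 2 * x * sin (t * x + phi)).
pose g' (t x : R) := gauss_fun x *
  ((4 * x ^+ 2 - 2 - t ^+ 2) * sin (t * x + phi) - 4 * x * t * cos (t * x + phi)).
have dlin (t x : R) : is_derive x 1 (fun y : R => t * y + phi) t.
  apply: is_derive_eq1 (is_derive_add1 (is_derive_mul1 (is_derive_cst1 x t) (is_derive_id1 x)) (is_derive_cst1 x phi)) _.
  by ring.
have dG (t x : R) : is_derive x 1 (G t) (g t x).
  apply: is_derive_eq1 (is_derive_mul1 (is_derive_gauss x) (is_derive_sin1 (dlin t x))) _.
  by rewrite /g; ring.
have dg (t x : R) : is_derive x 1 (g t) (g' t x).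
  have e1 := is_derive_mul1 (is_derive_cst1 x t) (is_derive_cos1 (dlin t x)).
  have e2 := is_derive_mul1 (is_derive_mul1 (is_derive_cst1 x (-2)) (is_derive_id1 x)) (is_derive_sin1 (dlin t x)).
  have := is_derive_mul1 (is_derive_gauss x) (is_derive_add1 e1 e2).
  have -> : g t = (fun y : R => gauss_fun y * (t * cos (t * y + phi) + -2 * y * sin (t * y + phi))).
    by apply/funext => y; rewrite /g; ring.
  by move=> /is_derive_eq1; apply; rewrite /g'; ring.
(* The polynomial factor of [g'] is at most [6 x^2 + 2 + 3 T^2] by [2ab <= a^2 + b^2]; then
   [x^2 <= 2 exp |x|] and [1 <= exp |x|] give 14. *)
pose K := (14 + 3 * T ^+ 2) * expR 1.
have g'K (t : R) : 0 <= t <= T -> forall x : R, `|g' t x| <= K * expR (- `|x|).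
  move=> /andP[t0 tT] x; rewrite /g' normrM (ger0_norm (gauss_fun_ge0 x)).
  have e1 : `|(4 * x ^+ 2 - 2 - t ^+ 2) * sin (t * x + phi) - 4 * x * t * cos (t * x + phi)| <= 6 * x ^+ 2 + 2 + 3 * T ^+ 2.
    apply: le_trans (ler_normB _ _) _; rewrite !normrM.
    have s1 := sin_max (t * x + phi); have s2 := cos_max (t * x + phi).
    have tt : t ^+ 2 <= T ^+ 2 by rewrite ler_sqr// nnegrE (le_trans t0).
    have a1 : `|4 * x ^+ 2 - 2 - t ^+ 2| * `|sin (t * x + phi)| <= 4 * x ^+ 2 + 2 + t ^+ 2.
      have -> : 4 * x ^+ 2 + 2 + t ^+ 2 = (4 * x ^+ 2 + 2 + t ^+ 2) * 1 by rewrite mulr1.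
      apply: ler_pM => //.
      rewrite ler_norml; have := sqr_ge0 x; have := sqr_ge0 t; lra.
    have a2 : `|4| * `|x| * `|t| * `|cos (t * x + phi)| <= 2 * x ^+ 2 + 2 * t ^+ 2.
      have -> : 2 * x ^+ 2 + 2 * t ^+ 2 = (2 * x ^+ 2 + 2 * t ^+ 2) * 1 by rewrite mulr1.
      apply: ler_pM => //.
      rewrite (ger0_norm (_ : 0 <= 4))// (ger0_norm t0) -(real_normK (num_real x)).
      by have := sqr_ge0 (`|x| - t); nra.
    by lra.
  have e2 := sqr_le_exp x.
  have e3 : 1 <= expR `|x| by rewrite -expR0 ler_expR.
  apply: (@le_trans _ _ (expR 1 * expR (- (2 * `|x|)) * ((14 + 3 * T ^+ 2) * expR `|x|))).
    apply: ler_pM => //; [exact: gauss_fun_ge0|exact: gauss_le_exp|].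
    apply: (le_trans e1).
    have := ler_wpM2l (sqr_ge0 T) e3; lra.
  have -> : expR (- `|x|) = expR (- (2 * `|x|)) * expR `|x|.
    by rewrite -expRD; congr expR; lra.
  by rewrite /K le_eqVlt; apply/orP; left; apply/eqP; ring.
(* Boundary terms of the truncation, which vanish as [m] grows. *)
pose bd m : R := gauss_fun (h * m.+1%:R + s) + gauss_fun (h * m%:R - s).
have B m (t : R) : 0 <= t <= T ->
    `|\sum_(k <- box m) h * g t (x_ k)| <= h * (K * expR 1 * exp_mass R) + bd m.
  move=> tT; have := riemann_box s h0 h1 (dG t) (dg t) (g'K t tT) m.
  set S := \sum_(k <- box m) _ => HS.
  have : `|S| <= `|S - (G t (h * m.+1%:R + s) - G t (- (h * m%:R) + s))| +
     `|G t (h * m.+1%:R + s) - G t (- (h * m%:R) + s)|.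
    by apply: le_trans (ler_normD _ _); rewrite subrK.
  move=> /le_trans; apply; apply: lerD => //.
  apply: le_trans (ler_normB _ _) _; rewrite /bd.
  apply: lerD; rewrite /G normrM ger0_norm ?gauss_fun_ge0// -[leRHS]mulr1.
    by rewrite ler_wpM2l ?gauss_fun_ge0// sin_max.
  rewrite -(gaussN (_ - s)) opprB addrC.
  by rewrite ler_wpM2l ?gauss_fun_ge0// sin_max.
have dF m (t : R) : is_derive t 1 (fun y : R => expR (y ^+ 2 / 4) * Fm m y)
    (expR (t ^+ 2 / 4) * (2^-1 * \sum_(k <- box m) h * g t (x_ k))).
  have e1 k : is_derive t 1 (fun y : R => h * gauss_fun (x_ k) * cos (y * x_ k + phi))
      (h * gauss_fun (x_ k) * (- sin (t * x_ k + phi) * x_ k)).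
    have l : is_derive t 1 (fun y : R => y * x_ k + phi) (x_ k).
      apply: is_derive_eq1 (is_derive_add1 (is_derive_mul1 (is_derive_id1 t) (is_derive_cst1 t (x_ k))) (is_derive_cst1 t phi)) _.
      by ring.
    by apply: is_derive_eq1 (is_derive_mul1 (is_derive_cst1 t (h * gauss_fun (x_ k))) (is_derive_cos1 l)) _; ring.
  have e2 := is_derive_sum1 (box m) e1.
  have e3 : is_derive t 1 (fun y : R => y ^+ 2 / 4) (t / 2).
    have := is_derive_mul1 (is_derive_cst1 t 4^-1) (is_derive_mul1 (is_derive_id1 t) (is_derive_id1 t)).
    have -> : (fun y : R => 4^-1 * (y * y)) = (fun y : R => y ^+ 2 / 4).
      by apply/funext => y; rewrite expr2; ring.
    by move=> /is_derive_eq1; apply; field.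
  apply: is_derive_eq1 (is_derive_mul1 (is_derive_exp1 e3) e2) _.
  set S1 := \sum_(_ <- _) _; set S2 := \sum_(_ <- _) _; set S3 := \sum_(_ <- _) _.
  suff E : S1 + t / 2 * S2 = 2^-1 * S3 by rewrite -E; ring.
  rewrite /S1 /S2 /S3 !mulr_sumr -big_split/=; apply: eq_bigr => k _.
  by rewrite /g; field.
have C m : `|expR (T ^+ 2 / 4) * Fm m T - Fm m 0| <=
    expR (T ^+ 2 / 4) * (h * (K * expR 1 * exp_mass R) + bd m) * T.
  have := @mean_value_bound R _ _ 0 T (expR (T ^+ 2 / 4) * (h * (K * expR 1 * exp_mass R) + bd m)) T0 (dF m) _.
  rewrite expr0n mul0r expR0 mul1r subr0; apply=> t /andP[t0 tT].
  rewrite normrM ger0_norm ?expR_ge0//; apply: ler_pM => //.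
    by rewrite ler_expR ler_pM2r// ler_sqr// nnegrE (le_trans t0).
  have := B m t; rewrite t0 tT normrM (ger0_norm (_ : 0 <= 2^-1)) ?invr_ge0// => /(_ isT).
  have := normr_ge0 (\sum_(k <- box m) h * g t (x_ k)); lra.
have sF (t : R) : rsummable (fun k : int => h * gauss_fun (x_ k) * cos (t * x_ k + phi)).
  by apply: (gauss_trig_summable (c := fun x => cos (t * x + phi))) => x; exact: cos_max.
have l1 : `|expR (T ^+ 2 / 4) * Fm m T - Fm m 0| @[m --> \oo] --> `|expR (T ^+ 2 / 4) * F T - F 0|.
  rewrite !FE; apply: cvg_norm; apply: cvgB; last exact: rsum_box_cvg (sF 0).
  by apply: cvgMr; exact: rsum_box_cvg (sF T).
have lb : bd m @[m --> \oo] --> (0 : R).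
  rewrite -[X in _ --> X](addr0 0); apply: cvgD.
    by apply: cvg_comp cvg_gauss_fun; exact: affine_cvgy.
  by apply: cvg_comp cvg_gauss_fun; exact: affine_cvgy0.
have l2 : (expR (T ^+ 2 / 4) * (h * (K * expR 1 * exp_mass R) + bd m) * T) @[m --> \oo] -->
    expR (T ^+ 2 / 4) * (h * (K * expR 1 * exp_mass R) + 0) * T.
  by apply: cvgMl; apply: cvgMr; apply: cvgD => //; exact: cvg_cst.
have -> : h * (expR (T ^+ 2 / 4) * T * ((14 + 3 * T ^+ 2) * expR 1 * expR 1 * exp_mass R)) =
    expR (T ^+ 2 / 4) * (h * (K * expR 1 * exp_mass R) + 0) * T.
  by rewrite /K; ring.
by apply: ler_cvg_to l1 l2 _; near=> m; exact: C.
Unshelve. all: by end_near. Qed.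

End fixed_mesh.

End gauss_fourier.

Section gauss_fourier_line.
Variable R : realType.
Local Notation nc := (@ComplexField.Normc.normc R).
Local Notation "x %:C" := (real_complex R x) (at level 1, format "x %:C").

Lemma nc_realD_le (z : R[i]) (a b e1 e2 : R) : `|complex.Re z - a| <= e1 -> 
  `|complex.Im z - b| <= e2 -> nc (z - Complex a b) <= e1 + e2.
Proof.
move=> h1 h2; rewrite (le_trans (nc_ReIm _))//; case: z h1 h2 => x y /= h1 h2.
exact: lerD.
Qed.

Lemma gauss_fourier_base (t : R) : exists C : R, 0 <= C /\
  forall h s : R, 0 < h -> h <= 1 ->
  csummable (fun k : int => (h * gauss_fun (h * k%:~R + s))%:C * cexpi (t * (h * k%:~R + s))) /\
  nc (csum (fun k : int => (h * gauss_fun (h * k%:~R + s))%:C * cexpi (t * (h * k%:~R + s)))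
      - (Num.sqrt pi * expR (- (t ^+ 2 / 4)))%:C) <= h * C.
Proof.
pose T : R := `|t|.
pose C0 := expR (T ^+ 2 / 4) * T * ((14 + 3 * T ^+ 2) * expR 1 * expR 1 * exp_mass R).
pose C1 := 2 * expR 1 * expR 1 * exp_mass R.
have m0 : 0 <= exp_mass R by rewrite mulr_ge0// addr_ge0// expR_ge0.
have C00 : 0 <= C0.
  by rewrite /C0 !mulr_ge0 ?expR_ge0 ?normr_ge0//; have := sqr_ge0 T; lra.
have C10 : 0 <= C1 by rewrite /C1 !mulr_ge0 ?expR_ge0.
exists ((C0 + C1) + C0); split; first by rewrite !addr_ge0.
move=> h s h0 h1.
have sg := gauss_lattice_summable s h0 h1.
have sf : csummable (fun k : int => (h * gauss_fun (h * k%:~R + s))%:C * cexpi (t * (h * k%:~R + s))).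
  apply: csummable_le sg => k; rewrite ncM nc_cexpi mulr1 nc_real ger0_norm//.
  by rewrite mulr_ge0 ?gauss_fun_ge0// ltW.
split=> //.
pose F phi (y : R) := rsum (fun k : int => h * gauss_fun (h * k%:~R + s) * cos (y * (h * k%:~R + s) + phi)).
have ode phi : `|expR (T ^+ 2 / 4) * F phi T - F phi 0| <= h * C0.
  by apply: (@gauss_lattice_ode R h s h0 h1 phi T (F phi)) => //; exact: normr_ge0.
have F00 : F 0 0 = rsum (fun k : int => h * gauss_fun (h * k%:~R + s)).
  by apply: eq_rsum => k; rewrite mul0r addr0 cos0 mulr1.
have mass : `|F 0 0 - Num.sqrt pi| <= h * C1 by rewrite F00; exact: gauss_lattice_mass.
have e1 : expR (- (T ^+ 2 / 4)) <= 1.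
  by rewrite expR_le1 oppr_le0 divr_ge0// sqr_ge0.
have tT : t ^+ 2 = T ^+ 2 by rewrite /T real_normK// num_real.
have finish (phi a b : R) : `|F phi 0 - a| <= b -> `|F phi T - a * expR (- (t ^+ 2 / 4))| <= h * C0 + b.
  move=> Fa.
  have -> : F phi T - a * expR (- (t ^+ 2 / 4)) =
    expR (- (T ^+ 2 / 4)) * ((expR (T ^+ 2 / 4) * F phi T - F phi 0) + (F phi 0 - a)).
    rewrite -tT addrA subrK mulrBr mulrA -expRD addNr expR0 mul1r; congr (_ - _).
    by rewrite mulrC.
  rewrite normrM ger0_norm ?expR_ge0// -[leRHS]mul1r; apply: ler_pM => //.
  by rewrite (le_trans (ler_normD _ _))// lerD.
rewrite mulrDr mulrDr.
apply: (@nc_realD_le _ (Num.sqrt pi * expR (- (t ^+ 2 / 4))) 0).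
  have -> : complex.Re (csum (fun k : int => (h * gauss_fun (h * k%:~R + s))%:C * cexpi (t * (h * k%:~R + s)))) = F 0 T.
    apply: eq_rsum => k; rewrite cReM /= mul0r subr0 addr0.
    by rewrite -[in LHS]cos_norm -[in RHS]cos_norm !normrM normr_id.
  exact: finish.
(* A quarter-period phase turns the sine of the imaginary part into a cosine, to which the same
   differential inequality applies; [cos phi = 0] makes the initial value vanish. *)
have [phi [cphi Ephi]] : exists phi : R, cos phi = 0 /\ forall x : R, sin (t * x) = cos (T * x + phi).
  have [t0|t0] := leP 0 t.
    exists (- (pi / 2)); split; first by rewrite cosN cos_pihalf.
    by move=> x; rewrite cosBpihalf /T ger0_norm.
  exists (pi / 2); split; first by rewrite cos_pihalf.
  by move=> x; rewrite cosDpihalf /T ltr0_norm// mulNr sinN opprK.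
have -> : complex.Im (csum (fun k : int => (h * gauss_fun (h * k%:~R + s))%:C * cexpi (t * (h * k%:~R + s)))) = F phi T.
  by apply: eq_rsum => k; rewrite cImM /= mul0r addr0 Ephi.
have := @finish phi 0 0; rewrite mul0r addr0; apply.
rewrite subr0 normr_le0; apply/eqP.
rewrite -[RHS](rsum0 R int); apply: eq_rsum => k.
by rewrite mul0r add0r cphi mulr0.
Qed.

(** Rescaling by [sqrt (q / 2)]; the restriction on [h] keeps the rescaled mesh below 1. The
    uniformity in the shift [s] is what the induction on the dimension requires. *)
Lemma gauss_fourier_line (q t : R) : 0 < q -> exists C h0 : R, [/\ 0 < h0, 0 <= C &
  forall h s : R, 0 < h -> h <= h0 ->
  csummable (fun k : int => (h * expR (- (q * (h * k%:~R + s) ^+ 2 / 2)))%:C * cexpi (t * (h * k%:~R + s))) /\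
  nc (csum (fun k : int => (h * expR (- (q * (h * k%:~R + s) ^+ 2 / 2)))%:C * cexpi (t * (h * k%:~R + s)))
      - (Num.sqrt (2 * pi / q) * expR (- (t ^+ 2 / q / 2)))%:C) <= h * C].
Proof.
move=> q0; pose a := Num.sqrt (q / 2).
have a0 : 0 < a by rewrite sqrtr_gt0 divr_gt0.
have a2 : a ^+ 2 = q / 2 by rewrite sqr_sqrtr// divr_ge0// ltW.
have an0 : a != 0 by rewrite gt_eqF.
have [C [C0 HC]] := gauss_fourier_base (t / a).
exists C, a^-1; split=> // [|h s h0 h1]; first by rewrite invr_gt0.
have [|s1 e1] := HC (a * h) (a * s) (mulr_gt0 a0 h0).
  by rewrite -ler_pdivlMl// mulr1.
have E k : (h * expR (- (q * (h * k%:~R + s) ^+ 2 / 2)))%:C * cexpi (t * (h * k%:~R + s)) =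
  (a^-1)%:C * ((a * h * gauss_fun (a * h * k%:~R + a * s))%:C * cexpi (t / a * (a * h * k%:~R + a * s))).
  rewrite mulrA -rmorphM; congr (_%:C * cexpi _); last by field.
  rewrite !mulrA mulVf// mul1r; congr (_ * expR (- _)).
  have -> : (a * h * k%:~R + a * s) ^+ 2 = a ^+ 2 * (h * k%:~R + s) ^+ 2 by ring.
  by rewrite a2; field.
rewrite (funext E); split; first exact: csummableZ.
rewrite csumZ//.
have -> : (Num.sqrt (2 * pi / q) * expR (- (t ^+ 2 / q / 2)))%:C =
  (a^-1)%:C * (Num.sqrt pi * expR (- ((t / a) ^+ 2 / 4)))%:C.
  rewrite -rmorphM mulrA; congr (_ * expR (- _))%:C.
    have -> : 2 * pi / q = (q / 2)^-1 * pi by field; rewrite gt_eqF.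
    by rewrite sqrtrM ?invr_ge0 ?divr_ge0 ?ltW// sqrtrV ?divr_ge0 ?ltW.
  by rewrite exprMn exprVn a2; field; rewrite gt_eqF.
rewrite -mulrBr ncM nc_real gtr0_norm ?invr_gt0//.
by rewrite ler_pdivrMl// mulrA.
Qed.

End gauss_fourier_line.

(** * Quadratic forms and completing the square *)

Section forms.
Variable R : realType.

Lemma dotpE d (u v : 'rV[R]_d) : dotp u v = (u *m v^T) 0 0.
Proof. by rewrite /dotp mxE; apply: eq_bigr => i _; rewrite mxE. Qed.

Lemma dotpC d (u v : 'rV[R]_d) : dotp u v = dotp v u.
Proof. by apply: eq_bigr => i _; rewrite mulrC. Qed.

Lemma dotpDl d (u v w : 'rV[R]_d) : dotp (u + v) w = dotp u w + dotp v w.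
Proof. by rewrite /dotp -big_split; apply: eq_bigr => i _; rewrite mxE mulrDl. Qed.

Lemma dotpZl d (a : R) (u w : 'rV[R]_d) : dotp (a *: u) w = a * dotp u w.
Proof. by rewrite /dotp mulr_sumr; apply: eq_bigr => i _; rewrite mxE mulrA. Qed.

Lemma dotpNl d (u w : 'rV[R]_d) : dotp (- u) w = - dotp u w.
Proof. by rewrite -scaleN1r dotpZl mulN1r. Qed.

Lemma dotpBl d (u v w : 'rV[R]_d) : dotp (u - v) w = dotp u w - dotp v w.
Proof. by rewrite dotpDl dotpNl. Qed.

Lemma dotpDr d (u v w : 'rV[R]_d) : dotp w (u + v) = dotp w u + dotp w v.
Proof. by rewrite dotpC dotpDl !(dotpC _ w). Qed.

Lemma dotpZr d (a : R) (u w : 'rV[R]_d) : dotp w (a *: u) = a * dotp w u.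
Proof. by rewrite dotpC dotpZl dotpC. Qed.

Lemma dotpNr d (u w : 'rV[R]_d) : dotp w (- u) = - dotp w u.
Proof. by rewrite dotpC dotpNl dotpC. Qed.

Lemma dotpBr d (u v w : 'rV[R]_d) : dotp w (u - v) = dotp w u - dotp w v.
Proof. by rewrite dotpDr dotpNr. Qed.

Lemma dotp0l d (w : 'rV[R]_d) : dotp 0 w = 0.
Proof. by rewrite /dotp big1// => i _; rewrite mxE mul0r. Qed.

Lemma dotp_ge0 d (u : 'rV[R]_d) : 0 <= dotp u u.
Proof. by apply: sumr_ge0 => i _; rewrite -expr2 sqr_ge0. Qed.

Lemma dotp_row_mx d1 d2 (u1 v1 : 'rV[R]_d1) (u2 v2 : 'rV[R]_d2) :
  dotp (row_mx u1 u2) (row_mx v1 v2) = dotp u1 v1 + dotp u2 v2.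
Proof.
rewrite /dotp big_split_ord/=; congr (_ + _); apply: eq_bigr => i _.
  by rewrite !row_mxEl.
by rewrite !row_mxEr.
Qed.

Lemma quad_formE d (Q : 'M[R]_d) v : quad_form Q v = dotp (v *m Q) v.
Proof. by rewrite dotpE. Qed.

Lemma quad_formZ d (Q : 'M[R]_d) a v : quad_form Q (a *: v) = a ^+ 2 * quad_form Q v.
Proof. by rewrite !quad_formE -scalemxAl dotpZl dotpZr mulrA. Qed.

Lemma quad_form0 d (Q : 'M[R]_d) : quad_form Q 0 = 0.
Proof. by rewrite quad_formE mul0mx dotp0l. Qed.

Lemma dotp_mul_sym d (Q : 'M[R]_d) u v : Q^T = Q -> dotp (u *m Q) v = dotp u (v *m Q).
Proof. by move=> QT; rewrite !dotpE trmx_mul QT mulmxA. Qed.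

Lemma posdef_unit d (Q : 'M[R]_d) : sym_posdef Q -> Q \in unitmx.
Proof.
move=> [_ pQ]; rewrite -row_free_unit -kermx_eq0; apply/rowV0P => v /sub_kermxP vQ.
apply/eqP/negPn/negP => /pQ; by rewrite quad_formE vQ dotp0l ltxx.
Qed.

Lemma quad_form_inv d (Q : 'M[R]_d) (z w : 'rV[R]_d) : Q \in unitmx -> w *m Q = z ->
  quad_form (invmx Q) z = dotp w z.
Proof. by move=> uQ <-; rewrite quad_formE mulmxK. Qed.

End forms.

Section completing_the_square.
Variables (R : realType) (d : nat).
Variables (q : R) (b : 'rV[R]_d) (Q' : 'M[R]_d).
Hypothesis q0 : q != 0.
Let Q : 'M[R]_(1 + d) := block_mx q%:M b b^T Q'.
Let a : 'rV[R]_d := q^-1 *: b.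
Let S : 'M[R]_d := Q' - q^-1 *: (b^T *m b).

Lemma dotp_scalar_mx (s t : R) : dotp (s%:M : 'rV_1) t%:M = s * t.
Proof. by rewrite /dotp big_ord1 !mxE !mulr1n. Qed.

Lemma mul_row_tr (u v : 'rV[R]_d) : u *m v^T = (dotp u v)%:M.
Proof. by rewrite [LHS]mx11_scalar dotpE. Qed.

Lemma mul_schur (v : 'rV[R]_d) : v *m S = v *m Q' - (dotp a v) *: b.
Proof.
rewrite mulmxBr -scalemxAr mulmxA mul_row_tr mul_scalar_mx scalerA.
by rewrite /a dotpZl (dotpC b).
Qed.

Lemma quad_form_block (y : R) (v : 'rV[R]_d) :
  quad_form Q (row_mx y%:M v) = q * (y + dotp a v) ^+ 2 + quad_form S v.
Proof.
rewrite !quad_formE mul_schur dotpBl dotpZl mul_row_block dotp_row_mx.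
rewrite mul_row_tr -scalar_mxM -(raddfD (@scalar_mx R 1)) dotp_scalar_mx mul_scalar_mx dotpDl dotpZl.
by rewrite /a !dotpZl (dotpC v b); field.
Qed.

Lemma det_block_schur : \det Q = q * \det S.
Proof.
have E : Q *m block_mx 1%:M (- a) 0 1%:M = block_mx q%:M 0 b^T S.
  rewrite mulmx_block !mulmx1 !mulmx0 !addr0 !mulmxN mul_scalar_mx /a !scalerA mulfV// scale1r.
  by rewrite addNr -scalemxAr addrC.
have := congr1 determinant E.
by rewrite det_mulmx det_ublock !det1 !mulr1 det_lblock det_scalar1.
Qed.

(** The two terms are the exponents produced by the Fourier transform in the first coordinate and,
    at the shifted frequency, in the remaining coordinates with the Schur complement as form. *)
Lemma quad_form_inv_block (z1 : R) (z : 'rV[R]_d) : Q \in unitmx -> S \in unitmx ->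
  quad_form (invmx Q) (row_mx z1%:M z) = z1 ^+ 2 / q + quad_form (invmx S) (z - z1 *: a).
Proof.
move=> uQ uS; set w := (z - z1 *: a) *m invmx S.
have wS : w *m S = z - z1 *: a by rewrite mulmxKV.
rewrite (quad_form_inv uS wS).
rewrite (@quad_form_inv _ _ _ _ (row_mx (z1 / q - dotp a w)%:M w) uQ); last first.
  rewrite mul_row_block mul_row_tr -scalar_mxM -(raddfD (@scalar_mx R 1)) mul_scalar_mx.
  congr row_mx.
    have -> : dotp w b = q * dotp a w by rewrite dotpC /a dotpZl mulrA mulfV// mul1r.
    by congr (_%:M); field.
  move: wS; rewrite mul_schur => /eqP; rewrite subr_eq => /eqP ->.
  by set t := dotp a w; rewrite /a; apply/rowP => i; rewrite !mxE; ring.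
rewrite dotp_row_mx dotp_scalar_mx dotpBr dotpZr (dotpC w a).
by field.
Qed.

End completing_the_square.

Section gauss_fourier_forms.
Variable R : realType.
Local Notation nc := (@ComplexField.Normc.normc R).
Local Notation "x %:C" := (real_complex R x) (at level 1, format "x %:C").

Definition gauss_term d (Q : 'M[R]_d) (z : 'rV[R]_d) (h : R) (x : 'rV[int]_d) : R[i] :=
  (h ^+ d * expR (- (quad_form Q (h *: rvec R x) / 2)))%:C * cexpi (dotp z (h *: rvec R x)).

Lemma nc_gauss_term d (Q : 'M[R]_d) (z : 'rV[R]_d) (h : R) (x : 'rV[int]_d) : 0 <= h ->
  nc (gauss_term Q z h x) = h ^+ d * expR (- (quad_form Q (h *: rvec R x) / 2)).
Proof.
by move=> h0; rewrite ncM nc_cexpi mulr1 nc_real ger0_norm// mulr_ge0 ?expR_ge0// exprn_ge0.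
Qed.

Lemma rvec_row_mx d (k : int) (x : 'rV[int]_d) :
  rvec R (row_mx (k%:M : 'rV_1) x) = row_mx (k%:~R)%:M (rvec R x).
Proof.
by apply/rowP => i; rewrite !mxE; case: (fintype.split i) => j; rewrite !mxE ?ord1 ?eqxx ?mulr1n.
Qed.

Lemma scalar_row_bij d : bijective (fun u : 'rV[int]_d * int => row_mx (u.2%:M : 'rV_1) u.1).
Proof.
exists (fun v : 'rV[int]_(1 + d) => (rsubmx v, lsubmx v 0 0)) => [[x k]|v] /=.
  by rewrite row_mxKr row_mxKl mxE mulr1n.
by rewrite -mx11_scalar hsubmxK.
Qed.

(** After completing the square, the first coordinate carries a one-dimensional Gaussian whose
    center depends on the other coordinates, hence the need for bounds uniform in the shift. *)
Lemma gauss_term_block d (q : R) (b : 'rV[R]_d) (Q' : 'M[R]_d) (z1 : R) (z : 'rV[R]_d)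
    (h : R) (k : int) (x : 'rV[int]_d) : q != 0 ->
  gauss_term (block_mx q%:M b b^T Q' : 'M[R]_(1 + d)) (row_mx z1%:M z) h (row_mx (k%:M : 'rV_1) x) =
  gauss_term (Q' - q^-1 *: (b^T *m b)) (z - z1 *: (q^-1 *: b)) h x *
  ((h * expR (- (q * (h * k%:~R + dotp (q^-1 *: b) (h *: rvec R x)) ^+ 2 / 2)))%:C *
   cexpi (z1 * (h * k%:~R + dotp (q^-1 *: b) (h *: rvec R x)))).
Proof.
move=> q0; rewrite /gauss_term rvec_row_mx scale_row_mx scale_scalar_mx.
rewrite quad_form_block// dotp_row_mx dotp_scalar_mx.
set s := dotp (q^-1 *: b) _; set qS := quad_form (_ - _) _.
rewrite mulrACA -rmorphM -cexpiD; congr (_%:C * cexpi _).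
  by rewrite mulrACA -exprSr -expRD; congr (_ * expR _); ring.
by rewrite dotpBl dotpZl -/s; ring.
Qed.

Definition gauss_value d (Q : 'M[R]_d) (z : 'rV[R]_d) : R :=
  Num.sqrt ((2 * pi) ^+ d / \det Q) * expR (- (quad_form (invmx Q) z / 2)).

(** Induction on the dimension, splitting off one coordinate. Positivity of the determinant comes
    along as a product of pivots. *)
Lemma gauss_fourier d (Q : 'M[R]_d) : sym_posdef Q -> 0 < \det Q /\
  forall (z : 'rV[R]_d) (e : R), 0 < e -> exists h0 : R, 0 < h0 /\
  forall h : R, 0 < h -> h <= h0 ->
  csummable (gauss_term Q z h) /\
  nc (csum (gauss_term Q z h) - (gauss_value Q z)%:C) <= e.
Proof.
elim: d => [|d IH] in Q *.
  move=> _; split; first by rewrite det_mx00.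
  move=> z e e0; exists 1; split=> // h h0 h1.
  have z0 : forall t : 'rV[int]_0, t \notin [:: 0] -> gauss_term Q z h t = 0.
    by move=> t; rewrite inE thinmx0 eqxx.
  have [sf ->] := csum_finsupp (isT : uniq [:: 0]) z0; split=> //.
  rewrite big_seq1 /gauss_term /gauss_value det_mx00 !quad_formE /dotp !big_ord0.
  rewrite expr0 mul0r oppr0 expR0 !mulr1 cexpi0 mulr1 divr1 sqrtr1.
  by rewrite rmorph1 subrr nc0 ltW.
move=> pQ; have [QT Qpos] := pQ.
pose q := Q 0 0; pose b := ursubmx (Q : 'M[R]_(1 + d)); pose Q' := drsubmx (Q : 'M[R]_(1 + d)).
have QE : Q = block_mx q%:M b b^T Q'.
  have E1 : ulsubmx (Q : 'M[R]_(1 + d)) = q%:M.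
    rewrite [LHS]mx11_scalar !mxE; congr ((Q _ _)%:M); exact/val_inj.
  have E2 : dlsubmx (Q : 'M[R]_(1 + d)) = b^T.
    by apply/matrixP => i j; rewrite !mxE -[in RHS]QT mxE.
  by rewrite -[LHS](submxK (Q : 'M[R]_(1 + d))) E1 E2.
have q0 : 0 < q.
  have e0 : delta_mx 0 0 != 0 :> 'rV[R]_(1 + d).
    by apply/eqP => /matrixP /(_ 0 0) /eqP; rewrite !mxE !eqxx oner_eq0.
  have := Qpos _ e0; rewrite quad_formE /dotp (bigD1 0)//= big1 ?addr0 => [|i i0].
    by rewrite -rowE !mxE !eqxx mulr1.
  by rewrite [X in _ * X]mxE eqxx (negPf i0) mulr0.
have qn0 : q != 0 by rewrite gt_eqF.
pose a : 'rV[R]_d := q^-1 *: b; pose S : 'M[R]_d := Q' - q^-1 *: (b^T *m b).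
have quadE y v : quad_form Q (row_mx (y%:M : 'rV_1) v) = q * (y + dotp a v) ^+ 2 + quad_form S v.
  by rewrite QE; exact: quad_form_block.
have pS : sym_posdef S.
  split.
    have Q'T : Q'^T = Q' by apply/matrixP => i j; rewrite !mxE -[in RHS]QT mxE.
    by rewrite /S linearB linearZ /= trmx_mul trmxK Q'T.
  move=> v v0; have := @Qpos (row_mx ((- dotp a v)%:M : 'rV_1) v).
  rewrite quadE addNr expr0n mulr0 add0r; apply.
  apply: contra v0 => /eqP/(congr1 (fun u : 'rV[R]_(1 + d) => rsubmx u)).
  by rewrite row_mxKr linear0 => ->.
have [detS HS] := IH S pS.
have detE : \det Q = q * \det S by rewrite QE; exact: det_block_schur.
split; first by rewrite detE mulr_gt0.
move=> z e e0.
pose z1 : R := (lsubmx (z : 'rV[R]_(1 + d))) 0 0; pose z' := rsubmx (z : 'rV[R]_(1 + d)).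
have zE : z = row_mx (z1%:M : 'rV_1) z' by rewrite -mx11_scalar hsubmxK.
have [C [h1 [h10 C0 HC]]] := gauss_fourier_line z1 q0.
(* At frequency 0 the same estimate bounds the total mass of the Gaussians on the lines, which gives
   absolute summability over pairs. *)
have [C' [h2 [h20 C'0 HC']]] := gauss_fourier_line 0 q0.
pose g1 := Num.sqrt (2 * pi / q) * expR (- (z1 ^+ 2 / q / 2)).
pose G0 := Num.sqrt ((2 * pi) ^+ d / \det S).
have g10 : 0 <= g1 by rewrite mulr_ge0 ?sqrtr_ge0 ?expR_ge0.
have G00 : 0 <= G0 by rewrite sqrtr_ge0.
have [h3 [h30 H3]] := HS 0 1 ltr01.
(* [e1] and [h5] are chosen so that the error in the last [d] coordinates and the error on the lines
   are at most [e / 2] each. *)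
pose e1 := e / (2 * (g1 + 1)).
have e10 : 0 < e1 by rewrite divr_gt0// mulr_gt0//; lra.
have [h4 [h40 H4]] := HS (z' - z1 *: a) e1 e10.
pose h5 := e / (2 * ((C + 1) * (G0 + 1))).
have h50 : 0 < h5 by rewrite divr_gt0// !mulr_gt0//; lra.
pose hm := Num.min (Num.min h1 h2) (Num.min (Num.min h3 h4) h5).
exists hm; split; first by rewrite !lt_min h10 h20 h30 h40 h50.
move=> h h0; rewrite /hm !le_min => /andP[/andP[hh1 hh2] /andP[/andP[hh3 hh4] hh5]].
have [sT0 eT0] := H3 h h0 hh3.
have [sT eT] := H4 h h0 hh4.
pose J (s : R) (k : int) := (h * expR (- (q * (h * k%:~R + s) ^+ 2 / 2)))%:C * cexpi (z1 * (h * k%:~R + s)).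
pose T x := gauss_term S (z' - z1 *: a) h x.
pose sh x := dotp a (h *: rvec R x).
have termE x k : gauss_term Q z h (row_mx (k%:M : 'rV_1) x) = T x * J (sh x) k.
  by rewrite QE zE; exact: gauss_term_block.
have sJ x : csummable (J (sh x)) by have [] := HC h (sh x) h0 hh1.
have nJ x : nc (csum (J (sh x)) - g1%:C) <= h * C by have [] := HC h (sh x) h0 hh1.
have mJ x : rsum (fun k => nc (J (sh x) k)) <= Num.sqrt (2 * pi / q) + h * C'.
  have [s1 n1] := HC' h (sh x) h0 hh2.
  have E : forall k, (h * expR (- (q * (h * k%:~R + sh x) ^+ 2 / 2)))%:C * cexpi (0 * (h * k%:~R + sh x)) = (nc (J (sh x) k))%:C.
    move=> k; rewrite mul0r cexpi0 mulr1 /J ncM nc_cexpi mulr1 nc_real ger0_norm//.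
    by rewrite mulr_ge0 ?expR_ge0// ltW.
  move: n1; rewrite (eq_csum E) csum_real expr0n !mul0r oppr0 expR0 mulr1 -rmorphB nc_real.
  by rewrite ler_norml => /andP[_]; rewrite lerBlDl.
have sTJ : csummable (fun u : 'rV[int]_d * int => T u.1 * J (sh u.1) u.2).
  apply: rsummable_pair => [x|].
    apply: rsummable_le (rsummableZ (nc (T x)) (sJ x)) => k /=.
    by rewrite ncM ger0_norm// mulr_ge0 ?nc_ge0.
  apply: rsummable_le (rsummableZ (Num.sqrt (2 * pi / q) + h * C') sT) => x /=.
  rewrite ger0_norm; last by apply: rsum_ge0.
  rewrite (@eq_rsum _ _ _ (fun k => nc (T x) * nc (J (sh x) k))); last first.
    by move=> k; rewrite ncM ger0_norm// mulr_ge0 ?nc_ge0.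
  rewrite rsumZ; last exact: sJ.
  by rewrite mulrC ler_wpM2r ?nc_ge0.
have bij := scalar_row_bij d.
have EE : gauss_term Q z h \o (fun u : 'rV[int]_d * int => row_mx (u.2%:M : 'rV_1) u.1) =
   (fun u => T u.1 * J (sh u.1) u.2) by apply/funext => -[x k] /=.
split.
  by apply/(csummable_reindex _ bij); rewrite EE.
rewrite (csum_reindex _ bij) EE.
have [_ ->] := csum_pair sTJ.
(* The line sums are replaced by their common limit [g1], at a cost uniform in the shift. *)
have -> : csum (fun x => csum (fun y => T (x, y).1 * J (sh (x, y).1) (x, y).2)) =
   g1%:C * csum T + csum (fun x => T x * (csum (J (sh x)) - g1%:C)).
  rewrite -csumZ// -csumD.
  - by apply: eq_csum => x /=; rewrite csumZ//; ring.
  - exact: csummableZ.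
  - apply: csummable_le (rsummableZ (h * C) sT) => x.
    by rewrite ncM mulrC ler_wpM2r ?nc_ge0.
have -> : gauss_value Q z = g1 * gauss_value S (z' - z1 *: a).
  rewrite /gauss_value zE detE [X in quad_form (invmx X)]QE quad_form_inv_block//; last 2 first.
  - by rewrite -QE; exact: posdef_unit.
  - exact: posdef_unit.
  rewrite /g1 mulrACA -expRD; congr (_ * expR _); last by ring.
  rewrite -sqrtrM; last by rewrite divr_ge0 ?mulr_ge0 ?pi_ge0// ltW.
  by congr Num.sqrt; rewrite exprS; field; rewrite qn0 gt_eqF.
set X := csum (fun x => T x * _).
have -> : g1%:C * csum T + X - (g1 * gauss_value S (z' - z1 *: a))%:C =
  g1%:C * (csum T - (gauss_value S (z' - z1 *: a))%:C) + X.
  have R4 (u v w x : R[i]) : u * v + x - u * w = u * (v - w) + x by ring.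
  by rewrite (rmorphM (real_complex R) g1); exact: R4.
rewrite (le_trans (ncD _ _))// ncM nc_real ger0_norm//.
have b1 : g1 * nc (csum T - (gauss_value S (z' - z1 *: a))%:C) <= e / 2.
  apply: le_trans (_ : g1 * e1 <= _); first by rewrite ler_wpM2l.
  rewrite /e1 mulrA ler_pdivrMr; last by rewrite mulr_gt0//; lra.
  by have := e0; nra.
have b2 : nc X <= e / 2.
  apply: le_trans (@nc_csum_le _ _ _ (fun x => (h * C) * nc (T x)) _ _) _.
  - by move=> x; rewrite ncM mulrC ler_wpM2r ?nc_ge0.
  - exact: rsummableZ.
  rewrite rsumZ//.
  have mT : rsum (fun x => nc (T x)) <= G0 + 1.
    have E : forall x, gauss_term S 0 h x = (nc (T x))%:C.
      move=> x; rewrite nc_gauss_term ?ltW//.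
      by rewrite /gauss_term dotp0l cexpi0 mulr1.
    move: eT0; rewrite (eq_csum E) csum_real -rmorphB nc_real /gauss_value quad_form0 mul0r oppr0 expR0 mulr1.
    by rewrite ler_norml => /andP[_]; rewrite lerBlDl.
  apply: (@le_trans _ _ (h5 * ((C + 1) * (G0 + 1)))).
    rewrite -mulrA; apply: ler_pM => //; [exact: ltW|by rewrite mulr_ge0// rsum_ge0// => x; exact: nc_ge0|].
    by apply: ler_pM => //; [rewrite rsum_ge0// => x; exact: nc_ge0|lra].
  have G1 : G0 + 1 != 0 by rewrite gt_eqF//; lra.
  have C1 : C + 1 != 0 by rewrite gt_eqF//; lra.
  by rewrite /h5 le_eqVlt; apply/orP; left; apply/eqP; field; rewrite G1 C1.
by have := lerD b1 b2; lra.
Qed.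

End gauss_fourier_forms.

(** * Discrete Fourier inversion *)

Section lattice_boxes.
Variable d : nat.

Definition lbox (m : nat) : seq 'rV[int]_d :=
  [seq \row_i (Posz (f i) - Posz m)%R | f : {ffun 'I_d -> 'I_m.*2.+1} <- enum {: {ffun 'I_d -> 'I_m.*2.+1}}].

Lemma lbox_uniq m : uniq (lbox m).
Proof.
rewrite map_inj_uniq ?enum_uniq// => f g /rowP fg; apply/ffunP => i.
by have := fg i; rewrite !mxE => /addIr[] /val_inj.
Qed.

Lemma mem_lbox m (y : 'rV[int]_d) : (y \in lbox m) = [forall i, (`|y 0%R i|%N <= m)%N].
Proof.
apply/mapP/forallP => [[f _ ->] i|ym].
  rewrite mxE; have : (nat_of_ord (f i) < m.*2.+1)%N by exact: ltn_ord.
  by move: (nat_of_ord _) => k; lia.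
have H i : (`|(y 0 i + Posz m)%R|%N < m.*2.+1)%N by have := ym i; lia.
exists [ffun i => Ordinal (H i)]; first by rewrite mem_enum.
by apply/rowP => i; rewrite mxE ffunE /=; have := ym i; lia.
Qed.

Lemma sub_lbox (s : seq 'rV[int]_d) : exists m, {subset s <= lbox m}.
Proof.
elim: s => [|y s [m sm]]; first by exists 0%N.
exists (maxn m (\max_i `|y 0%R i|%N)) => z; rewrite in_cons => /orP[/eqP ->|/sm].
  rewrite mem_lbox; apply/forallP => i; rewrite leq_max; apply/orP; right.
  exact: (leq_bigmax i).
rewrite !mem_lbox => /forallP zm; apply/forallP => i.
by rewrite (leq_trans (zm i))// leq_maxl.
Qed.

End lattice_boxes.

Section discrete_fourier.
Variable R : realType.
Local Notation nc := (@ComplexField.Normc.normc R).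
Local Notation "x %:C" := (real_complex R x) (at level 1, format "x %:C").

Lemma cexpi_2pi_nat (n : nat) : cexpi (2 * pi * n%:R) = 1 :> R[i].
Proof.
have h : cexpi (2 * pi) = 1 :> R[i].
  by rewrite mulrC -[2]/(2%:R) mulr_natr /cexpi cos2pi sin2pi.
by rewrite mulr_natr cexpi_mulrn h expr1n.
Qed.

Lemma cexpi_2pi_int (n : int) : cexpi (2 * pi * n%:~R) = 1 :> R[i].
Proof.
case: n => n; first by rewrite -pmulrn cexpi_2pi_nat.
by rewrite NegzE mulrNz mulrN cexpiN -pmulrn cexpi_2pi_nat invr1.
Qed.

Lemma cexpi_neq1 (a : R) : 0 < a -> a < 2 * pi -> cexpi a != 1 :> R[i].
Proof.
move=> a0 a2; apply/eqP => /(congr1 (@complex.Re R)) => E.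
have {}E : cos a = 1 by [].
have s0 : 0 < sin (a / 2) by apply: sin_gt0_pi; apply/andP; split; lra.
have := cos_mulr2n (a / 2); have := sin2cos2 (a / 2).
have -> : (a / 2) *+ 2 = a by rewrite -mulr_natr; field.
by rewrite E; nra.
Qed.

Lemma geometric_roots (M : nat) (w : R[i]) : w ^+ M = 1 -> w != 1 ->
  \sum_(k < M) w ^+ k = 0.
Proof.
move=> wM w1; apply/(mulfI (_ : w - 1 != 0)); first by rewrite subr_eq0.
by rewrite mulr0 -subrX1 wM subrr.
Qed.

(** Orthogonality of characters of the cyclic group of order [2 m + 1]; the odd order makes the
    symmetric box a full set of residues. *)
Lemma dft_line (m : nat) (x : int) :
  \sum_(k < m.*2.+1) cexpi (2 * pi / m.*2.+1%:R * (Posz k - Posz m)%:~R * x%:~R) =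
  (if (Posz m.*2.+1 %| x)%Z then m.*2.+1%:R else 0) :> R[i].
Proof.
set M := m.*2.+1; have M0 : (M%:R : R) != 0 by rewrite pnatr_eq0.
have E (k : 'I_M) : cexpi (2 * pi / M%:R * (Posz k - Posz m)%:~R * x%:~R) =
    cexpi (- (2 * pi / M%:R * m%:R * x%:~R)) * cexpi (2 * pi / M%:R * x%:~R) ^+ k :> R[i].
  rewrite -cexpi_mulrn -cexpiD -mulr_natr intrB -!pmulrn; congr cexpi; ring.
under eq_bigr do rewrite E; rewrite -mulr_sumr.
case: ifPn => [/dvdzP[q ->]|Mx].
  have -> : cexpi (- (2 * pi / M%:R * m%:R * (q * M)%:~R)) = 1 :> R[i].
    have -> : 2 * pi / M%:R * m%:R * (q * M)%:~R = 2 * pi * (q * m)%:~R :> R.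
      by rewrite !intrM -!pmulrn; field.
    by rewrite cexpiN cexpi_2pi_int invr1.
  have -> : cexpi (2 * pi / M%:R * (q * M)%:~R) = 1 :> R[i].
    by rewrite intrM -!pmulrn mulrCA -(cexpi_2pi_int q); congr cexpi; field.
  by rewrite mul1r; under eq_bigr do rewrite expr1n; rewrite sumr_const card_ord.
rewrite geometric_roots ?mulr0//.
  rewrite -cexpi_mulrn -(cexpi_2pi_int x) -mulr_natr; congr cexpi; field.
  by rewrite ?M0.
have M0z : Posz M != 0 by [].
rewrite (divz_eq x M) intrD intrM mulrDr cexpiD.
have -> : cexpi (2 * pi / M%:R * ((x %/ M)%Z%:~R * M%:~R)) = 1 :> R[i].
  by rewrite -(cexpi_2pi_int (x %/ M)%Z) -!pmulrn; congr cexpi; field.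
rewrite mul1r; have r0 := modz_ge0 x M0z.
have rM : (x %% M)%Z < Posz M by rewrite ltz_pmod.
have rn0 : (x %% M)%Z != 0 by apply: contra Mx => /eqP/dvdz_mod0P.
have rp : 0 < (x %% M)%Z by rewrite lt_neqAle eq_sym rn0.
have Mp : (0 : R) < M%:R by rewrite ltr0n.
have p2 : (0 : R) < 2 * pi by rewrite mulr_gt0// pi_gt0.
apply: cexpi_neq1; first by rewrite !mulr_gt0 ?invr_gt0 ?pi_gt0// ltr0z.
rewrite -mulrA gtr_pMr// mulrC ltr_pdivrMr// mul1r.
by rewrite [M%:R]pmulrn ltr_int.
Qed.

Variable d : nat.
Implicit Types x y : 'rV[int]_d.

Definition dft_step (m : nat) : R := 2 * pi / m.*2.+1%:R.

Lemma dft_box (m : nat) x :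
  \sum_(y <- lbox d m) cexpi (dotp (dft_step m *: rvec R y) (rvec R x)) =
  (if [forall i, (Posz m.*2.+1 %| x 0%R i)%Z] then m.*2.+1%:R ^+ d else 0) :> R[i].
Proof.
rewrite /lbox big_map big_enum /=.
transitivity (\sum_(f : {ffun 'I_d -> 'I_m.*2.+1}) \prod_(i < d)
   cexpi (2 * pi / m.*2.+1%:R * (Posz (f i) - Posz m)%:~R * (x 0 i)%:~R) : R[i]).
  apply: eq_bigr => f _; rewrite /dotp cexpi_sum; apply: eq_bigr => i _.
  by rewrite !mxE.
rewrite -(bigA_distr_bigA (fun i (k : 'I_m.*2.+1) => cexpi (2 * pi / m.*2.+1%:R * (Posz k - Posz m)%:~R * (x 0 i)%:~R))) /=.
under eq_bigr do rewrite dft_line.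
case: ifPn => [/forallP h|/forallPn[i hi]].
  by under eq_bigr => i _ do rewrite h; rewrite prodr_const card_ord.
by rewrite (bigD1 i)//= (negPf hi) mul0r.
Qed.

(** The discrete transform recovers the sum of [P] over the class of [x] modulo [M = 2 m + 1]. A
    finite set carries almost all the mass of [P]; once [M] exceeds the differences of its points
    from [x], it meets this class at most in [x], and the rest of the class is a small tail. *)
Lemma dft_inversion (P : 'rV[int]_d -> R[i]) x (e : R) : csummable P -> 0 < e ->
  exists m0 : nat, forall m : nat, (m0 <= m)%N ->
  nc ((m.*2.+1%:R ^- d)%:C * \sum_(y <- lbox d m)
        cexpi (- dotp (dft_step m *: rvec R y) (rvec R x)) *
        csum (fun w => P w * cexpi (dotp (dft_step m *: rvec R y) (rvec R w)))
      - P x) <= e.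
Proof.
move=> sP e0; have [s hs] := rsum_tail sP e0.
have [m0 sm0] := sub_lbox (x :: s).
exists m0.*2 => m m0m.
set M := m.*2.+1.
pose g w : R[i] := P w * (if [forall i, (Posz M %| (w - x)%R 0%R i)%Z] then 1 else 0).
have sPc y : csummable (fun w => P w * cexpi (dotp (dft_step m *: rvec R y) (rvec R w))).
  by apply: csummable_le sP => w; rewrite ncM nc_cexpi mulr1.
have sg : csummable g.
  by apply: csummable_le sP => w; rewrite /g ncM; case: ifP; rewrite ?nc1 ?nc0 ?mulr1 ?mulr0 ?nc_ge0.
have Mn0 : (M%:R : R[i]) ^+ d != 0 by rewrite expf_neq0// pnatr_eq0.
have -> : (M%:R ^- d)%:C * \sum_(y <- lbox d m) cexpi (- dotp (dft_step m *: rvec R y) (rvec R x)) *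
        csum (fun w => P w * cexpi (dotp (dft_step m *: rvec R y) (rvec R w))) = csum g.
  under eq_bigr do rewrite -csumZ//.
  rewrite -csum_sum => [|y _]; last exact: csummableZ.
  rewrite -csumZ; last by apply: csummable_sum => y _; exact: csummableZ.
  apply: eq_csum => w.
  have -> : \sum_(y <- lbox d m) cexpi (- dotp (dft_step m *: rvec R y) (rvec R x)) *
     (P w * cexpi (dotp (dft_step m *: rvec R y) (rvec R w))) =
     P w * \sum_(y <- lbox d m) cexpi (dotp (dft_step m *: rvec R y) (rvec R (w - x))).
    rewrite mulr_sumr; apply: eq_bigr => y _; rewrite mulrCA -cexpiD; congr (_ * cexpi _).
    have -> : rvec R (w - x) = rvec R w - rvec R x by apply/rowP => i; rewrite !mxE intrB.
    by rewrite dotpBr addrC.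
  rewrite dft_box -/M mulrCA /g; congr (_ * _); case: ifP => _; last by rewrite mulr0.
  by rewrite fmorphV rmorphXn rmorph_nat mulVf.
pose g0 w : R[i] := if w == x then P x else 0.
have g0E : forall w, w \notin [:: x] -> g0 w = 0.
  by move=> w; rewrite inE /g0 => /negPf ->.
have [sg0 eg0] := csum_finsupp (isT : uniq [:: x]) g0E.
have -> : P x = csum g0 by rewrite eg0 big_seq1 /g0 eqxx.
rewrite -csumB//; apply: le_trans (nc_csum (csummableB sg sg0)) _.
have E w : nc (g w - g0 w) = `|nc (g w - g0 w)| by rewrite ger0_norm// nc_ge0.
rewrite (eq_rsum E); apply: hs => w.
  rewrite !ger0_norm ?nc_ge0// /g /g0; case: eqP => [->|_].
    have -> : [forall i, (Posz M %| (x - x)%R 0%R i)%Z] by apply/forallP => i; rewrite subrr mxE dvdz0.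
    by rewrite mulr1 subrr nc0 nc_ge0.
  by rewrite subr0; case: ifP; rewrite ?mulr1 ?mulr0 ?nc0 ?nc_ge0.
move=> ws; rewrite /g /g0; case: eqP => [->|/eqP wx].
  have -> : [forall i, (Posz M %| (x - x)%R 0%R i)%Z] by apply/forallP => i; rewrite subrr mxE dvdz0.
  by rewrite mulr1 subrr nc0.
case: ifPn => [/forallP h|_]; last by rewrite mulr0 subr0 nc0.
exfalso; move/negP: wx; apply; apply/eqP/rowP => i.
have := h i; rewrite !mxE => /dvdzP[q qE].
have /sm0 : x \in x :: s by rewrite in_cons eqxx.
have /sm0 : w \in x :: s by rewrite in_cons ws orbT.
rewrite !mem_lbox => /forallP/(_ i) w1 /forallP/(_ i) x1.
have [q0|q0] := eqVneq q 0; first by move: qE; rewrite q0 mul0r => /eqP; rewrite subr_eq0 => /eqP.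
exfalso; have : (1 <= `|q|)%N by rewrite absz_gt0.
have : `|(w 0 i - x 0 i)%R|%N = (`|q| * M)%N by rewrite qE abszM.
have a1 : (`|(w 0%R i - x 0%R i)%R| <= m0 + m0)%N.
  by move: w1 x1; move: (w 0 i) (x 0 i) => u v; lia.
move=> a2 a3.
have : (M <= `|q| * M)%N by rewrite leq_pmull.
by rewrite -a2 /M; move: a1 m0m; move: `|_|%N => u; lia.
Qed.

End discrete_fourier.

(** * Doeblin chains and the corrector *)

Section matrix_norm.
Variable R : realType.
Local Notation nc := (@ComplexField.Normc.normc R).
Local Notation "x %:C" := (real_complex R x) (at level 1, format "x %:C").

(** The operator norm for the sup norm on columns. Stochastic matrices, and complex matrices
    dominated by them entrywise, have norm at most 1. *)
Definition opn m n (A : 'M[R[i]]_(m, n)) : R :=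
  \big[Order.max/0]_(k < m) \sum_j nc (A k j).

Lemma opn_ge0 m n (A : 'M[R[i]]_(m, n)) : 0 <= opn A.
Proof. by rewrite /opn; elim/big_ind : _ => // [x y x0 y0|k _]; rewrite ?le_max ?x0// sumr_ge0// => j _; exact: nc_ge0. Qed.

Lemma row_le_opn m n (A : 'M[R[i]]_(m, n)) k : \sum_j nc (A k j) <= opn A.
Proof. exact: (le_bigmax_cond _ (fun k => \sum_j nc (A k j))). Qed.

Lemma opn_le m n (A : 'M[R[i]]_(m, n)) (a : R) : 0 <= a ->
  (forall k, \sum_j nc (A k j) <= a) -> opn A <= a.
Proof. by move=> a0 h; apply: bigmax_le. Qed.

Lemma entry_le_opn m n (A : 'M[R[i]]_(m, n)) k j : nc (A k j) <= opn A.
Proof.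
apply: le_trans (row_le_opn A k); rewrite (bigD1 j)//= lerDl sumr_ge0// => i _.
exact: nc_ge0.
Qed.

Lemma opn_col_le m (A : 'cV[R[i]]_m) (a : R) : 0 <= a ->
  (forall k, nc (A k 0) <= a) -> opn A <= a.
Proof. by move=> a0 h; apply: opn_le => // k; rewrite big_ord1. Qed.

Lemma opnD m n (A B : 'M[R[i]]_(m, n)) : opn (A + B) <= opn A + opn B.
Proof.
apply: opn_le => [|k]; first by rewrite addr_ge0 ?opn_ge0.
apply: le_trans (lerD (row_le_opn A k) (row_le_opn B k)).
by rewrite -big_split; apply: ler_sum => j _; rewrite mxE ncD.
Qed.

Lemma opnZ m n (a : R[i]) (A : 'M[R[i]]_(m, n)) : opn (a *: A) <= nc a * opn A.
Proof.
apply: opn_le => [|k]; first by rewrite mulr_ge0 ?opn_ge0 ?nc_ge0.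
under eq_bigr do rewrite mxE ncM.
by rewrite -mulr_sumr ler_wpM2l ?nc_ge0// row_le_opn.
Qed.

Lemma opnN m n (A : 'M[R[i]]_(m, n)) : opn (- A) = opn A.
Proof. by congr bigop.body; apply/funext => k; congr BigBody; apply: eq_bigr => j _; rewrite mxE ncN. Qed.

Lemma opnB m n (A B : 'M[R[i]]_(m, n)) : opn (A - B) <= opn A + opn B.
Proof. by rewrite -(opnN B) opnD. Qed.

Lemma opn0 m n : opn (0 : 'M[R[i]]_(m, n)) = 0.
Proof.
apply/le_anti; rewrite opn_ge0 andbT; apply: opn_le => // k.
by rewrite big1// => j _; rewrite mxE nc0.
Qed.

Lemma opnM m n p (A : 'M[R[i]]_(m, n)) (B : 'M[R[i]]_(n, p)) :
  opn (A *m B) <= opn A * opn B.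
Proof.
apply: opn_le => [|k]; first by rewrite mulr_ge0 ?opn_ge0.
apply: (@le_trans _ _ (\sum_j \sum_i nc (A k i) * nc (B i j))).
  apply: ler_sum => j _; rewrite mxE; apply: le_trans (nc_sum _ _ _) _.
  by apply: ler_sum => i _; rewrite ncM.
rewrite exchange_big /=; apply: (@le_trans _ _ (\sum_i nc (A k i) * opn B)).
  by apply: ler_sum => i _; rewrite -mulr_sumr ler_wpM2l ?nc_ge0// row_le_opn.
by rewrite -mulr_suml ler_wpM2r ?opn_ge0// row_le_opn.
Qed.

Lemma opn_sum m n (I : Type) (r : seq I) (F : I -> 'M[R[i]]_(m, n)) :
  opn (\sum_(i <- r) F i) <= \sum_(i <- r) opn (F i).
Proof.
elim: r => [|i r IH]; first by rewrite !big_nil opn0.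
by rewrite !big_cons (le_trans (opnD _ _))// lerD2l.
Qed.

Lemma opn1_le n : opn (1%:M : 'M[R[i]]_n) <= 1.
Proof.
apply: opn_le => // k; rewrite (bigD1 k)//= big1 ?addr0 ?mxE ?eqxx ?nc1// => j jk.
by rewrite mxE eq_sym (negPf jk) nc0.
Qed.

Lemma opn_pow n (A : 'M[R[i]]_n) (a : R) k : opn A <= a -> opn (A ^+ k) <= a ^+ k.
Proof.
move=> Aa; have a0 : 0 <= a by rewrite (le_trans (opn_ge0 A)).
elim: k => [|k IH]; first by rewrite !expr0 opn1_le.
by rewrite !exprS (le_trans (opnM _ _))// ler_pM// opn_ge0.
Qed.

Definition cmx m n (A : 'M[R]_(m, n)) : 'M[R[i]]_(m, n) := map_mx (real_complex R) A.

Lemma cmxM m n p (A : 'M[R]_(m, n)) (B : 'M[R]_(n, p)) : cmx (A *m B) = cmx A *m cmx B.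
Proof. exact: map_mxM. Qed.

Lemma cmxD m n (A B : 'M[R]_(m, n)) : cmx (A + B) = cmx A + cmx B.
Proof. exact: map_mxD. Qed.

Lemma cmxB m n (A B : 'M[R]_(m, n)) : cmx (A - B) = cmx A - cmx B.
Proof. exact: map_mxB. Qed.

Lemma cmxZ m n (a : R) (A : 'M[R]_(m, n)) : cmx (a *: A) = a%:C *: cmx A.
Proof. exact: map_mxZ. Qed.

Lemma cmxX n (A : 'M[R]_n) k : cmx (A ^+ k) = cmx A ^+ k.
Proof.
elim: k => [|k IH]; first by rewrite !expr0 /cmx map_mx1.
by rewrite !exprS -IH; exact: cmxM.
Qed.

Lemma opn_cmx_col n (v : 'cV[R]_n) k : `|v k 0| <= opn (cmx v).
Proof. by have := entry_le_opn (cmx v) k 0; rewrite mxE nc_real. Qed.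

Definition ones n : 'cV[R]_n := const_mx 1.

Lemma opn_ones n : opn (cmx (ones n)) <= 1.
Proof. by apply: opn_col_le => // k; rewrite !mxE nc_real normr1. Qed.

Lemma power_perturbation n p (A B : 'M[R[i]]_n) (v : 'M[R[i]]_(n, p)) (k : nat) :
  opn A <= 1 -> opn B <= 1 -> 
  opn (A ^+ k *m v - B ^+ k *m v) <= k%:R * opn (A - B) * opn v.
Proof.
move=> A1 B1; rewrite -mulmxBl; apply: le_trans (opnM _ _) _.
rewrite ler_wpM2r ?opn_ge0//.
elim: k => [|k IH]; first by rewrite !expr0 subrr opn0 mul0r.
have -> : A ^+ k.+1 - B ^+ k.+1 = A * (A ^+ k - B ^+ k) + (A - B) * B ^+ k.
  by rewrite mulrBr mulrBl -!exprS addrA subrK.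
apply: le_trans (opnD _ _) _; rewrite -natr1 [leRHS]mulrDl mul1r; apply: lerD.
  apply: le_trans (opnM _ _) _; apply: le_trans IH.
  by rewrite ler_piMl// opn_ge0.
apply: le_trans (opnM _ _) _; rewrite ler_piMr ?opn_ge0//.
by rewrite -(expr1n _ k) opn_pow.
Qed.

(** Since [A] and [l] are both contractive, the defect of an approximate eigenvector accumulates
    only linearly in the number of steps. *)
Lemma power_pseudo_eigenvector n p (A : 'M[R[i]]_n) (c : 'M[R[i]]_(n, p)) (l : R[i]) (r : R) k :
  opn A <= 1 -> nc l <= 1 -> opn (A *m c - l *: c) <= r ->
  opn (A ^+ k *m c - l ^+ k *: c) <= k%:R * r.
Proof.
move=> A1 l1 Ac; elim: k => [|k IH]; first by rewrite !expr0 mul1mx scale1r subrr opn0 mul0r.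
have -> : A ^+ k.+1 *m c - l ^+ k.+1 *: c =
    A ^+ k *m (A *m c - l *: c) + l *: (A ^+ k *m c - l ^+ k *: c).
  rewrite exprSr mulmxBr scalerBr scalerA -exprS -scalemxAr mulmxA.
  by rewrite addrA subrK.
apply: le_trans (opnD _ _) _; rewrite -natr1 mulrDl mul1r addrC; apply: lerD.
  apply: le_trans (opnZ _ _) _; apply: le_trans IH.
  by rewrite ler_piMl// opn_ge0.
apply: le_trans (opnM _ _) _; apply: le_trans Ac; rewrite ler_piMl ?opn_ge0//.
by rewrite -(expr1n _ k) opn_pow.
Qed.

End matrix_norm.

(** * Stochastic matrices with a Doeblin minorization *)

Section doeblin.
Variables (R : realType) (N : nat).
Local Notation nc := (@ComplexField.Normc.normc R).
Local Notation "x %:C" := (real_complex R x) (at level 1, format "x %:C").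
Local Notation one := (ones R N).

(** As the entries of [nu] are at most 1, the last clause bounds [F ^+ m] from below by [b] times
    the stationary projection. *)
Definition doeblin (m : nat) (b : R) (F : 'M[R]_N) (nu : 'rV[R]_N) : Prop :=
  [/\ [/\ 0 < b, b <= 1 & forall k j, 0 <= F k j],
      F *m one = one, (forall j, 0 <= nu 0 j) /\ nu *m one = 1%:M, nu *m F = nu
    & forall k j, b <= (F ^+ m) k j].

Variables (m : nat) (b : R) (F : 'M[R]_N) (nu : 'rV[R]_N).
Hypothesis H : doeblin m b F nu.

Lemma stochastic_pow k : [/\ forall i j, 0 <= (F ^+ k) i j, F ^+ k *m one = one & nu *m F ^+ k = nu].
Proof.
have [[_ _ F0] F1 _ nuF _] := H.
elim: k => [|k [IH1 IH2 IH3]]; first by split=> [i j||]; rewrite expr0 ?mul1mx ?mulmx1// mxE ler0n.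
split; last 2 first.
- by rewrite exprS -mulmxA IH2.
- by rewrite exprS mulmxA nuF.
move=> i j; rewrite exprS mxE; apply: sumr_ge0 => l _; exact: mulr_ge0.
Qed.

Lemma nu_sum : \sum_j nu 0 j = 1.
Proof.
have [_ _ [_ /matrixP nu1] _ _] := H; have := nu1 0 0; rewrite !mxE eqxx mulr1n => <-.
by apply: eq_bigr => j _; rewrite mxE mulr1.
Qed.

Lemma nu_le1 j : 0 <= nu 0 j <= 1.
Proof.
have [_ _ [nu0 _] _ _] := H; rewrite nu0 -nu_sum (bigD1 j)//= lerDl.
by rewrite sumr_ge0.
Qed.

Lemma row_sum1 (A : 'M[R]_N) i : A *m one = one -> \sum_j A i j = 1.
Proof.
move=> /matrixP/(_ i 0); rewrite !mxE => <-.
by apply: eq_bigr => j _; rewrite mxE mulr1.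
Qed.

Lemma opn_stochastic : opn (cmx F) <= 1.
Proof.
have [[_ _ F0] F1 _ _ _] := H.
apply: opn_le => // k; rewrite -(row_sum1 k F1); apply: ler_sum => j _.
by rewrite mxE nc_real ger0_norm.
Qed.

Lemma opn_nu_mul p (v : 'M[R[i]]_(N, p)) : opn (cmx nu *m v) <= opn v.
Proof.
apply: le_trans (opnM _ _) _; rewrite ler_piMl ?opn_ge0//.
apply: opn_le => // k; rewrite ord1 -nu_sum; apply: ler_sum => j _.
by rewrite mxE nc_real ger0_norm//; case/andP: (nu_le1 j).
Qed.

(** Subtracting [b] times the stationary projection, which annihilates [v], leaves a nonnegative
    matrix with row sums [1 - b]. *)
Lemma doeblin_contraction (v : 'cV[R[i]]_N) : cmx nu *m v = 0 ->
  opn (cmx (F ^+ m) *m v) <= (1 - b) * opn v.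
Proof.
move=> nuv; have [[b0 b1 _] _ [nu0 _] _ Fb] := H.
have [_ Fm1 _] := stochastic_pow m.
have b10 : 0 <= 1 - b by rewrite subr_ge0.
apply: opn_col_le => [|k]; first by rewrite mulr_ge0 ?opn_ge0.
have -> : (cmx (F ^+ m) *m v) k 0 = \sum_j ((F ^+ m) k j - b * nu 0 j)%:C * v j 0.
  have nuv0 : \sum_j (nu 0 j)%:C * v j 0 = 0.
    move: nuv => /matrixP/(_ 0 0); rewrite !mxE => E; rewrite -[RHS]E.
    by apply: eq_bigr => j _; rewrite mxE.
  transitivity (\sum_j ((F ^+ m) k j)%:C * v j 0 - b%:C * \sum_j (nu 0 j)%:C * v j 0).
    by rewrite nuv0 mulr0 subr0 mxE; apply: eq_bigr => j _; rewrite mxE.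
  rewrite mulr_sumr -sumrB.
  by apply: eq_bigr => j _; rewrite rmorphB rmorphM mulrBl mulrA.
apply: le_trans (nc_sum _ _ _) _.
have -> : 1 - b = \sum_j ((F ^+ m) k j - b * nu 0 j).
  by rewrite sumrB (row_sum1 k Fm1) -mulr_sumr nu_sum mulr1.
rewrite mulr_suml; apply: ler_sum => j _; rewrite ncM nc_real ger0_norm; last first.
  rewrite subr_ge0 (le_trans _ (Fb k j))// ler_piMr ?(ltW b0)//.
  by case/andP: (nu_le1 j).
rewrite ler_wpM2l//; last exact: entry_le_opn.
rewrite subr_ge0 (le_trans _ (Fb k j))// ler_piMr ?(ltW b0)//.
by case/andP: (nu_le1 j).
Qed.

Lemma doeblin_contraction_iter s (v : 'cV[R[i]]_N) : cmx nu *m v = 0 ->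
  opn (cmx (F ^+ (m * s)) *m v) <= (1 - b) ^+ s * opn v.
Proof.
move=> nuv; have [[b0 b1 _] _ _ _ _] := H.
elim: s => [|s IH]; first by rewrite muln0 !expr0 mul1r /cmx map_mx1 mul1mx.
rewrite mulnS exprD cmxM -mulmxA; apply: le_trans (doeblin_contraction _) _.
  have [_ _ E] := stochastic_pow (m * s).
  by rewrite mulmxA -cmxM E.
by rewrite exprS -mulrA ler_wpM2l// subr_ge0.
Qed.

Lemma stationary_limit s j :
  opn (cmx (F ^+ (m * s)) *m (delta_mx j 0 : 'cV[R[i]]_N) - (nu 0 j)%:C *: cmx one) <= (1 - b) ^+ s.
Proof.
have [[b0 b1 _] _ [_ nu1] _ _] := H.
set v := (delta_mx j 0 : 'cV[R[i]]_N) - (nu 0 j)%:C *: cmx one.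
have nuv : cmx nu *m v = 0.
  rewrite mulmxBr -scalemxAr -cmxM nu1; apply/matrixP => k l; rewrite !ord1 !mxE eqxx mulr1.
  rewrite (bigD1 j)//= big1 => [|i ij].
    by rewrite !mxE !eqxx addr0 !mulr1 subrr.
  by rewrite !mxE (negPf ij) mulr0.
have v1 : opn v <= 1.
  apply: opn_col_le => // k; rewrite !mxE eqxx andbT rmorph1 mulr1.
  have -> : (k == j)%:R - (nu 0 j)%:C = ((k == j)%:R - nu 0 j)%:C by rewrite rmorphB rmorph_nat.
  rewrite nc_real ler_norml; have := nu_le1 j.
  by case: eqP => _ /=; rewrite ?mulr1n ?mulr0n; lra.
have := doeblin_contraction_iter s nuv.
rewrite mulmxBr -scalemxAr -cmxM; have [_ -> _] := stochastic_pow (m * s).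
move=> /le_trans; apply; rewrite ler_piMr// exprn_ge0// subr_ge0//.
Qed.

(* The fundamental matrix of the chain, which solves the Poisson equation. *)
Definition fund : 'M[R]_N := invmx (1%:M - F + one *m nu).

(** A vector in the kernel has [nu]-mean 0 and is fixed by [F], so the contraction forces it to
    vanish. *)
Lemma fund_unit : 1%:M - F + one *m nu \in unitmx.
Proof.
have [[b0 b1 _] F1 [_ nu1] nuF _] := H.
rewrite -unitmx_tr -row_free_unit -kermx_eq0; apply/rowV0P => v /sub_kermxP vE.
have : (1%:M - F + one *m nu) *m v^T = 0.
  by apply: trmx_inj; rewrite trmx_mul trmxK vE trmx0.
move=> E; have E1 : nu *m v^T = 0.
  have := congr1 (mulmx nu) E; rewrite mulmx0 mulmxA mulmxDr mulmxBr mulmx1 nuF subrr add0r.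
  by rewrite mulmxA nu1 mul1mx.
have E2 : F *m v^T = v^T.
  move: E; rewrite mulmxDl -mulmxA E1 mulmx0 addr0 mulmxBl mul1mx => /eqP.
  by rewrite subr_eq0 => /eqP.
have E3 k : F ^+ k *m v^T = v^T.
  by elim: k => [|k IH]; rewrite ?expr0 ?mul1mx// exprS -mulmxA IH.
have := @doeblin_contraction (cmx v^T) _; rewrite -!cmxM E1 E3 => h.
have {}h : opn (cmx v^T) <= (1 - b) * opn (cmx v^T).
  by apply: h; apply/matrixP => i j; rewrite !mxE.
have z : opn (cmx v^T) = 0.
  by apply/le_anti; rewrite opn_ge0 andbT; have := opn_ge0 (cmx v^T); nra.
apply/rowP => i; have := opn_cmx_col v^T i; rewrite z !mxE normr_le0 => /eqP ->//.
Qed.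

(** The norm bound avoids estimating the inverse matrix: [m] iterations of the Poisson equation cost
    [m] times the norm of [v], and the contraction of [F ^+ m] absorbs what is left of the
    solution. *)
Lemma fund_solves (v : 'cV[R]_N) : nu *m v = 0 ->
  [/\ fund *m v = F *m (fund *m v) + v, nu *m (fund *m v) = 0 &
      opn (cmx (fund *m v)) <= m%:R / b * opn (cmx v)].
Proof.
move=> nuv; have [[b0 b1 _] F1 [_ nu1] nuF _] := H.
set c := fund *m v.
have E : (1%:M - F + one *m nu) *m c = v by rewrite mulmxA mulmxV ?fund_unit// mul1mx.
have nuc : nu *m c = 0.
  have := congr1 (mulmx nu) E; rewrite nuv mulmxA mulmxDr mulmxBr mulmx1 nuF subrr add0r.
  by rewrite mulmxA nu1 mul1mx.
have cE : c = F *m c + v.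
  by rewrite -[in RHS]E mulmxDl -mulmxA nuc mulmx0 addr0 mulmxBl mul1mx addrC subrK.
split=> //.
have it k : opn (cmx c - cmx (F ^+ k *m c)) <= k%:R * opn (cmx v).
  elim: k => [|k IH]; first by rewrite expr0 mul1mx subrr opn0 mul0r.
  have -> : cmx c - cmx (F ^+ k.+1 *m c) =
     (cmx c - cmx (F ^+ k *m c)) + cmx F ^+ k *m cmx v.
    rewrite -cmxX -cmxM -!cmxB -cmxD; congr cmx.
    have Fc : F *m c = c - v by rewrite {2}cE addrK.
    have -> : F ^+ k.+1 *m c = F ^+ k *m (F *m c) by rewrite exprSr mulmxA.
    by rewrite Fc mulmxBr opprB addrA addrAC.
  apply: le_trans (opnD _ _) _; rewrite -natr1 mulrDl mul1r lerD//.
  apply: le_trans (opnM _ _) _; rewrite ler_piMl ?opn_ge0//.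
  by rewrite -(expr1n _ k) opn_pow// opn_stochastic.
have h1 : opn (cmx c) <= m%:R * opn (cmx v) + (1 - b) * opn (cmx c).
  have e1 : cmx c = (cmx c - cmx (F ^+ m *m c)) + cmx (F ^+ m) *m cmx c.
    by rewrite -cmxM subrK.
  rewrite [X in opn X <= _]e1; apply: le_trans (opnD _ _) _; apply: lerD => //.
  apply: doeblin_contraction; rewrite -cmxM nuc.
  by apply/matrixP => i j; rewrite !mxE rmorph0.
by rewrite mulrAC ler_pdivlMr//; lra.
Qed.

End doeblin.

(** * The corrector and the effective covariance *)

Section corrector.
Variables (R : realType) (N d : nat).
Local Notation nc := (@ComplexField.Normc.normc R).
Local Notation "x %:C" := (real_complex R x) (at level 1, format "x %:C").
Local Notation one := (ones R N).
Local Notation I := (Complex 0 1 : R[i]).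

Definition n1 (xi : 'rV[R]_d) : R := \sum_i `|xi 0 i|.

Lemma n1_ge0 xi : 0 <= n1 xi. Proof. by apply: sumr_ge0. Qed.

Lemma n1Z a xi : n1 (a *: xi) = `|a| * n1 xi.
Proof. by rewrite /n1 mulr_sumr; apply: eq_bigr => i _; rewrite mxE normrM. Qed.

(* Second order expansion at the origin of the characteristic matrix [Psi] of a
   Markov additive chain with modulating chain [F] and centered increments:
   [D1 i] and [D2 i j] are the matrices of first and second moments. *)
Record char_expansion (m : nat) (b K : R) (F : 'M[R]_N) (nu : 'rV[R]_N)
    (D1 : 'I_d -> 'M[R]_N) (D2 : 'I_d -> 'I_d -> 'M[R]_N)
    (Psi : 'rV[R]_d -> 'M[R[i]]_N) : Prop := CharExpansion {
  ce_doeblin : doeblin m b F nu;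
  ce_K : 0 <= K;
  ce_D1 : forall i, opn (cmx (D1 i)) <= K;
  ce_D2 : forall i j, opn (cmx (D2 i j)) <= K;
  ce_sym : forall i j, D2 i j = D2 j i;
  ce_centered : forall i, nu *m (D1 i *m one) = 0;
  ce_contraction : forall xi, opn (Psi xi) <= 1;
  ce_remainder : forall xi, opn (Psi xi - (cmx F + I *: cmx (\sum_i xi 0 i *: D1 i)
    - (2^-1)%:C *: cmx (\sum_i \sum_j (xi 0 i * xi 0 j) *: D2 i j))) <= K * n1 xi ^+ 3 }.

Variables (m : nat) (b K : R) (F : 'M[R]_N) (nu : 'rV[R]_N).
Variables (D1 : 'I_d -> 'M[R]_N) (D2 : 'I_d -> 'I_d -> 'M[R]_N).
Variable (Psi : 'rV[R]_d -> 'M[R[i]]_N).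

Definition mean_corr (i : 'I_d) : 'cV[R]_N := fund F nu *m (D1 i *m one).

(** The asymptotic covariance of the additive component: second moments of one step plus the
    correlations between different times, which the fundamental matrix sums up. *)
Definition eff_cov : 'M[R]_d := \matrix_(i, j)
  (nu *m (D2 i j *m one + D1 i *m mean_corr j + D1 j *m mean_corr i)) 0 0.

Let A1 (xi : 'rV[R]_d) : 'M[R]_N := \sum_i xi 0 i *: D1 i.
Let A2 (xi : 'rV[R]_d) : 'M[R]_N := \sum_i \sum_j (xi 0 i * xi 0 j) *: D2 i j.
Let c1 (xi : 'rV[R]_d) : 'cV[R]_N := fund F nu *m (A1 xi *m one).
Let w2 (xi : 'rV[R]_d) : 'cV[R]_N := A2 xi *m one + 2 *: (A1 xi *m c1 xi).
Let q (xi : 'rV[R]_d) : R := quad_form eff_cov xi.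
Let c2 (xi : 'rV[R]_d) : 'cV[R]_N := fund F nu *m (w2 xi - q xi *: one).

(** The terms of order one and two are fixed by two Poisson equations. The first is solvable because
    the increments are centered, the second because [q xi] is the [nu]-mean of [w2 xi]. *)
Definition corr (xi : 'rV[R]_d) : 'cV[R[i]]_N :=
  cmx one + I *: cmx (c1 xi) - (2^-1)%:C *: cmx (c2 xi).

Lemma quad_form_sum n (Q : 'M[R]_n) xi : quad_form Q xi = \sum_i \sum_j xi 0 i * xi 0 j * Q i j.
Proof.
rewrite quad_formE /dotp exchange_big; apply: eq_bigr => j _.
rewrite mxE mulr_suml; apply: eq_bigr => i _; ring.
Qed.

Lemma eff_cov_quad xi : quad_form eff_cov xi = (nu *m w2 xi) 0 0.
Proof.
rewrite quad_form_sum.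
have E1 : A2 xi *m one = \sum_i \sum_j (xi 0 i * xi 0 j) *: (D2 i j *m one).
  rewrite /A2 mulmx_suml; apply: eq_bigr => i _; rewrite mulmx_suml; apply: eq_bigr => j _.
  by rewrite -scalemxAl.
have E2 : c1 xi = \sum_i xi 0 i *: mean_corr i.
  rewrite /c1 /A1 mulmx_suml mulmx_sumr; apply: eq_bigr => i _.
  by rewrite -scalemxAl -scalemxAr.
have E3 : A1 xi *m c1 xi = \sum_i \sum_j (xi 0 i * xi 0 j) *: (D1 i *m mean_corr j).
  rewrite E2 /A1 mulmx_suml; apply: eq_bigr => i _; rewrite mulmx_sumr; apply: eq_bigr => j _.
  by rewrite -scalemxAl -scalemxAr scalerA.
have E4 : A1 xi *m c1 xi = \sum_i \sum_j (xi 0 i * xi 0 j) *: (D1 j *m mean_corr i).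
  rewrite E3 exchange_big; apply: eq_bigr => i _; apply: eq_bigr => j _.
  by rewrite mulrC.
have -> : w2 xi = \sum_i \sum_j (xi 0 i * xi 0 j) *: (D2 i j *m one + D1 i *m mean_corr j + D1 j *m mean_corr i).
  (* The factor 2 in [w2] is split into the two orders of the indices, which matches the symmetric
     form of [eff_cov]. *)
  rewrite /w2 scaler_nat mulr2n {1}E3 E4 E1 -!big_split /=; apply: eq_bigr => i _.
  rewrite -!big_split /=; apply: eq_bigr => j _.
  by rewrite !scalerDr addrA.
rewrite mulmx_sumr summxE; apply: eq_bigr => i _; rewrite mulmx_sumr summxE.
by apply: eq_bigr => j _; rewrite -scalemxAr !mxE.
Qed.

Let g : R := m%:R / b.
(** Three constants built from [m], [b] and [K] only: for the size of the form, for the distance of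
    the corrector from the constant vector, and for the defect in the eigenvalue equation. *)
Definition KQ : R := K + 2 * (K * (g * K)).
Definition Kd : R := g * K + g * KQ.
Definition Kc : R := K + 3 * (K * Kd) + KQ * Kd.

Hypothesis H : char_expansion m b K F nu D1 D2 Psi.

Let H0 := ce_doeblin H.
Let K0 := ce_K H.

Let b0 : 0 < b. Proof. by case: H0 => -[]. Qed.
Let g0 : 0 <= g. Proof. by rewrite divr_ge0// ltW// b0. Qed.
Lemma KQ_ge0 : 0 <= KQ.
Proof.
have k0 := K0; have gg := g0; rewrite /KQ -/g; apply: addr_ge0 => //.
by apply: mulr_ge0 => //; apply: mulr_ge0 => //; apply: mulr_ge0.
Qed.
Lemma Kd_ge0 : 0 <= Kd. Proof. by rewrite /Kd -/g; apply: addr_ge0; apply: mulr_ge0; rewrite ?K0 ?KQ_ge0 ?g0. Qed.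
Lemma Kc_ge0 : 0 <= Kc. Proof. by rewrite /Kc !addr_ge0 ?mulr_ge0 ?K0 ?KQ_ge0 ?Kd_ge0. Qed.

Lemma eff_cov_sym : eff_cov^T = eff_cov.
Proof.
apply/matrixP => i j; rewrite mxE [LHS]mxE [RHS]mxE.
by rewrite (ce_sym H) addrAC.
Qed.

Lemma moment1_bound (xi : 'rV[R]_d) : opn (cmx (\sum_i xi 0 i *: D1 i)) <= K * n1 xi.
Proof.
rewrite -/(A1 xi).
have -> : cmx (A1 xi) = \sum_i (xi 0 i)%:C *: cmx (D1 i).
  by rewrite /A1 /cmx map_mx_sum; apply: eq_bigr => i _; exact: cmxZ.
apply: le_trans (opn_sum _ _) _; rewrite mulrC /n1 mulr_suml; apply: ler_sum => i _.
by apply: le_trans (opnZ _ _) _; rewrite nc_real ler_wpM2l// (ce_D1 H).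
Qed.

Lemma moment2_bound (xi : 'rV[R]_d) : opn (cmx (\sum_i \sum_j (xi 0 i * xi 0 j) *: D2 i j)) <= K * n1 xi ^+ 2.
Proof.
rewrite -/(A2 xi).
have -> : cmx (A2 xi) = \sum_i \sum_j (xi 0 i * xi 0 j)%:C *: cmx (D2 i j).
  rewrite /A2 /cmx map_mx_sum; apply: eq_bigr => i _; rewrite map_mx_sum.
  by apply: eq_bigr => j _; exact: cmxZ.
apply: le_trans (opn_sum _ _) _; rewrite expr2 mulrC {1}/n1 !mulr_suml; apply: ler_sum => i _.
apply: le_trans (opn_sum _ _) _; rewrite {1}/n1 mulr_sumr mulr_suml; apply: ler_sum => j _.
by apply: le_trans (opnZ _ _) _; rewrite nc_real normrM ler_wpM2l ?mulr_ge0// (ce_D2 H).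
Qed.

Let bA1 xi : opn (cmx (A1 xi)) <= K * n1 xi. Proof. exact: moment1_bound. Qed.
Let bA2 xi : opn (cmx (A2 xi)) <= K * n1 xi ^+ 2. Proof. exact: moment2_bound. Qed.
Let bone : opn (cmx one) <= 1. Proof. exact: opn_ones. Qed.

Let nuA1 xi : nu *m (A1 xi *m one) = 0.
Proof.
rewrite /A1 mulmx_suml mulmx_sumr big1// => i _.
by rewrite -scalemxAl -scalemxAr (ce_centered H) scaler0.
Qed.

Let c1E xi : [/\ c1 xi = F *m c1 xi + A1 xi *m one, nu *m c1 xi = 0 &
  opn (cmx (c1 xi)) <= g * (K * n1 xi)].
Proof.
have [e1 e2 e3] := fund_solves H0 (nuA1 xi); split=> //.
apply: le_trans e3 _; rewrite ler_wpM2l ?g0// cmxM; apply: le_trans (opnM _ _) _.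
by rewrite -[leRHS]mulr1; apply: ler_pM; rewrite ?opn_ge0.
Qed.

Let bw2 xi : opn (cmx (w2 xi)) <= KQ * n1 xi ^+ 2.
Proof.
have [_ _ e3] := c1E xi.
rewrite /w2 cmxD cmxZ; apply: le_trans (opnD _ _) _; rewrite /KQ mulrDl; apply: lerD.
  rewrite cmxM; apply: le_trans (opnM _ _) _.
  by rewrite -[leRHS]mulr1; apply: ler_pM; rewrite ?opn_ge0.
apply: le_trans (opnZ _ _) _; rewrite nc_real ger0_norm// -mulrA ler_wpM2l// cmxM.
apply: le_trans (opnM _ _) _.
have -> : K * (g * K) * n1 xi ^+ 2 = (K * n1 xi) * (g * (K * n1 xi)) by ring.
by apply: ler_pM; rewrite ?opn_ge0.
Qed.

Lemma eff_cov_bound xi : `|quad_form eff_cov xi| <= KQ * n1 xi ^+ 2.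
Proof.
rewrite eff_cov_quad; apply: le_trans (opn_cmx_col _ _) _; rewrite cmxM.
by apply: le_trans (opn_nu_mul H0 _) _.
Qed.

Let c2E xi : [/\ c2 xi = F *m c2 xi + (w2 xi - q xi *: one), nu *m c2 xi = 0 &
  opn (cmx (c2 xi)) <= g * (2 * KQ * n1 xi ^+ 2)].
Proof.
have [_ _ [_ nu1] _ _] := H0.
have nuw : nu *m (w2 xi - q xi *: one) = 0.
  rewrite mulmxBr -scalemxAr nu1 /q eff_cov_quad.
  by apply/matrixP => i j; rewrite !ord1 !mxE eqxx mulr1n mulr1 subrr.
have [e1 e2 e3] := fund_solves H0 nuw; split=> //.
apply: le_trans e3 _; rewrite ler_wpM2l ?g0// cmxB cmxZ; apply: le_trans (opnB _ _) _.
have -> : 2 * KQ * n1 xi ^+ 2 = KQ * n1 xi ^+ 2 + KQ * n1 xi ^+ 2 by ring.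
apply: lerD => //; apply: le_trans (opnZ _ _) _; rewrite nc_real -[leRHS]mulr1.
by apply: ler_pM; rewrite ?opn_ge0//; exact: eff_cov_bound.
Qed.

Lemma corr_near1 xi : n1 xi <= 1 -> opn (corr xi - cmx one) <= Kd * n1 xi.
Proof.
move=> r1; have [_ _ e1] := c1E xi; have [_ _ e2] := c2E xi.
have -> : corr xi - cmx one = I *: cmx (c1 xi) - (2^-1)%:C *: cmx (c2 xi).
  by rewrite /corr addrAC (addrC (cmx one)) addrK.
apply: le_trans (opnB _ _) _; rewrite /Kd mulrDl; apply: lerD.
  apply: le_trans (opnZ _ _) _.
  have -> : nc I = 1 by rewrite /ComplexField.Normc.normc expr0n expr1n add0r sqrtr1.
  by rewrite mul1r -mulrA.
apply: le_trans (opnZ _ _) _; rewrite nc_real ger0_norm ?invr_ge0//.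
rewrite ler_pdivrMl//; apply: le_trans e2 _.
have -> : 2 * (g * KQ * n1 xi) = g * (2 * KQ * n1 xi) by ring.
by rewrite ler_wpM2l ?g0// ler_wpM2l ?mulr_ge0 ?KQ_ge0// expr2 ler_piMl ?n1_ge0.
Qed.

(** The cancellation in abstract form: once both Poisson equations have been substituted, all terms
    of order at most two disappear. The vectors [x] and [y] have order one and two. *)
Let corr_identity (e x y a1e a1x a1y a2e a2x a2y : 'cV[R[i]]_N) (t : R[i]) :
  (e + I *: (x - a1e) - (2^-1)%:C *: (y - (a2e + 2%:C *: a1x - t *: e)))
  + I *: (a1e + I *: a1x - (2^-1)%:C *: a1y)
  - (2^-1)%:C *: (a2e + I *: a2x - (2^-1)%:C *: a2y)
  - (1 - (2^-1)%:C * t) *: (e + I *: x - (2^-1)%:C *: y) =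
  ((2^-1)%:C * t) *: (I *: x - (2^-1)%:C *: y)
  - (I * (2^-1)%:C) *: a1y - ((2^-1)%:C * I) *: a2x + ((2^-1)%:C * (2^-1)%:C) *: a2y.
Proof.
have II : I * I = -1 by apply: cplx_eq; rewrite ?cReM ?cImM /= ?mul0r ?mul1r ?mulr0 ?sub0r ?addr0 ?oppr0.
have h2 : (2^-1)%:C * 2%:C = 1 by rewrite -rmorphM mulVf// rmorph1.
move: I II ((2^-1)%:C) 2%:C h2 => J JJ h z hz.
apply/matrixP => k j; rewrite !mxE.
have -> : J * (a1e k j + J * a1x k j - h * a1y k j) = J * a1e k j + (J * J) * a1x k j - J * h * a1y k j by ring.
have -> : h * (y k j - (a2e k j + z * a1x k j - t * e k j)) =
  h * y k j - h * a2e k j - (h * z) * a1x k j + h * t * e k j by ring.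
by rewrite JJ hz; ring.
Qed.

Lemma corr_eigen xi : n1 xi <= 1 ->
  opn (Psi xi *m corr xi - (1 - quad_form eff_cov xi / 2)%:C *: corr xi) <= Kc * n1 xi ^+ 3.
Proof.
move=> r1; set r := n1 xi in r1 *; have r0 : 0 <= r := n1_ge0 xi.
have [e1 _ n1c] := c1E xi; have [e2 _ n2c] := c2E xi; have nq := eff_cov_bound xi.
have [_ F1 _ _ _] := H0.
rewrite -/r in n1c n2c nq.
set E := Psi xi - (cmx F + I *: cmx (A1 xi) - (2^-1)%:C *: cmx (A2 xi)).
have nE : opn E <= K * r ^+ 3 by exact: (ce_remainder H).
have PsiE : Psi xi = E + (cmx F + I *: cmx (A1 xi) - (2^-1)%:C *: cmx (A2 xi)).
  by rewrite /E subrK.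
pose x := cmx (c1 xi); pose y := cmx (c2 xi); pose t : R[i] := (q xi)%:C.
have X1 : cmx F *m x = x - cmx (A1 xi) *m cmx one.
  by rewrite /x -!cmxM -cmxB; congr cmx; rewrite {2}e1 addrK.
have X2 : cmx F *m y = y - (cmx (A2 xi) *m cmx one + 2%:C *: (cmx (A1 xi) *m x) - t *: cmx one).
  rewrite /x /y /t -!cmxM -!cmxZ -!cmxD -!cmxB; congr cmx.
  by rewrite {2}e2 addrK.
have lE : (1 - q xi / 2)%:C = 1 - (2^-1)%:C * t.
  by rewrite rmorphB rmorphM rmorph1 mulrC.
(* Only the Taylor remainder [E] and products of total order three or more remain. *)
have main : Psi xi *m corr xi - (1 - q xi / 2)%:C *: corr xi =
  E *m corr xi + (((2^-1)%:C * t) *: (I *: x - (2^-1)%:C *: y)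
  - (I * (2^-1)%:C) *: (cmx (A1 xi) *m y) - ((2^-1)%:C * I) *: (cmx (A2 xi) *m x)
  + ((2^-1)%:C * (2^-1)%:C) *: (cmx (A2 xi) *m y)).
  rewrite -(corr_identity (cmx one) x y (cmx (A1 xi) *m cmx one) (cmx (A1 xi) *m x) (cmx (A1 xi) *m y) (cmx (A2 xi) *m cmx one)).
  rewrite lE PsiE mulmxDl -addrA; congr (_ + _); rewrite /corr -/x -/y; congr (_ - _).
  rewrite mulmxBl mulmxDl -!scalemxAl; congr (_ + _ *: _ - _ *: _).
  - have Fone : cmx F *m cmx one = cmx one by rewrite -cmxM F1.
    by rewrite mulmxBr mulmxDr -!scalemxAr X1 X2 Fone.
  - by rewrite mulmxBr mulmxDr -!scalemxAr.
  - by rewrite mulmxBr mulmxDr -!scalemxAr.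
have ncI : nc I = 1 by rewrite /ComplexField.Normc.normc expr0n expr1n add0r sqrtr1.
have nch : nc (2^-1)%:C = 2^-1 by rewrite nc_real ger0_norm// invr_ge0.
have r2 : r ^+ 2 <= r by rewrite expr2 ler_piMl.
have ge_Kd : opn (I *: x - (2^-1)%:C *: y) <= Kd * r.
  have := corr_near1 r1; have -> // : corr xi - cmx one = I *: x - (2^-1)%:C *: y.
  by rewrite /corr -/x -/y addrAC (addrC (cmx one)) addrK.
have b1 : opn (E *m corr xi) <= K * r ^+ 3 * (1 + Kd).
  apply: le_trans (opnM _ _) _; apply: ler_pM; rewrite ?opn_ge0//.
  have -> : corr xi = cmx one + (corr xi - cmx one) by rewrite addrC subrK.
  apply: le_trans (opnD _ _) _; apply: lerD => //.
  by apply: le_trans (corr_near1 r1) _; rewrite ler_piMr ?Kd_ge0.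
have b2 : opn (((2^-1)%:C * t) *: (I *: x - (2^-1)%:C *: y)) <= KQ * Kd * r ^+ 3.
  apply: le_trans (opnZ _ _) _; rewrite ncM nch nc_real.
  have -> : KQ * Kd * r ^+ 3 = (KQ * r ^+ 2) * (Kd * r) by ring.
  apply: ler_pM; rewrite ?opn_ge0 ?mulr_ge0 ?invr_ge0//.
  by have := normr_ge0 (q xi); rewrite -/(q xi) in nq; lra.
have ny : opn y <= 2 * (Kd * r ^+ 2).
  apply: le_trans n2c _; rewrite /Kd.
  have p : 0 <= g * K * r ^+ 2 by apply: mulr_ge0; [exact: mulr_ge0 g0 K0|exact: sqr_ge0].
  rewrite -subr_ge0 (_ : _ - _ = 2 * (g * K * r ^+ 2)); last by rewrite -/g; ring.
  by apply: mulr_ge0.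
have nx : opn x <= Kd * r.
  apply: le_trans n1c _; rewrite /Kd.
  have p : 0 <= g * KQ * r by apply: mulr_ge0 => //; exact: mulr_ge0 g0 KQ_ge0.
  rewrite -subr_ge0 (_ : _ - _ = g * KQ * r)//; by rewrite -/g; ring.
have b3 : opn ((I * (2^-1)%:C) *: (cmx (A1 xi) *m y)) <= K * Kd * r ^+ 3.
  apply: le_trans (opnZ _ _) _; rewrite ncM ncI nch mul1r ler_pdivrMl//.
  apply: le_trans (opnM _ _) _.
  have -> : 2 * (K * Kd * r ^+ 3) = (K * r) * (2 * (Kd * r ^+ 2)) by ring.
  by apply: ler_pM; rewrite ?opn_ge0//; exact: moment1_bound.
have b4 : opn (((2^-1)%:C * I) *: (cmx (A2 xi) *m x)) <= 2^-1 * (K * Kd * r ^+ 3).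
  apply: le_trans (opnZ _ _) _; rewrite ncM ncI nch mulr1 ler_wpM2l ?invr_ge0//.
  apply: le_trans (opnM _ _) _.
  have -> : K * Kd * r ^+ 3 = (K * r ^+ 2) * (Kd * r) by ring.
  by apply: ler_pM; rewrite ?opn_ge0//; exact: moment2_bound.
have b5 : opn (((2^-1)%:C * (2^-1)%:C) *: (cmx (A2 xi) *m y)) <= 2^-1 * (K * Kd * r ^+ 3).
  apply: le_trans (opnZ _ _) _; rewrite ncM nch -mulrA ler_wpM2l ?invr_ge0//.
  rewrite ler_pdivrMl//; apply: le_trans (opnM _ _) _.
  apply: (@le_trans _ _ ((K * r) * (2 * (Kd * r ^+ 2)))).
    apply: ler_pM; rewrite ?opn_ge0//; apply: le_trans (moment2_bound xi) _.
    by rewrite ler_wpM2l ?K0.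
  by rewrite le_eqVlt; apply/orP; left; apply/eqP; ring.
rewrite main.
apply: le_trans (opnD _ _) _; apply: le_trans (lerD b1 (opnD _ _)) _.
apply: le_trans (lerD (lexx _) (lerD (opnB _ _) b5)) _.
apply: le_trans (lerD (lexx _) (lerD (lerD (opnB _ _) b4) (lexx _))) _.
apply: le_trans (lerD (lexx _) (lerD (lerD (lerD b2 b3) (lexx _)) (lexx _))) _.
by rewrite le_eqVlt; apply/orP; left; apply/eqP; rewrite /Kc; field.
Qed.

End corrector.

(** * Powers of the characteristic matrix *)

Section power_limit.
Variables (R : realType) (N d : nat).
Local Notation nc := (@ComplexField.Normc.normc R).
Local Notation "x %:C" := (real_complex R x) (at level 1, format "x %:C").
Local Notation one := (ones R N).
Local Notation I := (Complex 0 1 : R[i]).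
Variables (m : nat) (b K : R) (F : 'M[R]_N) (nu : 'rV[R]_N).
Variables (D1 : 'I_d -> 'M[R]_N) (D2 : 'I_d -> 'I_d -> 'M[R]_N).
Variable (Psi : 'rV[R]_d -> 'M[R[i]]_N).
Hypothesis H : char_expansion m b K F nu D1 D2 Psi.
Local Notation Q := (eff_cov F nu D1 D2).
Local Notation cr := (corr F nu D1 D2).
Local Notation kq := (KQ m b K).
Local Notation kd := (Kd m b K).
Local Notation kc := (Kc m b K).

Lemma opn_dist_le p n (A B : 'M[R[i]]_(p, n)) : opn B <= opn A + opn (A - B).
Proof.
rewrite [X in opn X <= _](_ : _ = A - (A - B)); first exact: opnB.
by rewrite opprB addrC subrK.
Qed.

(** Along [t *: xi] an eigenvalue above 1 would gain at order [t^2], while the defect of the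
    corrector is of order [t^3]. *)
Lemma scaling_contradiction (a t c r k o : R) : 0 < a -> 0 < t ->
  2 * k * (t * r) <= 1 -> 4 * c * r ^+ 3 * t < a -> 1 - k * (t * r) <= o ->
  (1 + a * t ^+ 2) * o <= o + c * (t * r) ^+ 3 -> False.
Proof.
move=> a0 t0 u2 u3 h2 h3.
have o2 : 2^-1 <= o by lra.
have h4 : a * t ^+ 2 * 2^-1 <= c * (t * r) ^+ 3.
  apply: le_trans (_ : a * t ^+ 2 * o <= _); last by lra.
  by rewrite ler_wpM2l// mulr_ge0 ?sqr_ge0// ltW.
have h5 : t ^+ 2 * (a * 2^-1) <= t ^+ 2 * (c * r ^+ 3 * t).
  have -> : t ^+ 2 * (c * r ^+ 3 * t) = c * (t * r) ^+ 3 by ring.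
  by rewrite mulrA (mulrC _ a).
rewrite ler_pM2l ?exprn_gt0// in h5; lra.
Qed.

Lemma one_le_corr (k : 'I_N) xi : n1 xi <= 1 -> 1 - kd * n1 xi <= opn (cr xi).
Proof.
move=> r1; have := corr_near1 H r1.
have : 1 <= opn (cmx one) by have := entry_le_opn (cmx one) k 0; rewrite !mxE nc_real normr1.
by have := opn_dist_le (cr xi) (cmx one); lra.
Qed.

(* A contraction cannot have an eigenvalue [1 - Q/2] larger than 1. *)
Lemma eff_cov_ge0 (k : 'I_N) xi : 0 <= quad_form Q xi.
Proof.
rewrite leNgt; apply/negP => q0.
set a := - quad_form Q xi / 2; have a0 : 0 < a by rewrite /a; lra.
set r := n1 xi; have r0 : 0 <= r := n1_ge0 xi.
have kd0 : 0 <= kd := Kd_ge0 H.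
have kc0 : 0 <= kc := Kc_ge0 H.
(* The inverse of a sum of all lower bounds that [1 / t] must satisfy: the corrector is defined,
   stays close to the constant vector, and the cubic error is dominated. *)
pose t := (1 + r + 2 * kd * r + 4 * kc * r ^+ 3 / a)^-1.
have p1 : 0 <= 2 * kd * r by rewrite !mulr_ge0.
have p2 : 0 <= 4 * kc * r ^+ 3 / a.
  by apply: divr_ge0; [apply: mulr_ge0; [exact: mulr_ge0|exact: exprn_ge0]|exact: ltW].
set s := 1 + r + 2 * kd * r + 4 * kc * r ^+ 3 / a in t.
have s0 : 0 < s by rewrite /s; lra.
have t0 : 0 < t by rewrite invr_gt0.
have ts : t * s = 1 by rewrite mulVf// gt_eqF.
pose X := 4 * kc * r ^+ 3.
have [s1 s2 s3] : [/\ r <= s, 2 * kd * r <= s & X / a < s].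
  by rewrite /s -/X; move: p2; rewrite -/X; split; lra.
have u1 : t * r <= 1 by rewrite -ts ler_wpM2l ?(ltW t0).
have u2 : 2 * kd * (t * r) <= 1.
  have -> : 2 * kd * (t * r) = t * (2 * kd * r) by ring.
  by have := ler_wpM2l (ltW t0) s2; rewrite ts.
have u3 : X * t < a.
  have h : t * (X / a) < 1 by rewrite -ts ltr_pM2l.
  have -> : X * t = (t * (X / a)) * a by field; rewrite gt_eqF.
  by rewrite gtr_pMl.
have n1t : n1 (t *: xi) = t * r by rewrite n1Z gtr0_norm.
have h1 := @corr_eigen _ _ _ _ _ _ _ _ _ _ _ H (t *: xi); rewrite n1t in h1; have {}h1 := h1 u1.
have h2 := @one_le_corr k (t *: xi); rewrite n1t in h2; have {}h2 := h2 u1.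
have mu : 1 - quad_form Q (t *: xi) / 2 = 1 + a * t ^+ 2.
  by rewrite quad_formZ /a; field.
rewrite mu in h1.
have at0 : 0 <= a * t ^+ 2 by rewrite mulr_ge0 ?sqr_ge0// ltW.
have pmu : 0 < 1 + a * t ^+ 2 by rewrite ltr_pwDl.
have h3 : (1 + a * t ^+ 2) * opn (cr (t *: xi)) <= opn (cr (t *: xi)) + kc * (t * r) ^+ 3.
  have E : cr (t *: xi) = ((1 + a * t ^+ 2)^-1)%:C *: ((1 + a * t ^+ 2)%:C *: cr (t *: xi)).
    by rewrite scalerA -rmorphM mulVf ?rmorph1 ?scale1r// gt_eqF.
  have e1 : (1 + a * t ^+ 2) * opn (cr (t *: xi)) <= opn ((1 + a * t ^+ 2)%:C *: cr (t *: xi)).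
    rewrite -ler_pdivlMl// [X in opn X <= _]E; apply: le_trans (opnZ _ _) _.
    by rewrite nc_real ger0_norm ?invr_ge0// ltW.
  apply: le_trans e1 _.
  apply: le_trans (opn_dist_le (Psi (t *: xi) *m cr (t *: xi)) _) _; apply: lerD => //.
  apply: le_trans (opnM _ _) _; rewrite ler_piMl ?opn_ge0//.
  exact: (ce_contraction H).
exact: (scaling_contradiction a0 t0 u2 u3 h2 h3).
Qed.

Lemma opn_delta_col (j : 'I_N) : opn (delta_mx j 0 : 'cV[R[i]]_N) <= 1.
Proof. by apply: opn_col_le => // i; rewrite mxE; case: (_ && _); rewrite ?nc1 ?nc0. Qed.

Lemma exp_sub_linear (y : R) : 0 <= y -> 0 <= expR (- y) - (1 - y) <= y ^+ 2.
Proof.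
move=> y0; have h1 := expR_ge1Dx (- y); have h2 := expR_ge1Dx y.
apply/andP; split; first by lra.
have p : 0 < 1 + y by lra.
have : expR (- y) <= (1 + y)^-1.
  by rewrite expRN lef_pV2// ?posrE ?expR_gt0.
have : (1 + y)^-1 <= 1 - y + y ^+ 2.
  have y3 : 0 <= y ^+ 3 by rewrite exprn_ge0.
  rewrite -[leLHS]mul1r ler_pdivrMr//.
  have -> : (1 - y + y ^+ 2) * (1 + y) = 1 + y ^+ 3 by ring.
  by lra.
by lra.
Qed.

Lemma pow_dist (x y : R) n : `|x| <= 1 -> `|y| <= 1 -> `|x ^+ n - y ^+ n| <= n%:R * `|x - y|.
Proof.
move=> x1 y1; elim: n => [|n IH]; first by rewrite !expr0 subrr normr0 mul0r.
have -> : x ^+ n.+1 - y ^+ n.+1 = x * (x ^+ n - y ^+ n) + (x - y) * y ^+ n by rewrite !exprS; ring.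
apply: le_trans (ler_normD _ _) _; rewrite -natr1 [leRHS]mulrDl mul1r lerD//.
  by rewrite normrM; apply: le_trans IH; rewrite ler_piMl.
by rewrite normrM ler_piMr// normrX exprn_ile1.
Qed.

Lemma char_near eta : n1 eta <= 1 -> opn (Psi eta - cmx F) <= 3 * K * n1 eta.
Proof.
set r := n1 eta => r1; have r0 : 0 <= r := n1_ge0 eta; have K0 := ce_K H.
have h := ce_remainder H eta; rewrite -/r in h.
pose B1 := \sum_i eta 0 i *: D1 i.
pose B2 := \sum_i \sum_j (eta 0 i * eta 0 j) *: D2 i j.
rewrite -/B1 -/B2 in h.
have bB1 : opn (cmx B1) <= K * r := moment1_bound H eta.
have bB2 : opn (cmx B2) <= K * r ^+ 2 := moment2_bound H eta.
have r2 : r ^+ 2 <= r by rewrite expr2 ler_piMl.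
have r3 : r ^+ 3 <= r by rewrite exprS ler_piMr// exprn_ile1.
have e1 : K * r ^+ 2 <= K * r by rewrite ler_wpM2l.
have e2 : K * r ^+ 3 <= K * r by rewrite ler_wpM2l.
have -> : Psi eta - cmx F = (Psi eta - (cmx F + I *: cmx B1 - (2^-1)%:C *: cmx B2)) +
   (I *: cmx B1 - (2^-1)%:C *: cmx B2).
  move: (Psi eta) (cmx F) (I *: cmx B1) ((2^-1)%:C *: cmx B2) => X Y Z W.
  by apply/matrixP => i i'; rewrite !mxE; ring.
apply: le_trans (opnD _ _) _; apply: le_trans (lerD h (opnB _ _)) _.
have i1 : opn (I *: cmx B1) <= K * r.
  apply: le_trans (opnZ _ _) _.
  have -> : nc I = 1 by rewrite /ComplexField.Normc.normc expr0n expr1n add0r sqrtr1.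
  by rewrite mul1r.
have i2 : opn ((2^-1)%:C *: cmx B2) <= K * r.
  apply: le_trans (opnZ _ _) _; rewrite nc_real ger0_norm ?invr_ge0//.
  have := opn_ge0 (cmx B2); lra.
by lra.
Qed.

Lemma telescope_columns (X Y o c : 'cV[R[i]]_N) (M e : R[i]) :
  Y - e *: o = (X - M *: c) - (X - Y) + M *: (c - o) + (M - e) *: o.
Proof. by apply/matrixP => i i'; rewrite !mxE; ring. Qed.

Lemma telescope_limit (X Y Z o : 'cV[R[i]]_N) (v e : R[i]) :
  X - (v * e) *: o = (X - v *: Z) - v *: (Y - Z) + v *: (Y - e *: o).
Proof. by apply/matrixP => i i'; rewrite !mxE; ring. Qed.

(** The [m * s] factors next to the basis vector are compared with [F], whose powers send it close
    to [nu_j] times the constant vector; there the corrector takes over. The bound by 4 keeps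
    [1 - Q / 2] in [[-1, 1]]. *)
Lemma power_limit (k : 'I_N) (n s : nat) (xi : 'rV[R]_d) j : (0 < n)%N -> (m * s <= n)%N ->
  let r := n1 ((Num.sqrt n%:R)^-1 *: xi) in
  r <= 1 -> kq * r ^+ 2 <= 4 ->
  opn (Psi ((Num.sqrt n%:R)^-1 *: xi) ^+ n *m delta_mx j 0 -
       (nu 0 j * expR (- (quad_form Q xi / 2)))%:C *: cmx one) <=
  (1 - b) ^+ s + r * (6 * (m * s)%:R * K + 2 * kd + kc * n1 xi ^+ 2 + kq ^+ 2 * n1 xi ^+ 2).
Proof.
move=> n0 msn r r1 kq4.
have sn0 : 0 < Num.sqrt n%:R :> R by rewrite sqrtr_gt0 ltr0n.
set eta := (Num.sqrt n%:R)^-1 *: xi in r r1 kq4 *.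
have r0 : 0 <= r := n1_ge0 _.
have sn2 : Num.sqrt n%:R ^+ 2 = n%:R :> R by rewrite sqr_sqrtr.
have nr2 : n%:R * r ^+ 2 = n1 xi ^+ 2.
  rewrite /r /eta n1Z gtr0_norm ?invr_gt0// exprMn exprVn sn2 mulrA mulfV ?mul1r//.
  by rewrite pnatr_eq0 -lt0n.
have qE : quad_form Q xi = n%:R * quad_form Q eta.
  rewrite /eta quad_formZ exprVn sn2 mulrA mulfV ?mul1r//.
  by rewrite pnatr_eq0 -lt0n.
have K0 := ce_K H; have dob := ce_doeblin H; have [[b0 b1 _] F1 _ _ _] := dob.
have P1 := ce_contraction H eta; have F1' := opn_stochastic dob.
have q0 := eff_cov_ge0 k eta.
have qb := eff_cov_bound H eta; rewrite (ger0_norm q0) -/r in qb.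
set l := (m * s)%N in msn *.
have PF : opn (Psi eta - cmx F) <= 3 * K * r := char_near r1.
have [nuj0 nuj1] := andP (nu_le1 dob j).
have T1 : opn (Psi eta ^+ l *m (delta_mx j 0 : 'cV[R[i]]_N) - (nu 0 j)%:C *: cmx one) <= l%:R * (3 * K * r) + (1 - b) ^+ s.
  have -> : Psi eta ^+ l *m (delta_mx j 0 : 'cV[R[i]]_N) - (nu 0 j)%:C *: cmx one =
    (Psi eta ^+ l *m delta_mx j 0 - cmx F ^+ l *m delta_mx j 0) + (cmx (F ^+ l) *m delta_mx j 0 - (nu 0 j)%:C *: cmx one).
    by rewrite cmxX addrA subrK.
  apply: le_trans (opnD _ _) _; apply: lerD; last exact: stationary_limit dob s j.
  apply: le_trans (power_perturbation _ _ P1 F1') _.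
  rewrite -[leRHS]mulr1; apply: ler_pM; rewrite ?mulr_ge0 ?opn_ge0//.
    by rewrite ler_wpM2l.
  exact: opn_delta_col.
have Pp p : opn (Psi eta ^+ p) <= 1 by rewrite -(expr1n _ p) opn_pow.
have P1l : opn (Psi eta ^+ l *m cmx one - cmx one) <= l%:R * (3 * K * r).
  have := power_perturbation (cmx one) l P1 F1'.
  rewrite -cmxX -cmxM; have [_ -> _] := stochastic_pow dob l.
  move=> /le_trans; apply; rewrite -[leRHS]mulr1; apply: ler_pM; rewrite ?mulr_ge0 ?opn_ge0 ?opn_ones//.
  by rewrite ler_wpM2l.
set mu := 1 - quad_form Q eta / 2.
have mu1 : `|mu| <= 1 by rewrite ler_norml /mu; lra.
have e1 : `|expR (- (quad_form Q eta / 2))| <= 1.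
  by rewrite ger0_norm ?expR_ge0// expR_le1 oppr_le0 divr_ge0.
have muE : `|mu ^+ n - expR (- (quad_form Q xi / 2))| <= r * (kq ^+ 2 * n1 xi ^+ 2).
  have -> : expR (- (quad_form Q xi / 2)) = expR (- (quad_form Q eta / 2)) ^+ n.
    by rewrite -expRM_natl; congr expR; rewrite qE; ring.
  apply: le_trans (pow_dist _ mu1 e1) _.
  rewrite -nr2.
  have y0 : 0 <= quad_form Q eta / 2 by rewrite divr_ge0.
  have /andP[d0 d1] := exp_sub_linear y0.
  rewrite distrC ger0_norm -?/mu//.
  have -> : r * (kq ^+ 2 * (n%:R * r ^+ 2)) = n%:R * (r * (kq * r) ^+ 2) by ring.
  rewrite ler_wpM2l//; apply: le_trans d1 _.
  apply: le_trans (_ : (kq * r ^+ 2) ^+ 2 <= _).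
    by rewrite ler_sqr ?nnegrE//; lra.
  have -> : (kq * r ^+ 2) ^+ 2 = r * (r * (kq * r) ^+ 2) by ring.
  by rewrite ler_piMl// mulr_ge0// sqr_ge0.
have T2 : opn (Psi eta ^+ n *m cmx one - (expR (- (quad_form Q xi / 2)))%:C *: cmx one) <=
    r * (2 * kd + kc * n1 xi ^+ 2 + kq ^+ 2 * n1 xi ^+ 2).
  set c := cr eta.
  have c1 := corr_near1 H r1; rewrite -/c -/r in c1.
  have c2 := corr_eigen H r1; rewrite -/c -/r -/mu in c2.
  have muc : nc mu%:C <= 1 by rewrite nc_real.
  have c3 := power_pseudo_eigenvector n P1 muc c2.
  have -> : Psi eta ^+ n *m cmx one - (expR (- (quad_form Q xi / 2)))%:C *: cmx one =
    (Psi eta ^+ n *m c - mu%:C ^+ n *: c) - Psi eta ^+ n *m (c - cmx one)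
    + mu%:C ^+ n *: (c - cmx one) + (mu%:C ^+ n - (expR (- (quad_form Q xi / 2)))%:C) *: cmx one.
    rewrite (mulmxBr (Psi eta ^+ n) c (cmx one)); exact: telescope_columns.
  apply: le_trans (opnD _ _) _; apply: le_trans (lerD (opnD _ _) (lexx _)) _.
  apply: le_trans (lerD (lerD (opnB _ _) (lexx _)) (lexx _)) _.
  have b1' : n%:R * (kc * r ^+ 3) = r * (kc * n1 xi ^+ 2) by rewrite -nr2; ring.
  rewrite b1' in c3.
  have b2 : opn (Psi eta ^+ n *m (c - cmx one)) <= kd * r.
    apply: le_trans (opnM _ _) _; apply: le_trans c1; rewrite ler_piMl ?opn_ge0//.
  have b3 : opn (mu%:C ^+ n *: (c - cmx one)) <= kd * r.
    apply: le_trans (opnZ _ _) _; apply: le_trans c1; rewrite ler_piMl ?opn_ge0//.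
    by rewrite ncX exprn_ile1// nc_ge0.
  have b4 : opn ((mu%:C ^+ n - (expR (- (quad_form Q xi / 2)))%:C) *: cmx one) <= r * (kq ^+ 2 * n1 xi ^+ 2).
    apply: le_trans (opnZ _ _) _; rewrite -rmorphXn -rmorphB nc_real.
    apply: le_trans muE; rewrite ler_piMr// opn_ones//.
  apply: le_trans (lerD (lerD (lerD c3 b2) b3) b4) _.
  by rewrite le_eqVlt; apply/orP; left; apply/eqP; ring.
(* [Psi eta ^+ l] nearly fixes the constant vector, so the [l] factors already spent are restored
   before the estimate for the full power is applied. *)
have -> : Psi eta ^+ n *m (delta_mx j 0 : 'cV[R[i]]_N) - (nu 0 j * expR (- (quad_form Q xi / 2)))%:C *: cmx one =
   Psi eta ^+ (n - l) *m (Psi eta ^+ l *m delta_mx j 0 - (nu 0 j)%:C *: cmx one)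
   - (nu 0 j)%:C *: (Psi eta ^+ (n - l) *m (Psi eta ^+ l *m cmx one - cmx one))
   + (nu 0 j)%:C *: (Psi eta ^+ n *m cmx one - (expR (- (quad_form Q xi / 2)))%:C *: cmx one).
  have PE : Psi eta ^+ (n - l) *m Psi eta ^+ l = Psi eta ^+ n.
    by have := exprD (Psi eta) (n - l) l; rewrite subnK// => ->.
  rewrite !mulmxBr !mulmxA PE rmorphM -scalemxAr; exact: telescope_limit.
have vn : nc (nu 0 j)%:C <= 1 by rewrite nc_real ger0_norm.
apply: le_trans (opnD _ _) _; apply: le_trans (lerD (opnB _ _) (lexx _)) _.
have t1 : opn (Psi eta ^+ (n - l) *m (Psi eta ^+ l *m (delta_mx j 0 : 'cV[R[i]]_N) - (nu 0 j)%:C *: cmx one)) <=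
   l%:R * (3 * K * r) + (1 - b) ^+ s.
  by apply: le_trans (opnM _ _) _; apply: le_trans T1; rewrite ler_piMl ?opn_ge0// Pp.
have t2 : opn ((nu 0 j)%:C *: (Psi eta ^+ (n - l) *m (Psi eta ^+ l *m cmx one - cmx one))) <= l%:R * (3 * K * r).
  apply: le_trans (opnZ _ _) _; apply: le_trans (_ : 1 * opn (Psi eta ^+ (n - l) *m (Psi eta ^+ l *m cmx one - cmx one)) <= _).
    by rewrite ler_wpM2r ?opn_ge0.
  by rewrite mul1r; apply: le_trans (opnM _ _) _; apply: le_trans P1l; rewrite ler_piMl ?opn_ge0// Pp.
have t3 : opn ((nu 0 j)%:C *: (Psi eta ^+ n *m cmx one - (expR (- (quad_form Q xi / 2)))%:C *: cmx one)) <=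
    r * (2 * kd + kc * n1 xi ^+ 2 + kq ^+ 2 * n1 xi ^+ 2).
  by apply: le_trans (opnZ _ _) _; apply: le_trans T2; rewrite ler_piMl ?opn_ge0.
apply: le_trans (lerD (lerD t1 t2) t3) _.
by rewrite le_eqVlt; apply/orP; left; apply/eqP; ring.
Qed.

End power_limit.

(** * Transforms of the tilted kernel *)

Section convolution.
Variables (R : realType) (V : zmodType).
Local Notation nc := (@ComplexField.Normc.normc R).

Let shear_bij : bijective (fun z : V * V => (z.1, z.2 - z.1)).
Proof.
exists (fun z => (z.1, z.2 + z.1)); first by case=> y x /=; rewrite subrK.
by case=> y x /=; rewrite addrK.
Qed.

Lemma csummable_conv (f g : V -> R[i]) : csummable f -> csummable g ->
  csummable (fun z : V * V => f z.1 * g (z.2 - z.1)).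
Proof.
move=> hf hg.
exact: (proj2 (csummable_reindex (fun z : V * V => f z.1 * g z.2) shear_bij) (csummable_prod hf hg)).
Qed.

Lemma csum_conv (f g : V -> R[i]) : csummable f -> csummable g ->
  csummable (fun x => csum (fun y => f y * g (x - y))) /\
  csum (fun x => csum (fun y => f y * g (x - y))) = csum f * csum g.
Proof.
move=> hf hg; have h := csummable_conv hf hg.
have swap_bij : bijective (fun z : V * V => (z.2, z.1)) by exists (fun z => (z.2, z.1)); case.
have h' := proj2 (csummable_reindex _ swap_bij) h.
have [/= s1 _] := csum_pair h'; split=> //.
rewrite -(csum_exchange h) mulrC -csumZ//; apply: eq_csum => y.
rewrite mulrC -csumZ//.
rewrite [RHS](@csum_reindex _ V V (fun x => x - y)).
  by apply: eq_csum => x.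
by exists (fun x => x + y) => x; rewrite ?subrK ?addrK.
Qed.

Lemma rsum_finite_fibre (T : choiceType) (I : finType) (f : T * I -> R) :
  (forall l, rsummable (fun x => f (x, l))) ->
  rsummable f /\ rsum f = \sum_l rsum (fun x => f (x, l)).
Proof.
move=> h.
have fin (g : I -> R) : rsummable g /\ rsum g = \sum_l g l.
  have [|s e] := @rsum_finsupp _ _ g (index_enum I) (index_enum_uniq I) => //.
  by move=> t; rewrite mem_index_enum.
have hs : rsummable f.
  apply: rsummable_pair => [x|]; first by case: (fin (fun y => f (x, y))).
  rewrite (_ : (fun x => _) = (fun x => \sum_l `|f (x, l)|)); last first.
    by apply/funext => x; case: (fin (fun l => `|f (x, l)|)).
  by apply: rsummable_sum => l _; exact: rsummable_norm.
split=> //; have [_ ->] := rsum_pair hs; rewrite -rsum_sum//.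
by apply: eq_rsum => x; case: (fin (fun y => f (x, y))).
Qed.

End convolution.

Section kernel_transform.
Variables (R : realType) (d N : nat) (p : lattice_kernel R d N).
Hypothesis p_inv : invariant_kernel p.
Local Notation nc := (@ComplexField.Normc.normc R).
Local Notation "x %:C" := (real_complex R x) (at level 1, format "x %:C").

Lemma kernel_ge0 a b : 0 <= p a b. Proof. by case: p_inv. Qed.

Lemma conv_pow_ge0 n a b : 0 <= conv_pow p n a b.
Proof.
elim: n a => [|n IH] a /=; first by [].
by apply: fine_ge0; apply: esum_ge0 => c _; rewrite lee_fin mulr_ge0 ?kernel_ge0.
Qed.

Lemma conv_powE n a b : conv_pow p n.+1 a b = rsum (fun c => p a c * conv_pow p n c b).
Proof. by rewrite rsum_ge0E// => c; rewrite mulr_ge0 ?kernel_ge0 ?conv_pow_ge0. Qed.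

Lemma conv_pow_shift n v x y l j : conv_pow p n (y + v, l) (x + v, j) = conv_pow p n (y, l) (x, j).
Proof.
elim: n y l => [|n IH] y l.
  by rewrite /= !xpair_eqE (inj_eq (addIr v)).
have bij : bijective (fun c : 'rV[int]_d * 'I_N => (c.1 + v, c.2)).
  by exists (fun c => (c.1 - v, c.2)); case=> c i /=; rewrite ?addrK ?subrK.
rewrite !conv_powE (rsum_reindex _ bij); apply: eq_rsum => -[c i] /=.
have [_ tr _] := p_inv.
by rewrite IH tr (tr y) opprD addrACA subrr addr0.
Qed.

Definition transform (w xi : 'rV[R]_d) : 'M[R[i]]_N := \matrix_(k, j)
  csum (fun x => (p (0, k) (x, j) * expR (dotp w (rvec R x)))%:C * cexpi (dotp (rvec R x) xi)).

Lemma rvecD (x y : 'rV[int]_d) : rvec R (x + y) = rvec R x + rvec R y.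
Proof. by apply/rowP => i; rewrite !mxE intrD. Qed.

Lemma rvec0 : rvec R (0 : 'rV[int]_d) = 0.
Proof. by apply/rowP => i; rewrite !mxE. Qed.

Section fixed_tilt.
Variable w : 'rV[R]_d.
Hypothesis w_fin : F_finite p w.

Lemma F_summable k j : rsummable (fun x => p (0, k) (x, j) * expR (dotp w (rvec R x))).
Proof.
have := w_fin k j; rewrite /F_entry /rsummable; congr (_ < _)%E; apply: eq_esum => x _.
by rewrite ger0_norm// mulr_ge0 ?kernel_ge0 ?expR_ge0.
Qed.

Lemma F_mxE k j : F_mx p w k j = rsum (fun x => p (0, k) (x, j) * expR (dotp w (rvec R x))).
Proof. by rewrite mxE rsum_ge0E// => x; rewrite mulr_ge0 ?kernel_ge0 ?expR_ge0. Qed.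

Section fixed_frequency.
Variable xi : 'rV[R]_d.

Let ch (x : 'rV[int]_d) : R[i] := (expR (dotp w (rvec R x)))%:C * cexpi (dotp (rvec R x) xi).

Let chD x y : ch (x + y) = ch x * ch y.
Proof. by rewrite /ch rvecD dotpDr dotpDl expRD cexpiD rmorphM; ring. Qed.

Let ncch x : nc (ch x) = expR (dotp w (rvec R x)).
Proof. by rewrite ncM nc_real nc_cexpi mulr1 ger0_norm ?expR_ge0. Qed.

(** The weight [ch] is multiplicative and invariance rewrites a step from [y] to [x] as one from 0
    to [x - y], so each convolution becomes a matrix product. *)
Lemma transform_pow n k j :
  csummable (fun x => (P_mx p n w x k j)%:C * cexpi (dotp (rvec R x) xi)) /\
  csum (fun x => (P_mx p n w x k j)%:C * cexpi (dotp (rvec R x) xi)) = (transform w xi ^+ n) k j.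
Proof.
have PE m l : (fun x => (P_mx p m w x l j)%:C * cexpi (dotp (rvec R x) xi)) =
  (fun x => (conv_pow p m (0, l) (x, j))%:C * ch x).
  by apply/funext => x; rewrite mxE rmorphM mulrA.
rewrite PE; elim: n k => [|n IH] k.
  have [||s e] := @csum_finsupp _ _ (fun x => (conv_pow p 0 (0, k) (x, j))%:C * ch x) [:: 0] => //.
    by move=> x /=; rewrite mem_seq1 xpair_eqE eq_sym => /negPf ->; rewrite mul0r.
  split=> //; rewrite e big_seq1 /= expr0 mxE xpair_eqE eqxx /=.
  rewrite /ch rvec0 dotpC !dotp0l expR0 cexpi0 mulr1 rmorph1 mulr1.
  by case: (k == j); rewrite ?rmorph1 ?rmorph0.
pose f k' l x := (p (0, k') (x, l))%:C * ch x.
have fs k' l : csummable (f k' l).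
  apply: csummable_le (F_summable k' l) => x; rewrite ncM ncch nc_real.
  by rewrite ger0_norm ?kernel_ge0.
have tE k' l : transform w xi k' l = csum (f k' l).
  by rewrite mxE; apply: eq_csum => x; rewrite rmorphM /f /ch mulrA.
pose g l x := (conv_pow p n (0, l) (x, j))%:C * ch x.
have gs l : csummable (g l) by have [] := IH l.
have pt l x y : f k l y * g l (x - y) =
   ch x * (p (0, k) (y, l) * conv_pow p n (0, l) (x - y, j))%:C.
  have -> : ch x = ch (x - y) * ch y by rewrite -chD subrK.
  by rewrite /f /g rmorphM; ring.
have sm l x : rsummable (fun y => p (0, k) (y, l) * conv_pow p n (0, l) (x - y, j)).
  have h : csummable (fun y => f k l y * g l (x - y)).
    have swap_bij : bijective (fun z : 'rV[int]_d * 'rV[int]_d => (z.2, z.1)).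
      by exists (fun z => (z.2, z.1)); case.
    have h' := proj2 (csummable_reindex _ swap_bij) (csummable_conv (fs k l) (gs l)).
    exact: (csummable_section x h').
  have := rsummableZ (expR (- dotp w (rvec R x))) h; congr rsummable; apply/funext => y.
  rewrite pt ncM ncch nc_real mulrA -expRD addNr expR0 mul1r ger0_norm//.
  by rewrite mulr_ge0 ?kernel_ge0 ?conv_pow_ge0.
have stepE x : (conv_pow p n.+1 (0, k) (x, j))%:C * ch x =
    \sum_l csum (fun y => f k l y * g l (x - y)).
  rewrite conv_powE.
  rewrite (_ : (fun c => _) = (fun c : 'rV[int]_d * 'I_N => p (0, k) (c.1, c.2) * conv_pow p n (0, c.2) (x - c.1, j))); last first.
    apply/funext => -[c l] /=; congr (_ * _).
    by rewrite -{1}[x](subrK c) -{1}[c]add0r conv_pow_shift.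
  have [_ ->] := @rsum_finite_fibre _ _ _ (fun c : 'rV[int]_d * 'I_N => p (0, k) (c.1, c.2) * conv_pow p n (0, c.2) (x - c.1, j)) (fun l => sm l x).
  rewrite rmorph_sum mulr_suml; apply: eq_bigr => l _ /=.
  rewrite (eq_csum (fun y => pt l x y)) csumZ; last exact: csummable_real.
  by rewrite csum_real mulrC.
have cs l := csum_conv (fs k l) (gs l).
rewrite (_ : (fun x => _) = (fun x => \sum_l csum (fun y => f k l y * g l (x - y)))); last first.
  by apply/funext => x.
split; first by apply: csummable_sum => l _; case: (cs l).
rewrite csum_sum; last by move=> l _; case: (cs l).
rewrite exprS mxE; apply: eq_bigr => l _; have [_ ->] := cs l.
by rewrite tE; congr (_ * _); have [_ <-] := IH l.
Qed.

End fixed_frequency.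

Lemma transform0 : transform w 0 = cmx (F_mx p w).
Proof.
apply/matrixP => k j; rewrite !mxE -rsum_ge0E; last first.
  by move=> x; rewrite mulr_ge0 ?kernel_ge0 ?expR_ge0.
rewrite -csum_real; apply: eq_csum => x.
by rewrite (dotpC _ 0) dotp0l cexpi0 mulr1.
Qed.

Lemma P_mx_ge0 n x k j : 0 <= P_mx p n w x k j.
Proof. by rewrite mxE mulr_ge0 ?conv_pow_ge0 ?expR_ge0. Qed.

Lemma P_mass n k j : rsummable (fun x => P_mx p n w x k j) /\
  rsum (fun x => P_mx p n w x k j) = (F_mx p w ^+ n) k j.
Proof.
have [h1 h2] := transform_pow 0 n k j.
split.
  by apply: rsummable_le h1 => x; rewrite ncM nc_cexpi mulr1 nc_real.
move: h2; rewrite transform0 -cmxX [RHS]mxE.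
rewrite (_ : (fun x => _) = (fun x => (P_mx p n w x k j)%:C)); last first.
  by apply/funext => x; rewrite (dotpC _ 0) dotp0l cexpi0 mulr1.
by rewrite csum_real => -[].
Qed.

End fixed_tilt.
End kernel_transform.

(** * Taylor bounds and absorption of powers by exponentials *)

Section elementary_bounds.
Variable R : realType.
Local Notation nc := (@ComplexField.Normc.normc R).
Local Notation "x %:C" := (real_complex R x) (at level 1, format "x %:C").
Local Notation I := (Complex 0 1 : R[i]).

(** Integrates inequalities: starting from the bounds of sine and cosine by 1, repeated use yields
    their Taylor bounds alternately. *)
Lemma ge0_of_derive (f df : R -> R) : f 0 = 0 ->
  (forall y : R, is_derive y 1 f (df y)) -> (forall y : R, 0 <= y -> 0 <= df y) ->
  forall x : R, 0 <= x -> 0 <= f x.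
Proof.
move=> f0 hf df0 x x0; have [c /andP[c0 _] e] := mean_value x0 hf.
by move: e; rewrite f0 !subr0 => ->; rewrite mulr_ge0 ?df0.
Qed.

Lemma is_derive_pow1 (x : R) n : is_derive x 1 (fun y : R => y ^+ n.+1) (n.+1%:R * x ^+ n).
Proof.
elim: n => [|n IH].
  by rewrite expr0 mulr1; exact: is_derive_id1.
rewrite (_ : (fun y => _) = (fun y => y * y ^+ n.+1)); last by apply/funext => y; rewrite exprS.
apply: is_derive_eq1 (is_derive_mul1 (is_derive_id1 x) IH) _.
by rewrite exprS -[n.+2%:R]natr1; ring.
Qed.

Let dpoly (a b c e x : R) : is_derive x 1 (fun y : R => a + (b * y + (c * y ^+ 2 + e * y ^+ 3)))
  (b + 2 * c * x + 3 * e * x ^+ 2).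
Proof.
apply: is_derive_eq1 (is_derive_add1 (is_derive_cst1 x a) (is_derive_add1
  (is_derive_mul1 (is_derive_cst1 x b) (is_derive_id1 x)) (is_derive_add1
  (is_derive_mul1 (is_derive_cst1 x c) (is_derive_pow1 x 1)) (is_derive_mul1 (is_derive_cst1 x e) (is_derive_pow1 x 2))))) _.
by ring.
Qed.

Let dpoly_sin (t a b c e x : R) : is_derive x 1 (fun y : R => t * sin y + (a + (b * y + (c * y ^+ 2 + e * y ^+ 3))))
  (t * cos x + (b + 2 * c * x + 3 * e * x ^+ 2)).
Proof.
apply: is_derive_eq1 (is_derive_add1 (is_derive_mul1 (is_derive_cst1 x t) (is_derive_sin1 (is_derive_id1 x))) (dpoly a b c e x)) _.
by ring.
Qed.

Let dpoly_cos (t a b c e x : R) : is_derive x 1 (fun y : R => t * cos y + (a + (b * y + (c * y ^+ 2 + e * y ^+ 3))))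
  (- t * sin x + (b + 2 * c * x + 3 * e * x ^+ 2)).
Proof.
apply: is_derive_eq1 (is_derive_add1 (is_derive_mul1 (is_derive_cst1 x t) (is_derive_cos1 (is_derive_id1 x))) (dpoly a b c e x)) _.
by ring.
Qed.

Let sin_ub (x : R) : 0 <= x -> sin x <= x.
Proof.
move=> x0; have := ge0_of_derive _ (dpoly_sin (-1) 0 1 0 0) _ x0.
rewrite sin0 => h; suff : 0 <= -1 * sin x + (0 + (1 * x + (0 * x ^+ 2 + 0 * x ^+ 3))) by lra.
by apply: h => [|y y0]; [ring|have := cos_le1 y; lra].
Qed.

Let cos_lb2 (x : R) : 0 <= x -> 1 - x ^+ 2 / 2 <= cos x.
Proof.
move=> x0; have := ge0_of_derive _ (dpoly_cos 1 (-1) 0 (2^-1) 0) _ x0.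
rewrite cos0 => h; suff : 0 <= 1 * cos x + (-1 + (0 * x + (2^-1 * x ^+ 2 + 0 * x ^+ 3))) by lra.
by apply: h => [|y y0]; [field|have := sin_ub y0; lra].
Qed.

Let sin_lb3 (x : R) : 0 <= x -> x - x ^+ 3 / 6 <= sin x.
Proof.
move=> x0; have := ge0_of_derive _ (dpoly_sin 1 0 (-1) 0 (6^-1)) _ x0.
rewrite sin0 => h; suff : 0 <= 1 * sin x + (0 + (-1 * x + (0 * x ^+ 2 + 6^-1 * x ^+ 3))) by lra.
by apply: h => [|y y0]; [ring|have := cos_lb2 y0; lra].
Qed.

Let cos_lb1 (x : R) : 0 <= x -> 1 - x <= cos x.
Proof.
move=> x0; have := ge0_of_derive _ (dpoly_cos 1 (-1) 1 0 0) _ x0.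
rewrite cos0 => h; suff : 0 <= 1 * cos x + (-1 + (1 * x + (0 * x ^+ 2 + 0 * x ^+ 3))) by lra.
by apply: h => [|y y0]; [ring|have := sin_le1 y; lra].
Qed.

Let sin_lb2 (x : R) : 0 <= x -> x - x ^+ 2 / 2 <= sin x.
Proof.
move=> x0; have := ge0_of_derive _ (dpoly_sin 1 0 (-1) (2^-1) 0) _ x0.
rewrite sin0 => h; suff : 0 <= 1 * sin x + (0 + (-1 * x + (2^-1 * x ^+ 2 + 0 * x ^+ 3))) by lra.
by apply: h => [|y y0]; [ring|have := cos_lb1 y0; lra].
Qed.

Let cos_ub3 (x : R) : 0 <= x -> cos x <= 1 - x ^+ 2 / 2 + x ^+ 3 / 6.
Proof.
move=> x0; have := ge0_of_derive _ (dpoly_cos (-1) 1 0 (- 2^-1) (6^-1)) _ x0.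
rewrite cos0 => h; suff : 0 <= -1 * cos x + (1 + (0 * x + (- 2^-1 * x ^+ 2 + 6^-1 * x ^+ 3))) by lra.
by apply: h => [|y y0]; [field|have := sin_lb2 y0; lra].
Qed.

Lemma cos_taylor (x : R) : `|cos x - (1 - x ^+ 2 / 2)| <= `|x| ^+ 3 / 6.
Proof.
wlog x0 : x / 0 <= x.
  by move=> h; case: (lerP 0 x) => [/h//|x0]; have := h (- x); rewrite cosN sqrrN normrN; apply; lra.
have h1 := cos_ub3 x0; have h2 := cos_lb2 x0; have h3 : 0 <= x ^+ 3 by rewrite exprn_ge0.
by rewrite (ger0_norm x0) ler_norml; lra.
Qed.

Lemma sin_taylor (x : R) : `|sin x - x| <= `|x| ^+ 3 / 6.
Proof.
wlog x0 : x / 0 <= x.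
  move=> h; case: (lerP 0 x) => [/h//|x0]; have := h (- x).
  by rewrite sinN -opprD !normrN; apply; lra.
have h1 := sin_ub x0; have h2 := sin_lb3 x0; have h3 : 0 <= x ^+ 3 by rewrite exprn_ge0.
by rewrite (ger0_norm x0) ler_norml; lra.
Qed.

Lemma cexpi_taylor (x : R) : nc (cexpi x - (1 + I * x%:C - (2^-1)%:C * (x ^+ 2)%:C)) <= `|x| ^+ 3.
Proof.
apply: le_trans (nc_ReIm _) _.
have h1 := cos_taylor x; have h2 := sin_taylor x.
have h3 : 0 <= `|x| ^+ 3 by rewrite exprn_ge0.
have -> : cexpi x - (1 + I * x%:C - (2^-1)%:C * (x ^+ 2)%:C) = Complex (cos x - (1 - x ^+ 2 / 2)) (sin x - x).
  by apply: cplx_eq; rewrite /cexpi /=; field.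
by rewrite /=; lra.
Qed.

(** [1 + cexpi t] is [2 cos (t / 2)] times a phase. This measures the interference of two equal
    masses at neighbouring points, the source of all decay on the torus. *)
Lemma nc_1_cexpi (t : R) : `|t| <= pi -> nc (1 + cexpi t) <= 2 - t ^+ 2 / 12.
Proof.
move=> tpi; set s := t / 2.
have s2 : `|s| <= 2.
  have -> : `|s| = `|t| / 2 by rewrite normrM [X in _ * X]ger0_norm ?invr_ge0.
  by have := pihalf_lt2 R; lra.
have h := cos_taylor s.
have h3 : `|s| ^+ 3 <= 2 * s ^+ 2 by rewrite -(real_normK (num_real s)) exprS ler_wpM2r ?sqr_ge0.
have c0 : cos s <= 1 - s ^+ 2 / 6 by move: h; rewrite ler_norml => /andP[_]; lra.
have c1 : 0 <= cos s.
  by apply: cos_ge0_pihalf; move: tpi; rewrite /s ler_norml; move: (pi : R) => q; lra.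
have -> : 1 + cexpi t = (2 * cos s)%:C * cexpi s.
  have -> : t = s + s by rewrite /s; field.
  apply: cplx_eq; rewrite /cexpi /= ?cosD ?sinD.
    by rewrite -{1}(cos2Dsin2 s); ring.
  by ring.
rewrite ncM nc_cexpi nc_real mulr1 ger0_norm ?mulr_ge0//.
have : t ^+ 2 = 4 * s ^+ 2 by rewrite /s; field.
by lra.
Qed.

Lemma exp_taylor1 (s : R) : `|expR s - 1 - s| <= s ^+ 2 * expR `|s|.
Proof.
have h1 := expR_ge1Dx s; have h2 := expR_ge1Dx (- s); have e0 := expR_gt0 s.
have en : expR s * expR (- s) = 1 by rewrite -expRD addrN expR0.
have h3 : expR s - 1 <= s * expR s.
  by have := ler_wpM2l (ltW e0) h2; rewrite en; lra.
have e1 : expR s <= expR `|s| by rewrite ler_expR ler_norm.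
have e2 : 1 <= expR `|s| by rewrite -expR0 ler_expR.
rewrite ger0_norm; last by lra.
case: (lerP 0 s) => s0.
  apply: le_trans (_ : s * (expR s - 1) <= _); first by lra.
  apply: le_trans (_ : s * (s * expR s) <= _); first by rewrite ler_wpM2l.
  have -> : s * (s * expR s) = s ^+ 2 * expR s by ring.
  by rewrite ler_wpM2l ?sqr_ge0.
apply: le_trans (_ : s ^+ 2 * 1 <= _); last by rewrite ler_wpM2l ?sqr_ge0.
have := ler_wnM2l (ltW s0) h1; rewrite mulr1; lra.
Qed.

(** The rate [dl / 4] per power is deliberate: for [r = 2] it leaves [dl / 2], which the remainder
    of the exponential in the eigenvalue expansion consumes. *)
Lemma pow_le_exp (dl y : R) (r : nat) : 0 < dl -> 0 <= y -> (r <= 3)%N ->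
  y ^+ r <= (1 + 4 / dl) ^+ 3 * expR (dl / 4 * r%:R * y).
Proof.
move=> dl0 y0 r3.
have h : y <= (4 / dl) * expR (dl / 4 * y).
  rewrite -ler_pdivrMl ?divr_gt0// invf_div; apply: le_trans (expR_ge1Dx _).
  by rewrite lerDr.
have d0 : 0 < 4 / dl by rewrite divr_gt0.
apply: le_trans (_ : ((4 / dl) * expR (dl / 4 * y)) ^+ r <= _).
  by apply: lerXn2r; rewrite ?nnegrE// (le_trans y0 h).
rewrite exprMn -expRM_natl (_ : r%:R * _ = dl / 4 * r%:R * y); last by ring.
rewrite ler_wpM2r ?expR_ge0//.
apply: le_trans (_ : (1 + 4 / dl) ^+ r <= _); first by apply: lerXn2r; rewrite ?nnegrE; lra.
by apply: ler_weXn2l => //; lra.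
Qed.

Lemma pow_le_exp_full (dl y : R) (r : nat) : 0 < dl -> 0 <= y -> (r <= 3)%N ->
  y ^+ r <= (1 + 4 / dl) ^+ 3 * expR (dl * y).
Proof.
move=> dl0 y0 r3; apply: le_trans (pow_le_exp dl0 y0 r3) _.
rewrite ler_wpM2l ?exprn_ge0 ?addr_ge0 ?divr_ge0 ?(ltW dl0)// ler_expR ler_wpM2r//.
have : r%:R <= 3 :> R by rewrite (ler_nat R r 3).
have -> : dl / 4 * r%:R = dl * (r%:R / 4) by field.
by move=> r3'; rewrite ler_piMr ?(ltW dl0)//; lra.
Qed.
End elementary_bounds.

Section doob_conjugation.
Variable N : nat.

(* For a positive eigenvector [c] of [M] with eigenvalue [l], [doob l c M] is
   the Doob transform of [M], a stochastic matrix. *)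
Definition doob (T : fieldType) (l : T) (c : 'cV[T]_N) (M : 'M[T]_N) : 'M[T]_N :=
  \matrix_(k, j) (M k j * (c j 0 / (l * c k 0))).

Lemma doob_pow (T : fieldType) (l : T) (c : 'cV[T]_N) (M : 'M[T]_N) n k j :
  (forall i, c i 0 != 0) -> l != 0 ->
  (doob l c M ^+ n) k j = (M ^+ n) k j * (c j 0 / (l ^+ n * c k 0)).
Proof.
move=> c0 l0; elim: n k => [|n IH] k.
  rewrite !expr0 !mxE; case: eqP => [->|_]; last by rewrite !mul0r.
  by rewrite !mul1r mulfV.
rewrite !exprS mxE [in RHS]mxE mulr_suml; apply: eq_bigr => i _.
by rewrite IH mxE; field; rewrite l0 !c0 expf_neq0.
Qed.

End doob_conjugation.

Section coordinate_norms.
Variables (R : realType) (d : nat).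

Lemma dotp_le_n1 (c : R) (v y : 'rV[R]_d) : (forall i, `|v 0 i| <= c) -> `|dotp v y| <= c * n1 y.
Proof.
move=> h; rewrite /dotp /n1 mulr_sumr; apply: le_trans (ler_norm_sum _ _ _) _.
by apply: ler_sum => i _; rewrite normrM ler_wpM2r.
Qed.

Lemma coord_le_n1 (v : 'rV[R]_d) i : `|v 0 i| <= n1 v.
Proof. by rewrite /n1 (bigD1 i)//= lerDl sumr_ge0. Qed.

Lemma dotp_n1 (v y : 'rV[R]_d) : `|dotp v y| <= n1 v * n1 y.
Proof. exact: dotp_le_n1 (coord_le_n1 v). Qed.

Lemma n1_0 : n1 (0 : 'rV[R]_d) = 0.
Proof. by rewrite /n1 big1// => i _; rewrite mxE normr0. Qed.

Lemma rvec_delta i : rvec R (delta_mx 0 i : 'rV[int]_d) = delta_mx 0 i.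
Proof. by apply/rowP => j; rewrite !mxE eqxx /=; case: (j == i). Qed.

Lemma dotp_delta (v : 'rV[R]_d) i : dotp v (delta_mx 0 i) = v 0 i.
Proof.
rewrite /dotp (bigD1 i)//= mxE !eqxx mulr1 big1 ?addr0// => j /negPf ji.
by rewrite mxE eqxx ji mulr0.
Qed.

Lemma max_coord (eta : 'rV[R]_d) : (0 < d)%N -> exists i, dotp eta eta / d%:R <= eta 0 i ^+ 2.
Proof.
move=> d0; apply: contrapT => /forallNP h.
have d0' : 0 < d%:R :> R by rewrite ltr0n.
have h' i : eta 0 i ^+ 2 < dotp eta eta / d%:R by rewrite ltNge; apply/negP/h.
have : \sum_i eta 0 i ^+ 2 < \sum_(i < d) dotp eta eta / d%:R.
  apply: ltr_sum => [|i _]; last exact: h'.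
  by apply/hasP; exists (Ordinal d0); rewrite ?mem_index_enum.
rewrite [X in _ < X]sumr_const card_ord -[X in _ < X]mulr_natr divfK ?gt_eqF//.
by rewrite /dotp; under eq_bigr do rewrite expr2; rewrite ltxx.
Qed.

End coordinate_norms.

(** * Tilted kernels: comparable eigenvectors and decay of transforms *)

Section tilted_kernel.
Variables (R : realType) (d N : nat) (p : lattice_kernel R d N).
Hypothesis p_inv : invariant_kernel p.
Local Notation nc := (@ComplexField.Normc.normc R).
Local Notation "x %:C" := (real_complex R x) (at level 1, format "x %:C").

(* All later estimates depend on [u] only through these constants, which can be
   chosen uniformly on compact sets. *)
Definition tilt_bounds (dl A : R) (m : nat) (a : R) (u : 'rV[R]_d) : Prop :=
  [/\ forall k j, rsummable (fun x => p (0, k) (x, j) * expR (dotp u (rvec R x) + dl * n1 (rvec R x))),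
      forall k j, rsum (fun x => p (0, k) (x, j) * expR (dotp u (rvec R x) + dl * n1 (rvec R x))) <= A,
      forall k j, a <= P_mx p m u 0 k j
    & forall i k j, a <= P_mx p m u (delta_mx 0 i) k j].

Lemma tilt_finite dl A m a u (w : 'rV[R]_d) : tilt_bounds dl A m a u ->
  (forall i, `|w 0 i - u 0 i| <= dl) -> F_finite p w.
Proof.
move=> [h _ _ _] wu k j; rewrite /F_entry.
have : rsummable (fun x => p (0, k) (x, j) * expR (dotp w (rvec R x))).
  apply: rsummable_le (h k j) => x; rewrite ger0_norm ?mulr_ge0 ?kernel_ge0 ?expR_ge0//.
  rewrite ler_wpM2l ?kernel_ge0// ler_expR.
  have -> : w = u + (w - u) by rewrite addrC subrK.
  rewrite dotpDl lerD2l; apply: le_trans (ler_norm _) _; apply: dotp_le_n1 => i.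
  by rewrite !mxE.
rewrite /rsummable; congr (_ < _)%E; apply: eq_esum => x _.
by rewrite ger0_norm// mulr_ge0 ?kernel_ge0 ?expR_ge0.
Qed.

(** Half of the exponential margin pays for moving the tilt. The lower bounds concern only 0 and the
    basis vectors, so they lose at most [exp (- dl / 2)]. *)
Lemma tilt_shift dl A m a u (w : 'rV[R]_d) : 0 < dl -> 0 < a -> tilt_bounds dl A m a u ->
  (forall i, `|w 0 i - u 0 i| <= dl / 2) -> tilt_bounds (dl / 2) A m (a * expR (- (dl / 2))) w.
Proof.
move=> dl0 a0 [h1 h2 h3 h4] wu.
have wE : w = u + (w - u) by rewrite addrC subrK.
have wu' i : `|(w - u) 0 i| <= dl / 2 by rewrite !mxE.
have le k j x : p (0, k) (x, j) * expR (dotp w (rvec R x) + dl / 2 * n1 (rvec R x)) <=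
   p (0, k) (x, j) * expR (dotp u (rvec R x) + dl * n1 (rvec R x)).
  rewrite ler_wpM2l ?kernel_ge0// ler_expR wE dotpDl -addrA lerD2l.
  have := le_trans (ler_norm _) (dotp_le_n1 (rvec R x) wu').
  by rewrite [in leRHS](splitr dl) mulrDl; lra.
have s k j : rsummable (fun x => p (0, k) (x, j) * expR (dotp w (rvec R x) + dl / 2 * n1 (rvec R x))).
  by apply: rsummable_le (h1 k j) => x; rewrite ger0_norm ?mulr_ge0 ?kernel_ge0 ?expR_ge0.
have e1 : expR (- (dl / 2)) <= 1 by rewrite expR_le1; lra.
split=> // [k j|k j|i k j].
- by apply: le_trans (h2 k j); apply: ler_rsum.
- apply: le_trans (_ : a <= _); first by rewrite ler_piMr// ltW.
  apply: le_trans (h3 k j) _; rewrite !mxE rvec0.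
  by rewrite ![dotp _ 0]dotpC !dotp0l.
- apply: le_trans (_ : P_mx p m u (delta_mx 0 i) k j * expR (- (dl / 2)) <= _).
    by rewrite ler_wpM2r ?expR_ge0.
  rewrite !mxE rvec_delta !dotp_delta -mulrA -expRD ler_wpM2l ?conv_pow_ge0// ler_expR.
  by have := wu i; rewrite ler_norml => /andP[]; lra.
Qed.

Variables (dl A : R) (m : nat) (a : R).
Hypotheses (dl0 : 0 < dl) (a0 : 0 < a) (m0 : (0 < m)%N).

Definition mass_ub : R := (N%:R * A) ^+ m.
(** A Harnack constant: the entries of [F_mx p w ^+ m] lie between [a] and [mass_ub], so the
    coordinates of a positive eigenvector are comparable up to this factor. *)
Definition ratio_ub : R := mass_ub / a.

Section fixed_tilt.
Variables (w : 'rV[R]_d) (l : R) (C : 'cV[R]_N).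
Hypotheses (w_bounds : tilt_bounds dl A m a w) (l0 : 0 < l).
Hypotheses (C0 : forall k, 0 < C k 0) (FC : F_mx p w *m C = l *: C).
Local Notation rho := ratio_ub.

Lemma tilt_F_finite : F_finite p w.
Proof. by apply: tilt_finite w_bounds _ => i; rewrite subrr normr0 ltW. Qed.

Lemma F_mx_ge0 k j : 0 <= F_mx p w k j.
Proof.
rewrite (F_mxE p_inv); apply: rsum_ge0 => x.
by rewrite mulr_ge0 ?kernel_ge0 ?expR_ge0.
Qed.

Lemma F_mx_le k j : F_mx p w k j <= A.
Proof.
have [h1 h2 _ _] := w_bounds; apply: le_trans (h2 k j); rewrite (F_mxE p_inv).
apply: ler_rsum => //; first exact: F_summable tilt_F_finite _ _.
by move=> x; rewrite ler_wpM2l ?kernel_ge0// ler_expR lerDl mulr_ge0 ?n1_ge0// ltW.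
Qed.

Lemma F_pow_lb k j : a <= (F_mx p w ^+ m) k j.
Proof.
have [_ _ h _] := w_bounds; apply: le_trans (h k j) _.
have [s <-] := P_mass p_inv tilt_F_finite m k j.
exact: (@ler_rsum1 _ _ (fun x => P_mx p m w x k j) 0 (fun x => P_mx_ge0 p_inv w m x k j)).
Qed.

Lemma F_pow_ub k j : (F_mx p w ^+ m) k j <= mass_ub.
Proof.
have A0 : 0 <= A := le_trans (F_mx_ge0 k j) (F_mx_le k j).
have h : opn (cmx (F_mx p w)) <= N%:R * A.
  apply: opn_le => [|i]; first by rewrite mulr_ge0.
  apply: le_trans (_ : \sum_(j < N) A <= _).
    by apply: ler_sum => i' _; rewrite mxE nc_real ger0_norm ?F_mx_ge0// F_mx_le.
  by rewrite sumr_const card_ord -[leLHS]mulr_natl.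
have := opn_pow m h; rewrite -cmxX; apply: le_trans.
apply: le_trans (entry_le_opn _ k j); rewrite mxE nc_real; exact: ler_norm.
Qed.

Lemma F_powC n : F_mx p w ^+ n *m C = l ^+ n *: C.
Proof.
elim: n => [|n IH]; first by rewrite !expr0 mul1mx scale1r.
have -> : F_mx p w ^+ n.+1 = F_mx p w ^+ n *m F_mx p w by rewrite exprSr.
by rewrite -mulmxA FC -scalemxAr IH scalerA exprS.
Qed.

Let S : R := \sum_k C k 0.

Let FCE n k : \sum_j (F_mx p w ^+ n) k j * C j 0 = l ^+ n * C k 0.
Proof. by have := F_powC n => /matrixP/(_ k 0); rewrite !mxE. Qed.

Let lC_lb k : a * S <= l ^+ m * C k 0.
Proof.
rewrite -FCE /S mulr_sumr; apply: ler_sum => j _.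
by rewrite ler_wpM2r ?(ltW (C0 _))// F_pow_lb.
Qed.

Let lC_ub k : l ^+ m * C k 0 <= mass_ub * S.
Proof.
rewrite -FCE /S mulr_sumr; apply: ler_sum => j _.
by rewrite ler_wpM2r ?(ltW (C0 _))// F_pow_ub.
Qed.

Let lm0 : 0 < l ^+ m. Proof. by rewrite exprn_gt0. Qed.

Let S0 (k : 'I_N) : 0 < S.
Proof. by rewrite /S (bigD1 k)//= ltr_pwDl// sumr_ge0// => i _; rewrite ltW. Qed.

Lemma ratio_ub_ge1 (k : 'I_N) : 1 <= rho.
Proof. by rewrite ler_pdivlMr// mul1r; apply: le_trans (F_pow_lb k k) (F_pow_ub k k). Qed.

Lemma eigenvector_ratio k j : C j 0 <= rho * C k 0.
Proof.
have h1 := lC_lb k; have h2 := lC_ub j.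
have r0 : 0 <= rho by apply: le_trans (ratio_ub_ge1 k).
rewrite -(ler_pM2l lm0); apply: le_trans h2 _.
have -> : mass_ub * S = rho * (a * S) by rewrite /ratio_ub mulrA divfK ?gt_eqF.
by rewrite (mulrCA _ rho) ler_wpM2l.
Qed.

Let Phi eta := doob l%:C (cmx C) (transform p w eta).

Let Cc0 i : cmx C i 0 != 0.
Proof. by rewrite mxE; apply/eqP => -[] /eqP; rewrite gt_eqF. Qed.

Let lc0 : l%:C != 0 :> R[i].
Proof. by apply/eqP => -[] /eqP; rewrite gt_eqF. Qed.

Let Phi_pow eta n k j : (Phi eta ^+ n) k j = (transform p w eta ^+ n) k j * (C j 0 / (l ^+ n * C k 0))%:C.
Proof. by rewrite doob_pow// !mxE !rmorphM fmorphV rmorphM rmorphXn. Qed.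

Let pos_w n k j : 0 <= C j 0 / (l ^+ n * C k 0).
Proof. by rewrite divr_ge0 ?mulr_ge0 ?exprn_ge0 ?(ltW (C0 _)) ?(ltW l0). Qed.

Lemma transform_pow_le eta n k j : nc ((transform p w eta ^+ n) k j) <= (F_mx p w ^+ n) k j.
Proof.
have [h1 <-] := transform_pow p_inv tilt_F_finite eta n k j.
have [s <-] := P_mass p_inv tilt_F_finite n k j.
apply: nc_csum_le => // x; rewrite ncM nc_cexpi nc_real mulr1 ger0_norm//.
exact: P_mx_ge0.
Qed.

(** In modulus the transform is dominated by its value at frequency 0, whose conjugate is
    stochastic. *)
Lemma doob_transform_le1 eta n : opn (Phi eta ^+ n) <= 1.
Proof.
apply: opn_le => // k.
apply: le_trans (_ : \sum_j (F_mx p w ^+ n) k j * C j 0 / (l ^+ n * C k 0) <= _).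
  apply: ler_sum => j _; rewrite Phi_pow ncM nc_real ger0_norm ?pos_w//.
  by rewrite -[leRHS]mulrA ler_wpM2r ?pos_w ?transform_pow_le.
rewrite -mulr_suml FCE divff// gt_eqF// mulr_gt0 ?exprn_gt0//.
Qed.

(** The mass [a] is split off at 0 and at the [i]-th basis vector. These two masses interfere with
    relative phase [eta 0 i]; the rest is bounded by its total mass. *)
Lemma transform_pow_gap (eta : 'rV[R]_d) i k j : `|eta 0 i| <= pi ->
  nc ((transform p w eta ^+ m) k j) <= (F_mx p w ^+ m) k j - a * (eta 0 i ^+ 2 / 12).
Proof.
move=> ei.
have [h1 <-] := transform_pow p_inv tilt_F_finite eta m k j.
have [s <-] := P_mass p_inv tilt_F_finite m k j.
pose e : 'rV[int]_d := delta_mx 0 i.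
have e0 : e != 0 by apply/eqP => /rowP/(_ i); rewrite !mxE !eqxx.
pose g x : R := a * ((x == 0)%:R + (x == e)%:R).
have us : uniq [:: 0; e] by rewrite /= mem_seq1 eq_sym e0.
have sg x : x \notin [:: 0; e] -> g x = 0.
  by rewrite !inE negb_or /g => /andP[/negPf -> /negPf ->]; rewrite addr0 mulr0.
have [g1 g2] := rsum_finsupp us sg.
pose gc x := (g x)%:C * cexpi (dotp (rvec R x) eta).
have [|gc1 gc2] := @csum_finsupp _ _ gc _ us.
  by move=> x /sg; rewrite /gc => ->; rewrite mul0r.
have g0 : g 0 = a by rewrite /g eqxx [0 == e]eq_sym (negPf e0) addr0 mulr1.
have ge : g e = a by rewrite /g eqxx (negPf e0) add0r mulr1.
have gsum : rsum g = 2 * a by rewrite g2 !big_cons big_nil g0 ge; ring.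
have gcsum : csum gc = a%:C * (1 + cexpi (eta 0 i)).
  rewrite gc2 !big_cons big_nil addr0 /gc g0 ge rvec0 dotp0l cexpi0.
  by rewrite rvec_delta dotpC dotp_delta; ring.
have Pg x : g x <= P_mx p m w x k j.
  have [_ _ t3 t4] := w_bounds.
  rewrite /g; case: (eqVneq x 0) => [->|x0].
    by rewrite [0 == e]eq_sym (negPf e0) addr0 mulr1.
  case: (eqVneq x e) => [->|xe]; first by rewrite add0r mulr1; exact: t4.
  by rewrite addr0 mulr0 P_mx_ge0.
have -> : csum (fun x => (P_mx p m w x k j)%:C * cexpi (dotp (rvec R x) eta)) =
  csum gc + csum (fun x => (P_mx p m w x k j)%:C * cexpi (dotp (rvec R x) eta) - gc x).
  by rewrite csumB// addrC subrK.
apply: le_trans (ncD _ _) _; rewrite gcsum ncM nc_real gtr0_norm//.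
have b2 : nc (csum (fun x => (P_mx p m w x k j)%:C * cexpi (dotp (rvec R x) eta) - gc x)) <=
   rsum (fun x => P_mx p m w x k j) - 2 * a.
  rewrite -gsum -rsumB//; apply: nc_csum_le; last exact: rsummableB.
  move=> x; rewrite /gc -mulrBl -rmorphB ncM nc_cexpi mulr1 nc_real ger0_norm//.
  by rewrite subr_ge0.
have b1 := ler_wpM2l (ltW a0) (nc_1_cexpi ei).
by apply: le_trans (lerD b1 b2) _; rewrite le_eqVlt; apply/orP; left; apply/eqP; ring.
Qed.

(** Each row loses [a] times the sum of [C], relative to a total [l ^+ m * C k] of at most [mass_ub]
    times this sum; the quotient is at least [1 / rho]. *)
Lemma doob_transform_gap (k0 : 'I_N) (eta : 'rV[R]_d) i : `|eta 0 i| <= pi ->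
  opn (Phi eta ^+ m) <= 1 - eta 0 i ^+ 2 / (12 * rho).
Proof.
move=> ei; have row k : \sum_j nc ((Phi eta ^+ m) k j) <= 1 - eta 0 i ^+ 2 / (12 * rho).
  have lC0 : 0 < l ^+ m * C k 0 by rewrite mulr_gt0.
  apply: le_trans (_ : \sum_j ((F_mx p w ^+ m) k j * C j 0 / (l ^+ m * C k 0) -
     a * (eta 0 i ^+ 2 / 12) / (l ^+ m * C k 0) * C j 0) <= _).
    apply: ler_sum => j _; rewrite Phi_pow ncM nc_real ger0_norm ?pos_w//.
    apply: le_trans (ler_wpM2r (pos_w m k j) (transform_pow_gap k j ei)) _.
    by rewrite le_eqVlt; apply/orP; left; apply/eqP; ring.
  rewrite sumrB -mulr_suml FCE divff ?gt_eqF// -mulr_sumr -/S lerD2l lerN2.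
  have r0 : 0 < rho by apply: lt_le_trans (ratio_ub_ge1 k).
  have sp := S0 k; have M0 : 0 < mass_ub.
    by apply: lt_le_trans a0 _; apply: le_trans (F_pow_lb k k) (F_pow_ub k k).
  rewrite [leRHS]mulrAC ler_pdivlMr//.
  apply: le_trans (ler_wpM2l _ (lC_ub k)) _.
    by rewrite divr_ge0 ?sqr_ge0// mulr_ge0 ?(ltW r0).
  rewrite /ratio_ub le_eqVlt; apply/orP; left; apply/eqP; field.
  by rewrite gt_eqF ?gt_eqF.
apply: opn_le => //; apply: le_trans (row k0).
by apply: sumr_ge0 => j _; exact: nc_ge0.
Qed.

(** The 12 comes from the interference of two masses, [rho] from the Doob normalization, [m] from
    the number of steps that yield one gain, and [d] from passing to the largest coordinate. *)
Definition decay_rate : R := (12 * rho * m%:R * d%:R)^-1.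

(** The gain [y] is realized once per block of [m] steps. It is at most 2, so an incomplete last
    block is paid for by [expR 2]. *)
Lemma doob_transform_decay (k0 : 'I_N) (eta : 'rV[R]_d) n : (0 < d)%N ->
  (forall i, `|eta 0 i| <= pi) ->
  opn (Phi eta ^+ n) <= expR 2 * expR (- (decay_rate * n%:R * dotp eta eta)).
Proof.
move=> d0 epi; have [i hi] := max_coord eta d0.
have r1 := ratio_ub_ge1 k0; have r0 : 0 < rho by apply: lt_le_trans r1.
set y := eta 0 i ^+ 2 / (12 * rho).
have y0 : 0 <= y by rewrite divr_ge0 ?sqr_ge0// mulr_ge0 ?(ltW r0).
have y2 : y <= 2.
  rewrite ler_pdivrMr; last exact: mulr_gt0.
  have p4 : `|eta 0 i| <= 4.
    by apply: le_trans (epi i) _; have := pihalf_lt2 R; rewrite ltr_pdivrMr// => /ltW; rewrite -natrM.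
  have : eta 0 i ^+ 2 <= 16.
    rewrite -real_normK ?num_real//; apply: le_trans (_ : 4 ^+ 2 <= _); last by lra.
    by apply: lerXn2r; rewrite ?nnegrE.
  by lra.
have step : opn (Phi eta ^+ m) <= expR (- y).
  apply: le_trans (doob_transform_gap k0 (epi i)) _; exact: expR_ge1Dx.
have -> : Phi eta ^+ n = (Phi eta ^+ m) ^+ (n %/ m) *m Phi eta ^+ (n %% m).
  by rewrite -exprM mulnC; have := exprD (Phi eta) (n %/ m * m) (n %% m); rewrite -divn_eq => ->.
apply: le_trans (opnM _ _) _.
apply: le_trans (_ : expR (- y) ^+ (n %/ m) * 1 <= _).
  by apply: ler_pM; rewrite ?opn_ge0 ?doob_transform_le1 ?opn_pow.
rewrite mulr1 -expRM_natl -expRD ler_expR.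
have m0' : 0 < m%:R :> R by rewrite ltr0n.
have d0' : 0 < d%:R :> R by rewrite ltr0n.
have dq : n%:R / m%:R - 1 <= (n %/ m)%:R :> R.
  rewrite lerBlDr ler_pdivrMr// -[1]/(1%:R) -natrD -natrM ler_nat addn1.
  by rewrite ltnW// ltn_ceil.
have e1 : decay_rate * n%:R * dotp eta eta <= n%:R / m%:R * y.
  have -> : decay_rate * n%:R * dotp eta eta = n%:R / m%:R * ((dotp eta eta / d%:R) / (12 * rho)).
    by rewrite /decay_rate; field; rewrite !gt_eqF.
  rewrite ler_wpM2l ?divr_ge0// ler_wpM2r// invr_ge0 mulr_ge0 ?(ltW r0)//.
have e2 := ler_wpM2r y0 dq.
by rewrite mulrBl mul1r in e2; lra.
Qed.

End fixed_tilt.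
End tilted_kernel.

(** * First order perturbation of the Perron eigenvalue *)

Section perron_perturbation.
Variables (R : realType) (N : nat).
Local Notation one := (ones R N).
Variables (m : nat) (b : R) (F : 'M[R]_N) (nu : 'rV[R]_N).
Hypothesis H : doeblin m b F nu.

(** With [z] the eigenvector normalized by [nu z = 1], pairing with [nu] gives
    [l - 1 = nu (Fw - F) z]. The difference of [z] and the constant vector solves a Poisson equation
    with right side of order [r], so replacing [z] costs order [r^2]. The ratio bound [rho] controls
    the norm of [z]. *)
Lemma perron_perturbation (Fw E : 'M[R]_N) (c : 'cV[R]_N) (l r K rho : R) (k0 : 'I_N) :
  0 <= r -> r <= 1 -> 0 <= K -> 1 <= rho ->
  opn (cmx (Fw - F - E)) <= K * r ^+ 2 -> opn (cmx E) <= K * r ->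
  (forall k, 0 < c k 0) -> (forall k j, c j 0 <= rho * c k 0) -> Fw *m c = l *: c ->
  `|l - 1 - (nu *m (E *m one)) 0 0| <= (K * rho + K * (m%:R / b) * (2 * K * rho + 2 * K * rho ^+ 2)) * r ^+ 2.
Proof.
move=> r0 r1 K0 rho1 hE1 hE2 c0 cr Fc.
have [[b0 b1 _] F1 [nu0 nu1] nuF _] := H.
have nus := nu_sum H.
pose t := (nu *m c) 0 0.
have t0 : 0 < t.
  rewrite /t mxE; have h k : c k0 0 / rho <= c k 0 by rewrite ler_pdivrMr 1?mulrC ?(lt_le_trans _ rho1).
  apply: lt_le_trans (_ : c k0 0 / rho <= _); first by rewrite divr_gt0 ?(lt_le_trans _ rho1).
  rewrite -[leLHS]mul1r -nus mulr_suml; apply: ler_sum => k _.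
  by rewrite ler_wpM2l.
pose z := t^-1 *: c.
have Fz : Fw *m z = l *: z by rewrite /z -scalemxAr Fc !scalerA mulrC.
have nuz : nu *m z = 1%:M.
  rewrite /z -scalemxAr [nu *m c]mx11_scalar -/t; apply/matrixP => i j.
  by rewrite !ord1 !mxE eqxx !mulr1n mulVf// gt_eqF.
have oz : opn (cmx z) <= rho.
  have rho0 : 0 <= rho by apply: le_trans rho1.
  apply: opn_col_le => // k; rewrite mxE nc_real mxE mulrC.
  rewrite ger0_norm ?divr_ge0 ?(ltW t0) ?(ltW (c0 _))// ler_pdivrMr//.
  rewrite /t mxE mulr_sumr -[leLHS]mul1r -nus mulr_suml; apply: ler_sum => j _.
  by rewrite mulrCA ler_wpM2l.
clearbody z.
have oFd : opn (cmx (Fw - F)) <= 2 * K * r.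
  have -> : Fw - F = (Fw - F - E) + E by rewrite subrK.
  rewrite cmxD; apply: le_trans (opnD _ _) _; apply: le_trans (lerD hE1 hE2) _.
  have : K * r ^+ 2 <= K * r by rewrite ler_wpM2l// expr2 ler_piMl.
  by lra.
have oFz : opn (cmx ((Fw - F) *m z)) <= 2 * K * r * rho.
  rewrite cmxM; apply: le_trans (opnM _ _) _.
  by apply: ler_pM; rewrite ?opn_ge0.
have oz0 := opn_ge0 (cmx z).
have nul (v : 'cV[R]_N) : `|(nu *m v) 0 0| <= opn (cmx v).
  by apply: le_trans (opn_cmx_col _ _) _; rewrite cmxM; apply: opn_nu_mul H _ _.
have lE : l - 1 = (nu *m ((Fw - F) *m z)) 0 0.
  rewrite mulmxBl Fz mulmxBr -scalemxAr nuz mulmxA nuF nuz.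
  by rewrite !mxE eqxx mulr1n mulr1.
have l1 : `|l - 1| <= 2 * K * r * rho by rewrite lE; exact: le_trans (nul _) oFz.
pose rhs := (Fw - F) *m z - (l - 1) *: z.
have nur : nu *m rhs = 0.
  rewrite /rhs mulmxBr -scalemxAr nuz [nu *m _]mx11_scalar -lE.
  by apply/matrixP => i j; rewrite !ord1 !mxE !eqxx !mulr1n mulr1 subrr.
have orhs : opn (cmx rhs) <= (2 * K * rho + 2 * K * rho ^+ 2) * r.
  rewrite /rhs cmxB cmxZ; apply: le_trans (opnB _ _) _.
  have -> : (2 * K * rho + 2 * K * rho ^+ 2) * r = 2 * K * r * rho + 2 * K * r * rho * rho by ring.
  apply: lerD => //; apply: le_trans (opnZ _ _) _; rewrite nc_real.
  by apply: ler_pM.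
have z1 : z - one = fund F nu *m rhs.
  have e : (1%:M - F + one *m nu) *m (z - one) = rhs.
    rewrite mulmxDl mulmxBl mul1mx (mulmxBr F) F1 -mulmxA (mulmxBr nu) nuz nu1 subrr mulmx0 addr0.
    rewrite /rhs mulmxBl Fz scalerBl scale1r.
    by move: (F *m z) (l *: z) => y x; apply/matrixP => i j; rewrite !mxE; ring.
  by rewrite -e mulmxA /fund mulVmx ?mul1mx//; exact: fund_unit H.
have oz1 : opn (cmx (z - one)) <= m%:R / b * ((2 * K * rho + 2 * K * rho ^+ 2) * r).
  have [_ _ h] := fund_solves H nur; rewrite z1; apply: le_trans h _.
  by rewrite ler_wpM2l// divr_ge0 ?(ltW b0).
have -> : l - 1 - (nu *m (E *m one)) 0 0 = (nu *m ((Fw - F - E) *m z)) 0 0 + (nu *m (E *m (z - one))) 0 0.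
  rewrite lE mulmxBr (mulmxBr nu) (mulmxBl _ E) (mulmxBr nu).
  by move: (nu *m _) (nu *m (E *m z)) (nu *m (E *m one)) => x y x'; rewrite !mxE; ring.
apply: le_trans (ler_normD _ _) _; rewrite mulrDl; apply: lerD.
  apply: le_trans (nul _) _; rewrite cmxM; apply: le_trans (opnM _ _) _.
  have -> : K * rho * r ^+ 2 = K * r ^+ 2 * rho by ring.
  by apply: ler_pM; rewrite ?opn_ge0.
apply: le_trans (nul _) _; rewrite cmxM; apply: le_trans (opnM _ _) _.
have -> : K * (m%:R / b) * (2 * K * rho + 2 * K * rho ^+ 2) * r ^+ 2 =
  K * r * (m%:R / b * ((2 * K * rho + 2 * K * rho ^+ 2) * r)) by ring.
by apply: ler_pM; rewrite ?opn_ge0.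
Qed.

End perron_perturbation.

(** * Moments of the Doob-transformed chain *)

Section moments.
Variables (R : realType) (d N : nat) (p : lattice_kernel R d N).
Hypothesis p_inv : invariant_kernel p.
Local Notation nc := (@ComplexField.Normc.normc R).
Local Notation "x %:C" := (real_complex R x) (at level 1, format "x %:C").
Local Notation one := (ones R N).
Local Notation I := (Complex 0 1 : R[i]).

Variables (dl A : R) (m : nat) (a : R).
Hypotheses (dl0 : 0 < dl) (a0 : 0 < a) (m0 : (0 < m)%N).
Variables (u : 'rV[R]_d) (C : 'cV[R]_N) (nu : 'rV[R]_N).
Hypotheses (u_bounds : tilt_bounds p dl A m a u).
Hypotheses (C0 : forall k, 0 < C k 0) (FC : F_mx p u *m C = 1 *: C).
Hypotheses (nu0 : forall k, 0 < nu 0 k) (nuF : nu *m F_mx p u = 1 *: nu).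
Hypothesis nuC : (nu *m C) 0 0 = 1.
Local Notation rho := (ratio_ub N A m a).

Definition doob_kernel (k j : 'I_N) (x : 'rV[int]_d) : R :=
  p (0, k) (x, j) * expR (dotp u (rvec R x)) * (C j 0 / C k 0).

Definition doob_moment (g : 'rV[int]_d -> R) : 'M[R]_N :=
  \matrix_(k, j) rsum (fun x => doob_kernel k j x * g x).

Definition doob_drift : 'rV[R]_d :=
  \row_i ((\row_j (nu 0 j * C j 0)) *m (doob_moment (fun x => (x 0 i)%:~R) *m one)) 0 0.

Definition centered_moment1 (i : 'I_d) : 'M[R]_N :=
  doob_moment (fun x => (rvec R x - doob_drift) 0 i).

Definition centered_moment2 (i j : 'I_d) : 'M[R]_N :=
  doob_moment (fun x => (rvec R x - doob_drift) 0 i * (rvec R x - doob_drift) 0 j).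

Definition doob_char (xi : 'rV[R]_d) : 'M[R[i]]_N :=
  cexpi (- dotp doob_drift xi) *: doob 1 (cmx C) (transform p u xi).

(** [growth1] bounds the first moments and hence the drift. The extra factor in [growth] pays for
    centering, since a centered coordinate is at most the l1 norm of [x] plus [growth1]. *)
Definition growth1 : R := N%:R * (rho * A * (1 + 4 / dl) ^+ 3).
Definition growth : R := growth1 * expR (dl * growth1).
Definition doeblin_const : R := (N%:R * rho ^+ 2)^-1.

Local Notation q := doob_kernel.
Local Notation Fh := (doob 1 C (F_mx p u)).
Local Notation nuh := (\row_j (nu 0 j * C j 0)).
Let u_fin : F_finite p u := tilt_F_finite p_inv dl0 u_bounds.

Let ratio := eigenvector_ratio p_inv dl0 a0 u_bounds ltr01 C0 FC.

Lemma doob_kernel_ge0 k j x : 0 <= q k j x.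
Proof. by rewrite mulr_ge0 ?divr_ge0 ?(ltW (C0 _))// mulr_ge0 ?kernel_ge0 ?expR_ge0. Qed.

Let rho0 (k : 'I_N) : 0 <= rho.
Proof. exact: le_trans ler01 (ratio_ub_ge1 p_inv dl0 a0 u_bounds k). Qed.

Lemma doob_kernel_le k j x :
  q k j x * expR (dl * n1 (rvec R x)) <= rho * (p (0, k) (x, j) * expR (dotp u (rvec R x) + dl * n1 (rvec R x))).
Proof.
have -> : q k j x * expR (dl * n1 (rvec R x)) =
  C j 0 / C k 0 * (p (0, k) (x, j) * expR (dotp u (rvec R x) + dl * n1 (rvec R x))).
  by rewrite /doob_kernel expRD; ring.
by rewrite ler_wpM2r ?ler_pdivrMr// mulr_ge0 ?kernel_ge0 ?expR_ge0.
Qed.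

Lemma moment_summable k j (g : 'rV[int]_d -> R) c : 
  (forall x, `|g x| <= c * expR (dl * n1 (rvec R x))) ->
  rsummable (fun x => q k j x * g x) /\ rsum (fun x => `|q k j x * g x|) <= c * (rho * A).
Proof.
move=> hg; have [h1 h2 _ _] := u_bounds.
have c0 : 0 <= c by have := le_trans (normr_ge0 _) (hg 0); rewrite pmulr_lge0 ?expR_gt0.
have le x : `|q k j x * g x| <= c * (rho * (p (0, k) (x, j) * expR (dotp u (rvec R x) + dl * n1 (rvec R x)))).
  rewrite normrM (ger0_norm (doob_kernel_ge0 _ _ _)).
  apply: le_trans (ler_wpM2l (doob_kernel_ge0 k j x) (hg x)) _.
  by rewrite mulrCA ler_wpM2l// doob_kernel_le.
have s : rsummable (fun x => c * (rho * (p (0, k) (x, j) * expR (dotp u (rvec R x) + dl * n1 (rvec R x))))).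
  by apply: rsummableZ; apply: rsummableZ; exact: h1.
have sg : rsummable (fun x => q k j x * g x) by exact: rsummable_le s.
split=> //; apply: le_trans (ler_rsum (rsummable_norm sg) s le) _.
rewrite rsumZ; last by apply: rsummableZ; exact: h1.
by rewrite rsumZ// ler_wpM2l// ler_wpM2l ?(rho0 k).
Qed.

Lemma opn_moment (g : 'rV[int]_d -> R[i]) c (M : 'M[R[i]]_N) : 0 <= c ->
  (forall x, nc (g x) <= c * expR (dl * n1 (rvec R x))) ->
  (forall k j, M k j = csum (fun x => (q k j x)%:C * g x)) ->
  opn M <= N%:R * (c * (rho * A)).
Proof.
move=> c0 hg hM.
have row k j : nc (M k j) <= c * (rho * A).
  rewrite hM; have hg' x : `|nc (g x)| <= c * expR (dl * n1 (rvec R x)).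
    by rewrite ger0_norm ?nc_ge0.
  have [s1 s2] := moment_summable k j hg'.
  apply: le_trans s2; apply: nc_csum_le; last exact: rsummable_norm.
  by move=> x; rewrite ncM nc_real -[X in _ * X <= _]ger0_norm ?nc_ge0// -normrM.
have sum k : \sum_j nc (M k j) <= N%:R * (c * (rho * A)).
  apply: le_trans (_ : \sum_(j < N) c * (rho * A) <= _); first by apply: ler_sum => j _.
  by rewrite sumr_const card_ord -[leLHS]mulr_natl.
apply: opn_le => //.
case: (pselect (exists k : 'I_N, True)) => [[k _]|h].
  by apply: le_trans (sum k); apply: sumr_ge0 => j _; exact: nc_ge0.
suff -> : N%:R = 0 :> R by rewrite mul0r.
apply/eqP; rewrite pnatr_eq0; case: N h => // n h; exfalso; apply: h; by exists ord0.
Qed.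

Lemma cmx_moment (g : 'rV[int]_d -> R) k j :
  cmx (doob_moment g) k j = csum (fun x => (q k j x)%:C * (g x)%:C).
Proof.
rewrite !mxE -csum_real; apply: eq_csum => x; exact: rmorphM.
Qed.

Lemma opn_real_moment (g : 'rV[int]_d -> R) c : 0 <= c ->
  (forall x, `|g x| <= c * expR (dl * n1 (rvec R x))) ->
  opn (cmx (doob_moment g)) <= N%:R * (c * (rho * A)).
Proof.
move=> c0 hg; apply: (@opn_moment (fun x => (g x)%:C)) => // [x|k j].
  by rewrite nc_real.
exact: cmx_moment.
Qed.

(** Exponential moments at [u] are the matrices of neighbouring tilts conjugated by the same [C];
    this links the moments at [u] with the values of [lam] nearby. *)
Lemma doob_moment_exp (v : 'rV[R]_d) : n1 v <= dl ->
  doob_moment (fun x => expR (dotp v (rvec R x))) = doob 1 C (F_mx p (u + v)).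
Proof.
move=> vdl; apply/matrixP => k j; rewrite !mxE.
have fin : F_finite p (u + v).
  apply: (tilt_finite p_inv u_bounds) => i; rewrite mxE addrAC subrr add0r.
  exact: le_trans (coord_le_n1 v i) vdl.
rewrite -rsum_ge0E; last by move=> x; rewrite mulr_ge0 ?kernel_ge0 ?expR_ge0.
rewrite mul1r mulrC -rsumZ; last exact: F_summable.
apply: eq_rsum => x; rewrite /doob_kernel dotpDl expRD; ring.
Qed.

Lemma doob_moment1 : doob_moment (fun=> 1) = Fh.
Proof.
have := @doob_moment_exp 0; rewrite n1_0 addr0 => <-; last exact: ltW.
by congr doob_moment; apply/funext => x; rewrite dotp0l expR0.
Qed.

Lemma doob_doeblin (k0 : 'I_N) : doeblin m doeblin_const Fh nuh.
Proof.
have r1 := ratio_ub_ge1 p_inv dl0 a0 u_bounds k0.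
have rr0 : 0 < rho by apply: lt_le_trans r1.
have N0 : 0 < N%:R :> R by rewrite ltr0n; case: N k0 => // -[].
have N1 : 1 <= N%:R :> R by rewrite ler1n; case: N k0 => // -[].
have F0 k j := F_mx_ge0 p_inv u k j.
have nus : \sum_j nu 0 j * C j 0 = 1 by rewrite -nuC mxE.
have CN k : C k 0 != 0 by rewrite gt_eqF.
split.
- have Nr0 : 0 < N%:R * rho ^+ 2 := mulr_gt0 N0 (exprn_gt0 2 rr0).
  split; first by rewrite invr_gt0.
    rewrite invf_le1//.
    by apply: mulr_ege1 => //; apply: exprn_ege1.
  by move=> k j; rewrite mxE mul1r mulr_ge0 ?divr_ge0 ?(ltW (C0 _)).
- apply/matrixP => k j; rewrite !ord1 !mxE.
  have := FC => /matrixP/(_ k 0); rewrite !mxE mul1r => e.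
  rewrite -[RHS](mulfV (CN k)) -{1}e mulr_suml; apply: eq_bigr => i _.
  by rewrite !mxE mul1r mulr1 mulrA.
- split; first by move=> j; rewrite mxE mulr_ge0 ?ltW.
  apply/matrixP => i j; rewrite !ord1 !mxE eqxx -[RHS]nus; apply: eq_bigr => k _.
  by rewrite !mxE mulr1.
- apply/matrixP => i j; rewrite !ord1 !mxE.
  have := nuF => /matrixP/(_ 0 j); rewrite !mxE mul1r => <-.
  rewrite mulr_suml; apply: eq_bigr => k _; rewrite !mxE mul1r.
  by field.
- move=> k j; rewrite doob_pow ?oner_neq0// expr1n mul1r.
  have lb := F_pow_lb p_inv dl0 u_bounds k j.
  (* [C] is fixed by the [m]-th power, whose entries are at most [mass_ub], and its coordinates are
     comparable. Hence [a * (C j / C k)] is at least [1 / (N rho^2)]. *)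
  have CE : C k 0 <= N%:R * (mass_ub N A m * (rho * C j 0)).
    have := F_powC FC m => /matrixP/(_ k 0); rewrite expr1n !mxE mul1r => <-.
    apply: le_trans (_ : \sum_(i < N) mass_ub N A m * (rho * C j 0) <= _).
      apply: ler_sum => i _; apply: ler_pM => //; rewrite ?(ltW (C0 _))//.
        exact: le_trans (ltW a0) (F_pow_lb p_inv dl0 u_bounds k i).
      have h := F_pow_ub p_inv dl0 u_bounds k i. exact: h.
    by rewrite sumr_const card_ord -[leLHS]mulr_natl.
  apply: le_trans (_ : a * (C j 0 / C k 0) <= _); last first.
    by rewrite ler_wpM2r// divr_ge0 ?(ltW (C0 _)).
  rewrite mulrA ler_pdivlMr// /doeblin_const ler_pdivrMl; last exact: mulr_gt0 N0 (exprn_gt0 2 rr0).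
  apply: le_trans CE _; rewrite le_eqVlt; apply/orP; left; apply/eqP.
  by rewrite /ratio_ub; field; rewrite gt_eqF.
Qed.

Local Notation c3 := ((1 + 4 / dl) ^+ 3).

Let c3_ge0 : 0 <= c3.
Proof. by rewrite exprn_ge0// addr_ge0// divr_ge0// ltW. Qed.

Let A0 (k : 'I_N) : 0 <= A.
Proof. exact: le_trans (F_mx_ge0 p_inv u k k) (F_mx_le p_inv dl0 u_bounds k k). Qed.

Lemma growth1_ge0 (k : 'I_N) : 0 <= growth1.
Proof. exact: mulr_ge0 (ler0n _ _) (mulr_ge0 (mulr_ge0 (rho0 k) (A0 k)) c3_ge0). Qed.

Let coord_int (x : 'rV[int]_d) i : (x 0 i)%:~R = rvec R x 0 i.
Proof. by rewrite mxE. Qed.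

Lemma opn_coord_moment i : opn (cmx (doob_moment (fun x => (x 0 i)%:~R))) <= growth1.
Proof.
have -> : growth1 = N%:R * (c3 * (rho * A)) by rewrite /growth1; ring.
apply: opn_real_moment => // x; rewrite coord_int.
apply: le_trans (coord_le_n1 _ i) _; rewrite -[leLHS]expr1.
exact: pow_le_exp_full (n1_ge0 _) _.
Qed.

Lemma drift_bound (k0 : 'I_N) i : `|doob_drift 0 i| <= growth1.
Proof.
rewrite mxE; apply: le_trans (opn_cmx_col _ _) _; rewrite cmxM.
apply: le_trans (opn_nu_mul (doob_doeblin k0) _) _; rewrite cmxM.
apply: le_trans (opnM _ _) _; rewrite -[leRHS]mulr1.
by apply: ler_pM; rewrite ?opn_ge0 ?opn_ones ?opn_coord_moment.
Qed.

Local Notation L x := (n1 (rvec R x) + growth1).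
Local Notation y x := (rvec R x - doob_drift).

Let growthE : growth = N%:R * (c3 * expR (dl * growth1) * (rho * A)).
Proof. by rewrite /growth /growth1; ring. Qed.

Let yL (k0 : 'I_N) x i : `|y x 0 i| <= L x.
Proof.
have -> : y x 0 i = rvec R x 0 i - doob_drift 0 i by rewrite [LHS]mxE [X in _ + X]mxE.
apply: le_trans (ler_normB _ _) _.
by apply: lerD; [exact: coord_le_n1|exact: drift_bound].
Qed.

Let L_exp (k0 : 'I_N) (x : 'rV[int]_d) r : (r <= 3)%N ->
  L x ^+ r <= c3 * expR (dl * growth1) * expR (dl * n1 (rvec R x)).
Proof.
move=> r3; rewrite -mulrA -expRD -mulrDr (addrC growth1).
by apply: pow_le_exp_full => //; apply: addr_ge0 (n1_ge0 _) (growth1_ge0 k0).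
Qed.

Let c'0 : 0 <= c3 * expR (dl * growth1). Proof. by rewrite mulr_ge0 ?expR_ge0. Qed.

Let sL (k0 : 'I_N) x (xi : 'rV[R]_d) : `|dotp (y x) xi| <= n1 xi * L x.
Proof. by rewrite mulrC; apply: dotp_le_n1 => i; exact: yL. Qed.

Let s_exp (k0 : 'I_N) x (xi : 'rV[R]_d) r : (r <= 3)%N ->
  `|dotp (y x) xi ^+ r| <= n1 xi ^+ r * (c3 * expR (dl * growth1)) * expR (dl * n1 (rvec R x)).
Proof.
move=> r3; rewrite normrX -mulrA; apply: le_trans (_ : n1 xi ^+ r * L x ^+ r <= _); last first.
  by apply: ler_wpM2l; [exact: exprn_ge0 (n1_ge0 _)|exact: L_exp].
rewrite -exprMn; apply: lerXn2r; rewrite ?nnegrE ?normr_ge0//; last exact: sL.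
by apply: mulr_ge0 (n1_ge0 _) (addr_ge0 (n1_ge0 _) (growth1_ge0 k0)).
Qed.

Lemma doob_moment_sum (T : finType) (c : T -> R) (g : T -> 'rV[int]_d -> R) (e : T -> R) :
  (forall i x, `|g i x| <= e i * expR (dl * n1 (rvec R x))) ->
  \sum_i c i *: doob_moment (g i) = doob_moment (fun x => \sum_i c i * g i x).
Proof.
move=> hg; apply/matrixP => k j; rewrite summxE mxE.
have s i : rsummable (fun x => q k j x * g i x) by case: (moment_summable k j (hg i)).
rewrite (@eq_rsum _ _ _ (fun x => \sum_i c i * (q k j x * g i x))); last first.
  by move=> x; rewrite mulr_sumr; apply: eq_bigr => i _; rewrite mulrCA.
rewrite rsum_sum; last by move=> i _; exact: rsummableZ.
by apply: eq_bigr => i _; rewrite !mxE rsumZ.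
Qed.

Let D1E (k0 : 'I_N) (xi : 'rV[R]_d) : \sum_i xi 0 i *: centered_moment1 i = doob_moment (fun x => dotp (y x) xi).
Proof.
rewrite (@doob_moment_sum _ _ _ (fun=> c3 * expR (dl * growth1))); last first.
  move=> i x; apply: le_trans (yL k0 x i) _; rewrite -[leLHS]expr1; exact: L_exp.
by congr doob_moment; apply/funext => x; apply: eq_bigr => i _; rewrite mulrC.
Qed.

Let yy_exp (k0 : 'I_N) x i j : `|y x 0 i * y x 0 j| <= c3 * expR (dl * growth1) * expR (dl * n1 (rvec R x)).
Proof.
rewrite normrM; apply: le_trans (_ : L x ^+ 2 <= _); last exact: L_exp.
by rewrite expr2; apply: ler_pM; rewrite ?normr_ge0//; exact: yL.
Qed.

Let D2E (k0 : 'I_N) (xi : 'rV[R]_d) : \sum_i \sum_j (xi 0 i * xi 0 j) *: centered_moment2 i j =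
  doob_moment (fun x => dotp (y x) xi ^+ 2).
Proof.
rewrite pair_bigA /= (@doob_moment_sum _ (fun z : 'I_d * 'I_d => xi 0 z.1 * xi 0 z.2) _ (fun=> c3 * expR (dl * growth1))); last first.
  by move=> i x; exact: yy_exp.
congr doob_moment; apply/funext => x.
rewrite -(pair_bigA _ (fun i j => xi 0 i * xi 0 j * (y x 0 i * y x 0 j))) /=.
rewrite expr2 [X in _ = X * _]/dotp mulr_suml; apply: eq_bigr => i _.
by rewrite mulr_sumr; apply: eq_bigr => j _; ring.
Qed.

Lemma doob_charE xi k j : doob_char xi k j = csum (fun x => (q k j x)%:C * cexpi (dotp (y x) xi)).
Proof.
rewrite !mxE mul1r.
have s := F_summable p_inv u_fin k j.
have cs : csummable (fun x => (p (0, k) (x, j) * expR (dotp u (rvec R x)))%:C * cexpi (dotp (rvec R x) xi)).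
  apply: csummable_le (s) => x; rewrite ncM nc_cexpi mulr1 nc_real ger0_norm//.
  by rewrite mulr_ge0 ?kernel_ge0 ?expR_ge0.
rewrite [X in _ * X]mulrC -csumZ// -csumZ; last exact: csummableZ.
apply: eq_csum => x; rewrite dotpBl cexpiD /doob_kernel !rmorphM fmorphV; ring.
Qed.

Lemma doob_char_expansion (k0 : 'I_N) : char_expansion m doeblin_const growth Fh nuh
  centered_moment1 centered_moment2 doob_char.
Proof.
have dob := doob_doeblin k0.
split=> //.
- by rewrite growthE; apply: mulr_ge0 (ler0n _ _) (mulr_ge0 c'0 (mulr_ge0 (rho0 k0) (A0 k0))).
- move=> i; rewrite growthE; apply: opn_real_moment => // x.
  by apply: le_trans (yL k0 x i) _; rewrite -[leLHS]expr1; exact: L_exp.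
- by move=> i j; rewrite growthE; apply: opn_real_moment => // x; exact: yy_exp.
- by move=> i j; congr doob_moment; apply/funext => x; rewrite mulrC.
- move=> i.
  have e : centered_moment1 i = doob_moment (fun x => (x 0 i)%:~R) - doob_drift 0 i *: Fh.
    rewrite -doob_moment1; apply/matrixP => k j; rewrite !mxE.
    have [|s1 _] := @moment_summable k j (fun x => (x 0 i)%:~R) c3.
      move=> x; rewrite coord_int; apply: le_trans (coord_le_n1 _ i) _; rewrite -[leLHS]expr1.
      exact: pow_le_exp_full (n1_ge0 _) _.
    have [|s2 _] := @moment_summable k j (fun=> 1) 1.
      by move=> x; rewrite normr1 mul1r -expR0 ler_expR mulr_ge0 ?n1_ge0// ltW.
    rewrite -rsumZ// -rsumB//; last exact: rsummableZ.
    by apply: eq_rsum => x; rewrite !mxE; ring.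
  have [_ F1 [_ nu1] _ _] := dob.
  rewrite e mulmxBl mulmxBr -scalemxAl F1 -scalemxAr nu1.
  rewrite [nuh *m _]mx11_scalar; apply/matrixP => i' j'.
  by rewrite !ord1 !mxE eqxx !mulr1n mulr1 subrr.
- move=> xi; apply: le_trans (opnZ _ _) _; rewrite nc_cexpi mul1r.
  by have := doob_transform_le1 p_inv dl0 u_bounds ltr01 C0 FC xi 1; rewrite expr1 rmorph1.
- move=> xi; rewrite (D1E k0) (D2E k0).
  have -> : growth * n1 xi ^+ 3 = N%:R * (n1 xi ^+ 3 * (c3 * expR (dl * growth1)) * (rho * A)).
    by rewrite growthE; ring.
  (* All moments are merged into one sum whose summand is the third order Taylor remainder of the
     exponential. *)
  apply: (@opn_moment (fun x => cexpi (dotp (y x) xi) - (1 + I * (dotp (y x) xi)%:C - (2^-1)%:C * (dotp (y x) xi ^+ 2)%:C))).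
  + by rewrite mulr_ge0 ?exprn_ge0 ?n1_ge0.
  + by move=> x; apply: le_trans (cexpi_taylor _) _; rewrite -normrX s_exp.
  move=> k j; rewrite -doob_moment1.
  have sq (g : 'rV[int]_d -> R[i]) c : (forall x, nc (g x) <= c * expR (dl * n1 (rvec R x))) ->
      csummable (fun x => (q k j x)%:C * g x).
    move=> hg; have [|s _] := @moment_summable k j (fun x => nc (g x)) c.
      by move=> x; rewrite ger0_norm ?nc_ge0.
    apply: csummable_le s => x; rewrite ncM nc_real ger0_norm ?doob_kernel_ge0//.
  have e1 x : 1 <= 1 * expR (dl * n1 (rvec R x)).
    by rewrite mul1r -expR0 ler_expR mulr_ge0 ?n1_ge0// ltW.
  have s0 : csummable (fun x => (q k j x)%:C * cexpi (dotp (y x) xi)).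
    by apply: (sq _ 1) => x; rewrite nc_cexpi.
  have s1 : csummable (fun x => (q k j x)%:C * 1%:C).
    by apply: (sq _ 1) => x; rewrite nc_real normr1.
  have s2 : csummable (fun x => (q k j x)%:C * (dotp (y x) xi)%:C).
    by apply: (sq (fun x => (dotp (y x) xi)%:C)) => x; rewrite nc_real -[dotp _ _]expr1; exact: s_exp.
  have s3 : csummable (fun x => (q k j x)%:C * (dotp (y x) xi ^+ 2)%:C).
    by apply: (sq (fun x => (dotp (y x) xi ^+ 2)%:C)) => x; rewrite nc_real; exact: s_exp.
  have entry (X M0 M1 M2 : 'M[R[i]]_N) (s t : R[i]) :
      (X - (M0 + s *: M1 - t *: M2)) k j = X k j - (M0 k j + s * M1 k j - t * M2 k j).
    by rewrite !mxE.
  rewrite entry doob_charE !cmx_moment.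
  rewrite -csumZ// -csumZ// -csumD//; last exact: csummableZ.
  rewrite -csumB; [|exact: csummableD s1 (csummableZ _ s2)|exact: csummableZ].
  rewrite -csumB//; last exact: csummableB (csummableD s1 (csummableZ _ s2)) (csummableZ _ s3).
  by apply: eq_csum => x; rewrite rmorph1; ring.
Qed.

(** Comparability constant for quotients of two eigenvectors: one factor [rho] for [u], and
    [rho * expR (dl / 2)] for the shifted tilt with its weaker lower bound. *)
Definition ratio_near : R := rho * expR (dl / 2) * rho.

Definition eigenvalue_const : R :=
  growth1 * ratio_near + growth1 * (m%:R / doeblin_const) *
    (2 * growth1 * ratio_near + 2 * growth1 * ratio_near ^+ 2).

Let dot_exp (v : 'rV[R]_d) x : `|dotp v (rvec R x)| <= n1 v * c3 * expR (dl * n1 (rvec R x)).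
Proof.
apply: le_trans (dotp_n1 _ _) _; rewrite -mulrA ler_wpM2l ?n1_ge0// -[leLHS]expr1.
exact: pow_le_exp_full (n1_ge0 _) _.
Qed.

Lemma eigenvalue_expansion (k0 : 'I_N) (v : 'rV[R]_d) (l : R) (C' : 'cV[R]_N) :
  n1 v <= 1 -> n1 v <= dl / 2 -> 0 < l -> (forall k, 0 < C' k 0) ->
  F_mx p (u + v) *m C' = l *: C' ->
  `|l - 1 - dotp doob_drift v| <= eigenvalue_const * n1 v ^+ 2.
Proof.
move=> v1 v2 l0 C'0 FC'.
have r1 := ratio_ub_ge1 p_inv dl0 a0 u_bounds k0.
have dlp := dl0; have dlv : n1 v <= dl by lra.
have vi i : `|(u + v) 0 i - u 0 i| <= dl / 2.
  by rewrite mxE addrAC subrr add0r (le_trans (coord_le_n1 v i)).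
have wb := tilt_shift p_inv dl0 a0 u_bounds vi.
have dl2 : 0 < dl / 2 by rewrite divr_gt0.
have a' : 0 < a * expR (- (dl / 2)) by rewrite mulr_gt0 ?expR_gt0.
have wratio := eigenvector_ratio p_inv dl2 a' wb l0 C'0 FC'.
have rE : ratio_ub N A m (a * expR (- (dl / 2))) = rho * expR (dl / 2).
  by rewrite /ratio_ub expRN invfM invrK mulrA.
rewrite rE in wratio.
pose E := doob_moment (fun x => dotp v (rvec R x)).
(* The eigenvector at the tilt [u + v], in the coordinates of the Doob transform at [u]. *)
pose c : 'cV[R]_N := \col_j (C' j 0 / C j 0).
have CN k : C k 0 != 0 by rewrite gt_eqF.
have K0 := growth1_ge0 k0.
have gE : growth1 = N%:R * (c3 * (rho * A)) by rewrite /growth1; ring.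
have EE : E = \sum_i v 0 i *: doob_moment (fun x => (x 0 i)%:~R).
  rewrite (@doob_moment_sum _ _ _ (fun=> c3)).
    by congr doob_moment; apply/funext => x; apply: eq_bigr => i _; rewrite mxE.
  move=> i x; rewrite coord_int; apply: le_trans (coord_le_n1 _ i) _; rewrite -[leLHS]expr1.
  exact: pow_le_exp_full (n1_ge0 _) _.
have -> : dotp doob_drift v = (nuh *m (E *m one)) 0 0.
  rewrite EE mulmx_suml mulmx_sumr summxE; apply: eq_bigr => i _.
  by rewrite -scalemxAl -scalemxAr [RHS]mxE mulrC [doob_drift 0 i]mxE.
apply: (@perron_perturbation _ _ _ _ _ _ (doob_doeblin k0) (doob 1 C (F_mx p (u + v))) _ c) => //.
- exact: n1_ge0.
- rewrite /ratio_near; apply: mulr_ege1 => //; apply: mulr_ege1 => //.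
  by rewrite -[leLHS]expR0 ler_expR ltW.
- rewrite -doob_moment_exp// -doob_moment1.
  have -> : doob_moment (fun x => expR (dotp v (rvec R x))) - doob_moment (fun=> 1) - E =
     doob_moment (fun x => expR (dotp v (rvec R x)) - 1 - dotp v (rvec R x)).
    apply/matrixP => k j; rewrite !mxE.
    have [|s1 _] := @moment_summable k j (fun=> 1) 1.
      by move=> x; rewrite normr1 mul1r -expR0 ler_expR mulr_ge0 ?n1_ge0// ltW.
    have [s2 _] := moment_summable k j (dot_exp v).
    have [|s3 _] := @moment_summable k j (fun x => expR (dotp v (rvec R x))) 1.
      move=> x; rewrite mul1r ger0_norm ?expR_ge0// ler_expR.
      apply: le_trans (ler_norm _) _; apply: le_trans (dotp_n1 _ _) _.
      by rewrite ler_wpM2r ?n1_ge0.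
    by rewrite -!rsumB//; [apply: eq_rsum => x; ring|exact: rsummableB].
  have -> : growth1 * n1 v ^+ 2 = N%:R * (n1 v ^+ 2 * c3 * (rho * A)) by rewrite gE; ring.
  apply: opn_real_moment; first by rewrite mulr_ge0 ?sqr_ge0.
  move=> x; apply: le_trans (exp_taylor1 _) _.
  set y := n1 (rvec R x); have y0 : 0 <= y := n1_ge0 _.
  have b1 : `|dotp v (rvec R x)| <= n1 v * y := dotp_n1 _ _.
  have b2 : expR `|dotp v (rvec R x)| <= expR (dl / 2 * y).
    by rewrite ler_expR; apply: le_trans b1 _; rewrite ler_wpM2r.
  have b3 : dotp v (rvec R x) ^+ 2 <= n1 v ^+ 2 * y ^+ 2.
    rewrite -exprMn -(real_normK (num_real (dotp _ _))).
    by apply: lerXn2r; rewrite ?nnegrE ?normr_ge0 ?mulr_ge0 ?n1_ge0.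
  apply: le_trans (ler_pM (sqr_ge0 _) (expR_ge0 _) b3 b2) _.
  have b4 := @pow_le_exp _ dl y 2 dl0 y0 isT.
  apply: le_trans (_ : n1 v ^+ 2 * (c3 * expR (dl / 4 * 2%:R * y)) * expR (dl / 2 * y) <= _).
    by rewrite ler_wpM2r ?expR_ge0// ler_wpM2l ?sqr_ge0.
  have -> : n1 v ^+ 2 * (c3 * expR (dl / 4 * 2%:R * y)) * expR (dl / 2 * y) =
    n1 v ^+ 2 * c3 * (expR (dl / 4 * 2%:R * y) * expR (dl / 2 * y)) by ring.
  by rewrite -expRD (_ : dl / 4 * 2%:R * y + dl / 2 * y = dl * y)//; field.
- have -> : growth1 * n1 v = N%:R * (n1 v * c3 * (rho * A)) by rewrite gE; ring.
  by apply: opn_real_moment; [rewrite mulr_ge0 ?n1_ge0|exact: dot_exp].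
- by move=> k; rewrite mxE divr_gt0.
- move=> k j; rewrite !mxE /ratio_near.
  have h1 := wratio k j; have h2 := ratio j k.
  rewrite ler_pdivrMr//; apply: le_trans h1 _.
  have e0 : 0 <= rho * expR (dl / 2) by apply: mulr_ge0 (rho0 k) (expR_ge0 _).
  have -> : rho * expR (dl / 2) * rho * (C' k 0 / C k 0) * C j 0 =
    rho * expR (dl / 2) * (C' k 0 / C k 0) * (rho * C j 0) by ring.
  apply: le_trans (_ : rho * expR (dl / 2) * (C' k 0 / C k 0) * C k 0 <= _).
    by rewrite -[leRHS]mulrA divfK.
  by rewrite ler_wpM2l// mulr_ge0// divr_ge0 ?ltW.
apply/matrixP => k j; rewrite !ord1 !mxE.
have := FC' => /matrixP/(_ k 0); rewrite !mxE => e.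
rewrite mulrA -e mulr_suml; apply: eq_bigr => i _; rewrite !mxE mul1r.
by field; rewrite !CN.
Qed.

End moments.

(** * Dominant eigenvalues *)

Section perron_frobenius.
Variables (R : realType) (d N : nat) (p : lattice_kernel R d N).
Hypothesis p_inv : invariant_kernel p.
Local Notation nc := (@ComplexField.Normc.normc R).
Local Notation "x %:C" := (real_complex R x) (at level 1, format "x %:C").
Local Notation one := (ones R N).
Variables (C : 'rV[R]_d -> 'cV[R]_N) (nu : 'rV[R]_d -> 'rV[R]_N).
Hypothesis C_nu : PF_eigenvectors p C nu.
Variables (dl A : R) (m : nat) (a : R).
Hypotheses (dl0 : 0 < dl) (a0 : 0 < a) (m0 : (0 < m)%N).
Variable k0 : 'I_N.

(** The only alternative is the default value 0, and then a positive vector would be annihilated by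
    a matrix power with positive entries. *)
Lemma lam_gt0 (D B c : R) w : 0 < D -> 0 < c -> tilt_bounds p D B m c w -> 0 < lam p w.
Proof.
move=> D0 c0 wb; have fin := tilt_F_finite p_inv D0 wb.
rewrite /lam; case: xgetP => [l _ [l0 _]//|h].
have [/(_ w fin) [e _ C0 _ _] _] := C_nu.
have l0 : lam p w = 0 by rewrite /lam; case: xgetP => // l _ hl; case: (h l hl).
rewrite l0 in e.
have := F_powC e m; rewrite expr0n eqn0Ngt m0 scale0r => /matrixP/(_ k0 0); rewrite !mxE => s0.
suff : 0 < \sum_j (F_mx p w ^+ m) k0 j * C w j 0 by rewrite s0 ltxx.
have pos j : 0 < (F_mx p w ^+ m) k0 j by apply: lt_le_trans c0 (F_pow_lb p_inv D0 wb k0 j).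
by rewrite (bigD1 k0)//= ltr_pwDl ?mulr_gt0// sumr_ge0// => j _; rewrite mulr_ge0 ?ltW.
Qed.

Section fixed_point.
Variable u : 'rV[R]_d.
Hypotheses (u_bounds : tilt_bounds p dl A m a u) (lam1 : lam p u = 1).

Lemma PF_facts : [/\ forall k, 0 < C u k 0, F_mx p u *m C u = 1 *: C u, forall k, 0 < nu u 0 k,
  nu u *m F_mx p u = 1 *: nu u & (nu u *m C u) 0 0 = 1].
Proof.
have [/(_ u (tilt_F_finite p_inv dl0 u_bounds)) [e1 e2 C0 nu0 [_ e3]] _] := C_nu.
by rewrite lam1 in e1 e2.
Qed.

Local Notation drift := (doob_drift p u (C u) (nu u)).
Local Notation Kl := (eigenvalue_const N dl A m a).

Lemma lam_expansion (v : 'rV[R]_d) : n1 v <= 1 -> n1 v <= dl / 2 ->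
  `|lam p (u + v) - 1 - dotp drift v| <= Kl * n1 v ^+ 2.
Proof.
move=> v1 v2; have [C0 FC nu0 nuF nuC] := PF_facts.
have vi i : `|(u + v) 0 i - u 0 i| <= dl / 2.
  by rewrite mxE addrAC subrr add0r (le_trans (coord_le_n1 v i)).
have wb := tilt_shift p_inv dl0 a0 u_bounds vi.
have dl2 : 0 < dl / 2 by rewrite divr_gt0.
have a' : 0 < a * expR (- (dl / 2)) by rewrite mulr_gt0 ?expR_gt0.
have [/(_ _ (tilt_F_finite p_inv dl2 wb)) [e1 _ C'0 _ _] _] := C_nu.
have l0 := lam_gt0 dl2 a' wb.
exact: (eigenvalue_expansion p_inv dl0 a0 u_bounds C0 FC nu0 nuF nuC k0 v1 v2 l0 C'0 e1).
Qed.

Lemma gradient_lam : gradient (lam p) u = drift.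
Proof.
apply/rowP => i; rewrite mxE; apply: cvg_lim => //.
apply/cvgrPdist_le => e e0 /=.
(* The sign of the constant is read off from the expansion at one admissible increment. *)
have K0 : 0 <= Kl.
  have n0 : 0 <= n1 (dl / 2 *: delta_mx 0 i : 'rV[R]_d) by exact: n1_ge0.
  have := lam_expansion (v := Num.min 1 (dl / 2) *: delta_mx 0 i).
  have m0' : 0 < Num.min 1 (dl / 2) by rewrite lt_min ltr01 divr_gt0.
  have nd : n1 (Num.min 1 (dl / 2) *: delta_mx 0 i : 'rV[R]_d) = Num.min 1 (dl / 2).
    rewrite n1Z gtr0_norm// /n1 (bigD1 i)//= mxE !eqxx normr1 big1 ?addr0 ?mulr1//.
    by move=> j /negPf ji; rewrite mxE ji andbF normr0.
  rewrite nd ge_min lexx ge_min lexx orbT => /(_ isT isT) /(le_trans (normr_ge0 _)).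
  by rewrite pmulr_lge0// exprn_gt0.
have nd (h : R) : n1 (h *: delta_mx 0 i : 'rV[R]_d) = `|h|.
  rewrite n1Z /n1 (bigD1 i)//= mxE !eqxx normr1 big1 ?addr0 ?mulr1//.
  by move=> j /negPf ji; rewrite mxE ji andbF normr0.
near=> h.
have h0 : h != 0 by near: h; exact: nbhs_dnbhs_neq.
have hs : `|h| <= Num.min (Num.min 1 (dl / 2)) (e / (Kl + 1)).
  near: h; apply: dnbhs0_le; rewrite !lt_min ltr01 !divr_gt0//; lra.
have [h1 h2 h3] : [/\ `|h| <= 1, `|h| <= dl / 2 & `|h| <= e / (Kl + 1)].
  by move: hs; rewrite !le_min => /andP[/andP[]].
have := lam_expansion (v := h *: delta_mx 0 i); rewrite nd => /(_ h1 h2).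
rewrite dotpZr dotp_delta => le.
rewrite /= [h *: _ + u]addrC lam1.
have hn0 : 0 < `|h| by rewrite normr_gt0.
have -> : drift 0 i - h^-1 *: (lam p (u + h *: delta_mx 0 i) - 1) =
   - (h^-1 * (lam p (u + h *: delta_mx 0 i) - 1 - h * drift 0 i)).
  move: (drift 0 i) (lam p _ - 1) => x y; have -> : h^-1 *: y = h^-1 * y by [].
  by field.
rewrite normrN normrM normfV ler_pdivrMl//; apply: le_trans le _.
rewrite expr2 mulrCA ler_wpM2l//; move: h3; rewrite ler_pdivlMr; last by lra.
by move=> h3; apply: le_trans h3; rewrite mulrDr mulr1 mulrC lerDl.
Unshelve. all: by end_near.
Qed.

End fixed_point.
End perron_frobenius.

(** * Eigenvalues of matrices with a power close to a rank one projection *)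

Section spectrum.
Variables (R : realType).
Local Notation nc := (@ComplexField.Normc.normc R).
Local Notation "x %:C" := (real_complex R x) (at level 1, format "x %:C").

Lemma char_poly_conj (T : fieldType) n (P M : 'M[T]_n) : P \in unitmx ->
  char_poly (P *m M *m invmx P) = char_poly M.
Proof.
move=> Pu; rewrite /char_poly.
have -> : char_poly_mx (P *m M *m invmx P) =
  map_mx polyC P *m char_poly_mx M *m map_mx polyC (invmx P).
  rewrite /char_poly_mx mulmxBr mulmxBl -!map_mxM; congr (_ - _).
  by rewrite mul_mx_scalar -scalemxAl -map_mxM mulmxV// map_mx1 scalemx1.
by rewrite !det_mulmx mulrAC -det_mulmx -map_mxM mulmxV// map_mx1 det1 mul1r.
Qed.

Lemma trig_mul (T : comNzRingType) n (A B : 'M[T]_n) : is_trig_mx A -> is_trig_mx B ->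
  is_trig_mx (A *m B) /\ forall i, (A *m B) i i = A i i * B i i.
Proof.
move=> /is_trig_mxP tA /is_trig_mxP tB; split.
  apply/is_trig_mxP => i j ij; rewrite mxE big1// => k _.
  case: (ltnP i k) => ik; first by rewrite tA// mul0r.
  by rewrite tB ?mulr0// (leq_ltn_trans ik).
move=> i; rewrite mxE (bigD1 i)//= big1 ?addr0// => k ki.
case: (ltngtP i k) => ik; first by rewrite tA// mul0r.
  by rewrite tB// mulr0.
by rewrite (val_inj ik) eqxx in ki.
Qed.

Lemma trig_pow (T : comNzRingType) n (A : 'M[T]_n) s : is_trig_mx A ->
  is_trig_mx (A ^+ s) /\ forall i, (A ^+ s) i i = A i i ^+ s.
Proof.
move=> tA; elim: s => [|s [IH1 IH2]].
  split=> [|i]; rewrite ?expr0; last by rewrite mxE eqxx.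
  by apply/is_trig_mxP => i j ij; rewrite mxE -val_eqE ltn_eqF.
have [h1 h2] := trig_mul tA IH1; rewrite exprS; split=> // i.
by rewrite exprS -IH2 -h2.
Qed.

(** Triangularization gives the eigenvalues with algebraic multiplicity together with the traces of
    powers; the traces will count the large eigenvalues. *)
Lemma schur_spectrum n (M : 'M[R[i]]_n) : (0 < n)%N -> exists t : 'I_n -> R[i],
  char_poly M = \prod_i ('X - (t i)%:P) /\ forall s, \tr (M ^+ s) = \sum_i t i ^+ s.
Proof.
move=> n0; have [P Pu] := Schur M n0.
have Pu' := unitarymx_unit Pu.
rewrite /similar_to conjumx// => tr.
set T := P *m M *m invmx P in tr.
exists (fun i => T i i); split; first by rewrite -(char_poly_conj M Pu') char_poly_trig.
move=> s; have [_ h] := trig_pow s tr.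
have -> : \tr (M ^+ s) = \tr (T ^+ s).
  have -> : T ^+ s = P *m M ^+ s *m invmx P.
    elim: s {h} => [|s IH]; first by rewrite !expr0 mulmx1 mulmxV.
    have -> : T ^+ s.+1 = T *m T ^+ s by rewrite exprS.
    have -> : M ^+ s.+1 = M *m M ^+ s by rewrite exprS.
    by rewrite IH /T !mulmxA mulmxKV.
  by rewrite mxtrace_mulC mulmxA mulVmx// mul1mx.
by apply: eq_bigr => i _; rewrite h.
Qed.

End spectrum.

Section dominant_eigenvalue.
Variables (R : realType) (N : nat).
Local Notation nc := (@ComplexField.Normc.normc R).
Local Notation "x %:C" := (real_complex R x) (at level 1, format "x %:C").
Local Notation one := (ones R N).
Variables (nu : 'rV[R]_N) (M : 'M[R[i]]_N) (s : nat) (e : R).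
Hypotheses (N0 : (0 < N)%N) (s0 : (0 < s)%N).
Hypotheses (nu0 : forall j, 0 <= nu 0 j) (nu1 : nu *m one = 1%:M).
Hypotheses (e0 : 0 <= e) (e1 : e * (16 * N%:R ^+ 2) <= 1).
Hypothesis M_near : opn (M ^+ s - cmx (one *m nu)) <= e.

Let n : R := N%:R.
Let N1 : 1 <= n. Proof. by rewrite ler1n. Qed.

Let onu : opn (cmx nu) <= 1.
Proof.
apply: opn_le => // k; rewrite ord1.
have /matrixP/(_ 0 0) := nu1; rewrite mxE [RHS]mxE eqxx mulr1n => <-.
by apply: ler_sum => j _; rewrite !mxE nc_real mulr1 ger0_norm.
Qed.

Let eigen_pow (v : 'rV[R[i]]_N) r q : v *m M = r *: v -> v *m M ^+ q = r ^+ q *: v.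
Proof.
move=> h; elim: q => [|q IH]; first by rewrite !expr0 mulmx1 scale1r.
by rewrite exprSr -[_ * _]/(_ *m _) mulmxA IH -scalemxAl h scalerA exprSr.
Qed.

(** [M ^+ s] is the projection plus a small matrix: the eigenvector equation applied to the constant
    vector gives the first bound, and taking norms gives the second. *)
Lemma eigen_near (v : 'rV[R[i]]_N) r : v *m M = r *: v ->
  nc (r ^+ s - 1) * nc ((v *m cmx one) 0 0) <= e * opn v /\
  nc r ^+ s * opn v <= nc ((v *m cmx one) 0 0) + e * opn v.
Proof.
move=> vM; have nE := M_near; set E := M ^+ s - cmx (one *m nu) in nE.
have hp : r ^+ s *: v = (v *m cmx one) 0 0 *: cmx nu + v *m E.
  rewrite -(eigen_pow s vM) /E mulmxBr cmxM mulmxA.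
  rewrite -mul_scalar_mx -mx11_scalar.
  by rewrite addrC subrK.
have vE : opn (v *m E) <= e * opn v.
  by apply: le_trans (opnM _ _) _; rewrite mulrC ler_wpM2r ?opn_ge0.
split.
  have : (r ^+ s *: v) *m cmx one = ((v *m cmx one) 0 0 *: cmx nu + v *m E) *m cmx one by rewrite hp.
  rewrite mulmxDl -!scalemxAl -cmxM nu1 => /matrixP/(_ 0 0).
  rewrite [LHS]mxE [RHS]mxE [(_ *: cmx _) 0 0]mxE [cmx _ 0 0]mxE [1%:M 0 0]mxE eqxx rmorph1 mulr1 => h.
  rewrite -ncM mulrBl mul1r h addrAC subrr add0r.
  apply: le_trans (entry_le_opn _ _ _) _; apply: le_trans (opnM _ _) _.
  rewrite -[leRHS]mulr1; apply: ler_pM => //; rewrite ?opn_ge0//; exact: opn_ones.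
have rv : nc r ^+ s * opn v <= opn (r ^+ s *: v).
  rewrite -ncX; case: (eqVneq (r ^+ s) 0) => [->|rs0]; first by rewrite nc0 mul0r opn_ge0.
  have h := opnZ (r ^+ s)^-1 (r ^+ s *: v).
  have e' : nc (r ^+ s) * nc (r ^+ s)^-1 = 1 by rewrite -ncM mulfV// nc1.
  rewrite scalerA mulVf// scale1r in h.
  by have := ler_wpM2l (nc_ge0 (r ^+ s)) h; rewrite mulrA e' mul1r.
apply: le_trans rv _; rewrite hp; apply: le_trans (opnD _ _) _; apply: lerD => //.
apply: le_trans (opnZ _ _) _; rewrite -[leRHS]mulr1.
by apply: ler_wpM2l; rewrite ?nc_ge0.
Qed.

Let opn_gt0 (v : 'rV[R[i]]_N) : v != 0 -> 0 < opn v.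
Proof.
move=> v0; rewrite lt_neqAle opn_ge0 andbT eq_sym; apply: contra v0 => /eqP h.
apply/eqP/matrixP => i j; rewrite mxE; apply: nc_eq0; apply/eqP.
by rewrite eq_le nc_ge0 andbT -h entry_le_opn.
Qed.

Let numeric (a x y z : R) : 0 < y -> 0 <= a -> 0 <= x -> 0 <= z ->
  a * x <= e * y -> z * y <= x + e * y -> 1 < 4 * n * z -> a * (3 * n) <= 1.
Proof.
move=> y0 a0 x0 z0 h1 h2 h3; have N1' := N1; have e1' := e1; have e0' := e0; rewrite -/n in e1'.
have [n0 nn] : 0 < n /\ 0 < n ^+ 2 by split; [lra|apply: exprn_gt0; lra].
have h4 : y * (3 * n) <= x * (16 * n ^+ 2).
  have a1 : z * y * (16 * n ^+ 2) <= (x + e * y) * (16 * n ^+ 2).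
    by rewrite ler_wpM2r// mulr_ge0// ltW.
  have a2 : (4 * n * z) * (y * (4 * n)) = z * y * (16 * n ^+ 2) by ring.
  have a3 : y * (4 * n) <= (4 * n * z) * (y * (4 * n)).
    by rewrite ler_peMl ?(ltW h3)// mulr_ge0 ?mulr_ge0 ?ltW.
  have a4 : e * (16 * n ^+ 2) * y <= 1 * y by rewrite ler_wpM2r// ltW.
  have a5 : y <= y * n by rewrite ler_peMr// ltW.
  have a6 : (x + e * y) * (16 * n ^+ 2) = x * (16 * n ^+ 2) + e * (16 * n ^+ 2) * y by ring.
  lra.
have h5 : a * (y * (3 * n)) <= a * (x * (16 * n ^+ 2)) by rewrite ler_wpM2l.
have h6 : a * (x * (16 * n ^+ 2)) <= y.
  have -> : a * (x * (16 * n ^+ 2)) = a * x * (16 * n ^+ 2) by ring.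
  apply: le_trans (_ : e * y * (16 * n ^+ 2) <= _); first by rewrite ler_wpM2r// mulr_ge0// ltW.
  have -> : e * y * (16 * n ^+ 2) = e * (16 * n ^+ 2) * y by ring.
  by rewrite -[leRHS]mul1r ler_wpM2r// ltW.
have h7 : (a * (3 * n)) * y <= 1 * y.
  have -> : (a * (3 * n)) * y = a * (y * (3 * n)) by ring.
  by rewrite mul1r (le_trans h5).
by move: h7; rewrite ler_pM2r.
Qed.

(** The [s]-th power of an eigenvalue either has modulus at most [1 / (4 n)] or is within
    [1 / (3 n)] of 1; a tolerance [e] of order [1 / n^2] creates this gap. *)
Lemma eigen_dichotomy r : eigenvalue M r -> 1 < 4 * n * nc r ^+ s -> nc (r ^+ s - 1) * (3 * n) <= 1.
Proof.
move=> /eigenvalueP[v vM v0] h; have [h1 h2] := eigen_near vM.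
by apply: (numeric (opn_gt0 v0) _ _ _ h1 h2 h); rewrite ?nc_ge0 ?exprn_ge0 ?nc_ge0.
Qed.

Lemma eigen_large r : eigenvalue M r -> 1 < 4 * n * nc r ^+ s ->
  exists v : 'rV[R[i]]_N, [/\ v *m M = r *: v, v != 0 & opn v <= 2 * nc ((v *m cmx one) 0 0)].
Proof.
move=> er h; have h1 := eigen_dichotomy er h.
have /eigenvalueP[v vM v0] := er; exists v; split=> //.
have [_ h2] := eigen_near vM; have v0' := opn_gt0 v0.
have N1' := N1; have e1' := e1; have e0' := e0; rewrite -/n in e1'.
have a1 : nc (r ^+ s - 1) * 3 <= 1.
  apply: le_trans h1; rewrite -[leLHS]mulr1 -mulrA ler_wpM2l ?nc_ge0//.
  by have := N1; lra.
have a2 : 1 <= nc (r ^+ s) + nc (r ^+ s - 1).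
  have -> : 1 = nc (r ^+ s - (r ^+ s - 1)) by rewrite subKr nc1.
  exact: ncB.
rewrite ncX in a2.
have a3 : e * 16 <= 1.
  apply: le_trans e1'; rewrite ler_wpM2l// ler_peMr// exprn_ege1//.
have a4 : 2 / 3 * opn v <= nc r ^+ s * opn v by rewrite ler_wpM2r ?(ltW v0')//; lra.
have a5 : e * opn v <= 16^-1 * opn v by rewrite ler_wpM2r ?(ltW v0')//; lra.
lra.
Qed.

Let nearE (B : nat) (z : R[i]) : nc (z - 1) * 16 <= 1 -> nc (z - B%:R) * 3 <= 1 -> B = 1%N.
Proof.
move=> h1 h2; have : nc (B%:R - 1) < 1.
  have -> : (B%:R - 1 : R[i]) = (z - 1) - (z - B%:R) by ring.
  by apply: le_lt_trans (ncB _ _) _; lra.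
have -> : (B%:R - 1 : R[i]) = (B%:R - 1)%:C by rewrite rmorphB rmorph1 rmorph_nat.
rewrite nc_real => h3; case: B h3 {h2} => [|[//|B]].
  by rewrite sub0r normrN normr1 ltxx.
by rewrite -[B.+2%:R]natr1 addrK normr_nat ltrn1.
Qed.

(** The trace of [M ^+ s] is close to 1, and it is within [1/3] of the number of large eigenvalues
    counted with algebraic multiplicity. So exactly one is large, and it is simple. *)
Lemma dominant_exists : exists l, [/\ is_dominant_eigenvalue M l, eigenvalue M l & 1 < 4 * n * nc l ^+ s].
Proof.
have [t [tP tT]] := schur_spectrum M N0.
have N1' := N1; have n0 : 0 < n by lra.
have te i : eigenvalue M (t i).
  rewrite eigenvalue_root_char tP rootE horner_prod (bigD1 i)//= hornerXsubC subrr.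
  by rewrite mul0r.
pose B : {set 'I_N} := finset (fun i => 1 < 4 * n * nc (t i) ^+ s).
have near i : nc (t i ^+ s - (i \in B)%:R) * (3 * n) <= 1.
  rewrite inE; case: (boolP (1 < _)) => h; first exact: eigen_dichotomy (te i) h.
  rewrite subr0 ncX; move: h; rewrite -leNgt.
  have : 0 <= nc (t i) ^+ s by rewrite exprn_ge0 ?nc_ge0.
  move: (nc (t i) ^+ s) => z z0 h.
  have : 0 <= n * z by rewrite mulr_ge0// ltW.
  move: h; have -> : z * (3 * n) = 3 * (n * z) by ring.
  have -> : 4 * n * z = 4 * (n * z) by ring.
  by lra.
have trn : \tr (cmx (one *m nu)) = 1.
  rewrite cmxM mxtrace_mulC -cmxM nu1 /mxtrace big_ord1 !mxE eqxx; exact: rmorph1.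
have trM : nc (\tr (M ^+ s) - 1) * 16 <= 1.
  have -> : \tr (M ^+ s) - 1 = \tr (M ^+ s - cmx (one *m nu)) by rewrite raddfB /= trn.
  have : nc (\tr (M ^+ s - cmx (one *m nu))) <= n * e.
    apply: le_trans (nc_sum _ _ _) _; apply: le_trans (_ : \sum_(i < N) e <= _).
      by apply: ler_sum => i _; apply: le_trans (entry_le_opn _ _ _) M_near.
    by rewrite sumr_const card_ord -[leLHS]mulr_natl.
  have e1' := e1; have e0' := e0; rewrite -/n in e1'.
  have : e * (16 * n) <= e * (16 * n ^+ 2) by rewrite ler_wpM2l// ler_wpM2l// expr2 ler_peMl// ltW.
  have -> : e * (16 * n) = 16 * (n * e) by ring.
  by lra.
have cardB : #|B| = 1%N.
  apply: (nearE trM); rewrite tT.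
  have -> : (#|B|%:R : R[i]) = \sum_i (i \in B)%:R.
    by rewrite -sum1_card natr_sum big_mkcond /=; apply: eq_bigr => i _; case: (i \in B).
  rewrite -sumrB.
  have b : nc (\sum_i (t i ^+ s - (i \in B)%:R)) <= \sum_(i < N) (3 * n)^-1.
    apply: le_trans (nc_sum _ _ _) _; apply: ler_sum => i _.
    by rewrite -[leRHS]mul1r ler_pdivlMr ?near// mulr_gt0.
  move: b; rewrite sumr_const card_ord -[X in _ <= X]mulr_natl -/n invfM mulrCA mulfV ?gt_eqF// mulr1.
  by lra.
have /cards1P[i0 Bi0] : #|B| == 1%N by rewrite cardB.
have i0B : i0 \in B by rewrite Bi0 set11.
have other i : i != i0 -> nc (t i) < nc (t i0).
  move=> ii0; have : i \notin B by rewrite Bi0 inE.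
  move: i0B; rewrite !inE -leNgt => h1 h2.
  rewrite ltNge; apply/negP => h3.
  have : nc (t i0) ^+ s <= nc (t i) ^+ s by apply: lerXn2r; rewrite ?nnegrE ?nc_ge0.
  move=> /(ler_wpM2l (_ : 0 <= 4 * n)) => /(_ (mulr_ge0 (ler0n _ 4) (ltW n0))).
  lra.
exists (t i0); split; [|exact: te|by move: i0B; rewrite inE].
split.
  rewrite tP (bigD1 i0)//= mupMl.
    by have := mup_XsubCX 1 (t i0) (t i0); rewrite expr1 eqxx.
  rewrite rootE horner_prod prodf_seq_neq0; apply/allP => i _; apply/implyP => ii0.
  rewrite hornerXsubC subr_eq0; apply/eqP => h.
  by have := other i ii0; rewrite h ltxx.
move=> r; rewrite eigenvalue_root_char tP rootE horner_prod prodf_seq_eq0 => /hasP[i _ /= ].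
rewrite hornerXsubC subr_eq0 => /eqP ->; case: (eqVneq i i0) => [->|ii0 _]; first by rewrite eqxx.
by rewrite !normCE ltcR; exact: other.
Qed.

Lemma dominant_large l : is_dominant_eigenvalue M l -> eigenvalue M l -> 1 < 4 * n * nc l ^+ s.
Proof.
move=> [_ h] _; have [l' [_ e2 h2]] := dominant_exists.
case: (eqVneq l' l) => [<-//|ll'].
have := h _ e2 ll'; rewrite !normCE ltcR => lt.
apply: lt_le_trans h2 _; rewrite ler_wpM2l ?mulr_ge0 ?(le_trans ler01 N1)//.
by apply: lerXn2r; rewrite ?nnegrE ?nc_ge0// ltW.
Qed.

Lemma dominant_eigenvector l : is_dominant_eigenvalue M l ->
  exists v : 'rV[R[i]]_N, [/\ v *m M = l *: v, v != 0 & opn v <= 2 * nc ((v *m cmx one) 0 0)].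
Proof.
move=> dl; have el : eigenvalue M l.
  case: dl => mu _; rewrite eigenvalue_root_char; apply/negPn/negP => /mupNroot.
  by rewrite mu.
exact: eigen_large el (dominant_large dl el).
Qed.

End dominant_eigenvalue.

Section quadratic_forms.
Variable R : realType.
Local Notation nc := (@ComplexField.Normc.normc R).
Local Notation "x %:C" := (real_complex R x) (at level 1, format "x %:C").

Lemma archi_gt (x : R) : exists n : nat, x < n%:R.
Proof. by exists (Num.bound `|x|); apply: le_lt_trans (ler_norm x) (archi_boundP (normr_ge0 x)). Qed.

Lemma geometric_small (b e : R) : 0 < b -> b <= 1 -> 0 < e -> exists2 t, (0 < t)%N & (1 - b) ^+ t <= e.
Proof.
move=> b0 b1 e0; have [t ht] := archi_gt ((b * e)^-1).
have be0 : 0 < (b * e)^-1 by rewrite invr_gt0 mulr_gt0.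
have t0 : 0 < t%:R :> R by apply: lt_trans ht.
exists t; first by rewrite -(ltr0n R).
apply: le_trans (_ : expR (- b) ^+ t <= _).
  by apply: lerXn2r; rewrite ?nnegrE ?expR_ge0 ?expR_ge1Dx//; lra.
rewrite -expRM_natl mulrN expRN -[leRHS]invrK lef_pV2 ?posrE ?expR_gt0 ?invr_gt0//.
apply: le_trans (expR_ge1Dx _).
have : (b * e)^-1 * b <= t%:R * b by rewrite ler_wpM2r ?(ltW b0)// ltW.
by have -> : (b * e)^-1 * b = e^-1 by [field; rewrite !gt_eqF]; lra.
Qed.

Variable d : nat.

Lemma coord_le_euclid (v : 'rV[R]_d) i : v 0 i ^+ 2 <= dotp v v.
Proof. by rewrite /dotp (bigD1 i)//= -expr2 lerDl sumr_ge0// => j _; rewrite -expr2 sqr_ge0. Qed.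

Lemma n1_le_euclid (v : 'rV[R]_d) : n1 v <= d%:R * euclid_norm v.
Proof.
rewrite /n1; apply: le_trans (_ : \sum_(i < d) euclid_norm v <= _).
  apply: ler_sum => i _; rewrite -sqrtr_sqr; exact: ler_wsqrtr (coord_le_euclid v i).
by rewrite sumr_const card_ord -[leLHS]mulr_natl.
Qed.

Lemma n1_near0 (r : R) : 0 < r -> \forall xi \near (0 : 'rV[R]_d), n1 xi <= r.
Proof.
move=> r0; apply/nbhs_normP; exists (r / (d%:R + 1)); first by rewrite /= divr_gt0// ltr_wpDl.
move=> xi /=; rewrite sub0r normrN => h.
apply: le_trans (_ : \sum_(i < d) `|xi| <= _).
  apply: ler_sum => i _; rewrite [leRHS]mx_normrE.
  exact: (@le_bigmax _ _ _ 0 (fun z : 'I_1 * 'I_d => `|xi z.1 z.2|) (0, i)).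
rewrite sumr_const card_ord -[leLHS]mulr_natl.
apply: le_trans (_ : (d%:R + 1) * `|xi| <= _); first by rewrite ler_wpM2r// lerDl.
by rewrite mulrC -ler_pdivlMr ?ltr_wpDl// ltW.
Qed.

Lemma sym_form_eq0 (S : 'M[R]_d) : S^T = S -> (forall v, quad_form S v = 0) -> S = 0.
Proof.
move=> sS h.
have pol x y : dotp (x *m S) y = 0.
  have := h (x + y); rewrite quad_formE mulmxDl dotpDl !dotpDr -!quad_formE !h add0r addr0.
  by rewrite (dotp_mul_sym _ _ sS) dotpC => e; lra.
apply/matrixP => i j; rewrite mxE.
have := pol (delta_mx 0 i) (delta_mx 0 j); rewrite -rowE /dotp (bigD1 j)//= big1.
  by rewrite !mxE !eqxx mulr1 addr0.
by move=> k /negPf kj; rewrite [X in _ * X]mxE kj andbF mulr0.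
Qed.

(** Along a ray both forms scale like [t^2], so a difference smaller than every multiple of [t^2]
    vanishes; symmetry then determines the matrix by polarization. *)
Lemma expansion_unique (l : 'rV[R]_d -> R[i]) (Q Q' : 'M[R]_d) : Q^T = Q -> Q'^T = Q' ->
  (forall e : R, 0 < e -> \forall xi \near (0 : 'rV[R]_d),
    nc (l xi - (1 - 2^-1 * quad_form Q xi)%:C) <= e * euclid_norm xi ^+ 2) ->
  (forall e : R, 0 < e -> \forall xi \near (0 : 'rV[R]_d),
    nc (l xi - (1 - 2^-1 * quad_form Q' xi)%:C) <= e * euclid_norm xi ^+ 2) -> Q = Q'.
Proof.
move=> sQ sQ' h h'; apply/eqP; rewrite -subr_eq0; apply/eqP.
apply: sym_form_eq0 => [|v]; first by rewrite linearB /= sQ sQ'.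
have -> : quad_form (Q - Q') v = quad_form Q v - quad_form Q' v.
  by rewrite !quad_formE mulmxBr dotpBl.
apply/eqP/negPn/negP => ne.
pose a := `|quad_form Q v - quad_form Q' v|.
have a0 : 0 < a by rewrite normr_gt0.
pose y := dotp v v; have y0 : 0 <= y := dotp_ge0 v.
pose e := a / (8 * (y + 1)).
have e0 : 0 < e by rewrite divr_gt0 ?mulr_gt0 ?ltr_wpDl.
have : \forall xi \near (0 : 'rV[R]_d),
    nc (l xi - (1 - 2^-1 * quad_form Q xi)%:C) <= e * euclid_norm xi ^+ 2 /\
    nc (l xi - (1 - 2^-1 * quad_form Q' xi)%:C) <= e * euclid_norm xi ^+ 2.
  exact: filterI (h e e0) (h' e e0).
move=> /nbhs_normP[r /= r0 hr].
pose t := r / (2 * (1 + `|v|)).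
have v1 : 0 < 1 + `|v| by rewrite ltr_pwDl.
have t0 : 0 < t by rewrite divr_gt0 ?mulr_gt0.
have [] := hr (t *: v).
  rewrite /= sub0r normrN normrZ gtr0_norm// /t.
  have -> : r / (2 * (1 + `|v|)) * `|v| = r * (`|v| / (2 * (1 + `|v|))) by ring.
  rewrite gtr_pMr// ltr_pdivrMr ?mulr_gt0// mul1r.
  by have := normr_ge0 v; lra.
rewrite !quad_formZ /euclid_norm sqr_sqrtr ?dotp_ge0// dotpZl dotpZr -/y.
move: (l _) => z h1 h2.
have b : nc ((1 - 2^-1 * (t ^+ 2 * quad_form Q v))%:C - (1 - 2^-1 * (t ^+ 2 * quad_form Q' v))%:C) <= 2 * (e * (t * (t * y))).
  have -> : (1 - 2^-1 * (t ^+ 2 * quad_form Q v))%:C - (1 - 2^-1 * (t ^+ 2 * quad_form Q' v))%:C =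
    (z - (1 - 2^-1 * (t ^+ 2 * quad_form Q' v))%:C) - (z - (1 - 2^-1 * (t ^+ 2 * quad_form Q v))%:C) by ring.
  by apply: le_trans (ncB _ _) _; lra.
have tt : 0 < t ^+ 2 by rewrite exprn_gt0.
move: b; rewrite -rmorphB nc_real.
have -> : 1 - 2^-1 * (t ^+ 2 * quad_form Q v) - (1 - 2^-1 * (t ^+ 2 * quad_form Q' v)) =
   - (2^-1 * t ^+ 2) * (quad_form Q v - quad_form Q' v) by ring.
have t2 : 0 < 2^-1 * t ^+ 2 by rewrite mulr_gt0 ?invr_gt0.
rewrite normrM normrN (gtr0_norm t2).
have -> : 2 * (e * (t * (t * y))) = 2^-1 * t ^+ 2 * (4 * e * y) by field.
rewrite ler_pM2l ?mulr_gt0// -/a leNgt => /negP; apply.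
have -> : 4 * e * y = a * (y / (2 * (y + 1))) by rewrite /e; field; rewrite gt_eqF// ltr_wpDl.
by rewrite gtr_pMr// ltr_pdivrMr ?mulr_gt0 ?ltr_wpDl// mul1r; lra.
Qed.

End quadratic_forms.

Section eventual_limit.
Variables (R : realType) (N d : nat).
Local Notation nc := (@ComplexField.Normc.normc R).
Local Notation "x %:C" := (real_complex R x) (at level 1, format "x %:C").
Local Notation one := (ones R N).

(** The threshold is chosen before the matrices, from the constants, the radius and [e] alone;
    uniformity in the tilt rests on this order. *)
Lemma power_limit_eventually (m : nat) (b K R0 e : R) : 0 <= R0 -> 0 < e ->
  exists n1_ : nat, forall n, (n1_ <= n)%N ->
  forall (F : 'M[R]_N) (nu : 'rV[R]_N) (D1 : 'I_d -> 'M[R]_N) D2 (Psi : 'rV[R]_d -> 'M[R[i]]_N),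
  char_expansion m b K F nu D1 D2 Psi -> forall (j : 'I_N) xi, n1 xi <= R0 ->
  opn (Psi ((Num.sqrt n%:R)^-1 *: xi) ^+ n *m delta_mx j 0 -
       (nu 0 j * expR (- (quad_form (eff_cov F nu D1 D2) xi / 2)))%:C *: cmx one) <= e.
Proof.
move=> R00 e0.
(* For other values of [b] no chain satisfies the expansion. *)
case: (pselect (0 < b /\ b <= 1)) => [[b0 b1]|hb]; last first.
  by exists 0%N => n _ F nu D1 D2 Psi H; case: hb; case: (ce_doeblin H) => -[].
have e2 : 0 < e / 2 by rewrite divr_gt0.
have [s _ hs] := geometric_small b0 b1 e2.
pose X := `|6 * (m * s)%:R * K + 2 * Kd m b K| + `|Kc m b K| * R0 ^+ 2 + KQ m b K ^+ 2 * R0 ^+ 2.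
have X0 : 0 <= X.
  by apply: addr_ge0; [apply: addr_ge0 => //; apply: mulr_ge0 => //|apply: mulr_ge0]; exact: sqr_ge0.
(* [T] collects the requirements on [1 / r]: [r <= 1], [KQ r^2 <= 4] and [X r <= e / 2]. *)
pose T := 1 + `|KQ m b K| + 2 * X / e.
have T1 : 1 <= T by rewrite /T -addrA lerDl addr_ge0// divr_ge0 ?mulr_ge0// ltW.
have T0 : 0 < T by apply: lt_le_trans T1.
have [n1_ hn1] := archi_gt ((R0 * T) ^+ 2).
exists (maxn (maxn 1 n1_) (m * s)) => n.
rewrite !geq_max => /andP[/andP[n0 nn1] nms] F nu D1 D2 Psi H j xi hxi.
have sn0 : 0 < Num.sqrt n%:R :> R by rewrite sqrtr_gt0 ltr0n.
have xi0 := n1_ge0 xi.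
have rE : n1 ((Num.sqrt n%:R)^-1 *: xi) = n1 xi / Num.sqrt n%:R.
  by rewrite n1Z gtr0_norm ?invr_gt0// mulrC.
have RT : R0 * T <= Num.sqrt n%:R.
  rewrite -[leLHS]ger0_norm ?mulr_ge0 ?(ltW T0)// -sqrtr_sqr; apply: ler_wsqrtr.
  by apply: le_trans (ltW hn1) _; rewrite ler_nat.
have rT : n1 ((Num.sqrt n%:R)^-1 *: xi) * T <= 1.
  by rewrite rE mulrAC ler_pdivrMr// mul1r; apply: le_trans RT; rewrite ler_wpM2r ?(ltW T0).
set r := n1 ((Num.sqrt n%:R)^-1 *: xi) in rT *.
have r0 : 0 <= r := n1_ge0 _.
have r1 : r <= 1 by apply: le_trans rT; rewrite ler_peMr.
have kq := normr_ge0 (KQ m b K).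
have Xe : 0 <= 2 * X / e by rewrite divr_ge0 ?mulr_ge0// ltW.
have kqr : `|KQ m b K| * r <= 1.
  by apply: le_trans rT; rewrite mulrC ler_wpM2l// /T; lra.
have Xr : X * r <= e / 2.
  have : r * (2 * X / e) <= 1 by apply: le_trans rT; rewrite ler_wpM2l// /T; lra.
  have -> : r * (2 * X / e) = (X * r) * (2 / e) by ring.
  by rewrite -ler_pdivlMr ?divr_gt0// invf_div mul1r.
have kq4 : KQ m b K * r ^+ 2 <= 4.
  apply: le_trans (_ : `|KQ m b K| * r <= _); last by lra.
  apply: le_trans (_ : `|KQ m b K| * r ^+ 2 <= _); first by rewrite ler_wpM2r ?sqr_ge0// ler_norm.
  by rewrite ler_wpM2l// expr2 ler_piMl.
apply: le_trans (@power_limit _ _ _ _ _ _ _ _ _ _ _ H j n s xi j n0 nms r1 kq4) _.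
have xi2 : n1 xi ^+ 2 <= R0 ^+ 2 by apply: lerXn2r; rewrite ?nnegrE.
have c1 : Kc m b K * n1 xi ^+ 2 <= `|Kc m b K| * R0 ^+ 2.
  apply: le_trans (_ : `|Kc m b K| * n1 xi ^+ 2 <= _); first by rewrite ler_wpM2r ?sqr_ge0// ler_norm.
  by rewrite ler_wpM2l.
have c2 : KQ m b K ^+ 2 * n1 xi ^+ 2 <= KQ m b K ^+ 2 * R0 ^+ 2 by rewrite ler_wpM2l ?sqr_ge0.
have c3 := ler_norm (6 * (m * s)%:R * K + 2 * Kd m b K).
apply: le_trans (_ : e / 2 + X * r <= _); last by lra.
by apply: lerD => //; rewrite [leRHS]mulrC; apply: ler_wpM2l => //; rewrite /X; lra.
Qed.

End eventual_limit.

(** * Lower bound for the covariance and expansion of the dominant eigenvalue *)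

Section spectral_expansion.
Variables (R : realType) (N d : nat).
Local Notation nc := (@ComplexField.Normc.normc R).
Local Notation "x %:C" := (real_complex R x) (at level 1, format "x %:C").
Local Notation one := (ones R N).
Variables (m : nat) (b K : R) (F : 'M[R]_N) (nu : 'rV[R]_N).
Variables (D1 : 'I_d -> 'M[R]_N) (D2 : 'I_d -> 'I_d -> 'M[R]_N).
Variable (Psi : 'rV[R]_d -> 'M[R[i]]_N).
Hypothesis H : char_expansion m b K F nu D1 D2 Psi.
Hypothesis m0 : (0 < m)%N.
Variable k0 : 'I_N.
Local Notation Q := (eff_cov F nu D1 D2).

(* Off the spectral projection, powers of the characteristic matrix inherit
   exponential decay; comparison with the Gaussian limit bounds [Q] from below. *)
Lemma eff_cov_lower (B c : R) : 0 < c ->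
  (forall n (eta : 'rV[R]_d), (forall i, `|eta 0 i| <= pi) ->
     opn (Psi eta ^+ n) <= B * expR (- (c * n%:R * dotp eta eta))) ->
  forall xi, 2 * c * dotp xi xi <= quad_form Q xi.
Proof.
move=> c0 decay.
have nus := nu_sum (ce_doeblin H).
(* At [eta = xi / sqrt n] the decay bound does not depend on [n]; summing over [j] removes the
   weights [nu_j]. *)
have lim xi : expR (- (quad_form Q xi / 2)) <= N%:R * (B * expR (- (c * dotp xi xi))).
  apply/ler_addgt0Pr => e e0.
  have Np : 0 < N%:R :> R by rewrite ltr0n; case: N k0 => // -[].
  have [n1_ hn] := power_limit_eventually N d m b K (n1_ge0 xi) (divr_gt0 e0 Np).
  have [n2 hn2] := archi_gt (n1 xi ^+ 2).
  pose n := maxn (maxn 1 n1_) n2.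
  have [nA nB nC] : [/\ (0 < n)%N, (n1_ <= n)%N & (n2 <= n)%N].
    by rewrite /n !leq_max !leqnn !orbT.
  have sn0 : 0 < Num.sqrt n%:R :> R by rewrite sqrtr_gt0 ltr0n.
  have h j := hn n nB _ _ _ _ _ H j xi (lexx _).
  pose eta := (Num.sqrt n%:R)^-1 *: xi.
  have epi i : `|eta 0 i| <= pi.
    apply: le_trans (_ : 1 <= _); last by have := pi_ge2 R; lra.
    rewrite mxE normrM gtr0_norm ?invr_gt0// ler_pdivrMl// mulr1.
    apply: le_trans (coord_le_n1 xi i) _.
    rewrite -[leLHS]ger0_norm ?n1_ge0// -sqrtr_sqr; apply: ler_wsqrtr.
    by apply: le_trans (ltW hn2) _; rewrite ler_nat.
  have de : c * n%:R * dotp eta eta = c * dotp xi xi.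
    rewrite /eta dotpZl dotpZr; move: sn0 (sqr_sqrtr (ler0n R n)).
    move: (Num.sqrt _) => S S0 <-; by field; rewrite gt_eqF.
  have dec := decay n eta epi; rewrite de in dec.
  have each j : nu 0 j * expR (- (quad_form Q xi / 2)) <= B * expR (- (c * dotp xi xi)) + e / N%:R.
    have [nuj0 _] := andP (nu_le1 (ce_doeblin H) j).
    have hj := le_trans (entry_le_opn _ k0 0) (h j).
    set z := nu 0 j * _ in hj *.
    have z0 : 0 <= z by rewrite mulr_ge0 ?expR_ge0.
    have -> : z = nc (((Psi eta ^+ n *m (delta_mx j 0 : 'cV[R[i]]_N)) k0 0) - ((Psi eta ^+ n *m delta_mx j 0 - z%:C *: cmx one) k0 0)).
      have gen (X Y : 'cV[R[i]]_N) : X k0 0 - (X - Y) k0 0 = Y k0 0 by rewrite !mxE; ring.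
      by rewrite gen !mxE rmorph1 mulr1 nc_real ger0_norm.
    apply: le_trans (ncB _ _) _; apply: lerD => //; apply: le_trans (entry_le_opn _ _ _) _.
    apply: le_trans (opnM _ _) _; apply: le_trans dec.
    by rewrite ler_piMr ?opn_ge0// opn_delta_col.
  have -> : expR (- (quad_form Q xi / 2)) = \sum_j nu 0 j * expR (- (quad_form Q xi / 2)).
    by rewrite -mulr_suml nus mul1r.
  apply: le_trans (_ : \sum_(j < N) (B * expR (- (c * dotp xi xi)) + e / N%:R) <= _).
    by apply: ler_sum => j _.
  by rewrite sumr_const card_ord -[leLHS]mulr_natl mulrDr [X in _ + X <= _]mulrC divfK// gt_eqF.
move=> xi; rewrite leNgt; apply/negP => lt.
pose dd := c * dotp xi xi - quad_form Q xi / 2.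
have dd0 : 0 < dd by rewrite /dd; lra.
(* Both exponents are quadratic, so a large multiple of [xi] beats the constant [N B]. *)
have [n hn] := archi_gt (N%:R * B / dd).
have := lim (n%:R *: xi); rewrite quad_formZ dotpZl dotpZr.
have -> : - (c * (n%:R * (n%:R * dotp xi xi))) = - (n%:R ^+ 2 * dd) - (n%:R ^+ 2 * quad_form Q xi / 2) by rewrite /dd; ring.
rewrite expRD mulrA mulrA -[leLHS]mul1r ler_pM2r ?expR_gt0// expRN ler_pdivlMr ?expR_gt0// mul1r => h.
have h2 := expR_ge1Dx (n%:R ^+ 2 * dd).
have h3 : n%:R <= n%:R ^+ 2 :> R by rewrite -natrX ler_nat; case: n {hn h h2} => // n; rewrite expnS expn1 leq_pmulr.
rewrite ltr_pdivrMr// in hn.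
have : n%:R * dd <= n%:R ^+ 2 * dd by rewrite ler_wpM2r// ltW.
lra.
Qed.

(** [s] is fixed first, to bring [F ^+ s] close to the projection; the radius [r] then absorbs the
    factor [s] of the perturbation. *)
Lemma char_pow_near (e : R) : 0 < e -> exists s r, [/\ (0 < s)%N, 0 < r &
  forall xi, n1 xi <= r -> opn (Psi xi ^+ s - cmx (one *m nu)) <= e].
Proof.
move=> e0; have dob := ce_doeblin H; have [[b0 b1 _] _ _ _ _] := dob; have K0 := ce_K H.
have Np : 0 < N%:R :> R by rewrite ltr0n; case: N k0 => // -[].
have e' : 0 < e / 2 / N%:R by rewrite !divr_gt0.
have [t t0 ht] := geometric_small b0 b1 e'.
pose s := (m * t)%N; pose X := s%:R * (3 * K).
have X0 : 0 <= X by rewrite !mulr_ge0.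
pose r := Num.min 1 (e / 2 / (X + 1)).
have r0 : 0 < r by rewrite lt_min ltr01 !divr_gt0// ltr_wpDl.
exists s, r; split=> //; first by rewrite muln_gt0 m0.
move=> xi; rewrite le_min => /andP[x1 x2].
have -> : Psi xi ^+ s - cmx (one *m nu) = (Psi xi ^+ s *m 1%:M - cmx F ^+ s *m 1%:M) + (cmx (F ^+ s) - cmx (one *m nu)).
  by rewrite !mulmx1 cmxX addrA subrK.
apply: le_trans (opnD _ _) _; rewrite [leRHS]splitr; apply: lerD.
  apply: le_trans (power_perturbation _ _ (ce_contraction H xi) (opn_stochastic dob)) _.
  apply: le_trans (_ : s%:R * (3 * K * n1 xi) * 1 <= _).
    apply: ler_pM; rewrite ?mulr_ge0 ?opn_ge0 ?opn1_le//.
    by rewrite ler_wpM2l//; exact: (char_near H).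
  have -> : s%:R * (3 * K * n1 xi) * 1 = X * n1 xi by rewrite /X; ring.
  have X1 : 0 < X + 1 by rewrite ltr_wpDl.
  move: x2; rewrite ler_pdivlMr// => x2; apply: le_trans x2.
  by rewrite mulrC ler_wpM2l ?n1_ge0// lerDl.
have ent k j : nc ((cmx (F ^+ s) - cmx (one *m nu)) k j) <= e / 2 / N%:R.
  apply: le_trans ht; apply: le_trans (stationary_limit dob t j).
  apply: le_trans (entry_le_opn _ k 0).
  rewrite !mxE big_ord1 !mxE mul1r rmorph1 mulr1 (bigD1 j)//= big1 ?addr0 => [|i ij].
    by rewrite !mxE !eqxx mulr1.
  by rewrite [X in _ * X]mxE (negPf ij) mulr0.
apply: opn_le => [|k]; first by rewrite divr_ge0 ?ltW.
apply: le_trans (_ : \sum_(j < N) e / 2 / N%:R <= _); first by apply: ler_sum => j _; exact: ent.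
by rewrite sumr_const card_ord -[leLHS]mulr_natl mulrC divfK ?gt_eqF.
Qed.

(** A left eigenvector [v] of the dominant eigenvalue pairs with the corrector [c] without
    degenerating: [opn v] is at most 4 times the modulus of [v c]. Applying [v] to the approximate
    eigenvalue equation of [c] compares the two eigenvalues. *)
Lemma dominant_expansion : exists r, 0 < r /\ forall xi, n1 xi <= r ->
  (exists l, is_dominant_eigenvalue (Psi xi) l) /\
  (forall l, is_dominant_eigenvalue (Psi xi) l ->
    nc (l - (1 - quad_form Q xi / 2)%:C) <= 4 * Kc m b K * n1 xi ^+ 3).
Proof.
have N0 : (0 < N)%N by case: N k0 => // -[].
have Np : 0 < N%:R :> R by rewrite ltr0n.
pose e : R := (16 * N%:R ^+ 2)^-1.
have e0 : 0 < e by rewrite invr_gt0 mulr_gt0 ?exprn_gt0.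
have e1 : e * (16 * N%:R ^+ 2) <= 1 by rewrite mulVf ?gt_eqF// mulr_gt0 ?exprn_gt0.
have [s [r [s0 r0 hr]]] := char_pow_near e0.
have [_ _ [nu0 nu1] _ _] := ce_doeblin H.
have kd := Kd_ge0 H; have kc := Kc_ge0 H.
pose r' := Num.min r (Num.min 1 (4 * Kd m b K + 1)^-1).
exists r'; split; first by rewrite !lt_min r0 ltr01 invr_gt0 ltr_wpDl// mulr_ge0.
move=> xi; rewrite !le_min => /and3P[x1 x2 x3]; have near := hr xi x1.
split; first by have [l [dl _ _]] := dominant_exists N0 nu0 nu1 (ltW e0) e1 near; exists l.
move=> l dl; have [v [vM v0 hv]] := dominant_eigenvector N0 nu0 nu1 (ltW e0) e1 near dl.
set c := corr F nu D1 D2 xi.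
have c1 := corr_near1 H x2; have c2 := corr_eigen H x2; rewrite -/c in c1 c2.
clearbody c.
have ov : 0 < opn v.
  rewrite lt_neqAle opn_ge0 andbT eq_sym; apply: contra v0 => /eqP h.
  apply/eqP/matrixP => i j; rewrite mxE; apply: nc_eq0; apply/eqP.
  by rewrite eq_le nc_ge0 andbT -h entry_le_opn.
have vc : opn v <= 4 * nc ((v *m c) 0 0).
  have d1 : nc ((v *m (c - cmx one)) 0 0) <= opn v * (Kd m b K * n1 xi).
    apply: le_trans (entry_le_opn _ _ _) _; apply: le_trans (opnM _ _) _.
    by rewrite ler_wpM2l ?opn_ge0.
  have d2 : Kd m b K * n1 xi <= 4^-1.
    have x0 := n1_ge0 xi.
    move: x3; rewrite -[(4 * _ + 1)^-1]mul1r ler_pdivlMr; last by rewrite ltr_wpDl// mulr_ge0.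
    have -> : n1 xi * (4 * Kd m b K + 1) = 4 * (Kd m b K * n1 xi) + n1 xi by ring.
    lra.
  have d3 : opn v * (Kd m b K * n1 xi) <= opn v * 4^-1 by rewrite ler_wpM2l// ltW.
  have d4 : nc ((v *m cmx one) 0 0) <= nc ((v *m c) 0 0) + nc ((v *m (c - cmx one)) 0 0).
    have -> : (v *m cmx one) 0 0 = (v *m c) 0 0 - (v *m (c - cmx one)) 0 0.
      have gen (x y : 'M[R[i]]_1) : y 0 0 = x 0 0 - (x - y) 0 0 by rewrite !mxE; ring.
      by rewrite mulmxBr; exact: gen.
    exact: ncB.
  lra.
set l0 := (1 - quad_form Q xi / 2)%:C in c2 *.
have key : nc (l - l0) * nc ((v *m c) 0 0) <= opn v * (Kc m b K * n1 xi ^+ 3).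
  have -> : nc (l - l0) * nc ((v *m c) 0 0) = nc ((v *m (Psi xi *m c - l0 *: c)) 0 0).
    rewrite -ncM mulmxBr mulmxA vM -scalemxAl -scalemxAr.
    have gen (x : 'M[R[i]]_1) (s1 s2 : R[i]) : (s1 *: x - s2 *: x) 0 0 = (s1 - s2) * x 0 0.
      by rewrite !mxE; ring.
    by rewrite gen.
  apply: le_trans (entry_le_opn _ _ _) _; apply: le_trans (opnM _ _) _.
  by rewrite ler_wpM2l ?opn_ge0.
rewrite -(ler_pM2l ov).
apply: le_trans (_ : nc (l - l0) * (4 * nc ((v *m c) 0 0)) <= _).
  by rewrite mulrC ler_wpM2l ?nc_ge0.
have -> : opn v * (4 * Kc m b K * n1 xi ^+ 3) = 4 * (opn v * (Kc m b K * n1 xi ^+ 3)) by ring.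
by rewrite mulrCA ler_wpM2l.
Qed.

End spectral_expansion.

(** * Identification of the covariance form *)

Section covariance.
Variables (R : realType) (d N : nat) (p : lattice_kernel R d N).
Hypothesis p_inv : invariant_kernel p.
Local Notation nc := (@ComplexField.Normc.normc R).
Local Notation "x %:C" := (real_complex R x) (at level 1, format "x %:C").
Local Notation one := (ones R N).
Variables (C : 'rV[R]_d -> 'cV[R]_N) (nu : 'rV[R]_d -> 'rV[R]_N).
Hypothesis C_nu : PF_eigenvectors p C nu.
Variables (dl A : R) (m : nat) (a : R).
Hypotheses (d0 : (0 < d)%N) (dl0 : 0 < dl) (a0 : 0 < a) (m0 : (0 < m)%N).
Variable k0 : 'I_N.
Variable u : 'rV[R]_d.
Hypotheses (u_bounds : tilt_bounds p dl A m a u) (lam1 : lam p u = 1).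

Local Notation Psi := (doob_char p u (C u) (nu u)).
Local Notation Fh := (doob 1 (C u) (F_mx p u)).
Local Notation nuh := (\row_j (nu u 0 j * C u j 0)).
Local Notation D1 := (centered_moment1 p u (C u) (nu u)).
Local Notation D2 := (centered_moment2 p u (C u) (nu u)).
Local Notation drift := (doob_drift p u (C u) (nu u)).
Local Notation b := (doeblin_const N A m a).
Local Notation K := (growth N dl A m a).
Local Notation rate := (decay_rate d N A m a).

Definition doob_cov : 'M[R]_d := eff_cov Fh nuh D1 D2.

Lemma doob_expansion : char_expansion m b K Fh nuh D1 D2 Psi.
Proof.
have [C0 FC nu0 nuF nuC] := PF_facts p_inv C_nu dl0 u_bounds lam1.
exact: (doob_char_expansion p_inv dl0 a0 u_bounds C0 FC nu0 nuF nuC k0).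
Qed.

Lemma scale_mx_exp (T : comNzRingType) (s : T) (M : 'M[T]_N) n : (s *: M) ^+ n = s ^+ n *: M ^+ n.
Proof.
elim: n => [|n IH]; first by rewrite !expr0 scale1r.
have -> : (s *: M) ^+ n.+1 = (s *: M) *m (s *: M) ^+ n by rewrite exprS.
have -> : M ^+ n.+1 = M *m M ^+ n by rewrite exprS.
by rewrite IH -scalemxAl -scalemxAr scalerA exprS.
Qed.

Lemma doob_char_decay n (eta : 'rV[R]_d) : (forall i, `|eta 0 i| <= pi) ->
  opn (Psi eta ^+ n) <= expR 2 * expR (- (rate * n%:R * dotp eta eta)).
Proof.
move=> h; have [C0 FC nu0 nuF nuC] := PF_facts p_inv C_nu dl0 u_bounds lam1.
rewrite /doob_char scale_mx_exp; apply: le_trans (opnZ _ _) _.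
rewrite ncX nc_cexpi expr1n mul1r.
have := doob_transform_decay p_inv dl0 a0 m0 u_bounds ltr01 C0 FC k0 n d0 h.
by rewrite rmorph1.
Qed.

Lemma decay_rate_gt0 : 0 < rate.
Proof.
have r0 : 0 < ratio_ub N A m a by apply: lt_le_trans (ratio_ub_ge1 p_inv dl0 a0 u_bounds k0).
rewrite invr_gt0; apply: mulr_gt0; last by rewrite ltr0n.
by apply: mulr_gt0; [exact: mulr_gt0|rewrite ltr0n].
Qed.

Lemma doob_cov_lower xi : 2 * rate * dotp xi xi <= quad_form doob_cov xi.
Proof. exact: (eff_cov_lower doob_expansion k0 decay_rate_gt0 doob_char_decay). Qed.

Lemma doob_cov_posdef : sym_posdef doob_cov.
Proof.
split=> [|v v0]; first exact: eff_cov_sym doob_expansion.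
apply: lt_le_trans (doob_cov_lower v); rewrite mulr_gt0 ?mulr_gt0 ?decay_rate_gt0//.
have [i vi] : exists i, v 0 i != 0.
  by apply/existsP; apply: contra_neqT v0 => /existsPn h; apply/rowP => i; rewrite mxE; apply/eqP/negPn/h.
by apply: lt_le_trans (coord_le_euclid v i); rewrite exprn_even_gt0.
Qed.

Lemma doob_conjugate (T : fieldType) (c : 'cV[T]_N) (M : 'M[T]_N) : (forall i, c i 0 != 0) ->
  char_poly (doob 1 c M) = char_poly M.
Proof.
move=> c0; pose P := diag_mx (\row_i (c i 0)^-1).
have Pu : P \in unitmx.
  rewrite unitmxE det_diag unitfE; apply/prodf_neq0 => i _.
  by rewrite mxE invr_neq0.
rewrite -(char_poly_conj M Pu); congr char_poly.
rewrite -[LHS](mulmxK Pu); congr (_ *m _).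
apply/matrixP => i j; rewrite mul_mx_diag mul_diag_mx !mxE mul1r.
by field; rewrite !c0.
Qed.

Lemma dominant_char_poly (M M' : 'M[R[i]]_N) l : char_poly M = char_poly M' ->
  is_dominant_eigenvalue M l -> is_dominant_eigenvalue M' l.
Proof.
move=> E [h1 h2]; split=> [|r]; first by rewrite -E.
by rewrite eigenvalue_root_char -E -eigenvalue_root_char; exact: h2.
Qed.

(** The two matrices are conjugate by a diagonal matrix; their phases agree because the gradient of
    [lam] is the drift. *)
Lemma dominant_doob l xi : is_dominant_eigenvalue (chi_mx p u xi) l <->
  is_dominant_eigenvalue (Psi xi) l.
Proof.
have [C0 _ _ _ _] := PF_facts p_inv C_nu dl0 u_bounds lam1.
have E : char_poly (Psi xi) = char_poly (chi_mx p u xi).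
  have cC i : cmx (C u) i 0 != 0 by rewrite mxE; apply/eqP => -[] /eqP; rewrite gt_eqF.
  rewrite -(doob_conjugate (chi_mx p u xi) cC); congr char_poly.
  apply/matrixP => k j; rewrite /doob_char !mxE.
  by rewrite (gradient_lam p_inv C_nu dl0 a0 m0 k0 u_bounds lam1); exact: mulrA.
by split; apply: dominant_char_poly.
Qed.

Lemma doob_cov_quadratic : quadratic_expansion p u doob_cov.
Proof.
move=> e e0; have [r [r0 hr]] := dominant_expansion doob_expansion m0 k0.
have kc := Kc_ge0 doob_expansion; set kc_ := Kc m b K in kc hr.
pose r' := Num.min r (e / (4 * kc_ * d%:R ^+ 2 + 1)).
have X1 : 0 < 4 * kc_ * d%:R ^+ 2 + 1 by rewrite ltr_wpDl// !mulr_ge0 ?sqr_ge0.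
have r'0 : 0 < r' by rewrite lt_min r0 divr_gt0.
have near0 := n1_near0 d r'0; near=> xi.
have : n1 xi <= r' by near: xi; exact: near0.
rewrite le_min => /andP[x1 x2].
have [[l hl0] hl] := hr xi x1.
rewrite /lam_xi; case: xgetP => [l' _ /dominant_doob hl'|h]; last first.
  by case: (h l); apply/dominant_doob.
rewrite [2^-1 * _]mulrC; apply: le_trans (hl _ hl') _.
have n0 := n1_ge0 xi.
have n2 : n1 xi ^+ 2 <= d%:R ^+ 2 * euclid_norm xi ^+ 2.
  rewrite -exprMn; apply: lerXn2r; rewrite ?nnegrE ?n1_le_euclid//.
  by rewrite mulr_ge0 ?sqrtr_ge0.
have -> : 4 * kc_ * n1 xi ^+ 3 = 4 * kc_ * n1 xi * n1 xi ^+ 2 by ring.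
have kx : 0 <= 4 * kc_ * n1 xi by rewrite !mulr_ge0.
apply: le_trans (ler_wpM2l kx n2) _; rewrite mulrA ler_wpM2r ?sqr_ge0//.
move: x2; rewrite ler_pdivlMr// => x2; apply: le_trans x2.
have -> : 4 * kc_ * n1 xi * d%:R ^+ 2 = n1 xi * (4 * kc_ * d%:R ^+ 2) by ring.
by rewrite ler_wpM2l// lerDl.
Unshelve. all: by end_near.
Qed.

(** The choice operator needs a witness, and uniqueness of the expansion pins its value. *)
Lemma Q_mx_doob_cov : Q_mx p u = doob_cov.
Proof.
rewrite /Q_mx; case: xgetP => [Q _ [[sQ _] hQ]|h]; last first.
  by case: (h doob_cov); split; [exact: doob_cov_posdef|exact: doob_cov_quadratic].
exact: expansion_unique sQ (proj1 doob_cov_posdef) hQ doob_cov_quadratic.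
Qed.

End covariance.

(** * The local limit theorem *)

Section gaussian_domination.
Variables (R : realType) (N d : nat).
Local Notation nc := (@ComplexField.Normc.normc R).
Local Notation "x %:C" := (real_complex R x) (at level 1, format "x %:C").
Local Notation one := (ones R N).

Lemma gaussian_small (c e : R) : 0 < c -> 0 < e -> exists2 r : R, 0 <= r & forall s, r ^+ 2 <= s -> expR (- (c * s / 2)) <= e.
Proof.
move=> c0 e0; pose r := 1 + 2 / (c * e).
have q0 : 0 < 2 / (c * e) by rewrite divr_gt0 ?mulr_gt0.
exists r => [|s rs]; first by rewrite /r addr_ge0 ?(ltW q0).
rewrite expRN -[leRHS]invrK lef_pV2 ?posrE ?expR_gt0 ?invr_gt0//.
apply: le_trans (expR_ge1Dx _).
have : 2 / (c * e) <= s.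
  apply: le_trans rs; apply: le_trans (_ : r <= _); first by rewrite /r; lra.
  by rewrite expr2 ler_peMl// /r; lra.
move=> /(ler_wpM2l (ltW c0)).
have -> : c * (2 / (c * e)) = 2 * e^-1 by field; rewrite !gt_eqF.
lra.
Qed.

Definition char_decay (B c : R) (Psi : 'rV[R]_d -> 'M[R[i]]_N) : Prop :=
  forall n (eta : 'rV[R]_d), (forall i, `|eta 0 i| <= pi) ->
    opn (Psi eta ^+ n) <= B * expR (- (c * n%:R * dotp eta eta)).

(** For bounded [xi] this is the limit of the powers; for large [xi] both terms decay separately.
    Half of the Gaussian exponent produces the factor [e], the other half is kept as a summable
    weight. The second conclusion treats frequencies outside the rescaled torus. *)
Lemma gaussian_domination (m : nat) (b K B c e : R) : 0 <= B -> 0 < c -> 0 < e ->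
  exists n0 : nat, forall n, (n0 <= n)%N ->
  forall (F : 'M[R]_N) (nu : 'rV[R]_N) (D1 : 'I_d -> 'M[R]_N) D2 (Psi : 'rV[R]_d -> 'M[R[i]]_N),
  char_expansion m b K F nu D1 D2 Psi -> char_decay B c Psi ->
  (forall j (xi : 'rV[R]_d), (forall i, `|xi 0 i| <= pi * Num.sqrt n%:R) ->
    opn (Psi ((Num.sqrt n%:R)^-1 *: xi) ^+ n *m delta_mx j 0 -
       (nu 0 j * expR (- (quad_form (eff_cov F nu D1 D2) xi / 2)))%:C *: cmx one)
     <= e * expR (- (c * dotp xi xi / 2))) /\
  (forall (k0 : 'I_N) (xi : 'rV[R]_d) i, pi * Num.sqrt n%:R <= `|xi 0 i| ->
     expR (- (quad_form (eff_cov F nu D1 D2) xi / 2)) <= e * expR (- (c * dotp xi xi / 2))).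
Proof.
move=> B0 c0 e0.
have e' : 0 < e / (B + 1) by rewrite divr_gt0// ltr_wpDl.
have [r r0 hr] := gaussian_small c0 e'.
have dr0 : 0 <= d%:R * r by rewrite mulr_ge0.
have er0 : 0 < e * expR (- (c * r ^+ 2 / 2)) by rewrite mulr_gt0 ?expR_gt0.
have [n1_ hn1] := power_limit_eventually N d m b K dr0 er0.
have [n2 hn2] := archi_gt (r ^+ 2).
exists (maxn (maxn 1 n1_) n2) => n; rewrite !geq_max => /andP[/andP[n0 nn1] nn2].
move=> F nu D1 D2 Psi H dec; set Q := eff_cov F nu D1 D2.
have sn0 : 0 < Num.sqrt n%:R :> R by rewrite sqrtr_gt0 ltr0n.
have sn2 : Num.sqrt n%:R ^+ 2 = n%:R :> R by rewrite sqr_sqrtr.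
have low (k0 : 'I_N) xi : expR (- (quad_form Q xi / 2)) <= expR (- (c * dotp xi xi)).
  by rewrite ler_expR lerN2; have := eff_cov_lower H k0 c0 dec xi; rewrite -/Q; lra.
have far (y : R) : r ^+ 2 <= y -> (B + 1) * expR (- (c * y)) <= e * expR (- (c * y / 2)).
  move=> ry; have -> : - (c * y) = - (c * y / 2) + - (c * y / 2) by field.
  rewrite expRD mulrA ler_wpM2r ?expR_ge0//.
  by have := hr y ry; rewrite ler_pdivlMr ?ltr_wpDl// mulrC.
split=> [j xi hxi|k0 xi i hxi].
  have [nuj0 nuj1] := andP (nu_le1 (ce_doeblin H) j).
  case: (lerP (r ^+ 2) (dotp xi xi)) => ry; last first.
    apply: le_trans (hn1 n nn1 _ _ _ _ _ H j xi _) _.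
      apply: le_trans (n1_le_euclid xi) _; rewrite ler_wpM2l//.
      by rewrite -[leRHS]ger0_norm// -sqrtr_sqr; apply: ler_wsqrtr; exact: ltW.
    rewrite ler_wpM2l ?(ltW e0)// ler_expR lerN2 ler_wpM2r ?invr_ge0// ler_wpM2l ?(ltW c0)//.
    exact: ltW.
  apply: le_trans (far _ ry); apply: le_trans (opnB _ _) _; rewrite mulrDl mul1r; apply: lerD.
    apply: le_trans (opnM _ _) _; apply: le_trans (_ : opn (Psi ((Num.sqrt n%:R)^-1 *: xi) ^+ n) <= _).
      by rewrite ler_piMr ?opn_ge0// opn_delta_col.
    have -> : c * dotp xi xi = c * n%:R * dotp ((Num.sqrt n%:R)^-1 *: xi) ((Num.sqrt n%:R)^-1 *: xi).
      rewrite dotpZl dotpZr; move: sn0 sn2.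
      by move: (Num.sqrt _) => S S0 <-; field; rewrite gt_eqF.
    apply: dec => i; rewrite mxE normrM gtr0_norm ?invr_gt0// ler_pdivrMl// mulrC; exact: hxi.
  apply: le_trans (opnZ _ _) _; rewrite nc_real ger0_norm ?mulr_ge0 ?expR_ge0//.
  apply: le_trans (low j xi); rewrite -[leRHS]mulr1; apply: ler_pM; rewrite ?mulr_ge0 ?opn_ge0 ?opn_ones ?expR_ge0//.
  by rewrite ler_piMl ?expR_ge0.
apply: le_trans (low k0 xi) _; apply: le_trans (far (dotp xi xi) _).
  by rewrite ler_peMl ?expR_ge0// lerDr.
apply: le_trans (coord_le_euclid xi i); rewrite -(real_normK (num_real (xi 0 i))).
apply: lerXn2r; rewrite ?nnegrE//; apply: le_trans hxi.
apply: le_trans (_ : Num.sqrt n%:R <= _); last by rewrite ler_peMl ?(ltW sn0)//; have := pi_ge2 R; lra.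
rewrite -[leLHS]ger0_norm// -sqrtr_sqr; apply: ler_wsqrtr.
by apply: le_trans (ltW hn2) _; rewrite ler_nat.
Qed.

End gaussian_domination.

(** * From characteristic functions to local probabilities *)

Section lattice_llt.
Variables (R : realType) (d : nat).
Local Notation nc := (@ComplexField.Normc.normc R).
Local Notation "x %:C" := (real_complex R x) (at level 1, format "x %:C").

Lemma scalar_posdef (c : R) : 0 < c -> sym_posdef (c%:M : 'M[R]_d) /\
  forall v : 'rV[R]_d, quad_form c%:M v = c * dotp v v.
Proof.
move=> c0; have E (v : 'rV[R]_d) : quad_form c%:M v = c * dotp v v.
  by rewrite quad_formE mul_mx_scalar dotpZl.
split=> //; split=> [|v v0]; first exact: tr_scalar_mx.
rewrite E mulr_gt0//.
have [i vi] : exists i, v 0 i != 0.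
  by apply/existsP; apply: contra_neqT v0 => /existsPn h; apply/rowP => i; rewrite mxE; apply/eqP/negPn/h.
by apply: lt_le_trans (coord_le_euclid v i); rewrite exprn_even_gt0.
Qed.

(** Bounds the mass of the dominating Gaussian for all fine meshes, so that pointwise errors can be
    summed over the whole lattice. *)
Lemma gauss_mass (c : R) : 0 < c -> exists2 h0 : R, 0 < h0 & forall h, 0 < h -> h <= h0 ->
  rsummable (fun y : 'rV[int]_d => h ^+ d * expR (- (c * dotp (h *: rvec R y) (h *: rvec R y) / 2))) /\
  rsum (fun y : 'rV[int]_d => h ^+ d * expR (- (c * dotp (h *: rvec R y) (h *: rvec R y) / 2))) <= gauss_value (c%:M : 'M[R]_d) 0 + 1.
Proof.
move=> c0; have [pd qE] := scalar_posdef c0.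
have [_ /(_ 0 1 ltr01) [h0 [h00 hg]]] := gauss_fourier pd.
exists h0 => // h hp hh; have [s1 s2] := hg h hp hh.
have E : gauss_term (c%:M : 'M[R]_d) 0 h =
  (fun y => (h ^+ d * expR (- (c * dotp (h *: rvec R y) (h *: rvec R y) / 2)))%:C).
  by apply/funext => y; rewrite /gauss_term dotp0l cexpi0 mulr1 qE.
rewrite E in s1 s2; split.
  apply: rsummable_le s1 => y; rewrite nc_real//.
move: s2; rewrite csum_real -rmorphB nc_real => s2.
by have := le_trans (ler_norm _) s2; lra.
Qed.

Lemma dft_step_gt0 M : 0 < dft_step R M.
Proof. by rewrite divr_gt0 ?mulr_gt0 ?pi_gt0. Qed.

Lemma dft_step_small (S h0 : R) : 0 < S -> 0 < h0 -> exists M0, forall M, (M0 <= M)%N -> S * dft_step R M <= h0.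
Proof.
move=> S0 h0p; have [M0 hM0] := archi_gt (S * (2 * pi) / h0); exists M0 => M hM.
rewrite /dft_step mulrA ler_pdivrMr// [h0 * _]mulrC -ler_pdivrMr//.
apply: le_trans (ltW hM0) _; rewrite ler_nat; apply: leq_trans hM _.
by rewrite -addnn -addSn leq_addl.
Qed.

(* Discrete Fourier inversion with mesh [2 pi / (2 M + 1)]: letting [M] tend to
   infinity for fixed [n] replaces integration over the torus. *)
Lemma lattice_llt (n : nat) (P : 'rV[int]_d -> R) (phi : 'rV[R]_d -> R[i]) (mu : 'rV[R]_d)
    (Q : 'M[R]_d) (v c e : R) x :
  (0 < n)%N -> sym_posdef Q -> 0 < c -> 0 < e -> 0 <= v -> v <= 1 -> rsummable P ->
  (forall eta, csum (fun w => (P w)%:C * cexpi (dotp eta (rvec R w))) = cexpi (n%:R * dotp mu eta) * phi eta) ->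
  (forall xi : 'rV[R]_d, (forall i, `|xi 0 i| <= pi * Num.sqrt n%:R) ->
    nc (phi ((Num.sqrt n%:R)^-1 *: xi) - (v * expR (- (quad_form Q xi / 2)))%:C) <= e * expR (- (c * dotp xi xi / 2))) ->
  (forall (xi : 'rV[R]_d) i, pi * Num.sqrt n%:R <= `|xi 0 i| ->
     expR (- (quad_form Q xi / 2)) <= e * expR (- (c * dotp xi xi / 2))) ->
  `|(2 * pi * Num.sqrt n%:R) ^+ d * P x -
     v * gauss_value Q ((Num.sqrt n%:R)^-1 *: (rvec R x - n%:R *: mu))| <=
  e * (gauss_value (c%:M : 'M[R]_d) 0 + 3).
Proof.
move=> n0 pd c0 e0 v0 v1 sP hP near far.
have S0 : 0 < Num.sqrt n%:R :> R by rewrite sqrtr_gt0 ltr0n.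
set S := Num.sqrt n%:R in S0 near far *.
set z := S^-1 *: _.
have L0 : 0 < (2 * pi * S) ^+ d by rewrite exprn_gt0// !mulr_gt0 ?pi_gt0.
set L := (2 * pi * S) ^+ d in L0 *.
have [h1 h1p hm] := gauss_mass c0.
have [_ /(_ (- z) e e0) [h2 [h2p hQ]]] := gauss_fourier pd.
have eL : 0 < e / L by rewrite divr_gt0.
have [M1 hM1] := dft_inversion x (csummable_real sP) eL.
have [M2 hM2] := dft_step_small S0 h1p.
have [M3 hM3] := dft_step_small S0 h2p.
(* [M] may depend on [n], [x] and [e], because it disappears from the conclusion. *)
pose M := maxn M1 (maxn M2 M3).
have [m1 m2 m3] : [/\ (M1 <= M)%N, (M2 <= M)%N & (M3 <= M)%N] by rewrite /M !leq_max !leqnn !orbT.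
have inv := hM1 M m1.
set h := S * dft_step R M.
have h0 : 0 < h by rewrite mulr_gt0 ?dft_step_gt0.
have [gm1 gm2] := hm h h0 (hM2 M m2).
have [gq1 gq2] := hQ h h0 (hM3 M m3).
have hy y : dft_step R M *: rvec R y = S^-1 *: (h *: rvec R y).
  by rewrite scalerA /h mulrA mulVf ?mul1r// gt_eqF.
pose T y := (h ^+ d)%:C * cexpi (dotp (- z) (h *: rvec R y)) * phi (S^-1 *: (h *: rvec R y)).
have hL : M.*2.+1%:R ^- d = L^-1 * h ^+ d.
  rewrite /L /h -!exprVn -exprMn; congr (_ ^+ _); rewrite /dft_step.
  have id3 (p q s : R) : 0 < p -> 0 < q -> 0 < s -> q^-1 = (2 * p * s)^-1 * (s * (2 * p / q)).
    by move=> p0 q0 s0; field; rewrite !gt_eqF.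
  by apply: id3; rewrite ?pi_gt0 ?ltr0n.
have sumE : (M.*2.+1%:R ^- d)%:C * \sum_(y <- lbox d M)
        cexpi (- dotp (dft_step R M *: rvec R y) (rvec R x)) *
        csum (fun w => (P w)%:C * cexpi (dotp (dft_step R M *: rvec R y) (rvec R w))) =
   (L^-1)%:C * \sum_(y <- lbox d M) T y.
  rewrite hL rmorphM -mulrA; congr (_ * _); rewrite mulr_sumr; apply: eq_bigr => y _.
  rewrite hP /T -mulrA; congr (_ * _); rewrite mulrA -cexpiD hy; congr (cexpi _ * _).
  rewrite !dotpZl !dotpZr /z dotpNl dotpZl dotpBl dotpZl [dotp (rvec R y) _]dotpC.
  by rewrite -!/S; field; rewrite gt_eqF.
rewrite sumE in inv.
(* Extension by zero allows a comparison with the full Gaussian lattice sum; outside the box the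
   Gaussian itself is small by [far]. *)
pose g y := if y \in lbox d M then T y else 0.
have [gs gE] : csummable g /\ csum g = \sum_(y <- lbox d M) T y.
  have [|s1 s2] := @csum_finsupp _ _ g (lbox d M) (lbox_uniq d M).
    by move=> y /negPf; rewrite /g => ->.
  by split=> //; rewrite s2; apply: eq_big_seq => y yl; rewrite /g yl.
have point y : nc (g y - v%:C * gauss_term Q (- z) h y) <=
   e * (h ^+ d * expR (- (c * dotp (h *: rvec R y) (h *: rvec R y) / 2))).
  have hd : 0 <= h ^+ d by rewrite exprn_ge0// ltW.
  rewrite /g; case: ifP => [|/negbT]; rewrite mem_lbox.
    move=> /forallP yl.
    have -> : T y - v%:C * gauss_term Q (- z) h y = ((h ^+ d)%:C * cexpi (dotp (- z) (h *: rvec R y))) *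
      (phi (S^-1 *: (h *: rvec R y)) - (v * expR (- (quad_form Q (h *: rvec R y) / 2)))%:C).
      by rewrite /T /gauss_term !rmorphM; ring.
    rewrite ncM ncM nc_real nc_cexpi mulr1 ger0_norm// [leRHS]mulrCA ler_wpM2l//.
    apply: near => i; rewrite !mxE normrM gtr0_norm//.
    have yi := yl i; rewrite /h /dft_step.
    have yi' : `|(y 0%R i)%:~R| <= M%:R :> R.
      by rewrite -intr_norm -[M%:R]/(M%:Z%:~R) ler_int -abszE lez_nat.
    apply: le_trans (ler_wpM2l _ yi') _; first by rewrite mulr_ge0 ?(ltW S0)// ltW// dft_step_gt0.
    have M0' : 0 < M.*2.+1%:R :> R by rewrite ltr0n.
    have -> : S * (2 * pi / M.*2.+1%:R) * M%:R = (pi * S) * (2 * M%:R / M.*2.+1%:R) by ring.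
    rewrite ler_piMr ?mulr_ge0 ?pi_ge0 ?(ltW S0)// ler_pdivrMr// mul1r -natrM ler_nat.
    by rewrite mul2n.
  move=> /negP hn; have [i yi] : exists i, (M < `|y 0%R i|)%N.
    apply: contrapT => /forallNP h'; apply: hn; apply/forallP => i.
    by rewrite leqNgt; apply/negP/h'.
  rewrite sub0r ncN ncM nc_real ger0_norm// nc_gauss_term ?(ltW h0)// [leRHS]mulrCA.
  apply: le_trans (_ : h ^+ d * expR (- (quad_form Q (h *: rvec R y) / 2)) <= _).
    by rewrite ler_piMl// mulr_ge0 ?expR_ge0.
  rewrite ler_wpM2l//; apply: (far _ i); rewrite !mxE normrM (gtr0_norm h0).
  have yi' : M.+1%:R <= `|(y 0%R i)%:~R| :> R.
    by rewrite -intr_norm -[M.+1%:R]/(M.+1%:Z%:~R) ler_int -abszE lez_nat.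
  apply: le_trans (ler_wpM2l (ltW h0) yi').
  have M0' : 0 < M.*2.+1%:R :> R by rewrite ltr0n.
  have -> : h * M.+1%:R = (pi * S) * (2 * M.+1%:R / M.*2.+1%:R) by rewrite /h /dft_step; ring.
  rewrite ler_peMr ?mulr_ge0 ?pi_ge0 ?(ltW S0)// ler_pdivlMr// mul1r -natrM ler_nat.
  by rewrite mul2n doubleS.
have diff : nc (csum g - v%:C * csum (gauss_term Q (- z) h)) <= e * (gauss_value (c%:M : 'M[R]_d) 0 + 1).
  rewrite -csumZ// -csumB//; last exact: csummableZ.
  apply: le_trans (nc_csum_le point (rsummableZ _ gm1)) _.
  by rewrite rsumZ// ler_wpM2l// ltW.
have gvN : gauss_value Q (- z) = gauss_value Q z.
  have qN (X : 'M[R]_d) (w : 'rV[R]_d) : quad_form X (- w) = quad_form X w.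
    by rewrite -scaleN1r quad_formZ sqrrN expr1n mul1r.
  by rewrite /gauss_value qN.
rewrite gvN in gq2; rewrite gE in diff.
set V := gauss_value Q z in gq2 *.
set Sg := \sum_(y <- _) _ in diff inv.
have -> : `|L * P x - v * V| = nc (L%:C * (P x)%:C - v%:C * V%:C).
  by rewrite -!rmorphM -rmorphB nc_real.
(* Three errors: comparison with the Gaussian lattice sum, convergence of that sum, and Fourier
   inversion. The last two contribute [e] each, which turns [gauss_value + 1] into
   [gauss_value + 3]. *)
have -> : L%:C * (P x)%:C - v%:C * V%:C = (Sg - v%:C * csum (gauss_term Q (- z) h)) +
   v%:C * (csum (gauss_term Q (- z) h) - V%:C) - L%:C * ((L^-1)%:C * Sg - (P x)%:C).
  have e1 : L%:C * (L^-1)%:C = 1 by rewrite -rmorphM mulfV ?rmorph1// gt_eqF.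
  have -> : L%:C * ((L^-1)%:C * Sg - (P x)%:C) = (L%:C * (L^-1)%:C) * Sg - L%:C * (P x)%:C by ring.
  by rewrite e1; ring.
apply: le_trans (ncB _ _) _; apply: le_trans (lerD (ncD _ _) (lexx _)) _.
have b1 : nc (v%:C * (csum (gauss_term Q (- z) h) - V%:C)) <= e.
  by rewrite ncM nc_real ger0_norm//; apply: le_trans gq2; rewrite ler_piMl ?nc_ge0.
have b2 : nc (L%:C * ((L^-1)%:C * Sg - (P x)%:C)) <= e.
  rewrite ncM nc_real gtr0_norm//; apply: le_trans (ler_wpM2l (ltW L0) inv) _.
  by rewrite mulrCA mulfV ?mulr1// gt_eqF.
apply: le_trans (lerD (lerD diff b1) b2) _.
by rewrite le_eqVlt; apply/orP; left; apply/eqP; ring.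
Qed.

End lattice_llt.

Section local_bounds.
Variables (R : realType) (d : nat).
Local Notation nc := (@ComplexField.Normc.normc R).
Local Notation "x %:C" := (real_complex R x) (at level 1, format "x %:C").

Lemma lbox_step M (y : 'rV[int]_d) i : y \in lbox d M -> `|(dft_step R M *: rvec R y) 0 i| <= pi.
Proof.
rewrite mem_lbox => /forallP/(_ i) yi.
have yi' : `|(y 0%R i)%:~R| <= M%:R :> R.
  by rewrite -intr_norm -[M%:R]/(M%:Z%:~R) ler_int -abszE lez_nat.
rewrite !mxE normrM gtr0_norm ?dft_step_gt0//.
apply: le_trans (ler_wpM2l (ltW (dft_step_gt0 R M)) yi') _; rewrite /dft_step.
have -> : 2 * pi / M.*2.+1%:R * M%:R = pi * (2 * M%:R / M.*2.+1%:R) :> R by ring.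
by rewrite ler_piMr ?pi_ge0// ler_pdivrMr ?ltr0n// mul1r -natrM ler_nat mul2n.
Qed.

(** The inversion with every term bounded in modulus: only the order of magnitude is kept, which is
    enough for the tilts shifted with [n]. *)
Lemma lattice_local_bound (n : nat) (P : 'rV[int]_d -> R) (psi : 'rV[R]_d -> R[i]) (B c : R) x :
  (0 < n)%N -> 0 < c -> 0 <= B -> rsummable P ->
  (forall eta, csum (fun w => (P w)%:C * cexpi (dotp eta (rvec R w))) = psi eta) ->
  (forall eta : 'rV[R]_d, (forall i, `|eta 0 i| <= pi) -> nc (psi eta) <= B * expR (- (c * n%:R * dotp eta eta))) ->
  (2 * pi * Num.sqrt n%:R) ^+ d * `|P x| <= B * (gauss_value ((2 * c)%:M : 'M[R]_d) 0 + 1) + 1.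
Proof.
move=> n0 c0 B0 sP hP bP.
have S0 : 0 < Num.sqrt n%:R :> R by rewrite sqrtr_gt0 ltr0n.
have S2 : Num.sqrt n%:R ^+ 2 = n%:R :> R by rewrite sqr_sqrtr.
set S := Num.sqrt n%:R in S0 S2 *.
have L0 : 0 < (2 * pi * S) ^+ d by rewrite exprn_gt0// !mulr_gt0 ?pi_gt0.
set L := (2 * pi * S) ^+ d in L0 *.
have c2 : 0 < 2 * c by rewrite mulr_gt0.
have [h1 h1p hm] := gauss_mass d c2.
have eL : 0 < L^-1 by rewrite invr_gt0.
have [M1 hM1] := dft_inversion x (csummable_real sP) eL.
have [M2 hM2] := dft_step_small S0 h1p.
pose M := maxn M1 M2.
have [m1 m2] : (M1 <= M)%N /\ (M2 <= M)%N by rewrite /M !leq_max !leqnn !orbT.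
have inv := hM1 M m1.
set h := S * dft_step R M.
have h0 : 0 < h by rewrite mulr_gt0 ?dft_step_gt0.
have [gm1 gm2] := hm h h0 (hM2 M m2).
set T := \sum_(y <- _) _ in inv.
have hL : M.*2.+1%:R ^- d = L^-1 * h ^+ d.
  rewrite /L /h -!exprVn -exprMn; congr (_ ^+ _); rewrite /dft_step.
  have id3 (p q s : R) : 0 < p -> 0 < q -> 0 < s -> q^-1 = (2 * p * s)^-1 * (s * (2 * p / q)).
    by move=> p0 q0 s0; field; rewrite !gt_eqF.
  by apply: id3; rewrite ?pi_gt0 ?ltr0n.
have bT : h ^+ d * nc T <= B * (gauss_value ((2 * c)%:M : 'M[R]_d) 0 + 1).
  have hd0 : 0 <= h ^+ d by rewrite exprn_ge0 ?ltW.
  apply: le_trans (ler_wpM2l hd0 (nc_sum _ _ _)) _; rewrite mulr_sumr.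
  apply: le_trans (ler_wpM2l B0 gm2).
  apply: le_trans (_ : \sum_(y <- lbox d M) B * (h ^+ d * expR (- (2 * c * dotp (h *: rvec R y) (h *: rvec R y) / 2))) <= _).
    rewrite big_seq [leRHS]big_seq; apply: ler_sum => y yl.
    rewrite ncM nc_cexpi mul1r hP mulrCA ler_wpM2l//.
    apply: le_trans (bP _ (fun i => lbox_step i yl)) _.
    rewrite ler_wpM2l// ler_expR lerN2 /h -!scalerA !dotpZl !dotpZr -S2.
    by rewrite le_eqVlt; apply/orP; left; apply/eqP; field.
  rewrite -mulr_sumr ler_wpM2l//; apply: ler_sum_rsum => //; last exact: lbox_uniq.
  by move=> y; rewrite mulr_ge0 ?expR_ge0.
have -> : `|P x| = nc (P x)%:C by rewrite nc_real.
have -> : (P x)%:C = (M.*2.+1%:R ^- d)%:C * T - ((M.*2.+1%:R ^- d)%:C * T - (P x)%:C) by rewrite subKr.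
apply: le_trans (ler_wpM2l (ltW L0) (ncB _ _)) _; rewrite mulrDr; apply: lerD.
  rewrite hL ncM nc_real ger0_norm; last first.
    by apply: mulr_ge0; [exact: ltW|apply: exprn_ge0; exact: ltW].
  by rewrite mulrA mulrA mulfV ?mul1r ?gt_eqF.
by apply: le_trans (ler_wpM2l (ltW L0) inv) _; rewrite mulfV ?gt_eqF.
Qed.

(** Convex duality, from the nonnegativity of the form at [z Q^-1 - eta]. *)
Lemma fenchel (Q : 'M[R]_d) (z eta : 'rV[R]_d) : sym_posdef Q ->
  2 * dotp eta z - quad_form Q eta <= quad_form (invmx Q) z.
Proof.
move=> pd; have Qu := posdef_unit pd; have [sQ pos] := pd.
pose w := z *m invmx Q.
have wQ : w *m Q = z by rewrite /w mulmxKV.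
rewrite (quad_form_inv Qu wQ).
have q0 v : 0 <= quad_form Q v.
  by case: (eqVneq v 0) => [->|/pos/ltW//]; rewrite quad_form0.
have := q0 (w - eta); rewrite quad_formE mulmxBl dotpBl !dotpBr wQ -quad_formE.
rewrite (dotp_mul_sym _ _ sQ) wQ [dotp z w]dotpC [dotp z eta]dotpC; lra.
Qed.

(** Duality at plus and minus the [i]-th basis vector gives the exponential. The prefactor, which
    contains the determinant of [Q], is bounded by comparing lattice sums of two Gaussians on a
    common mesh, since [Q] dominates [2 c] times the Euclidean form. *)
Lemma gauss_value_tail (Q : 'M[R]_d) (c K : R) (z : 'rV[R]_d) i : sym_posdef Q -> 0 < c ->
  (forall xi, 2 * c * dotp xi xi <= quad_form Q xi) -> quad_form Q (delta_mx 0 i) <= K ->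
  gauss_value Q z <= (gauss_value ((2 * c)%:M : 'M[R]_d) 0 + 2) * expR (K / 2) * expR (- `|z 0 i|).
Proof.
move=> pd c0 low QK.
have c2 : 0 < 2 * c by rewrite mulr_gt0.
have [h1 h1p hm] := gauss_mass d c2.
have [dQ /(_ 0 1 ltr01) [h2 [h2p hQ]]] := gauss_fourier pd.
have b0 : gauss_value Q 0 <= gauss_value ((2 * c)%:M : 'M[R]_d) 0 + 2.
  pose h := Num.min h1 h2.
  have h0 : 0 < h by rewrite lt_min h1p.
  have [hh1 hh2] : h <= h1 /\ h <= h2 by rewrite !ge_min !lexx orbT.
  have [g1 g2] := hm h h0 hh1; have [q1 q2] := hQ h h0 hh2.
  have hd0 : 0 <= h ^+ d by rewrite exprn_ge0 ?ltW.
  have b : nc (csum (gauss_term Q 0 h)) <= gauss_value ((2 * c)%:M : 'M[R]_d) 0 + 1.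
    apply: le_trans g2; apply: nc_csum_le => // y.
    rewrite nc_gauss_term ?(ltW h0)// ler_wpM2l// ler_expR lerN2.
    by have := low (h *: rvec R y); lra.
  have : gauss_value Q 0 <= nc (csum (gauss_term Q 0 h)) + nc (csum (gauss_term Q 0 h) - (gauss_value Q 0)%:C).
    apply: le_trans (ler_norm _) _; rewrite -nc_real.
    have {1}-> : (gauss_value Q 0)%:C = csum (gauss_term Q 0 h) - (csum (gauss_term Q 0 h) - (gauss_value Q 0)%:C).
      by rewrite subKr.
    exact: ncB.
  by lra.
have e0 : gauss_value Q 0 = Num.sqrt ((2 * pi) ^+ d / \det Q).
  by rewrite /gauss_value quad_form0 mul0r oppr0 expR0 mulr1.
rewrite {1}/gauss_value -e0 -mulrA; apply: ler_pM; rewrite ?expR_ge0//.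
  by rewrite e0 sqrtr_ge0.
rewrite -expRD ler_expR.
have f1 := fenchel z (delta_mx 0 i) pd; have f2 := fenchel z (- delta_mx 0 i) pd.
have qN : quad_form Q (- delta_mx 0 i) = quad_form Q (delta_mx 0 i).
  by rewrite -scaleN1r quad_formZ sqrrN expr1n mul1r.
rewrite qN dotpNl in f2; rewrite dotpC dotp_delta in f1; rewrite dotpC dotp_delta in f2.
by case: (lerP 0 (z 0 i)) => zi; [rewrite ger0_norm//|rewrite ltr0_norm//]; lra.
Qed.

End local_bounds.

(** * Error bounds uniform over tilts with common constants *)

Section uniform_estimates.
Variables (R : realType) (d N : nat) (p : lattice_kernel R d N).
Hypothesis p_inv : invariant_kernel p.
Local Notation nc := (@ComplexField.Normc.normc R).
Local Notation "x %:C" := (real_complex R x) (at level 1, format "x %:C").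
Variables (C : 'rV[R]_d -> 'cV[R]_N) (nu : 'rV[R]_d -> 'rV[R]_N).
Hypothesis C_nu : PF_eigenvectors p C nu.
Variables (dl A : R) (m : nat) (a : R).
Hypotheses (d0 : (0 < d)%N) (dl0 : 0 < dl) (a0 : 0 < a) (m0 : (0 < m)%N).
Variable k0 : 'I_N.
Local Notation good u := (tilt_bounds p dl A m a u /\ lam p u = 1).
Local Notation rho := (ratio_ub N A m a).
Local Notation rate := (decay_rate d N A m a).
Local Notation b := (doeblin_const N A m a).
Local Notation K := (growth N dl A m a).
Local Notation nuh u := (\row_j (nu u 0 j * C u j 0)).
Local Notation Psi u := (doob_char p u (C u) (nu u)).
Local Notation drift u := (doob_drift p u (C u) (nu u)).
Local Notation cov u := (doob_cov p C nu u).

(** Larger than the entry of [A_mx] by the factor [(2 pi) ^ (d / 2)], so that only an integer power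
    of [sqrt n] occurs. *)
Definition llt_error (n : nat) (x : 'rV[int]_d) (u : 'rV[R]_d) (k j : 'I_N) : R :=
  (2 * pi * Num.sqrt n%:R) ^+ d * P_mx p n u x k j
  - C u k 0 * nu u 0 j * gauss_value (Q_mx p u) ((Num.sqrt n%:R)^-1 *: centered p n x u).

Lemma mul_delta_col (X : 'M[R[i]]_N) (t : R[i]) k j :
  (X *m delta_mx j 0 - t *: cmx (ones R N)) k 0 = X k j - t.
Proof.
have entry (Y Z : 'cV[R[i]]_N) : (Y - t *: Z) k 0 = Y k 0 - t * Z k 0 by rewrite !mxE.
rewrite entry [cmx _ k 0]mxE [ones _ _ k 0]mxE rmorph1 mulr1 mxE (bigD1 j)//= big1.
  by rewrite mxE !eqxx mulr1 addr0.
by move=> i /negPf ij; rewrite mxE ij mulr0.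
Qed.

Lemma transform_doob (w : 'rV[R]_d) (l : R) n k j (eta : 'rV[R]_d) : F_finite p w -> 0 < l ->
  (forall i, 0 < C w i 0) ->
  csum (fun x => (P_mx p n w x k j * (C w j 0 / (l ^+ n * C w k 0)))%:C * cexpi (dotp eta (rvec R x))) =
  (doob l%:C (cmx (C w)) (transform p w eta) ^+ n) k j.
Proof.
move=> fin l0 C0; have [s <-] : csummable (fun x => (P_mx p n w x k j)%:C * cexpi (dotp (rvec R x) eta)) /\
    csum (fun x => (P_mx p n w x k j)%:C * cexpi (dotp (rvec R x) eta)) * (C w j 0 / (l ^+ n * C w k 0))%:C =
    (doob l%:C (cmx (C w)) (transform p w eta) ^+ n) k j.
  have [s1 s2] := transform_pow p_inv fin eta n k j; split=> //.
  rewrite doob_pow; first by rewrite -s2 !mxE !rmorphM fmorphV rmorphM rmorphXn.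
    by move=> i; rewrite mxE; apply/eqP => -[] /eqP; rewrite gt_eqF.
  by apply/eqP => -[] /eqP; rewrite gt_eqF.
rewrite [RHS]mulrC -csumZ//; apply: eq_csum => x.
by rewrite rmorphM [dotp eta _]dotpC; ring.
Qed.

Lemma uniform_llt (e : R) : 0 < e -> exists n0 : nat, forall n, (n0 <= n)%N ->
  forall u, good u -> forall x k j, `|llt_error n x u k j| <= e.
Proof.
move=> e0.
(* One good tilt certifies the signs of the constants; without any the claim is vacuous. *)
case: (pselect (exists u, good u)) => [[u0 [ub0 ul0]]|h]; last first.
  by exists 0%N => n _ u gu; case: h; exists u.
have rate0 : 0 < rate := decay_rate_gt0 p_inv d0 dl0 a0 m0 k0 ub0.
have r0 : 0 < rho by apply: lt_le_trans (ratio_ub_ge1 p_inv dl0 a0 ub0 k0).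
pose V := gauss_value (rate%:M : 'M[R]_d) 0 + 3.
have V0 : 0 < V by rewrite ltr_wpDl// mulr_ge0 ?sqrtr_ge0 ?expR_ge0.
have e'0 : 0 < e / (rho * V) by apply: divr_gt0 => //; exact: mulr_gt0.
have [n1_ hn] := gaussian_domination N d m b K (expR_ge0 2) rate0 e'0.
exists (maxn 1 n1_) => n; rewrite geq_max => /andP[n0 nn1] u [ub ul] x k j.
have H := doob_expansion p_inv C_nu dl0 a0 k0 ub ul.
have dec : char_decay (expR 2) rate (Psi u).
  exact: (doob_char_decay p_inv C_nu d0 dl0 a0 m0 k0 ub ul).
have pd := doob_cov_posdef p_inv C_nu d0 dl0 a0 m0 k0 ub ul.
have [near far] := hn n nn1 _ _ _ _ _ H dec.
have [C0 FC nu0 nuF nuC] := PF_facts p_inv C_nu dl0 ub ul.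
have fin := tilt_F_finite p_inv dl0 ub.
have [nuj0 nuj1] := andP (nu_le1 (ce_doeblin H) j).
(* The law after Doob normalization; undoing the normalization at the end costs at most [rho]. *)
pose P x := P_mx p n u x k j * (C u j 0 / (1 ^+ n * C u k 0)).
have sP : rsummable P.
  have [s _] := P_mass p_inv fin n k j; have := rsummableZ (C u j 0 / (1 ^+ n * C u k 0)) s.
  by congr rsummable; apply/funext => y; rewrite mulrC.
have hP eta : csum (fun w => (P w)%:C * cexpi (dotp eta (rvec R w))) =
    cexpi (n%:R * dotp (drift u) eta) * (Psi u eta ^+ n) k j.
  rewrite (transform_doob n k j eta fin ltr01 C0) /doob_char scale_mx_exp mxE mulrA.
  rewrite -cexpi_mulrn -cexpiD mulNrn [n%:R * _]mulr_natl addrN cexpi0 mul1r.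
  by rewrite rmorph1.
have near' (xi : 'rV[R]_d) : (forall i, `|xi 0 i| <= pi * Num.sqrt n%:R) ->
    nc ((Psi u ((Num.sqrt n%:R)^-1 *: xi) ^+ n) k j - (nuh u 0 j * expR (- (quad_form (cov u) xi / 2)))%:C)
    <= e / (rho * V) * expR (- (rate * dotp xi xi / 2)).
  by move=> hxi; have := le_trans (entry_le_opn _ k 0) (near j xi hxi); rewrite mul_delta_col.
have := lattice_llt x n0 pd rate0 e'0 nuj0 nuj1 sP hP near' (far k0).
rewrite -/V => main.
rewrite /llt_error (Q_mx_doob_cov p_inv C_nu d0 dl0 a0 m0 k0 ub ul).
rewrite /centered (gradient_lam p_inv C_nu dl0 a0 m0 k0 ub ul).
set G := gauss_value _ _ in main *.
set L := (2 * pi * _) ^+ d in main *.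
have CN i : C u i 0 != 0 by rewrite gt_eqF.
have -> : L * P_mx p n u x k j - C u k 0 * nu u 0 j * G =
   (C u k 0 / C u j 0) * (L * P x - nuh u 0 j * G).
  by rewrite /P expr1n mul1r [(\row_j0 _) 0 j]mxE; field; rewrite !CN.
have q0 : 0 <= C u k 0 / C u j 0 by rewrite divr_ge0 ?ltW.
have qr : C u k 0 / C u j 0 <= rho.
  by rewrite ler_pdivrMr//; exact: (eigenvector_ratio p_inv dl0 a0 ub ltr01 C0 FC).
rewrite normrM ger0_norm//; apply: le_trans (ler_pM q0 (normr_ge0 _) qr main) _.
by rewrite le_eqVlt; apply/orP; left; apply/eqP; field; rewrite (gt_eqF V0) (gt_eqF r0).
Qed.

Local Notation a' := (a * expR (- (dl / 2))).
Local Notation rho' := (ratio_ub N A m a').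
Local Notation rate' := (decay_rate d N A m a').

Lemma n1_axis (h : R) (i : 'I_d) : n1 (h *: delta_mx 0 i : 'rV[R]_d) = `|h|.
Proof.
rewrite n1Z /n1 (bigD1 i)//= mxE !eqxx normr1 big1 ?addr0 ?mulr1//.
by move=> j /negPf ji; rewrite mxE ji andbF normr0.
Qed.

(* Tilting by [+- e_i / sqrt n] turns the uniform bound for the tilted kernel
   into exponential decay in the rescaled variable. *)
Lemma kernel_tail : exists B n0, 0 <= B /\ forall n, (n0 <= n)%N ->
  forall u, good u -> forall x k j i,
  (2 * pi * Num.sqrt n%:R) ^+ d * P_mx p n u x k j <=
  B * expR (- `|((Num.sqrt n%:R)^-1 *: centered p n x u) 0 i|).
Proof.
case: (pselect (exists u, good u)) => [[u0 [ub0 ul0]]|h]; last first.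
  by exists 0, 0%N; split=> // n _ u gu; case: h; exists u.
have dl2 : 0 < dl / 2 by rewrite divr_gt0.
have a'0 : 0 < a' by rewrite mulr_gt0 ?expR_gt0.
have wb0 : tilt_bounds p (dl / 2) A m a' u0.
  by apply: (tilt_shift p_inv dl0 a0 ub0) => i; rewrite subrr normr0 ltW.
have rate0 : 0 < rate' := decay_rate_gt0 p_inv d0 dl2 a'0 m0 k0 wb0.
have r0 : 0 < rho' by apply: lt_le_trans (ratio_ub_ge1 p_inv dl2 a'0 wb0 k0).
pose V := expR 2 * (gauss_value ((2 * rate')%:M : 'M[R]_d) 0 + 1) + 1.
have V0 : 0 <= V.
  by apply: addr_ge0 => //; apply: mulr_ge0 (expR_ge0 _) _; apply: addr_ge0 => //; rewrite mulr_ge0 ?sqrtr_ge0 ?expR_ge0.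
pose Kl := eigenvalue_const N dl A m a.
(* Guarantees [1 / sqrt n <= dl / 2], so that the shifted tilt keeps its bounds. *)
have [n1_ hn1] := archi_gt ((2 / dl) ^+ 2).
exists (rho' * V * expR Kl), (maxn 1 n1_); split.
  by apply: mulr_ge0 (mulr_ge0 (ltW r0) V0) (expR_ge0 _).
move=> n; rewrite geq_max => /andP[n0 nn1] u [ub ul] x k j i.
have S0 : 0 < Num.sqrt n%:R :> R by rewrite sqrtr_gt0 ltr0n.
have S2 : Num.sqrt n%:R ^+ 2 = n%:R :> R by rewrite sqr_sqrtr.
set S := Num.sqrt n%:R in S0 S2 *.
rewrite /centered (gradient_lam p_inv C_nu dl0 a0 m0 k0 ub ul).
set z := S^-1 *: _.
(* The tilt points in the direction of the coordinate, so that removing it yields the exponential of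
   minus its absolute value. *)
pose sg : R := if 0 <= z 0 i then 1 else -1.
have sgz : sg * z 0 i = `|z 0 i|.
  rewrite /sg; case: (lerP 0 (z 0 i)) => zi; first by rewrite mul1r ger0_norm.
  by rewrite mulN1r ltr0_norm.
have sg1 : `|sg| = 1 by rewrite /sg; case: ifP; rewrite ?normrN normr1.
pose v : 'rV[R]_d := (sg / S) *: delta_mx 0 i.
have nv : n1 v = S^-1 by rewrite n1_axis normrM sg1 mul1r gtr0_norm ?invr_gt0.
have v1 : n1 v <= 1.
  rewrite nv invf_le1// -[leLHS]sqrtr1; apply: ler_wsqrtr; by rewrite ler1n.
have v2 : n1 v <= dl / 2.
  rewrite nv -[leRHS]invf_div lef_pV2 ?posrE ?divr_gt0//.
  rewrite -[leLHS]ger0_norm ?divr_ge0 ?(ltW dl0)// -sqrtr_sqr; apply: ler_wsqrtr.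
  by apply: le_trans (ltW hn1) _; rewrite ler_nat.
have vi i' : `|(u + v) 0 i' - u 0 i'| <= dl / 2.
  by rewrite mxE addrAC subrr add0r (le_trans (coord_le_n1 v i')).
have wb := tilt_shift p_inv dl0 a0 ub vi.
have wfin := tilt_F_finite p_inv dl2 wb.
have [/(_ _ wfin) [FC _ C0 _ _] _] := C_nu.
have l0 := lam_gt0 p_inv C_nu m0 k0 dl2 a'0 wb.
have lexp := lam_expansion p_inv C_nu dl0 a0 m0 k0 ub ul v1 v2.
set w := u + v in wb wfin FC C0 l0 lexp *.
set l := lam p w in FC l0 lexp.
pose P y := P_mx p n w y k j * (C w j 0 / (l ^+ n * C w k 0)).
have ln0 : 0 < l ^+ n by rewrite exprn_gt0.
have sP : rsummable P.
  have [s _] := P_mass p_inv wfin n k j; have := rsummableZ (C w j 0 / (l ^+ n * C w k 0)) s.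
  by congr rsummable; apply/funext => y; rewrite mulrC.
have hP eta := transform_doob n k j eta wfin l0 C0.
have bP (eta : 'rV[R]_d) : (forall i, `|eta 0 i| <= pi) ->
   nc ((doob l%:C (cmx (C w)) (transform p w eta) ^+ n) k j) <= expR 2 * expR (- (rate' * n%:R * dotp eta eta)).
  move=> h; apply: le_trans (entry_le_opn _ _ _) _.
  exact: (doob_transform_decay p_inv dl2 a'0 m0 wb l0 C0 FC k0 n d0 h).
have loc := lattice_local_bound x n0 rate0 (expR_ge0 2) sP hP bP.
rewrite -/S -/V in loc; set L := (2 * pi * S) ^+ d in loc *.
have L0 : 0 < L by rewrite exprn_gt0// !mulr_gt0 ?pi_gt0.
have Pw0 := P_mx_ge0 p_inv w n x k j.
have CN i' : C w i' 0 != 0 by rewrite gt_eqF.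
have qr : C w k 0 / C w j 0 <= rho'.
  by rewrite ler_pdivrMr//; exact: (eigenvector_ratio p_inv dl2 a'0 wb l0 C0 FC).
have q0 : 0 <= C w k 0 / C w j 0 by rewrite divr_ge0 ?ltW.
have P0 : 0 <= P x by rewrite mulr_ge0// divr_ge0 ?mulr_ge0 ?(ltW ln0) ?(ltW (C0 _)).
rewrite (ger0_norm P0) in loc.
have bw : L * P_mx p n w x k j <= l ^+ n * (rho' * V).
  have -> : L * P_mx p n w x k j = l ^+ n * ((C w k 0 / C w j 0) * (L * P x)).
    by rewrite /P; field; rewrite !CN gt_eqF.
  rewrite ler_wpM2l ?(ltW ln0)//; apply: ler_pM => //.
  by rewrite mulr_ge0 ?(ltW L0).
(* The eigenvalue at the shifted tilt need not be 1, but [n * n1 v ^+ 2 = 1], so its [n]-th power is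
   the exponential of [n] times the drift along [v], up to the constant [exp Kl]. *)
have lexpn : l ^+ n <= expR (n%:R * dotp (drift u) v + Kl).
  apply: le_trans (_ : expR (l - 1) ^+ n <= _).
    apply: lerXn2r; rewrite ?nnegrE ?expR_ge0 ?(ltW l0)//.
    by apply: le_trans (expR_ge1Dx _); rewrite addrC subrK.
  rewrite -expRM_natl ler_expR.
  have le1 : l - 1 <= dotp (drift u) v + Kl * n1 v ^+ 2.
    by have := le_trans (ler_norm _) lexp; rewrite lerBlDl.
  apply: le_trans (ler_wpM2l (ler0n _ n) le1) _.
  by rewrite mulrDr nv exprVn S2 mulrCA mulfV ?mulr1// pnatr_eq0 -lt0n.
have PE : P_mx p n u x k j = expR (- dotp v (rvec R x)) * P_mx p n w x k j.
  by rewrite !mxE /w dotpDl expRD expRN mulrCA [X in _ = _ * X]mulrC mulrK ?unitfE ?gt_eqF ?expR_gt0.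
rewrite PE mulrCA; apply: le_trans (ler_wpM2l (expR_ge0 _) bw) _.
apply: le_trans (ler_wpM2l (expR_ge0 _) (ler_wpM2r (mulr_ge0 (ltW r0) V0) lexpn)) _.
rewrite [leLHS]mulrA -expRD [leLHS]mulrC -[leRHS]mulrA -expRD.
apply: ler_wpM2l; first exact: mulr_ge0 (ltW r0) V0.
rewrite ler_expR.
have -> : - dotp v (rvec R x) + (n%:R * dotp (drift u) v + Kl) = Kl - dotp v (rvec R x - n%:R *: drift u).
  by rewrite dotpBr dotpZr [dotp v (drift u)]dotpC; ring.
rewrite lerD2l lerN2 -sgz /z /v dotpZl [dotp (delta_mx _ _) _]dotpC dotp_delta.
by rewrite [X in sg * X <= _]mxE mulrA.
Qed.

(** The two terms of the error decay separately: the kernel by tilting, the Gaussian by convex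
    duality. *)
Lemma llt_error_tail : exists B n0, 0 <= B /\ forall n, (n0 <= n)%N ->
  forall u, good u -> forall x k j i,
  `|llt_error n x u k j| <= B * expR (- `|((Num.sqrt n%:R)^-1 *: centered p n x u) 0 i|).
Proof.
case: (pselect (exists u, good u)) => [[u0 [ub0 ul0]]|h]; last first.
  by exists 0, 0%N; split=> // n _ u gu; case: h; exists u.
have rate0 : 0 < rate := decay_rate_gt0 p_inv d0 dl0 a0 m0 k0 ub0.
have r0 : 0 < rho by apply: lt_le_trans (ratio_ub_ge1 p_inv dl0 a0 ub0 k0).
have [B [n0 [B0 hB]]] := kernel_tail.
pose B' := rho * ((gauss_value ((2 * rate)%:M : 'M[R]_d) 0 + 2) * expR (KQ m b K / 2)).
have B'0 : 0 <= B'.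
  apply: mulr_ge0 (ltW r0) (mulr_ge0 (addr_ge0 _ _) (expR_ge0 _)) => //.
  by rewrite mulr_ge0 ?sqrtr_ge0 ?expR_ge0.
exists (B + B'), n0; split; first exact: addr_ge0.
move=> n nn u [ub ul] x k j i.
have H := doob_expansion p_inv C_nu dl0 a0 k0 ub ul.
have pd := doob_cov_posdef p_inv C_nu d0 dl0 a0 m0 k0 ub ul.
have low := doob_cov_lower p_inv C_nu d0 dl0 a0 m0 k0 ub ul.
have [C0 FC nu0 nuF nuC] := PF_facts p_inv C_nu dl0 ub ul.
have Qi : quad_form (cov u) (delta_mx 0 i) <= KQ m b K.
  have := eff_cov_bound H (delta_mx 0 i).
  have := n1_axis 1 i; rewrite scale1r normr1 => ->; rewrite expr1n mulr1.
  exact: le_trans (ler_norm _).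
rewrite /llt_error; apply: le_trans (ler_normB _ _) _; rewrite [leRHS]mulrDl; apply: lerD.
  rewrite ger0_norm; first exact: (hB n nn u (conj ub ul)).
  by rewrite mulr_ge0 ?P_mx_ge0// exprn_ge0// !mulr_ge0 ?pi_ge0 ?sqrtr_ge0.
rewrite (Q_mx_doob_cov p_inv C_nu d0 dl0 a0 m0 k0 ub ul).
set z := _ *: centered _ _ _ _.
have tail := gauss_value_tail z pd rate0 low Qi.
have nuj : nu u 0 j * C u j 0 <= 1.
  by have [_] := andP (nu_le1 (ce_doeblin H) j); rewrite mxE.
have g0 : 0 <= gauss_value (cov u) z by rewrite mulr_ge0 ?sqrtr_ge0 ?expR_ge0.
have Ckj : C u k 0 * nu u 0 j <= rho.
  have := eigenvector_ratio p_inv dl0 a0 ub ltr01 C0 FC j k => h.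
  apply: le_trans (ler_wpM2r (ltW (nu0 j)) h) _.
  by rewrite -mulrA [C u j 0 * _]mulrC ler_piMr// ltW.
have Ckj0 : 0 <= C u k 0 * nu u 0 j by rewrite mulr_ge0 ?ltW.
rewrite normrM (ger0_norm Ckj0) (ger0_norm g0) /B' -[leRHS]mulrA.
exact: ler_pM.
Qed.

End uniform_estimates.

(** * Uniformity on compact sets *)

Section compactness.
Variables (R : realType) (d N : nat) (p : lattice_kernel R d N).
Hypotheses (p_inv : invariant_kernel p) (p_irr : strongly_irreducible p).
Variable U : set 'rV[R]_d.
Hypotheses (U_compact : compact U) (U_domain : U `<=` F_domain p).

Local Notation moment dl u k j :=
  (fun x => p (0, k) (x, j) * expR (dotp u (rvec R x) + dl * n1 (rvec R x))).

(* The orthant containing [x] turns the exponential of the l1 norm into one of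
   finitely many exponentials of linear forms. *)
Lemma moment_near (u0 : 'rV[R]_d) (dl : R) : 0 < dl ->
  (forall w : 'rV[R]_d, (forall i, `|w 0 i - u0 0 i| <= 2 * dl) -> F_finite p w) ->
  exists A : R, forall u : 'rV[R]_d, (forall i, `|u 0 i - u0 0 i| <= dl) -> forall k j,
    rsummable (moment dl u k j) /\ rsum (moment dl u k j) <= A.
Proof.
move=> dl0 fin; pose sg (s : {ffun 'I_d -> bool}) : 'rV[R]_d := \row_i (if s i then 1 else -1).
pose w s := u0 + (2 * dl) *: sg s.
have wfin s : F_finite p (w s).
  apply: fin => i; rewrite !mxE addrAC subrr add0r normrM gtr0_norm ?mulr_gt0//.
  by case: (s i); rewrite ?normrN normr1 mulr1.
pose T k j x := \sum_s p (0, k) (x, j) * expR (dotp (w s) (rvec R x)).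
have sT k j : rsummable (T k j).
  by apply: rsummable_sum => s _; have h := F_summable p_inv (wfin s) k j; exact: h.
exists (\sum_k \sum_j rsum (T k j)) => u hu k j.
have pos (k' j' : 'I_N) s x : 0 <= p (0, k') (x, j') * expR (dotp (w s) (rvec R x)).
  by rewrite mulr_ge0 ?kernel_ge0 ?expR_ge0.
have le x : moment dl u k j x <= T k j x.
  pose s : {ffun 'I_d -> bool} := [ffun i => 0 <= rvec R x 0 i].
  apply: le_trans (_ : p (0, k) (x, j) * expR (dotp (w s) (rvec R x)) <= _); last first.
    by rewrite /T (bigD1 s)//= lerDl sumr_ge0.
  rewrite ler_wpM2l ?kernel_ge0// ler_expR.
  have sE : dotp (sg s) (rvec R x) = n1 (rvec R x).
    rewrite /dotp /n1; apply: eq_bigr => i _; rewrite /s [sg _ 0 i]mxE ffunE.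
    case: (lerP 0 (rvec R x 0 i)) => h; first by rewrite mul1r ger0_norm.
    by rewrite mulN1r ltr0_norm.
  rewrite /w dotpDl dotpZl sE.
  have -> : u = u0 + (u - u0) by rewrite addrC subrK.
  have hu' i : `|(u - u0) 0 i| <= dl by rewrite !mxE.
  rewrite dotpDl -addrA lerD2l.
  by have := le_trans (ler_norm _) (dotp_le_n1 (rvec R x) hu'); lra.
have m0 x : 0 <= moment dl u k j x by rewrite mulr_ge0 ?kernel_ge0 ?expR_ge0.
have s1 : rsummable (moment dl u k j).
  by apply: rsummable_le (sT k j) => x; rewrite ger0_norm.
split=> //; apply: le_trans (ler_rsum s1 (sT k j) le) _.
have T0 k' j' : 0 <= rsum (T k' j') by apply: rsum_ge0 => x; apply: sumr_ge0.
rewrite (bigD1 k)//= (bigD1 j)//= -addrA lerDl addr_ge0 ?sumr_ge0//.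
by move=> k' _; apply: sumr_ge0.
Qed.

Lemma moment_mono (dl dl' : R) u k j : dl' <= dl -> rsummable (moment dl u k j) ->
  rsummable (moment dl' u k j) /\ rsum (moment dl' u k j) <= rsum (moment dl u k j).
Proof.
move=> le s.
have h x : moment dl' u k j x <= moment dl u k j x.
  by rewrite ler_wpM2l ?kernel_ge0// ler_expR lerD2l ler_wpM2r ?n1_ge0.
have s' : rsummable (moment dl' u k j).
  by apply: rsummable_le s => x; rewrite ger0_norm// mulr_ge0 ?kernel_ge0 ?expR_ge0.
by split=> //; exact: ler_rsum.
Qed.

(** A single integer [n] controls the inverse margin, the moments and the coordinates. All three
    bounds hold near each point for large [n], and compactness gives a common [n]. *)
Lemma compact_moments : exists dl A B : R, [/\ 0 < dl, 0 <= B & forall u, U u ->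
  (forall k j, rsummable (moment dl u k j) /\ rsum (moment dl u k j) <= A) /\
  (forall i, `|u 0 i| <= B)].
Proof.
pose P (n : nat) (u : 'rV[R]_d) :=
  (forall k j, rsummable (moment n.+1%:R^-1 u k j) /\ rsum (moment n.+1%:R^-1 u k j) <= n%:R) /\
  (forall i, `|u 0 i| <= n%:R).
have cov : \forall n \near \oo, U `<=` P n.
  move: U_compact => /compact_near_coveringP; apply => u0 Uu0.
  have := U_domain Uu0; rewrite /F_domain => /nbhs_normP[r /= r0 hr].
  have coord (v w : 'rV[R]_d) (c : R) i : `|v - w| < c -> `|w 0 i - v 0 i| <= c.
    move=> vw; apply: le_trans (ltW vw).
    rewrite [leRHS]mx_normrE -(normrN (w 0 i - v 0 i)) opprB.
    have -> : v 0 i - w 0 i = (v - w) 0 i by rewrite !mxE.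
    exact: (@le_bigmax _ _ _ 0 (fun z : 'I_1 * 'I_d => `|(v - w) z.1 z.2|) (0, i)).
  pose dl := r / 4; have dl0 : 0 < dl by rewrite divr_gt0.
  have fin (w : 'rV[R]_d) : (forall i, `|w 0 i - u0 0 i| <= 2 * dl) -> F_finite p w.
    move=> hw; apply: hr => /=.
    apply: le_lt_trans (_ : 2 * dl < r); last by rewrite /dl; lra.
    rewrite [leLHS]mx_normrE; apply/bigmax_leP; split; first by rewrite mulr_ge0// ltW.
    by move=> [i' i] _ /=; rewrite ord1 !mxE -normrN opprB.
  have [A hA] := moment_near dl0 fin.
  pose X := `|A| + \sum_i `|u0 0 i| + dl + dl^-1.
  have [n0 hn0] := archi_gt X.
  exists (ball_ Num.norm u0 dl, [set n | (n0 <= n)%N]).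
    split=> /=; last exact: nbhs_infty_ge.
    have b0 : \forall v \near u0, ball_ Num.norm u0 dl v by apply/nbhs_normP; exists dl.
    exact: b0.
  move=> [u n] [/= hu hn].
  have Xn : X <= n%:R by apply: le_trans (ltW hn0) _; rewrite ler_nat.
  have sn : 0 <= \sum_i `|u0 0 i| by apply: sumr_ge0.
  have dli : 0 < dl^-1 by rewrite invr_gt0.
  have ui i := coord _ _ _ i hu.
  split=> [k j|i].
    have [s1 s2] := hA u ui k j.
    have le : n.+1%:R^-1 <= dl.
      rewrite -[leRHS]invrK lef_pV2 ?posrE ?invr_gt0 ?ltr0n//.
      apply: le_trans (_ : n%:R <= _); last by rewrite ler_nat.
      by apply: le_trans Xn; rewrite /X; have := normr_ge0 A; lra.
    have [t1 t2] := moment_mono le s1.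
    split=> //; apply: le_trans t2 _; apply: le_trans s2 _; apply: le_trans Xn.
    by rewrite /X; have := ler_norm A; lra.
  have h1 : `|u0 0 i| <= \sum_i `|u0 0 i| := coord_le_n1 u0 i.
  have -> : u 0 i = u0 0 i + (u 0 i - u0 0 i) by rewrite addrC subrK.
  apply: le_trans (ler_normD _ _) _; have := ui i; have := normr_ge0 A.
  by move: Xn; rewrite /X; lra.
have [n hn] := filter_ex cov.
by exists n.+1%:R^-1, n%:R, n%:R; split=> // u /hn.
Qed.

(** Strong irreducibility is used at 0 and at the basis vectors only, so finitely many thresholds
    occur and [m] exceeds all of them. Tilting at such a point costs at most [exp (- B)]. *)
Lemma compact_tilt_bounds : exists (dl A : R) (m : nat) (a : R),
  [/\ 0 < dl, 0 < a, (0 < m)%N & forall u, U u -> tilt_bounds p dl A m a u].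
Proof.
have [dl [A [B [dl0 B0 hU]]]] := compact_moments.
pose pt (o : option 'I_d) : 'rV[int]_d := if o is Some i then delta_mx 0 i else 0.
pose I := ('I_N * 'I_N * option 'I_d)%type.
have [f hf] := @choice I nat (fun t n0 => forall n, (n0 <= n)%N -> 0 < conv_pow p n (0, t.1.1) (pt t.2, t.1.2))
  (fun t => p_irr t.1.1 t.1.2 0 (pt t.2)).
pose m := (\max_(t : I) f t).+1.
pose c (t : I) := conv_pow p m (0, t.1.1) (pt t.2, t.1.2).
have c0 t : 0 < c t by apply: hf; rewrite leqW// (leq_bigmax t).
(* [1 / s] plays the role of the minimum of the [c t]; the summand 1 keeps it meaningful for an
   empty index set. *)
pose s := 1 + \sum_t (c t)^-1.
have s0 : 0 < s by rewrite ltr_pwDl// sumr_ge0// => t _; rewrite invr_ge0 ltW.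
have cs t : s^-1 <= c t.
  rewrite -[leRHS]invrK lef_pV2 ?posrE ?invr_gt0// /s (bigD1 t)//=.
  by rewrite addrCA lerDl addr_ge0// sumr_ge0// => t' _; rewrite invr_ge0 ltW.
exists dl, A, m, (s^-1 * expR (- B)); split=> //; first by rewrite mulr_gt0 ?invr_gt0 ?expR_gt0.
move=> u /hU[h1 h2].
have low t : - B <= dotp u (rvec R (pt t.2)) -> s^-1 * expR (- B) <= P_mx p m u (pt t.2) t.1.1 t.1.2.
  move=> h; rewrite mxE; apply: ler_pM; rewrite ?invr_ge0 ?(ltW s0) ?expR_ge0 ?ler_expR//; exact: (cs t).
split=> [k j|k j|k j|i k j]; try by case: (h1 k j).
  by apply: (low (k, j, None)); rewrite /= rvec0 dotpC dotp0l oppr_le0.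
apply: (low (k, j, Some i)); rewrite /= rvec_delta dotp_delta.
by have := h2 i; rewrite ler_norml => /andP[].
Qed.

End compactness.

(** * Polynomial weights and normalization of the error *)

Section normalization.
Variables (R : realType) (d N : nat) (p : lattice_kernel R d N).

(** From [1 + r <= t exp (r / t)] with [t] so large that [n / t <= c]. *)
Lemma pow_exp_bounded (c : R) (n : nat) : 0 < c -> exists2 B : R, 0 < B & forall r, 0 <= r ->
  (1 + r) ^+ n * expR (- (c * r)) <= B.
Proof.
move=> c0; pose t := 1 + n%:R / c.
have t1 : 1 <= t by rewrite lerDl divr_ge0 ?(ltW c0).
have t0 : 0 < t by apply: lt_le_trans t1.
exists (t ^+ n); first by rewrite exprn_gt0.
move=> r r0; rewrite expRN ler_pdivrMr ?expR_gt0//.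
apply: le_trans (_ : (t * expR (r / t)) ^+ n <= _).
  apply: lerXn2r; rewrite ?nnegrE.
  - by rewrite addr_ge0.
  - by apply: mulr_ge0 (ltW t0) (expR_ge0 _).
  apply: le_trans (_ : t * (1 + r / t) <= _); last by rewrite ler_wpM2l ?expR_ge1Dx ?(ltW t0).
  by rewrite mulrDr mulr1 mulrCA mulfV ?gt_eqF// mulr1 lerD2r.
rewrite exprMn -expRM_natl ler_wpM2l ?exprn_ge0 ?(ltW t0)// ler_expR.
have -> : n%:R * (r / t) = r * (n%:R / t) by ring.
rewrite [leRHS]mulrC ler_wpM2l// ler_pdivrMr// /t mulrDr mulr1 mulrC divfK ?gt_eqF//.
by rewrite lerDr ltW.
Qed.

(** With the base [1 + r] the power is monotone in the exponent, so one integer exponent serves all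
    [gamma] up to [gamma0]. *)
Lemma powR_le_pow (r g : R) (G : nat) : 0 <= r -> 0 <= g -> g <= G%:R -> r `^ g <= (1 + r) ^+ G.
Proof.
move=> r0 g0 gG; have r1 : 0 <= 1 + r by rewrite addr_ge0.
rewrite -powR_mulrn//; apply: le_trans (_ : (1 + r) `^ g <= _).
  by apply: ge0_ler_powR; rewrite ?nnegrE// lerDr.
by apply: ler_powR; rewrite // lerDl.
Qed.

Variables (C : 'rV[R]_d -> 'cV[R]_N) (nu : 'rV[R]_d -> 'rV[R]_N).

Lemma A_mx_error n x u k j : (0 < n)%N -> 0 < \det (Q_mx p u) ->
  A_mx p C nu n x u k j = (2 * pi) `^ (- (d%:R / 2)) * llt_error p C nu n x u k j.
Proof.
move=> n0 det0; set c : R := 2 * pi.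
have c0 : 0 < c by rewrite mulr_gt0 ?pi_gt0.
have np : 0 <= n%:R :> R by [].
have cd : c `^ (- (d%:R / 2)) * c ^+ d = c `^ (d%:R / 2).
  rewrite -powR_mulrn ?(ltW c0)// -powRD; last by rewrite (gt_eqF c0) implybT.
  by congr (_ `^ _); field.
have e1 : (c * n%:R) `^ (d%:R / 2) = c `^ (- (d%:R / 2)) * (c * Num.sqrt n%:R) ^+ d.
  rewrite powRM ?(ltW c0)// exprMn mulrA cd; congr (_ * _).
  by rewrite mulrC powRrM powR12_sqrt// powR_mulrn ?sqrtr_ge0.
have sd : Num.sqrt (c ^+ d / \det (Q_mx p u)) = c `^ (d%:R / 2) * \det (Q_mx p u) `^ (- 2^-1).
  rewrite sqrtrM ?exprn_ge0 ?(ltW c0)// powRN powR12_sqrt ?(ltW det0)//.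
  rewrite sqrtrV ?(ltW det0)// powRrM powR_mulrn ?(ltW c0)// powR12_sqrt// exprn_ge0 ?ltW//.
have cc : c `^ (- (d%:R / 2)) * c `^ (d%:R / 2) = 1.
  by rewrite powRN mulVf// gt_eqF// powR_gt0.
have qz : quad_form (invmx (Q_mx p u)) ((Num.sqrt n%:R)^-1 *: centered p n x u) =
    n%:R^-1 * quad_form (Sigma_mx p u) (centered p n x u).
  by rewrite quad_formZ exprVn sqr_sqrtr.
rewrite /A_mx /llt_error /gauss_value -/c sd qz.
have entry (X Y : 'M[R]_N) (s t : R) : (s *: X - t *: Y) k j = s * X k j - t * Y k j by rewrite !mxE.
rewrite entry e1.
have -> : (C u *m nu u) k j = C u k 0 * nu u 0 j by rewrite mxE big_ord1.
have -> : - (2 * n%:R)^-1 * quad_form (Sigma_mx p u) (centered p n x u) =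
   - (n%:R^-1 * quad_form (Sigma_mx p u) (centered p n x u) / 2).
  by rewrite invfM; ring.
move: (expR _) (\det _ `^ _) (P_mx _ _ _ _ k j) ((c * _) ^+ d) (C u k 0) (nu u 0 j) cc.
move: (c `^ (- (d%:R / 2))) (c `^ (d%:R / 2)) => ci cp ex dt P L Ck nj cc.
have -> : ci * (L * P - Ck * nj * (cp * dt * ex)) = ci * L * P - (ci * cp) * (dt * ex * (Ck * nj)) by ring.
by rewrite cc mul1r.
Qed.

End normalization.

Section main.
Variables (R : realType) (d N : nat) (p : lattice_kernel R d N).
Hypotheses (p_inv : invariant_kernel p) (p_irr : strongly_irreducible p).
Variables (C : 'rV[R]_d -> 'cV[R]_N) (nu : 'rV[R]_d -> 'rV[R]_N).
Hypotheses (d0 : (0 < d)%N) (C_nu : PF_eigenvectors p C nu).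
Variable gamma0 : R.

Lemma scaled_norm n x u : (0 < n)%N ->
  euclid_norm (centered p n x u) / Num.sqrt n%:R = euclid_norm ((Num.sqrt n%:R)^-1 *: centered p n x u).
Proof.
move=> n0; have S0 : 0 < Num.sqrt n%:R :> R by rewrite sqrtr_gt0 ltr0n.
rewrite /euclid_norm dotpZl dotpZr mulrA -expr2 sqrtrM ?sqr_ge0// sqrtr_sqr.
by rewrite gtr0_norm ?invr_gt0// mulrC.
Qed.

Lemma euclid_le_coord (z : 'rV[R]_d) : exists i, euclid_norm z <= d%:R * `|z 0 i|.
Proof.
have [i hi] := max_coord z d0; exists i.
have dp : 0 < d%:R :> R by rewrite ltr0n.
have d1 : 1 <= d%:R :> R by rewrite ler1n.
rewrite -[leRHS]ger0_norm ?mulr_ge0// -sqrtr_sqr; apply: ler_wsqrtr.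
rewrite exprMn real_normK ?num_real//.
move: hi; rewrite ler_pdivrMr// => hi; apply: le_trans hi _.
by rewrite mulrC ler_wpM2r ?sqr_ge0// expr2 ler_peMl// ltW.
Qed.

Lemma uniform_convergence (U : set 'rV[R]_d) : compact U -> U `<=` H_set p ->
  forall e : R, 0 < e -> exists n0 : nat, forall n, (n0 <= n)%N ->
  forall (x : 'rV[int]_d) (u : 'rV[R]_d) (gamma : R), U u -> 0 <= gamma <= gamma0 ->
  forall k j, `|At_mx p C nu n x u gamma k j| < e.
Proof.
move=> Uc UH e e0.
case: (pselect (exists k : 'I_N, True)) => [[k0 _]|hN]; last first.
  by exists 0%N => n _ x u g _ _ k; case: hN; exists k.
have UF : U `<=` F_domain p by move=> u /UH[].
have [dl [A [m [a [dl0 a0 m0 hU]]]]] := compact_tilt_bounds p_inv p_irr Uc UF.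
have good u : U u -> tilt_bounds p dl A m a u /\ lam p u = 1 by move=> Uu; split; [exact: hU|case: (UH u Uu)].
have [B [n1_ [B0 hB]]] := llt_error_tail p_inv C_nu A d0 dl0 a0 m0 k0.
have [G hG] := archi_gt gamma0.
have dp : 0 < d%:R :> R by rewrite ltr0n.
have di : 0 < d%:R^-1 :> R by rewrite invr_gt0.
(* The exponent is doubled because the estimate is made for squares. The rate [1 / d] is what
   remains when the largest coordinate is replaced by the Euclidean norm. *)
have [M M0 hM] := pow_exp_bounded (G * 2) di.
have X0 : 0 < B * M + 1 by rewrite ltr_wpDl// mulr_ge0 ?(ltW M0).
(* This accuracy makes the product of the uniform bound and the tail bound, weighted by the squared
   power of [1 + r], strictly smaller than [e ^+ 2]. *)
have e'0 : 0 < e ^+ 2 / (B * M + 1) by rewrite divr_gt0// exprn_gt0.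
have [n2 hE] := uniform_llt p_inv C_nu A d0 dl0 a0 m0 k0 e'0.
exists (maxn (maxn 1 n1_) n2) => n; rewrite !geq_max => /andP[/andP[n0 nn1] nn2].
move=> x u g Uu /andP[g0 gg] k j.
have gu := good u Uu; have [ub ul] := gu.
have det0 : 0 < \det (Q_mx p u).
  rewrite (Q_mx_doob_cov p_inv C_nu d0 dl0 a0 m0 k0 ub ul).
  by have [] := gauss_fourier (doob_cov_posdef p_inv C_nu d0 dl0 a0 m0 k0 ub ul).
rewrite /At_mx mxE (A_mx_error C nu x k j n0 det0) (scaled_norm x u n0).
set z := _ *: centered p n x u.
have [i hi] := euclid_le_coord z.
set r := euclid_norm z in hi *; have r0 : 0 <= r := sqrtr_ge0 _.
have E1 := hE n nn2 u gu x k j; have E2 := hB n nn1 u gu x k j i.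
rewrite -/z in E2; set E := llt_error _ _ _ _ _ _ _ _ in E1 E2 *.
have c1 : (2 * pi) `^ (- (d%:R / 2)) <= 1 :> R.
  rewrite powRN invf_le1 ?powR_gt0 ?mulr_gt0 ?pi_gt0//.
  rewrite -[leLHS](powRr0 (2 * pi)); apply: ler_powR; last by rewrite divr_ge0.
  by have := pi_ge2 R; lra.
have rG : r `^ g <= (1 + r) ^+ G by apply: powR_le_pow => //; apply: le_trans gg (ltW hG).
have bound : `|r `^ g * ((2 * pi) `^ (- (d%:R / 2)) * E)| <= (1 + r) ^+ G * `|E|.
  rewrite normrM (ger0_norm (powR_ge0 _ _)); apply: ler_pM => //; first exact: powR_ge0.
  by rewrite normrM (ger0_norm (powR_ge0 _ _)) ler_piMl.
apply: le_lt_trans bound _.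
have EE : `|E| ^+ 2 <= e ^+ 2 / (B * M + 1) * (B * expR (- (d%:R^-1 * r))).
  rewrite expr2; apply: ler_pM => //; apply: le_trans E2 _.
  rewrite ler_wpM2l// ler_expR lerN2 mulrC ler_pdivrMr//.
  by rewrite mulrC.
have p0 : 0 <= (1 + r) ^+ G by rewrite exprn_ge0// addr_ge0.
rewrite -(ltr_pXn2r (_ : 0 < 2)%N) ?nnegrE ?mulr_ge0 ?(ltW e0)//.
rewrite exprMn -exprM.
apply: le_lt_trans (ler_wpM2l _ EE) _; first by rewrite exprn_ge0// addr_ge0.
have -> : (1 + r) ^+ (G * 2) * (e ^+ 2 / (B * M + 1) * (B * expR (- (d%:R^-1 * r)))) =
  e ^+ 2 / (B * M + 1) * (B * ((1 + r) ^+ (G * 2) * expR (- (d%:R^-1 * r)))) by ring.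
apply: le_lt_trans (_ : e ^+ 2 / (B * M + 1) * (B * M) < _).
  by rewrite ler_wpM2l ?(ltW e'0)// ler_wpM2l// hM.
rewrite mulrAC -mulrA gtr_pMr ?exprn_gt0// ltr_pdivrMr// mul1r.
by rewrite ltrDl.
Qed.

End main.

Theorem proposition3p11 (R : realType) (d N : nat) (hd : (1 <= d)%N) (hN : (1 <= N)%N)
    (p : lattice_kernel R d N)
    (p_inv : invariant_kernel p) (p_irr : strongly_irreducible p)
    (C : 'rV[R]_d -> 'cV[R]_N) (nu : 'rV[R]_d -> 'rV[R]_N)
    (C_nu : PF_eigenvectors p C nu)
    (gamma0 : R) (gamma0_ge0 : 0 <= gamma0) :
  (forall (x : 'rV[int]_d) (u : 'rV[R]_d) (gamma : R),
     H_set p u -> 0 <= gamma <= gamma0 ->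
     At_mx p C nu n x u gamma @[n --> \oo] --> (0 : 'M[R]_N)) /\
  (forall K : set 'rV[R]_d, compact K -> K `<=` H_set p ->
   forall e : R, 0 < e -> exists n0 : nat, forall n : nat, (n0 <= n)%N ->
   forall (x : 'rV[int]_d) (u : 'rV[R]_d) (gamma : R),
     K u -> 0 <= gamma <= gamma0 ->
     forall k j : 'I_N, `|At_mx p C nu n x u gamma k j| < e).
Proof.
have uniform K := uniform_convergence p_inv p_irr hd C_nu gamma0 (U := K).
split=> [x u g Hu hg|]; last exact: uniform.
apply/cvgrPdist_lt => e e0.
(* Pointwise convergence is the uniform statement for the compact set reduced to [u]. *)
have [|n0 hn] := uniform [set u] (@compact_set1 _ u) _ e e0; first by move=> w ->.
near=> n; rewrite sub0r normrN [ltLHS]mx_normrE; apply/bigmax_ltP; split=> // -[k j] _ /=.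
apply: hn => //; near: n; exact: nbhs_infty_ge.
Unshelve. all: by end_near.
Qed.
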